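(* Let $\alpha\in(0,2)$, let $\{X_t\}_{t\in\mathbb Z^d}$ be a stationary symmetric $\alpha$-stable random field and $S_n=\sum_{\|t\|_\infty\le n}X_t$, $n\in\mathbb N$. (a) (Dissipative case.) Suppose $X_t=\sum_{i=1}^\infty j_if(v_i,u_i-t)$, $t\in\mathbb Z^d$, where $\sum_i\delta_{(j_i,v_i,u_i)}$ is a Poisson random measure on $([-\infty,\infty]\setminus\{0\})\times W\times\mathbb Z^d$ with mean measure $\nu_\alpha\otimes\nu\otimes\zeta$, $(W,\mathcal W)$ is a standard Borel space with $\sigma$-finite measure $\nu$, $\zeta$ is counting measure on $\mathbb Z^d$, and $f\in L^\alpha(W\times\mathbb Z^d,\nu\otimes\zeta)$ satisfies $$\int_W\Big(\sum_{u\in\mathbb Z^d}|f(v,u)|\Big)^\alpha\nu(dv)<\infty .$$ Let $\gamma_n>0$ with $n^{d/\alpha}/\gamma_n\to0$. Then $$\frac{\gamma_n^\alpha}{n^d}\mathbb P(\gamma_n^{-1}S_n\in\cdot)\to C_f^\alpha\,\nu_\alpha(\cdot)\quad\text{as } n\to\infty\text{ in }\mathbb M_0(\mathbb R),$$ where $$C_f^\alpha=2^d\int_W\Big[\Big(\Big(\sum_{u\in\mathbb Z^d}f(v,u)\Big)^+\Big)^\alpha+\Big(\Big(\sum_{u\in\mathbb Z^d}f(v,u)\Big)^-\Big)^\alpha\Big]\nu(dv).$$ (b) (Conservative case.) Suppose $\{X_t\}$ is generated by a conservative nonsingular $\mathbb Z^d$-action $\{\phi_t\}$ with cocycle $\{c_t\}$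 and, with $K,F,p,l,H,\oplus,\Delta,\mathcal V$ as in the context, that $1\le p<d$, $\{\phi_t\}_{t\in F}$ is dissipative and $c_v\equiv1$ for all $v\in K$. Let $(W,\nu)$ and $h\in L^\alpha(W\times H,\nu\otimes\zeta_H)$ be as in the mixed moving average representation of $\{X_s\}_{s\in H}$ described in the context (with the normalization stated there), and suppose $$\int_W\Big(\sum_{u\in H}|h(v,u)|\Big)^\alpha\nu(dv)<\infty .$$ Let $\gamma_n>0$ with $n^{p/\alpha}/\gamma_n\to0$. Then $$\mu_n(\cdot):=\frac{\gamma_n^\alpha}{n^p}\mathbb P(n^{p-d}\gamma_n^{-1}S_n\in\cdot)\to\mu(\cdot):=C_{l,\mathcal V,h}^\alpha\,\nu_\alpha(\cdot)\quad\text{as }n\to\infty\text{ in }\mathbb M_0(\mathbb R),$$ where $$C_{l,\mathcal V,h}^\alpha=l\Big(\int_\Delta\mathcal V(y)^\alpha\,dy\Big)\int_W\Big[\Big(\Big(\sum_{u\in H}h(v,u)\Big)^+\Big)^\alpha+\Big(\Big(\sum_{u\in H}h(v,u)\Big)^-\Big)^\alpha\Big]\nu(dv).$$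
   Context: General notation: $x^+=\max(x,0)$, $x^-=\max(-x,0)$; $\|\cdot\|_\infty$ is the max norm. $\nu_\alpha$ is the symmetric measure on $[-\infty,\infty]\setminus\{0\}$ with $\nu_\alpha(x,\infty]=\nu_\alpha[-\infty,-x)=x^{-\alpha}$, $x>0$ (regarded on $\mathbb R\setminus\{0\}$, since it does not charge $\pm\infty$). Series over Poisson points are limits in probability as $\delta\downarrow0$ of the finite sums over terms of modulus greater than $\delta$. $\mathbb M_0(\mathbb R)$ is the space of Borel measures on $\mathbb R\setminus\{0\}$ that are finite outside every neighbourhood of $0$; $\rho_n\to\rho$ in $\mathbb M_0(\mathbb R)$ means $\int g\,d\rho_n\to\int g\,d\rho$ for every bounded continuous $g:\mathbb R\to\mathbb R$ vanishing in a neighbourhood of $0$. Group actions: a nonsingular action $\{\phi_t\}_{t\in G}$ of a countable abelian group $G$ on a $\sigma$-finite standard Borel space $(S,\mathcal S,\mu)$ is a family of measurable maps with $\phi_0=\mathrm{id}$, $\phi_{t_1+t_2}=\phi_{t_1}\circ\phi_{t_2}$ and $\mu\circ\phi_t^{-1}$ equivalent to $\mu$. A measurable $A\subseteq S$ is wandering if the sets $\phi_t(A)$, $t\in G$, are pairwise disjoint. The action is dissipative if $S=\bigcup_{t}\phi_t(W^* )$ for some wandering set $W^*$, and conservative if there is no wandering set of positive $\mu$-measure. A cocycle is a family of measurable $\pm1$-valued maps $c_t$ with $c_{t_1+t_2}(s)=c_{t_2}(s)c_{t_1}(\phi_{t_2}(s))$. A stationary symmetric $\alpha$-stable (S$\alpha$S)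 field $\{X_t\}_{t\in\mathbb Z^d}$ is generated by $\{\phi_t\}$ if, in finite-dimensional distributions, $X_t\stackrel{d}{=}\int_S c_t(s)\big(\frac{d\mu\circ\phi_t}{d\mu}(s)\big)^{1/\alpha}f(\phi_t(s))\,M(ds)$, with $M$ an S$\alpha$S random measure with control measure $\mu$, $f\in L^\alpha(S,\mu)$, $\{c_t\}$ a cocycle, and $\bigcup_t \mathrm{support}(f\circ\phi_t)=S$. (Fields generated by dissipative actions are, up to a multiplicative constant, exactly those of the form in (a).) Algebraic objects for (b): $K=\{t\in\mathbb Z^d:\phi_t=1_S\}$ and $A=\{\phi_t:t\in\mathbb Z^d\}\simeq\mathbb Z^d/K$. Write $A=\overline F\oplus\overline N$ with $\overline F$ free abelian of rank $p$ and $\overline N$ finite with $|\overline N|=l$. Let $\Psi:\overline F\to\mathbb Z^d$ be an injective homomorphism with $\Phi\circ\Psi=\mathrm{id}_{\overline F}$, where $\Phi(t)=\phi_t$, and let $F=\Psi(\overline F)$. Then $F+K$ is a direct sum, $K$ has rank $d-p$ and $\mathbb Z^d/(F+K)\simeq\overline N$. Let $x_1,\dots,x_l$ be coset representatives of $F+K$ in $\mathbb Z^d$ and $H=\bigcup_{k=1}^l(x_k+F)$, an abelian group (isomorphic to $\mathbb Z^d/K$) under addition $\oplus$ modulo $K$ ($s_1\oplus s_2$ is the unique $s\in H$ with $s_1+s_2-s\in K$). Each $t\in\mathbb Z^d$ is uniquely $t=t_H+t_K$ with $t_H\in H$, $t_K\in K$; $\pi(t)=t_H$. $U$ is a $d\times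 p$ matrix whose columns form a ($\mathbb Z$-)basis of $F$ and $V$ a $d\times(d-p)$ matrix whose columns form a ($\mathbb Z$-)basis of $K$. $\Delta=\{y\in\mathbb R^p:\exists\lambda\in\mathbb R^{d-p},\ \|Uy+V\lambda\|_\infty\le1\}$; for $y\in\Delta$, $Q_y=\{\lambda\in\mathbb R^{d-p}:\|Uy+V\lambda\|_\infty\le1\}$ and $\mathcal V(y)$ is the $(d-p)$-dimensional volume of $Q_y$. Representation and normalization for (b): under the stated assumptions there are a standard Borel space $(W,\mathcal W)$ with $\sigma$-finite measure $\nu$ and $h\in L^\alpha(W\times H,\nu\otimes\zeta_H)$ ($\zeta_H$ counting measure on $H$) with $X_s\stackrel{d}{=}\int_{W\times H}h(v,u\oplus s)M'(dv,du)$, $s\in H$, $M'$ an S$\alpha$S random measure with control measure $\nu\otimes\zeta_H$; moreover $X_t=X_{\pi(t)}$ a.s. for $t\in\mathbb Z^d$. After multiplication of the field by a deterministic positive constant (a standing normalization), $X_s=\sum_{i=1}^\infty j_ih(v_i,u_i\oplus s)$, $s\in H$, where $\sum_i\delta_{(j_i,v_i,u_i)}$ is a Poisson random measure on $([-\infty,\infty]\setminus\{0\})\times W\times H$ with mean measure $\nu_\alpha\otimes\nu\otimes\zeta_H$. *)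

(* Defs.v *)
From HB Require Import structures.
From mathcomp Require Import all_boot all_order all_algebra.
From mathcomp Require Import all_classical all_reals all_analysis.
From mathcomp Require Import measurable_realfun.

Set Implicit Arguments.
Unset Strict Implicit.
Unset Printing Implicit Defensive.

Import Order.TTheory GRing.Theory Num.Theory.
Import numFieldNormedType.Exports.
Import HBSimple.

Local Open Scope classical_set_scope.
Local Open Scope ring_scope.

(* Z^d as column vectors, with the discrete sigma-algebra. *)
Definition Zd (d : nat) : Type := 'cV[int]_d.

HB.instance Definition _ (d : nat) := GRing.Zmodule.on (Zd d).
HB.instance Definition _ (d : nat) := Countable.on (Zd d).
HB.instance Definition _ (d : nat) := isPointed.Build (Zd d) 0.
HB.instance Definition _ (d : nat) :=
  @isMeasurable.Build default_measure_display (Zd d)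
    discrete_measurable discrete_measurable0
    (@discrete_measurableC _) (@discrete_measurableU _).

Section counting_on.
Context (R : realType) (d : nat).

Lemma measurable_Zd (D : set (Zd d)) : measurable D.
Proof. by []. Qed.

Definition zeta (D : set (Zd d)) : set (Zd d) -> \bar R :=
  mrestr (@counting (Zd d) R) (measurable_Zd D).

HB.instance Definition _ (D : set (Zd d)) := Measure.on (zeta D).

Lemma sigma_finite_zeta (D : set (Zd d)) : sigma_finite setT (zeta D).
Proof.
exists (fun n => [set t : Zd d | pickle t = n]).
  by apply/seteqP; split => // t _; exists (pickle t).
move=> n; split=> //; rewrite /zeta /mrestr /counting asboolT ?ltry//.
have [[t tn]|nt] := pselect (exists t : Zd d, pickle t = n).
  apply: (sub_finite_set _ (finite_set1 t)) => s [/= sn _].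
  by apply: (pcan_inj (@pickleK (Zd d))); rewrite sn tn.
suff -> : [set t : Zd d | pickle t = n] `&` D = set0 by [].
by apply/seteqP; split => // t [/= tn _]; apply: nt; exists t.
Qed.

HB.instance Definition _ (D : set (Zd d)) :=
  @Measure_isSigmaFinite.Build _ _ _ (zeta D) (sigma_finite_zeta D).

End counting_on.


Section scaled_measure.
Local Open Scope ereal_scope.
Context d (T : measurableType d) (R : realType).
Variables (c : \bar R) (c0 : 0 <= c) (m : {measure set T -> \bar R}).

(* The library's [mscale] only allows real factors. *)
Definition emscale of 0 <= c := fun A : set T => c * m A.

Local Notation cm := (emscale c0).

Let emscale_set0 : cm set0 = 0.
Proof. by rewrite /emscale measure0 mule0. Qed.

Let emscale_ge0 A : 0 <= cm A.
Proof. by rewrite /emscale mule_ge0. Qed.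

Let emscale_sigma_additive : semi_sigma_additive cm.
Proof.
move=> F mF tF mUF; rewrite /emscale.
have e A : measurable A -> c * m A = \int[m]_(x in A) c by move=> mA; rewrite integral_cst.
rewrite e// ge0_integral_bigcup//.
under eq_fun do under eq_bigr do rewrite e//.
by apply: is_cvg_ereal_nneg_natsum_cond => n _ _; exact: integral_ge0.
Qed.

HB.instance Definition _ := isMeasure.Build _ _ _ cm
  emscale_set0 emscale_ge0 emscale_sigma_additive.

End scaled_measure.
Arguments emscale {d T R} c m _ _.

Lemma sigma_finite_product d1 d2 (T1 : measurableType d1)
    (T2 : measurableType d2) (R : realType)
    (m1 : {sigma_finite_measure set T1 -> \bar R})
    (m2 : {sigma_finite_measure set T2 -> \bar R}) :
  sigma_finite setT (m1 \x m2)%E.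
Proof.
have /sigma_finiteP[F [TF ndF Foo]] := sigma_finiteT m1.
have /sigma_finiteP[G [TG ndG Goo]] := sigma_finiteT m2.
exists (fun n => F n `*` G n).
  rewrite -setXTT TF TG predeqE => -[x y]; split.
    move=> [/= [n _ Fnx] [k _ Gky]]; exists (maxn n k) => //; split.
    - by move: x Fnx; exact/subsetPset/ndF/leq_maxl.
    - by move: y Gky; exact/subsetPset/ndG/leq_maxr.
  by move=> [n _ []/= ? ?]; split; exists n.
move=> k; have [? ?] := Foo k; have [? ?] := Goo k.
split; first exact: measurableX.
by rewrite product_measure1E// lte_mul_pinfty// ge0_fin_numE.
Qed.

Section lebesgue_tuple.
Context (R : realType).
Local Open Scope ereal_scope.

Definition cons_tuple n (z : R * n.-tuple R) : n.+1.-tuple R :=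
  [tuple of z.1 :: z.2].

Lemma measurable_cons_tuple n : measurable_fun setT (@cons_tuple n).
Proof. exact: (measurable_cons measurable_fst measurable_snd). Qed.


#[local] Hint Extern 0 (measurable_fun _ (@cons_tuple _)) =>
  solve [exact: measurable_cons_tuple] : core.

Section step.
Context n (m : {sigma_finite_measure set (n.-tuple R) -> \bar R}).

Definition lebesgue_cons : set (n.+1.-tuple R) -> \bar R :=
  pushforward (@lebesgue_measure R \x m) (@cons_tuple n).

Let lebesgue_cons0 : lebesgue_cons set0 = 0.
Proof. exact: measure0. Qed.

Let lebesgue_cons_ge0 A : 0 <= lebesgue_cons A.
Proof. exact: measure_ge0. Qed.

Let lebesgue_cons_sigma_additive : semi_sigma_additive lebesgue_cons.
Proof. exact: measure_semi_sigma_additive. Qed.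

HB.instance Definition _ := isMeasure.Build _ _ _ lebesgue_cons
  lebesgue_cons0 lebesgue_cons_ge0 lebesgue_cons_sigma_additive.

Let lebesgue_cons_sigma_finite : sigma_finite setT lebesgue_cons.
Proof.
have [F TF Foo] : sigma_finite setT (@lebesgue_measure R \x m).
  exact: sigma_finite_product.
pose g (t : n.+1.-tuple R) := (thead t, [tuple of behead t]).
have mg : measurable_fun setT g.
  apply: measurable_fun_pair; first exact: measurable_tnth.
  exact: measurable_behead.
have gK z : g (cons_tuple z) = z.
  by case: z => x t; rewrite /g /cons_tuple theadE; congr pair; exact/val_inj.
exists (fun k => g @^-1` F k).
  by rewrite -preimage_bigcup -TF preimage_setT.
move=> k; have [mF Fk] := Foo k; split.
  by rewrite -[X in measurable X]setTI; exact: mg.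
rewrite /lebesgue_cons /pushforward -comp_preimage.
by rewrite (_ : g \o _ = id)//; apply/funext => z; exact: gK.
Qed.

HB.instance Definition _ := @Measure_isSigmaFinite.Build _ _ _ lebesgue_cons
  lebesgue_cons_sigma_finite.

End step.

Fixpoint lebesgue_tuple n : {sigma_finite_measure set (n.-tuple R) -> \bar R} :=
  if n is n'.+1 then lebesgue_cons (lebesgue_tuple n') else \d_[tuple].

Lemma lebesgue_tuple_box n (a b : 'I_n -> R) : (forall i, (a i <= b i)%R) ->
  lebesgue_tuple n [set t | forall i, (a i <= tnth t i <= b i)%R] =
  (\prod_(i < n) (b i - a i))%R%:E.
Proof.
elim: n a b => [|n ih] a b ab.
  rewrite big_ord0 /= /dirac indicE mem_set//= => -[].
  by case.
rewrite big_ord_recl EFinM /=.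
set B := [set t | _].
set B' := [set t : n.-tuple R | forall i : 'I_n,
  (a (lift ord0 i) <= tnth t i <= b (lift ord0 i))%R].
have mB' : measurable B'.
  rewrite (_ : B' = \bigcap_(i in [set: 'I_n])
     ((@tnth n R)^~ i @^-1` `[a (lift ord0 i), b (lift ord0 i)])).
    apply: fin_bigcap_measurable => // i _.
    rewrite -[X in measurable X]setTI.
    by apply: measurable_tnth => //; exact: measurable_itv.
  apply/seteqP; split => [t Bt i _ /=|t Bt i]; first by rewrite in_itv/=; exact: Bt.
  by have := Bt i I; rewrite /= in_itv.
rewrite /lebesgue_cons /pushforward.
rewrite (_ : _ @^-1` B = `[a ord0, b ord0] `*` B').
  rewrite product_measure1E//= lebesgue_measure_itv/= lte_fin.
  rewrite [X in _ * X]ih//.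
  congr (_ * _).
  case: ltP => [//|ba]; congr EFin; apply/esym/eqP.
  by rewrite subr_eq0; apply/eqP/le_anti; rewrite ba ab.
apply/seteqP; split => -[x t] /=.
  move=> Bt; split; first by rewrite in_itv/=; have := Bt ord0; rewrite tnth0.
  by move=> i; have := Bt (lift ord0 i); rewrite tnthS.
move=> [+ B't] i; rewrite in_itv/= => xab.
by case: (unliftP ord0 i) => [j ->|->]; rewrite ?tnthS ?tnth0.
Qed.

End lebesgue_tuple.


Section nu_alpha.
Context (R : realType) (alpha : R).

Definition is_nu_alpha (m : {measure set R -> \bar R}) :=
  m [set 0] = 0%E /\
  forall x, 0 < x -> m `]x, +oo[%classic = (x `^ (- alpha))%:E /\
                     m `]-oo, - x[%classic = (x `^ (- alpha))%:E.

(* The image of Lebesgue measure on (0, +oo) by u |-> eps u^(-1/alpha). *)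
Let half (eps u : R) : R := eps * u `^ (- alpha^-1).

Let measurable_half eps : measurable_fun setT (half eps).
Proof. by apply: measurable_funM => //; exact: measurable_powR. Qed.

#[local] Hint Extern 0 (measurable_fun _ (half _)) =>
  solve [exact: measurable_half] : core.

Let half_measure eps : set R -> \bar R :=
  pushforward (mrestr (@lebesgue_measure R) (measurable_itv `]0, +oo[))
    (half eps).

Let half_measure0 eps : half_measure eps set0 = 0%E.
Proof. exact: measure0. Qed.

Let half_measure_ge0 eps A : (0 <= half_measure eps A)%E.
Proof. exact: measure_ge0. Qed.

Let half_measure_sigma_additive eps : semi_sigma_additive (half_measure eps).
Proof. exact: measure_semi_sigma_additive. Qed.

HB.instance Definition _ eps := isMeasure.Build _ _ _ (half_measure eps)
  (half_measure0 eps) (half_measure_ge0 eps) (@half_measure_sigma_additive eps).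

Let half_gt u x : 0 < alpha -> 0 < u -> 0 < x ->
  (x < u `^ (- alpha^-1)) = (u < x `^ (- alpha)).
Proof.
move=> a0 u0 x0.
have -> : x = (x `^ (- alpha)) `^ (- alpha^-1).
  by rewrite -powRrM mulrNN mulfV ?gt_eqF// powRr1// ltW.
set y := x `^ (- alpha); have y0 : 0 < y by exact: powR_gt0.
rewrite -powRrM mulrNN mulVf ?gt_eqF// powRr1 ?(ltW y0)//.
rewrite !powRN ltf_pV2 ?posrE ?powR_gt0//.
have ai0 : 0 < alpha^-1 by rewrite invr_gt0.
apply/idP/idP; last by apply: gt0_ltr_powR; rewrite ?nnegrE ?ltW.
by apply: contraTT; rewrite -!leNgt; apply: (ge0_ler_powR (ltW ai0));
  rewrite nnegrE ltW.
Qed.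

Lemma nu_alpha_exists : 0 < alpha ->
  exists m : {measure set R -> \bar R}, is_nu_alpha m.
Proof.
move=> a0.
pose m : {measure set R -> \bar R} :=
  measure_add (half_measure 1) (half_measure (-1)).
have mE A : m A = (half_measure 1 A + half_measure (-1) A)%E.
  exact: measure_addE.
exists m.
have E eps A B : [set u | 0 < u /\ A (half eps u)] = B ->
    half_measure eps A = lebesgue_measure B.
  move=> <-; rewrite /half_measure /pushforward /mrestr; congr lebesgue_measure.
  by apply/seteqP; split => u /=; rewrite in_itv/= andbT => -[].
have L0 : lebesgue_measure (set0 : set R) = 0%E by exact: measure0.
split=> [|x x0].
  rewrite mE !(E _ _ set0) ?L0 ?adde0//;
    by apply/seteqP; split => // u [u0] /eqP;
    rewrite /half ?mul1r ?mulN1r ?oppr_eq0 gt_eqF// powR_gt0.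
have y0 : 0 < x `^ (- alpha) by exact: powR_gt0.
have Ly : lebesgue_measure `]0, x `^ (- alpha)[%classic = (x `^ (- alpha))%:E.
  by rewrite lebesgue_measure_itv/= lte_fin y0 -EFinD subr0.
split; rewrite mE.
- rewrite (E 1 _ `]0, x `^ (- alpha)[%classic) ?(E (-1) _ set0) ?L0 ?adde0//.
  + apply/seteqP; split => // u [u0] /=; rewrite in_itv/= andbT /half mulN1r.
    by rewrite ltNge ltW// (lt_trans _ x0)// oppr_lt0 powR_gt0.
  + apply/seteqP; split => u /=; rewrite !in_itv/= ?andbT /half mul1r.
      by move=> [u0]; rewrite half_gt// u0.
    by move=> /andP[u0 ux]; rewrite half_gt.
- rewrite (E (-1) _ `]0, x `^ (- alpha)[%classic) ?(E 1 _ set0) ?L0 ?add0e//.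
  + apply/seteqP; split => // u [u0] /=; rewrite in_itv/= /half mul1r.
    by rewrite ltNge ltW// (@lt_trans _ _ 0) ?oppr_lt0// powR_gt0.
  + apply/seteqP; split => u /=; rewrite !in_itv/= /half mulN1r ltrN2.
      by move=> [u0]; rewrite half_gt// u0.
    by move=> /andP[u0 ux]; rewrite half_gt.
Qed.

End nu_alpha.

Section M0.
Context (R : realType).
Local Open Scope ereal_scope.

(* Measures on R \ {0} are represented by measures on R, whose mass at 0 is
   ignored. *)
Definition in_M0 (m : {measure set R -> \bar R}) :=
  forall e : R, (0 < e)%R -> m [set x | (e <= `|x|)%R] < +oo.

Definition M0_cvg (m_ : nat -> {measure set R -> \bar R})
    (m : {measure set R -> \bar R}) :=
  [/\ forall n, in_M0 (m_ n), in_M0 m &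
      forall g : R -> R, continuous g ->
        (exists M : R, forall x, (`|g x| <= M)%R) ->
        (\forall x \near (0 : R)%R, g x = 0%R) ->
        \int[m_ n]_x (g x)%:E @[n --> \oo] --> \int[m]_x (g x)%:E].

End M0.

(* A standard Borel space is isomorphic to a Polish space with its Borel
   sigma-algebra. *)
Definition standard_borel (R : realType) d (T : measurableType d) :=
  exists (E : completePseudoMetricType R) (f : T -> E),
    [/\ set_bij setT setT f, hausdorff_space E, @second_countable E &
        forall A : set E, <<s open >> A <-> measurable (f @^-1` A)].

Section laws.
Context (R : realType) d (Omega : measurableType d) (P : probability Omega R).
Local Open Scope ereal_scope.

Definition cvg_in_prob (I : Type) (F : set_system I)
    (Y : I -> Omega -> R) (Z : Omega -> R) :=
  forall e : R, (0 < e)%R ->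
    P [set w | (e < `|Y i w - Z w|)%R] @[i --> F] --> 0.

(* The terms [a i] are summed in the order given by their modulus. *)
Definition series_in_prob (a : nat -> Omega -> R) (Z : Omega -> R) :=
  (forall delta : R, (0 < delta)%R ->
    {ae P, forall w, finite_set [set i | (delta < `|a i w|)%R]}) /\
  cvg_in_prob (0^'+)%R
    (fun delta w => \sum_(i \in [set i | (delta < `|a i w|)%R]) a i w)%R Z.

Definition mutually_independent d' (T : measurableType d') n
    (Y : 'I_n -> Omega -> T) :=
  forall B : 'I_n -> set T, (forall i, measurable (B i)) ->
    P (\bigcap_i (Y i @^-1` B i)) = \prod_(i < n) P (Y i @^-1` B i).

Definition num_points (T : Type) (xi : nat -> Omega -> T) (A : set T)
  (w : Omega) : \bar R := counting [set i | A (xi i w)].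

Definition poisson_random_measure d' (T : measurableType d')
    (xi : nat -> Omega -> T) (Lam : {measure set T -> \bar R}) :=
  [/\ forall i, measurable_fun setT (xi i),
      forall A, measurable A -> Lam A < +oo -> forall k : nat,
        P [set w | num_points xi A w = k%:R%:E] =
        (fine (Lam A) ^+ k / k`!%:R * expR (- fine (Lam A)))%:E,
      forall A, measurable A -> Lam A = +oo ->
        P [set w | num_points xi A w = +oo] = 1 &
      forall n (A : 'I_n -> set T), (forall i, measurable (A i)) ->
        trivIset setT A -> mutually_independent (fun i => num_points xi (A i))].

(* The characteristic function of [Y] is exp (- (sigma |theta|) ^ alpha). *)
Definition is_SaS (alpha sigma : R) (Y : Omega -> R) :=
  forall theta : R,
    \int[P]_w (cos (theta * Y w))%:E =
      (expR (- (sigma * `|theta|) `^ alpha))%:E /\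
    \int[P]_w (sin (theta * Y w))%:E = 0.

Definition SaS_field (alpha : R) (T : Type) (X : T -> Omega -> R) :=
  forall n (t : 'I_n -> T) (c : 'I_n -> R), exists2 sigma : R, (0 <= sigma)%R &
    is_SaS alpha sigma (fun w => \sum_(i < n) c i * X (t i) w)%R.

(* [M A] is only meaningful for [A] measurable of finite [m]-measure. *)
Definition SaS_random_measure (alpha : R) d' (E : measurableType d')
    (m : {measure set E -> \bar R}) (M : set E -> {RV P >-> R}) :=
  [/\ forall A, measurable A -> m A < +oo ->
        is_SaS alpha (fine (m A) `^ alpha^-1)%R (M A),
      forall n (A : 'I_n -> set E),
        (forall i, measurable (A i)) -> (forall i, m (A i) < +oo) ->
        trivIset setT A -> mutually_independent (fun i => M (A i) : Omega -> R) &
      forall A : nat -> set E,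
        (forall i, measurable (A i)) -> m (\bigcup_i A i) < +oo ->
        trivIset setT A ->
        {ae P, forall w, series (fun i => M (A i) w) @ \oo --> M (\bigcup_i A i) w}].

(* [I] is the integral of [f] with respect to [M]: the limit in probability of
   integrals of simple functions converging to [f] in L^alpha. *)
Definition stable_integral (alpha : R) d' (E : measurableType d')
    (m : {measure set E -> \bar R}) (M : set E -> {RV P >-> R}) (f : E -> R)
    (I : Omega -> R) :=
  exists g : nat -> {sfun E >-> R},
    [/\ forall n, m [set x | g n x != 0%R] < +oo,
        \int[m]_x (`|f x - g n x| `^ alpha)%:E @[n --> \oo] --> 0 &
        cvg_in_prob \oo
          (fun n w => \sum_(y \in range (g n)) y * M (g n @^-1` [set y]) w)%R I].

End laws.

Section finite_dimensional_distributions.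
Context (R : realType) d (Omega : measurableType d) (P : probability Omega R).
Context d' (Omega' : measurableType d') (P' : probability Omega' R).

Definition fdd_eq (T : Type) (X : T -> Omega -> R) (Y : T -> Omega' -> R) :=
  forall n (t : n.-tuple T) (B : set (n.-tuple R)), measurable B ->
    P [set w | B [tuple of map (X ^~ w) t]] =
    P' [set w | B [tuple of map (Y ^~ w) t]].

End finite_dimensional_distributions.

Definition stationary (R : realType) d' (Omega : measurableType d')
    (P : probability Omega R) d (X : Zd d -> Omega -> R) :=
  forall h : Zd d, fdd_eq P P (fun t => X (t + h)) X.

Section actions.
Context (R : realType) (d : nat) dS (S : measurableType dS).
Variable mu : {sigma_finite_measure set S -> \bar R}.
Variable phi : Zd d -> S -> S.

Definition nonsingular_action :=
  [/\ forall t, measurable_fun setT (phi t),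
      phi 0 = id,
      forall t1 t2, phi (t1 + t2) = phi t1 \o phi t2 &
      forall t, pushforward mu (phi t) `<< mu /\ mu `<< pushforward mu (phi t)].

(* G is the index set of the (sub)action, the whole of Z^d or a subgroup. *)
Definition wandering (G : set (Zd d)) (A : set S) :=
  measurable A /\ trivIset G (fun t => phi t @` A).

Definition dissipative (G : set (Zd d)) :=
  exists2 W, wandering G W & \bigcup_(t in G) (phi t @` W) = setT.

Definition conservative (G : set (Zd d)) :=
  forall W, wandering G W -> mu W = 0%E.

Definition cocycle (c : Zd d -> S -> R) :=
  [/\ forall t, measurable_fun setT (c t),
      forall t s, c t s = 1 \/ c t s = -1 &
      forall t1 t2 s, c (t1 + t2) s = c t2 s * c t1 (phi t2 s)].

Definition is_density (rho : set S -> \bar R) (w : S -> R) :=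
  [/\ measurable_fun setT w, forall s, 0 <= w s &
      forall A, measurable A -> rho A = (\int[mu]_(s in A) (w s)%:E)%E].

(* [rn t] is a version of d(mu o phi_t)/dmu. *)
Definition generated_by (alpha : R) (c : Zd d -> S -> R)
    dO (Omega : measurableType dO) (P : probability Omega R)
    (X : Zd d -> Omega -> R) :=
  exists (f : S -> R) (rn : Zd d -> S -> R)
    (dO' : measure_display) (Omega' : measurableType dO')
    (P' : probability Omega' R) (M : set S -> {RV P' >-> R})
    (Y : Zd d -> {RV P' >-> R}),
    [/\ f \in Lfun mu alpha%:E /\ \bigcup_t [set s | f (phi t s) != 0] = setT,
        forall t, is_density (fun A => mu (phi t @` A)) (rn t),
        SaS_random_measure alpha mu M,
        forall t, stable_integral alpha mu M
          (fun s => c t s * rn t s `^ alpha^-1 * f (phi t s)) (Y t) &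
        fdd_eq P P' X Y].

Definition stabilizer : set (Zd d) := [set t | phi t = id].

(* [A = range phi] is the group of the maps phi_t under composition. *)
Definition free_abelian_of_rank (p : nat) (B : set (S -> S)) :=
  exists e : 'cV[int]_p -> S -> S,
    set_bij setT B e /\ forall x y, e (x + y) = e x \o e y.

Definition subgroup_of_maps (B : set (S -> S)) :=
  [/\ B id, forall a b, B a -> B b -> B (a \o b) &
      forall a, B a -> exists2 b, B b & a \o b = id /\ b \o a = id].

Definition direct_decomposition (Fbar Nbar : set (S -> S)) :=
  [/\ subgroup_of_maps Fbar, subgroup_of_maps Nbar,
      range phi = [set a \o b | a in Fbar & b in Nbar] &
      Fbar `&` Nbar = [set id]].

Definition section_on (Fbar : set (S -> S)) (Psi : (S -> S) -> Zd d) :=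
  [/\ forall a b, Fbar a -> Fbar b -> Psi (a \o b) = Psi a + Psi b,
      {in Fbar &, injective Psi} &
      forall a, Fbar a -> phi (Psi a) = a].

End actions.

Section lattices.
Context (d : nat).

Definition Zbasis k (B : 'M[int]_(d, k)) (G : set (Zd d)) :=
  set_bij setT G (fun z : 'cV[int]_k => B *m z : Zd d).

Definition sum_set (F K : set (Zd d)) : set (Zd d) :=
  [set f + k | f in F & k in K].

Definition coset_reps l (x : 'I_l -> Zd d) (G : set (Zd d)) :=
  forall t, exists! k, G (t - x k).

Definition coset_union l (x : 'I_l -> Zd d) (F : set (Zd d)) : set (Zd d) :=
  \bigcup_k [set x k + f | f in F].

Definition proj_mod (H K : set (Zd d)) (t : Zd d) : Zd d :=
  get [set s | H s /\ K (t - s)].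

Definition oplus (H K : set (Zd d)) (s1 s2 : Zd d) : Zd d :=
  proj_mod H K (s1 + s2).

Definition box (n : nat) : set (Zd d) :=
  [set t : 'cV[int]_d | mx_norm t <= n%:Z].

Context (R : realType).

(* For absolutely summable families. *)
Definition sumZ (D : set (Zd d)) (a : Zd d -> R) : R :=
  fine (\esum_(u in D) (Num.max (a u) 0)%:E) -
  fine (\esum_(u in D) (Num.max (- a u) 0)%:E).

Definition partial_sum dO (Omega : measurableType dO)
    (P : probability Omega R) (X : Zd d -> {RV P >-> R}) (n : nat) :
    {mfun Omega >-> R} :=
  \sum_(t \in box n) (X t : {mfun Omega >-> R}).

Section polytope.
Context p (U : 'M[int]_(d, p)) (V : 'M[int]_(d, d - p)).

Definition lincomb (y : p.-tuple R) (lam : (d - p).-tuple R) : 'cV[R]_d :=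
  map_mx intr U *m (\col_i tnth y i) + map_mx intr V *m (\col_i tnth lam i).

Definition Qset (y : p.-tuple R) : set ((d - p).-tuple R) :=
  [set lam | mx_norm (lincomb y lam) <= 1].

Definition Delta : set (p.-tuple R) := [set y | exists lam, Qset y lam].

Definition vol (y : p.-tuple R) : \bar R :=
  lebesgue_tuple R (d - p) (Qset y).

End polytope.

Local Open Scope ereal_scope.
Section constants.
Context (alpha : R) dW (W : measurableType dW).
Variable nu : {sigma_finite_measure set W -> \bar R}.

Definition abs_sum_finite (D : set (Zd d)) (h : W * Zd d -> R) :=
  \int[nu]_v poweR (\esum_(u in D) `|h (v, u)|%:E) alpha < +oo.

Definition tail_integral (D : set (Zd d)) (h : W * Zd d -> R) : \bar R :=
  \int[nu]_v ((Num.max (sumZ D (fun u => h (v, u))) 0) `^ alpha +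
              (Num.max (- sumZ D (fun u => h (v, u))) 0) `^ alpha)%:E.

Lemma tail_integral_ge0 D h : 0 <= tail_integral D h.
Proof.
by apply: integral_ge0 => v _; rewrite lee_fin addr_ge0 ?powR_ge0.
Qed.

Definition const_dissipative (f : W * Zd d -> R) : \bar R :=
  (2 ^+ d)%:E * tail_integral setT f.

Lemma const_dissipative_ge0 f : 0 <= const_dissipative f.
Proof. by rewrite mule_ge0 ?tail_integral_ge0// lee_fin exprn_ge0. Qed.

Definition const_conservative l p (U : 'M[int]_(d, p)) (V : 'M[int]_(d, d - p))
    (H : set (Zd d)) (h : W * Zd d -> R) : \bar R :=
  l%:R%:E * (\int[lebesgue_tuple R p]_(y in Delta U V) poweR (vol U V y) alpha)
  * tail_integral H h.

Lemma const_conservative_ge0 l p (U : 'M[int]_(d, p)) (V : 'M[int]_(d, d - p))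
  H h : 0 <= const_conservative l U V H h.
Proof.
rewrite mule_ge0 ?tail_integral_ge0// mule_ge0 ?lee_fin//.
by apply: integral_ge0 => y _; exact: poweR_ge0.
Qed.

End constants.

Definition rate (alpha gamma : R) (k n : nat) : \bar R :=
  (gamma `^ alpha / n%:R ^+ k)%:E.

Lemma rate_ge0 alpha gamma k n : 0 <= rate alpha gamma k n.
Proof. by rewrite lee_fin divr_ge0 ?powR_ge0 ?exprn_ge0. Qed.

End lattices.

(* Main.v *)
Require Import Defs.
From HB Require Import structures.
From mathcomp Require Import all_boot all_order all_algebra.
From mathcomp Require Import all_classical all_reals all_analysis.
From mathcomp Require Import measurable_realfun.
From mathcomp Require Import ring lra zify.

Set Implicit Arguments.
Unset Strict Implicit.
Unset Printing Implicit Defensive.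

Import Order.TTheory GRing.Theory Num.Theory.
Import numFieldNormedType.Exports.

Local Open Scope classical_set_scope.
Local Open Scope ring_scope.

(* The sum over the box is S_n = sum_i j_i b_n(v_i, u_i), where b_n is the sum of
   the kernel over the box. On the scale of the theorem two large terms are too
   rare to matter. The terms with |j b_n| <= eps are odd in j, so their sum is
   centered, and its second moment is controlled by the intensity of their squares,
   of order eps^(2 - alpha). Hence the law of S_n behaves as the intensity of the
   largest term, which is nu_alpha scaled by the integrals of (b_n^+)^alpha and
   (b_n^-)^alpha. Up to an error removed by dominated convergence, b_n(v, u) is
   N_n(u) sum_w h(v, w), where N_n(u) counts the points of the box congruent to u
   modulo K (K = 0 in the dissipative case). Comparing lattice points with the
   cubes of mesh 1/n they span, n^(p - d) N_n is an approximation of the volume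
   function, and its alpha-powers sum up to a Riemann sum over Delta.

   In the conservative case the series is only given on H, so that X_(t + k) = X_t
   is needed for k in K. The kernels of both variables agree almost everywhere, and
   the stable integral depends only on the class of the kernel: the difference of
   the integrals of two simple functions is a sum of independent SaS variables Z_i,
   estimated through E (sum_i sin Z_i)^2 = sum_i E (sin Z_i)^2 and the tails of the
   Z_i. *)

(** * Moments of Poisson random measures *)

(** Each [X t] is a limit of sums truncated at the size of its own terms, whereas the box sum has to
    be truncated at the size of the summed kernel, and the number of summands grows with n. The
    individual truncation level is sent to 0 with n fixed, which removes every constant depending on
    the number of summands; what remains depends only on the tail of the summed kernel.

    That tail is a pure power: integrating j out gives x^(-alpha) times the alpha-th moment of the
    kernel, on either side. So the image of the jump measure is, off 0, an exact multiple m_n of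
    [nu_alpha], the comparison error is tau m_n + B m_n^2 with B independent of n, and the growth of
    gamma enters through m_n -> 0.

    The exponent kappa = min(alpha, 1) governs the averaging: x^alpha is kappa-Holder on bounded
    sets, and kappa-th powers are subadditive, so errors split into products of a factor in v and a
    factor in u. For kappa < 1 an l^1 estimate does not bound a sum of kappa-th powers, so the
    cosets met by a box have to be counted as well. *)

Section poisson_moments.
Local Open Scope ereal_scope.
Context (R : realType) d (T : measurableType d) (P : probability T R).

Lemma nneseries_exp (l : R) : (0 <= l)%R ->
  \sum_(k <oo) (l ^+ k / k`!%:R)%:E = (expR l)%:E.
Proof.
move=> l0; rewrite expRE -EFin_lim; last first.
  rewrite /pseries/=; under eq_fun do rewrite mulrC.
  exact: is_cvg_series_exp_coeff.
apply/congr_lim/funext => n/=; rewrite /pseries/= /series/= -sumEFin//.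
by under eq_bigr do rewrite mulrC.
Qed.

(** The factor k cancels against k!. In probabilistic terms this is E[N g(N)] = l E[g(N + 1)] for a
    Poisson variable N, which yields the moments one degree at a time. *)
Lemma nneseries_exp_shift (l : R) (g : nat -> R) : (0 <= l)%R ->
  (forall k, 0 <= g k)%R ->
  \sum_(k <oo) (k%:R * g k * (l ^+ k / k`!%:R))%:E =
  l%:E * \sum_(k <oo) (g k.+1 * (l ^+ k / k`!%:R))%:E.
Proof.
move=> l0 g0.
have h0 k : (0 <= l ^+ k / k`!%:R)%R by rewrite divr_ge0 ?exprn_ge0.
have h1 k : (0 <= k%:R * g k * (l ^+ k / k`!%:R))%R by rewrite mulr_ge0// mulr_ge0.
rewrite nneseries_recl//; last by move=> k _; rewrite lee_fin; exact: h1.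
rewrite !mul0r add0e -(@nneseries_addn _ (fun k => (k%:R * g k * (l ^+ k / k`!%:R))%:E) 1); last first.
  by move=> k; rewrite lee_fin; exact: h1.
rewrite -nneseriesZl; last by move=> k _; rewrite lee_fin mulr_ge0//.
apply: eq_eseriesr => k _; rewrite -EFinM addn1 factS exprS natrM; congr EFin.
have H : (k`!%:R != 0 :> R)%R by rewrite pnatr_eq0 -lt0n fact_gt0.
have H0 : (k.+1%:R != 0 :> R)%R by rewrite pnatr_eq0.
rewrite invfM; move: (g _) (l ^+ k)%R (k`!%:R : R)%R (k.+1%:R : R)%R H H0 => a b c e c0 e0.
by field; rewrite c0 e0.
Qed.


Variables (N : T -> \bar R) (l : R).
Hypothesis (mN : measurable_fun setT N).
Hypothesis (N_nat : forall w, N w = +oo \/ exists k : nat, N w = k%:R%:E).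
Hypothesis NP : forall k : nat,
  P [set w | N w = k%:R%:E] = (l ^+ k / k`!%:R * expR (- l))%:E.
Hypothesis l0 : (0 <= l)%R.

Lemma measurable_level (k : nat) : measurable [set w | N w = k%:R%:E].
Proof. by have := mN measurableT (emeasurable_set1 k%:R%:E); rewrite setTI. Qed.

Lemma poisson_weights (g : nat -> R) : (forall k, 0 <= g k)%R ->
  \sum_(k <oo) (g k)%:E * P [set w | N w = k%:R%:E] =
  (expR (- l))%:E * \sum_(k <oo) (g k * (l ^+ k / k`!%:R))%:E.
Proof.
move=> g0; rewrite -nneseriesZl; last first.
  by move=> k _; rewrite lee_fin mulr_ge0// divr_ge0 ?exprn_ge0.
by apply: eq_eseriesr => k _; rewrite NP -!EFinM; congr EFin; ring.
Qed.

Lemma trivIset_level : trivIset setT (fun k : nat => [set w | N w = k%:R%:E]).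
Proof.
move=> i j _ _ [w [/= -> [] /eqP]].
by rewrite eqr_nat => /eqP.
Qed.

(** The hypotheses fix the probabilities of the finite values only; these already sum to exp(-l)
    exp(l) = 1. *)
Lemma poisson_finite : P [set w | N w = +oo] = 0.
Proof.
have mU : measurable (\bigcup_k [set w | N w = k%:R%:E]).
  by apply: bigcup_measurable => k _; exact: measurable_level.
have E1 : P (\bigcup_k [set w | N w = k%:R%:E]) = 1.
  rewrite measure_bigcup//=; last 2 first.
    by move=> k _; exact: measurable_level.
    exact: trivIset_level.
  have := @poisson_weights (fun=> 1%R) (fun=> ler01).
  under eq_eseriesr do rewrite mul1e.
  under [in X in _ = X -> _]eq_eseriesr do rewrite mul1r.
  rewrite nneseries_exp// -EFinM -expRD addNr expR0.
  by move=> <-; apply: eq_eseriesl => k; rewrite in_setT.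
rewrite (_ : [set _ | _] = ~` (\bigcup_k [set w | N w = k%:R%:E])).
  by rewrite probability_setC// E1 subee.
apply/seteqP; split => w /=.
  by move=> Nw [k _ /=]; rewrite Nw.
by have [//|[k Nk] H] := N_nat w; exfalso; apply: H; exists k.
Qed.

Lemma poisson_expectation (g : nat -> R) (f : \bar R -> \bar R) :
  (forall k, 0 <= g k)%R -> (forall k, f k%:R%:E = (g k)%:E) ->
  measurable_fun setT f -> (forall x, 0 <= f x) ->
  \int[P]_w f (N w) =
    (expR (- l))%:E * \sum_(k <oo) (g k * (l ^+ k / k`!%:R))%:E.
Proof.
move=> g0 fg mf f0; rewrite -poisson_weights//.
rewrite (@ge0_negligible_integral _ _ _ _ _ [set w | N w = +oo])//; last 3 first.
  by have := mN measurableT (emeasurable_set1 +oo); rewrite setTI.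
  exact: measurableT_comp.
  exact: poisson_finite.
set D := (_ `\` _).
have -> : D = \bigcup_k [set w | N w = k%:R%:E].
  apply/seteqP; split => w /=.
    by move=> [_]; have [//|[k Nk]] := N_nat w; exists k.
  by move=> [k _ /= Nk]; split => //=; rewrite Nk.
rewrite ge0_integral_bigcup//; last 3 first.
  exact: measurable_level.
  by apply: measurable_funTS; exact: measurableT_comp.
  exact: trivIset_level.
apply: eq_eseriesr => k _.
under eq_integral => w /[1!inE]/= Nk do rewrite Nk fg.
by rewrite integral_cst//; exact: measurable_level.
Qed.

Let N0 w : 0 <= N w.
Proof. by have [->//|[k ->]] := N_nat w; rewrite lee_fin. Qed.

Lemma poisson_mean : \int[P]_w N w = l%:E.
Proof.
(* The absolute value is the identity on the values of [N]; it is inserted because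
   [poisson_expectation] asks for a function that is nonnegative on all extended reals. *)
under eq_integral do rewrite -[N _]gee0_abs//.
rewrite (@poisson_expectation (fun k => k%:R * 1)%R (fun x => `|x|))//; last 2 first.
  by move=> k; rewrite mulr1 gee0_abs// lee_fin.
  exact: measurableT_comp.
rewrite nneseries_exp_shift//.
under eq_eseriesr do rewrite mul1r.
by rewrite nneseries_exp// -!EFinM mulrCA -expRD addNr expR0 mulr1.
Qed.

Lemma poisson_sqr_mean : \int[P]_w (N w * N w) = (l + l ^+ 2)%:E.
Proof.
rewrite (@poisson_expectation (fun k => k%:R * k%:R)%R (fun x => x * x))//; last 2 first.
  exact: emeasurable_funM.
  by move=> [x| |]; [rewrite -EFinM lee_fin -expr2 sqr_ge0|rewrite mulyy|rewrite mulNyNy].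
rewrite nneseries_exp_shift//.
have -> : \sum_(k <oo) (k.+1%:R * (l ^+ k / k`!%:R))%:E = (l * expR l + expR l)%:E.
  rewrite EFinD EFinM -(nneseries_exp l0).
  have := @nneseries_exp_shift l (fun=> 1%R) l0 (fun=> ler01).
  under [in RHS]eq_eseriesr do rewrite mul1r.
  move=> <-; rewrite -nneseriesD//; last 2 first.
    by move=> k _ _; rewrite lee_fin mulr1 mulr_ge0// divr_ge0 ?exprn_ge0.
    by move=> k _ _; rewrite lee_fin divr_ge0 ?exprn_ge0.
  by apply: eq_eseriesr => k _; rewrite -EFinD -natr1 mulrDl mulr1 mul1r.
rewrite -!EFinM; congr EFin; rewrite expRN.
by field; rewrite gt_eqF// expR_gt0.
Qed.

End poisson_moments.

Section nneseries_product.
Local Open Scope ereal_scope.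
Context (R : realType).
Implicit Types a b : nat -> \bar R.

Lemma nneseriesZr a x : (forall i, 0 <= a i) -> 0 <= x ->
  \sum_(i <oo) (a i * x) = (\sum_(i <oo) a i) * x.
Proof.
move=> a0 x0; rewrite -!ge0_integral_count//; last by move=> i; rewrite mule_ge0.
by rewrite ge0_integralZr.
Qed.

Lemma nneseriesZl_ereal a x : (forall i, 0 <= a i) -> 0 <= x ->
  \sum_(i <oo) (x * a i) = x * \sum_(i <oo) a i.
Proof.
by move=> a0 x0; under eq_eseriesr do rewrite muleC; rewrite nneseriesZr// muleC.
Qed.

Lemma nneseries_off_diagonal (c : nat -> nat -> \bar R) :
  (forall i j, 0 <= c i j) ->
  \sum_(i <oo) \sum_(j <oo) c i j = \sum_(i <oo) c i i +
    \sum_(i <oo) \sum_(j <oo) (if i == j then 0 else c i j).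
Proof.
move=> c0.
have d0 i j : 0 <= (if i == j then 0 else c i j) by case: ifP.
rewrite -nneseriesD//; last by move=> i _ _; exact: nneseries_ge0.
apply: eq_eseriesr => i _; rewrite (@nneseriesD1 _ _ i)//; congr (_ + _).
rewrite eseries_mkcond; apply: eq_eseriesr => j _.
by rewrite eq_sym; case: eqP.
Qed.

Lemma nneseriesM a b : (forall i, 0 <= a i) -> (forall i, 0 <= b i) ->
  (\sum_(i <oo) a i) * (\sum_(i <oo) b i) = \sum_(i <oo) a i * b i +
    \sum_(i <oo) \sum_(j <oo) (if i == j then 0 else a i * b j).
Proof.
move=> a0 b0; rewrite -nneseries_off_diagonal; last by move=> *; exact: mule_ge0.
rewrite -nneseriesZr//; last exact: nneseries_ge0.
by apply: eq_eseriesr => i _; rewrite nneseriesZl_ereal.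
Qed.

Lemma integral_mrestr d (T : measurableType d) (m : {measure set T -> \bar R})
    (D : set T) (mD : measurable D) (f : T -> \bar R) :
  (forall x, ~ D x -> f x = 0) -> \int[mrestr m mD]_x f x = \int[m]_x f x.
Proof.
move=> f0.
have fD : f = f \_ D.
  apply/funext => x; rewrite patchE; case: ifPn => //.
  by rewrite notin_setE => /f0.
rewrite fD -!integral_mkcond; apply: eq_measure_integral => A mA AD.
by rewrite /= /mrestr setIidl.
Qed.

End nneseries_product.

(** * Campbell formulas of first and second order *)

Section point_sums.
Local Open Scope ereal_scope.
Context (R : realType) d (Omega : measurableType d) (P : probability Omega R).
Context d' (E : measurableType d') (xi : nat -> Omega -> E).
Variable Lam : {measure set E -> \bar R}.
Hypothesis PRM : poisson_random_measure P xi Lam.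

Definition psum (f : E -> \bar R) (w : Omega) : \bar R := \sum_(i <oo) f (xi i w).

Lemma measurable_xi i : measurable_fun setT (xi i).
Proof. by have [] := PRM. Qed.

Let xim i : {mfun Omega >-> E} :=
  HB.pack (xi i) (isMeasurableFun.Build _ _ _ _ _ (measurable_xi i)).

Lemma psum_ge0 f : (forall x, 0 <= f x) -> forall w, 0 <= psum f w.
Proof. by move=> f0 w; exact: nneseries_ge0. Qed.

Lemma measurable_psum f : (forall x, 0 <= f x) -> measurable_fun setT f ->
  measurable_fun setT (psum f).
Proof.
move=> f0 mf; rewrite /psum.
apply: (@ge0_emeasurable_sum _ _ _ _ (fun i w => f (xi i w)) xpredT) => // k _.
by apply: measurableT_comp => //; exact: measurable_xi.
Qed.

Lemma num_pointsE A w : num_points R xi A w = psum (fun x => (\1_A x)%:E) w :> \bar R.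
Proof.
by rewrite /num_points counting_dirac; apply: eq_eseriesr => i _; rewrite diracE indicE.
Qed.

Lemma measurable_num_points A : measurable A ->
  measurable_fun setT (num_points R xi A : Omega -> \bar R).
Proof.
move=> mA; rewrite (_ : num_points R xi A = psum (fun x => (\1_A x)%:E)).
  apply: measurable_psum; first by move=> x; rewrite lee_fin.
  exact/measurable_EFinP/measurable_indic.
by apply/funext => w; exact: num_pointsE.
Qed.

Lemma num_points_nat A w : num_points R xi A w = +oo :> \bar R \/
  exists k : nat, num_points R xi A w = k%:R%:E :> \bar R.
Proof.
rewrite /num_points /counting; case: ifPn => _; last by left.
by right; eexists.
Qed.

Lemma mean_num_points A : measurable A -> \int[P]_w num_points R xi A w = Lam A.
Proof.
move=> mA; have [_ Pfin Poo _] := PRM.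
have [Aoo|] := eqVneq (Lam A) +oo.
  rewrite Aoo.
  have mN : measurable [set w | num_points R xi A w = +oo :> \bar R].
    have := measurable_num_points mA measurableT (emeasurable_set1 +oo).
    by rewrite setTI.
  apply/eqP; rewrite -leye_eq.
  have : \int[P]_(w in [set w | num_points R xi A w = +oo :> \bar R]) num_points R xi A w <=
      \int[P]_w num_points R xi A w.
    apply: ge0_subset_integral => //; exact: measurable_num_points.
  move/(le_trans _); apply.
  under eq_integral => w /[1!inE]/= Nw do rewrite Nw.
  by rewrite integral_cst// [X in _ * X](Poo _ mA Aoo) mule1.
rewrite -ltey => Afin.
have Af : Lam A \is a fin_num by rewrite ge0_fin_numE.
rewrite (@poisson_mean _ _ _ P (num_points R xi A) (fine (Lam A))).
- by rewrite fineK.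
- exact: measurable_num_points.
- exact: num_points_nat.
- by move=> k; exact: Pfin.
- exact: fine_ge0.
Qed.

Lemma sqr_mean_num_points A : measurable A -> Lam A < +oo ->
  \int[P]_w (num_points R xi A w * num_points R xi A w) = Lam A + Lam A * Lam A.
Proof.
move=> mA Afin; have [_ Pfin _ _] := PRM.
have Af : Lam A \is a fin_num by rewrite ge0_fin_numE.
rewrite (@poisson_sqr_mean _ _ _ P (num_points R xi A) (fine (Lam A))).
- by rewrite EFinD expr2 EFinM fineK.
- exact: measurable_num_points.
- exact: num_points_nat.
- by move=> k; exact: Pfin.
- exact: fine_ge0.
Qed.

(** The mean measure of the process, given as a series of probability measures so that integrals
    against it are computed term by term. *)
Definition intensity : set E -> \bar R :=
  mseries (fun i => distribution P (xim i)) 0.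

HB.instance Definition _ := Measure.on intensity.

Lemma intensityE A : measurable A -> Lam A = intensity A.
Proof.
move=> mA; rewrite -mean_num_points//.
under eq_integral do rewrite num_pointsE.
rewrite integral_nneseries//; last first.
  move=> i; apply/measurable_EFinP; apply: measurableT_comp => //; exact: measurable_xi.
apply: eq_eseriesr => i _.
rewrite (_ : (fun w => (\1_A (xi i w))%:E) = (fun w => (\1_(xi i @^-1` A) w)%:E))//.
by rewrite integral_indic ?setIT// -[X in measurable X]setTI; exact: measurable_xi.
Qed.

(** Campbell's formula. Since [Lam] agrees with the sum of the laws of the points, an integral
    against it is the series of the expectations of f(xi_i). *)
Lemma campbell f : (forall x, 0 <= f x) -> measurable_fun setT f ->
  \int[P]_w psum f w = \int[Lam]_x f x.
Proof.
move=> f0 mf.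
rewrite (eq_measure_integral intensity); last by move=> A mA _; exact: intensityE.
rewrite ge0_integral_measure_series// integral_nneseries//; last first.
  by move=> i; apply: measurableT_comp => //; exact: measurable_xi.
apply: eq_eseriesr => i _.
by rewrite ge0_integral_pushforward.
Qed.


Section second_moment.
Variables (A0 : set E) (mA0 : measurable A0) (A0fin : Lam A0 < +oo).

Let mA00 : measurable (A0 `*` A0).
Proof. exact: measurableX. Qed.

Lemma measurable_xi_pair i j : measurable_fun setT (fun w => (xi i w, xi j w)).
Proof. by apply: measurable_fun_pair; exact: measurable_xi. Qed.

Let xij i j : {mfun Omega >-> (E * E)%type} :=
  HB.pack (fun w => (xi i w, xi j w))
    (isMeasurableFun.Build _ _ _ _ _ (measurable_xi_pair i j)).

Definition off i j : {measure set (E * E) -> \bar R} :=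
  if i == j then (mzero : {measure set (E * E) -> \bar R})
  else (mrestr (distribution P (xij i j)) mA00 : {measure set (E * E) -> \bar R}).

(** The second factorial moment measure of the process, cut down to [A0]. As [A0] has finite
    intensity, the values on rectangles are finite and may be cancelled below, and the target
    product measure has finite factors. *)
Definition off2 : {measure set (E * E) -> \bar R} :=
  mseries (fun i => mseries (off i) 0) 0.

Definition offsum (F : E * E -> \bar R) (w : Omega) : \bar R :=
  \sum_(i <oo) \sum_(j <oo) (if i == j then 0 else F (xi i w, xi j w)).

Lemma offsum_ge0 F : (forall x, 0 <= F x) -> forall w, 0 <= offsum F w.
Proof.
move=> F0 w; apply: nneseries_ge0 => i _ _; apply: nneseries_ge0 => j _ _.
by case: eqP.
Qed.

Lemma measurable_offsum F : (forall x, 0 <= F x) -> measurable_fun setT F ->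
  measurable_fun setT (offsum F).
Proof.
move=> F0 mF; apply: (@ge0_emeasurable_sum _ _ _ _
    (fun i w => \sum_(j <oo) (if i == j then 0 else F (xi i w, xi j w))) xpredT).
  by move=> i w _ _; apply: nneseries_ge0 => j _ _; case: eqP.
move=> i _; apply: (@ge0_emeasurable_sum _ _ _ _
    (fun j w => if i == j then 0 else F (xi i w, xi j w)) xpredT).
  by move=> j w _ _; case: eqP.
by move=> j _; case: eqP => // _; apply: measurableT_comp => //; exact: measurable_xi_pair.
Qed.

Lemma psumM f g w : (forall x, 0 <= f x) -> (forall x, 0 <= g x) ->
  psum f w * psum g w = psum (fun x => f x * g x) w + offsum (fun z => f z.1 * g z.2) w.
Proof. by move=> f0 g0; rewrite /psum nneseriesM. Qed.

Let integral_off2 (F : E * E -> \bar R) : (forall x, 0 <= F x) ->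
  measurable_fun setT F -> (forall x, ~ (A0 `*` A0) x -> F x = 0) ->
  \int[off2]_x F x = \int[P]_w offsum F w.
Proof.
move=> F0 mF FA.
have mFx i j : measurable_fun setT (fun w => if i == j then 0 else F (xi i w, xi j w)).
  by case: eqP => // _; apply: measurableT_comp => //; exact: measurable_xi_pair.
have Fx0 i j w : 0 <= (if i == j then 0 else F (xi i w, xi j w)) by case: eqP.
rewrite ge0_integral_measure_series// integral_nneseries//; last 2 first.
  by move=> i; apply: (@ge0_emeasurable_sum _ _ _ _ _ xpredT).
  by move=> i w _; exact: nneseries_ge0.
apply: eq_eseriesr => i _.
rewrite ge0_integral_measure_series// integral_nneseries//.
apply: eq_eseriesr => j _; rewrite /off; case: eqP => ij.
  by rewrite integral_measure_zero integral0.
by rewrite integral_mrestr// ge0_integral_distribution.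
Qed.

Let off2_restr (X : set (E * E)) : off2 X = off2 (X `&` (A0 `*` A0)).
Proof.
apply: eq_eseriesr => i _; apply: eq_eseriesr => j _; rewrite /off.
by case: eqP => // _; rewrite /= /mrestr -setIA setIid.
Qed.

Let ind A B (z : E * E) : \bar R := (\1_A z.1)%:E * (\1_B z.2)%:E.

Let ind_ge0 A B z : 0 <= ind A B z.
Proof. by rewrite /ind -EFinM lee_fin mulr_ge0. Qed.

Let measurable_ind A B : measurable A -> measurable B ->
  measurable_fun setT (ind A B).
Proof.
move=> mA mB; apply: emeasurable_funM.
  apply/measurable_EFinP; apply: (measurableT_comp (measurable_indic mA)).
  exact: measurable_fst.
apply/measurable_EFinP; apply: (measurableT_comp (measurable_indic mB)).
exact: measurable_snd.
Qed.

Let off2_rect A B : measurable A -> measurable B -> A `<=` A0 -> B `<=` A0 ->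
  off2 (A `*` B) = \int[P]_w offsum (ind A B) w.
Proof.
move=> mA mB AA BA.
have E1 : ind A B = fun z => (\1_(A `*` B) z)%:E.
  apply/funext => -[x y]; rewrite /ind -EFinM; congr EFin; rewrite !indicE -natrM mulnb.
  by congr (_%:R); congr nat_of_bool; rewrite in_setX.
rewrite -[A `*` B]setIT -integral_indic//; last exact: measurableX.
rewrite -integral_off2; last 3 first.
  exact: ind_ge0.
  exact: measurable_ind.
  move=> x Ax; rewrite E1 indicE memNset// => -[/= ? ?]; apply: Ax.
  by split; [exact: AA|exact: BA].
by rewrite E1.
Qed.

Let off2C A B : measurable A -> measurable B -> A `<=` A0 -> B `<=` A0 ->
  off2 (A `*` B) = off2 (B `*` A).
Proof.
move=> mA mB AA BA; rewrite (off2_rect mA mB AA BA) (off2_rect mB mA BA AA).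
apply: eq_integral => w _; rewrite /offsum nneseries_interchange; last first.
  by move=> i j; case: eqP.
apply: eq_eseriesr => i _; apply: eq_eseriesr => j _.
by rewrite eq_sym; case: eqP => // _; rewrite /ind muleC.
Qed.

(** N(A)^2 is N(A) plus the number of ordered pairs of distinct points in A, so the mean l + l^2 of
    the square leaves l^2 for the pairs. *)
Let off2_square A : measurable A -> A `<=` A0 -> off2 (A `*` A) = Lam A * Lam A.
Proof.
move=> mA AA.
have Afin : Lam A < +oo by apply: le_lt_trans A0fin; apply: le_measure; rewrite ?inE.
have Af : Lam A \is a fin_num by rewrite ge0_fin_numE.
have NE w : num_points R xi A w * num_points R xi A w = num_points R xi A w +
    offsum (ind A A) w.
  rewrite num_pointsE psumM; last 2 first.
    by move=> x; rewrite lee_fin.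
    by move=> x; rewrite lee_fin.
  congr (_ + _); apply: eq_eseriesr => i _.
  by rewrite -EFinM indicE; case: (_ \in _); rewrite /= ?mulr1 ?mulr0.
have := sqr_mean_num_points mA Afin.
under eq_integral do rewrite NE.
rewrite ge0_integralD//; last 3 first.
  exact: measurable_num_points.
  by move=> w _; apply: offsum_ge0; exact: ind_ge0.
  by apply: measurable_offsum; [exact: ind_ge0|exact: measurable_ind].
rewrite mean_num_points// -off2_rect// => /(congr1 (fun x => x - Lam A)).
by rewrite [X in X - _]addeC [X in _ = X - _]addeC !addeK.
Qed.

Let off2_fin A B : measurable A -> measurable B -> A `<=` A0 -> B `<=` A0 ->
  off2 (A `*` B) \is a fin_num.
Proof.
move=> mA mB AA BA; rewrite ge0_fin_numE//.
apply: (@le_lt_trans _ _ (off2 (A0 `*` A0))).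
  apply: le_measure; rewrite ?inE; [exact: measurableX..|].
  by move=> [x y] [/= /AA ? /BA].
by rewrite off2_square// lte_mul_pinfty// ge0_fin_numE.
Qed.

Let off2Ul A B C : measurable A -> measurable B -> measurable C ->
  A `<=` A0 -> B `<=` A0 -> C `<=` A0 -> A `&` B = set0 ->
  off2 ((A `|` B) `*` C) = off2 (A `*` C) + off2 (B `*` C).
Proof.
move=> mA mB mC AA BA CA AB.
rewrite (_ : _ `*` _ = (A `*` C) `|` (B `*` C)); last first.
  by apply/seteqP; split => -[x y] /=; tauto.
rewrite measureU//; [exact: measurableX..|].
by apply/seteqP; split => -[x y] //= [[Ax _] [Bx _]]; have : (A `&` B) x by []; rewrite AB.
Qed.

(** Polarization: expanding the value on the square of the union of A and B gives Lam(A)^2 + 2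
    off2(A x B) + Lam(B)^2 by symmetry, to be compared with (Lam(A) + Lam(B))^2. All terms are
    finite, so the squares cancel. *)
Let off2_disjoint A B : measurable A -> measurable B ->
  A `<=` A0 -> B `<=` A0 -> A `&` B = set0 -> off2 (A `*` B) = Lam A * Lam B.
Proof.
move=> mA mB AA BA AB.
have mU : measurable (A `|` B) by exact: measurableU.
have UA : A `|` B `<=` A0 by move=> x [/AA|/BA].
have fin C : measurable C -> C `<=` A0 -> Lam C \is a fin_num.
  move=> mC CA; rewrite ge0_fin_numE//; apply: le_lt_trans A0fin.
  by apply: le_measure; rewrite ?inE.
have LU : Lam (A `|` B) = Lam A + Lam B.
  exact: measureU.
have := off2_square mU UA.
rewrite (off2Ul mA mB mU AA BA UA AB) (off2C mA mU AA UA) (off2C mB mU BA UA).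
rewrite (off2Ul mA mB mA AA BA AA AB) (off2Ul mA mB mB AA BA BA AB).
rewrite (off2C mB mA BA AA) !off2_square// LU.
move: (fin _ mA AA) (fin _ mB BA) (off2_fin mA mB AA BA).
move: (Lam A) (Lam B) (off2 _) => [a| |] [b| |] [c| |]// _ _ _.
by rewrite -!(EFinM, EFinD) => -[] H; congr EFin; lra.
Qed.

(** Cutting both sides along the intersection of A and B leaves one square and rectangles whose
    sides are disjoint. *)
Let off2E A B : measurable A -> measurable B ->
  off2 (A `*` B) = Lam (A `&` A0) * Lam (B `&` A0).
Proof.
move=> mA mB; rewrite off2_restr.
have -> : (A `*` B) `&` (A0 `*` A0) = (A `&` A0) `*` (B `&` A0).
  by apply/seteqP; split => -[x y] /=; tauto.
have mA' : measurable (A `&` A0) by exact: measurableI.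
have mB' : measurable (B `&` A0) by exact: measurableI.
have {mA mB}: A `&` A0 `<=` A0 /\ B `&` A0 `<=` A0 by split=> x [].
move: (A `&` A0) (B `&` A0) mA' mB' => {}A {}B mA mB [AA BA].
have mI : measurable (A `&` B) by exact: measurableI.
have mAB : measurable (A `\` B) by exact: measurableD.
have mBA : measurable (B `\` A) by exact: measurableD.
have IA : A `&` B `<=` A0 by move=> x [/AA].
have ABA : A `\` B `<=` A0 by move=> x [/AA].
have BAA : B `\` A `<=` A0 by move=> x [/BA].
have AE : A = (A `\` B) `|` (A `&` B) by rewrite setUC setUIDK.
have BE : B = (B `\` A) `|` (A `&` B) by rewrite setUC setIC setUIDK.
have D1 : (A `\` B) `&` (A `&` B) = set0.
  by apply/seteqP; split => x // [[_ ?] []].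
have D2 : (B `\` A) `&` (A `&` B) = set0.
  by apply/seteqP; split => x // [[_ ?] []].
have D3 : (A `\` B) `&` B = set0.
  by apply/seteqP; split => x // [[_ ?]].
rewrite [in LHS]AE (off2Ul mAB mI mB ABA IA BA D1) (off2_disjoint mAB mB ABA BA D3).
rewrite (off2C mI mB IA BA) {3}BE (off2Ul mBA mI mI BAA IA IA D2).
rewrite (off2_disjoint mBA mI BAA IA D2) off2_square//.
have LA : Lam A = Lam (A `\` B) + Lam (A `&` B).
  by rewrite {1}AE measureU.
have LB : Lam B = Lam (B `\` A) + Lam (A `&` B).
  by rewrite {1}BE measureU.
by rewrite -ge0_muleDl// -LB [Lam B * _]muleC -ge0_muleDl// -LA.
Qed.

Let Lam0 : {finite_measure set E -> \bar R} := mfrestr mA0 A0fin.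

(** Second order Campbell formula. The diagonal pairs give the integral of f g; the distinct pairs
    are integrated against [off2], which coincides with the product measure because it does so on
    rectangles. *)
Lemma mean_psumM (f g : E -> \bar R) : (forall x, 0 <= f x) ->
  (forall x, 0 <= g x) -> measurable_fun setT f -> measurable_fun setT g ->
  (forall x, ~ A0 x -> f x = 0) -> (forall x, ~ A0 x -> g x = 0) ->
  \int[P]_w (psum f w * psum g w) =
  \int[Lam]_x (f x * g x) + (\int[Lam]_x f x) * (\int[Lam]_x g x).
Proof.
move=> f0 g0 mf mg fA gA.
pose F (z : E * E) := f z.1 * g z.2.
have F0 z : 0 <= F z by exact: mule_ge0.
have mF : measurable_fun setT F.
  apply: emeasurable_funM.
    by apply: (measurableT_comp mf); exact: measurable_fst.
  by apply: (measurableT_comp mg); exact: measurable_snd.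
rewrite (eq_integral (fun w => psum (fun x => f x * g x) w + offsum F w));
  last by move=> w _; rewrite psumM.
rewrite ge0_integralD//; last 4 first.
  by move=> w _; apply: psum_ge0 => x; exact: mule_ge0.
  by apply: measurable_psum => [x|]; [exact: mule_ge0|exact: emeasurable_funM].
  by move=> w _; exact: offsum_ge0.
  exact: measurable_offsum.
rewrite campbell//; last 2 first.
  by move=> x; exact: mule_ge0.
  exact: emeasurable_funM.
congr (_ + _); rewrite -/F -integral_off2//; last first.
  move=> [x y] /= A00; rewrite /F /=.
  have [/fA ->|Ax] := pselect (~ A0 x); first by rewrite mul0e.
  rewrite gA ?mule0// => Ay; apply: A00; split => //; exact: contrapT.
rewrite (eq_measure_integral (Lam0 \x Lam0)); last first.
  by move=> X mX _; apply/esym/product_measure_unique => // A B mA mB; rewrite off2E.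
have LE u : (forall x, ~ A0 x -> u x = 0) -> \int[Lam0]_x u x = \int[Lam]_x u x.
  exact: integral_mrestr.
have FE x : \int[Lam0]_y F (x, y) = f x * \int[Lam]_y g y.
  by rewrite -(LE g)// -ge0_integralZl.
rewrite fubini_tonelli1//.
transitivity (\int[Lam0]_x (f x * \int[Lam]_y g y)).
  by apply: eq_integral => x _; exact: FE.
by rewrite ge0_integralZr ?LE//; exact: integral_ge0.
Qed.

End second_moment.

End point_sums.

Lemma maxrBN (R : realDomainType) (x : R) : x = Num.max x 0 - Num.max (- x) 0.
Proof.
have [x0|x0] := leP 0 x; first by rewrite max_r ?oppr_le0// subr0.
by rewrite max_l ?oppr_ge0 ?ltW// sub0r opprK.
Qed.

Lemma measurable_absr_gt (R : realType) d (T : measurableType d) (f : T -> R) (e : R) :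
  measurable_fun setT f -> measurable [set w | e < `|f w|].
Proof.
move=> mf; have : measurable_fun setT (fun w => `|f w|) by exact: measurableT_comp.
move=> /(_ measurableT _ (measurable_itv `]e, +oo[)); rewrite setTI.
by congr measurable; apply/seteqP; split => w /=; rewrite in_itv/= andbT.
Qed.

Lemma le_measure_ae (R : realType) d (T : measurableType d)
    (m : {measure set T -> \bar R}) (A B : set T) :
  measurable A -> measurable B -> {ae m, forall w, A w -> B w} -> (m A <= m B)%E.
Proof.
move=> mA mB [N [mN N0 AB]].
apply: (@le_trans _ _ (m (B `|` N))).
  apply: le_measure; rewrite ?inE//; first exact: measurableU.
  move=> w Aw; have [Bw|nBw] := pselect (B w); first by left.
  by right; apply: AB => /= /(_ Aw).
by apply: le_trans (measureU2 _ mB mN) _; rewrite [X in (_ + X)%E]N0 adde0.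
Qed.

Lemma markov_sqr (R : realType) d (T : measurableType d)
    (m : {measure set T -> \bar R}) (f : T -> R) (e : R) :
  measurable_fun setT f -> 0 < e ->
  (m [set w | (e < `|f w|)%R] <= (e ^- 2)%:E * \int[m]_w (f w ^+ 2)%:E)%E.
Proof.
move=> mf e0; have e20 : 0 < e ^+ 2 by rewrite exprn_gt0.
have mS := measurable_absr_gt e mf.
rewrite lee_pdivlMl// -[X in m X]setIT -integral_indic// -ge0_integralZl_EFin ?(ltW e20)//; last first.
  by apply/measurable_EFinP/measurable_indic.
apply: ge0_le_integral => //.
- by move=> w _; rewrite -EFinM lee_fin mulr_ge0// ltW.
- by apply: emeasurable_funM => //; apply/measurable_EFinP/measurable_indic.
- by apply/measurable_EFinP; exact: measurable_funX.
move=> w _; rewrite indicE; have [ew|_] := boolP (w \in _); last first.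
  by rewrite mule0 lee_fin sqr_ge0.
move: ew; rewrite inE/= mule1 lee_fin => ew.
by rewrite -[leRHS]real_normK ?num_real// ler_sqr ?nnegrE// ltW.
Qed.

(** * Centered sums over the points and their variance *)

Section signed_sums.
Local Open Scope ereal_scope.
Context (R : realType) d (Omega : measurableType d) (P : probability Omega R).
Context d' (E : measurableType d') (xi : nat -> Omega -> E).
Variable Lam : {measure set E -> \bar R}.
Hypothesis PRM : poisson_random_measure P xi Lam.
Implicit Types (q : E -> R) (A : set E).

Definition pospart q (x : E) : \bar R := (Num.max (q x) 0)%:E.
Definition negpart q (x : E) : \bar R := (Num.max (- q x) 0)%:E.

Lemma pospart_ge0 q x : 0 <= pospart q x.
Proof. by rewrite lee_fin le_max lexx orbT. Qed.

Lemma negpart_ge0 q x : 0 <= negpart q x.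
Proof. by rewrite lee_fin le_max lexx orbT. Qed.

Lemma measurable_pospart q : measurable_fun setT q -> measurable_fun setT (pospart q).
Proof. by move=> mq; apply/measurable_EFinP; exact: measurable_maxr. Qed.

Lemma measurable_negpart q : measurable_fun setT q -> measurable_fun setT (negpart q).
Proof.
move=> mq; apply/measurable_EFinP; apply: measurable_maxr => //.
exact: measurableT_comp.
Qed.

(** A sum with finite support, equal to 0 by convention when infinitely many terms are nonzero. It
    serves for q vanishing off a set of finite intensity, where almost surely finitely many points
    contribute. *)
Definition rsum q (w : Omega) : R := (\sum_(i \in [set: nat]) q (xi i w))%R.

Lemma rsum_fset A q w : finite_set [set i | A (xi i w)] ->
  (forall x, ~ A x -> q x = 0%R) ->
  rsum q w = (\sum_(i \in [set i | A (xi i w)]) q (xi i w))%R.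
Proof.
move=> fA qA; rewrite /rsum; apply/esym/fsbig_widen => // i [_ /= /qA]; exact.
Qed.

Lemma psum_fset A (f : E -> R) w : finite_set [set i | A (xi i w)] ->
  (forall x, 0 <= f x)%R -> (forall x, ~ A x -> f x = 0%R) ->
  psum xi (fun x => (f x)%:E) w = (\sum_(i \in [set i | A (xi i w)]) f (xi i w))%R%:E.
Proof.
move=> fA f0 fA0; rewrite /psum nneseries_esumT; last by move=> n; rewrite lee_fin.
rewrite -fsumEFin// -esum_fset//; last by move=> i _; rewrite lee_fin.
rewrite [RHS]esum_mkcond; apply: eq_esum => i _.
by case: ifPn => //; rewrite notin_setE => /= /fA0 ->.
Qed.

Lemma rsumE A q w : finite_set [set i | A (xi i w)] ->
  (forall x, ~ A x -> q x = 0%R) ->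
  rsum q w = (fine (psum xi (pospart q) w) - fine (psum xi (negpart q) w))%R.
Proof.
move=> fA qA; rewrite (rsum_fset fA qA).
rewrite (psum_fset fA); last 2 first.
  by move=> x; rewrite le_max lexx orbT.
  by move=> x /qA ->; rewrite maxxx.
rewrite (psum_fset fA); last 2 first.
  by move=> x; rewrite le_max lexx orbT.
  by move=> x /qA ->; rewrite oppr0 maxxx.
rewrite /= !fsbig_finite//= -sumrB; apply: eq_bigr => i _.
by rewrite [LHS]maxrBN.
Qed.

Lemma num_points_finite A w : num_points R xi A w < +oo -> finite_set [set i | A (xi i w)].
Proof. by rewrite /num_points /counting; case: asboolP. Qed.

Lemma ae_finite A : measurable A -> Lam A < +oo ->
  {ae P, forall w, finite_set [set i | A (xi i w)]}.
Proof.
move=> mA Afin.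
have Ai : P.-integrable setT (num_points R xi A).
  apply/integrableP; split; first exact: (measurable_num_points PRM).
  under eq_integral do rewrite gee0_abs// num_pointsE ?psum_ge0//.
  rewrite (campbell PRM); last 2 first.
    by move=> x; rewrite lee_fin.
    exact/measurable_EFinP/measurable_indic.
  by rewrite integral_indic// setIT.
have := integrable_ae measurableT Ai.
apply: filterS => w /(_ I) fN; apply: num_points_finite.
by rewrite ltey_eq fN.
Qed.

Lemma measurable_rsum q : measurable_fun setT q -> measurable_fun setT (rsum q).
Proof.
move=> mq.
pose A := [set x | q x != 0%R].
have mA : measurable A.
  have := mq measurableT _ (measurableC (measurable_set1 0%R)).
  rewrite setTI (_ : _ @^-1` _ = A)//.
  by apply/seteqP; split => x /= /eqP.
(* The default value 0 is taken exactly when infinitely many points lie in [A]; elsewhere the sum is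
   a difference of measurable series. *)
have fE : rsum q = fun w => if num_points R xi A w == +oo then 0%R else
    (fine (psum xi (pospart q) w) - fine (psum xi (negpart q) w))%R.
  apply/funext => w; case: ifPn => [/eqP Noo|Nfin].
    rewrite /rsum fsbig_dflt// => /(sub_finite_set _) fA.
    suff : num_points R xi A w < +oo by rewrite Noo.
    rewrite /num_points /counting asboolT ?ltry//; apply: fA => i /= /eqP q0.
    by split.
  rewrite (@rsumE A)//; last by move=> x /negP; rewrite negbK => /eqP.
  by apply: num_points_finite; rewrite ltey.
rewrite fE; apply: measurable_fun_ifT => //.
  apply: (measurable_fun_bool true); rewrite setTI.
  have := measurable_num_points PRM mA measurableT (emeasurable_set1 +oo).
  rewrite setTI; congr measurable.
  by apply/seteqP; split => w /= /eqP.
apply: measurable_funB; apply: measurableT_comp => //; apply: (measurable_psum PRM) => //.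
- exact: pospart_ge0.
- exact: measurable_pospart.
- exact: negpart_ge0.
- exact: measurable_negpart.
Qed.

Section variance.
Variables (sym : E -> E) (msym : measurable_fun setT sym).
Hypothesis Lam_sym : forall A, measurable A -> Lam (sym @^-1` A) = Lam A.
Variables (A0 : set E) (mA0 : measurable A0) (A0fin : Lam A0 < +oo).
Variables (q : E -> R) (mq : measurable_fun setT q) (B : R).
Hypothesis q_bnd : forall x, (`|q x| <= B)%R.
Hypothesis qA0 : forall x, ~ A0 x -> q x = 0%R.
Hypothesis q_odd : forall x, q (sym x) = (- q x)%R.

Lemma integral_sym (f : E -> \bar R) : (forall x, 0 <= f x) -> measurable_fun setT f ->
  \int[Lam]_x f (sym x) = \int[Lam]_x f x.
Proof.
move=> f0 mf; rewrite -(ge0_integral_pushforward msym _ measurableT mf)//.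
pose m := measure_function_pushforward__canonical__measure_function_Measure Lam msym.
by apply: (@eq_measure_integral _ _ _ setT Lam m) => A mA _; exact: Lam_sym.
Qed.

Let B0 : (0 <= B)%R.
Proof. exact: le_trans (q_bnd point). Qed.

Let pos_fin : \int[Lam]_x pospart q x < +oo.
Proof.
have -> : \int[Lam]_x pospart q x = \int[Lam]_(x in A0) pospart q x.
  rewrite [RHS]integral_mkcond; apply: eq_integral => x _; rewrite patchE.
  by case: ifPn => //; rewrite notin_setE /pospart => /qA0 ->; rewrite maxxx.
apply: (@le_lt_trans _ _ (\int[Lam]_(x in A0) B%:E)).
  apply: ge0_le_integral => //.
  - by move=> x _; exact: pospart_ge0.
  - by apply: measurable_funTS; exact: measurable_pospart.
  - move=> x _; rewrite lee_fin ge_max B0 andbT.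
    exact: le_trans (ler_norm _) (q_bnd x).
by rewrite integral_cst// lte_mul_pinfty// ge0_fin_numE.
Qed.

(** By oddness and symmetry q^+ and q^- have the same integral I. In the variance of the difference
    of the two one-sided sums the terms I^2 cancel, which leaves the integral of q^2; Chebyshev's
    inequality concludes. *)
Lemma rsum_var (eta : R) : (0 < eta)%R ->
  P [set w | (eta < `|rsum q w|)%R] <=
  (eta ^- 2)%:E * \int[Lam]_x (q x ^+ 2)%:E.
Proof.
move=> eta0.
have mp := measurable_pospart mq; have mn := measurable_negpart mq.
have p0 := pospart_ge0 q; have n0 := negpart_ge0 q.
have pA x : ~ A0 x -> pospart q x = 0 by rewrite /pospart => /qA0 ->; rewrite maxxx.
have nA x : ~ A0 x -> negpart q x = 0 by rewrite /negpart => /qA0 ->; rewrite oppr0 maxxx.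
have np : \int[Lam]_x negpart q x = \int[Lam]_x pospart q x.
  by rewrite -(integral_sym p0 mp); apply: eq_integral => x _; rewrite /pospart q_odd.
have UU := mean_psumM PRM mA0 A0fin p0 p0 mp mp pA pA.
have VV := mean_psumM PRM mA0 A0fin n0 n0 mn mn nA nA.
have UV := mean_psumM PRM mA0 A0fin p0 n0 mp mn pA nA.
pose I := \int[Lam]_x pospart q x.
have If : I \is a fin_num by rewrite ge0_fin_numE// integral_ge0.
have mU := measurable_psum PRM p0 mp.
have mV := measurable_psum PRM n0 mn.
have U0 := psum_ge0 xi p0; have V0 := psum_ge0 xi n0.
pose Z w := (fine (psum xi (pospart q) w) - fine (psum xi (negpart q) w))%R.
have mZ : measurable_fun setT Z by apply: measurable_funB; exact: measurableT_comp.
have mZ2 : measurable_fun setT (fun w => (Z w ^+ 2)%:E).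
  by apply/measurable_EFinP; exact: measurable_funX.
have IZ : \int[P]_w (Z w ^+ 2)%:E <= \int[Lam]_x (q x ^+ 2)%:E.
  (* Twice the cross moment is added to both sides, so that the pointwise inequality (u - v)^2 + 2 u
     v <= u^2 + v^2 is used without subtracting extended reals. *)
  have II : 2%:E * (I * I) \is a fin_num by rewrite !fin_numM.
  rewrite -(leeD2rE _ _ II).
  have -> : \int[P]_w (Z w ^+ 2)%:E + 2%:E * (I * I) =
      \int[P]_w ((Z w ^+ 2)%:E + 2%:E * (psum xi (pospart q) w * psum xi (negpart q) w)).
    rewrite ge0_integralD//; last 3 first.
    - by move=> w _; rewrite lee_fin sqr_ge0.
    - by move=> w _; rewrite !mule_ge0.
    - by apply: emeasurable_funM => //; exact: emeasurable_funM.
    rewrite ge0_integralZl//; last 2 first.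
    - exact: emeasurable_funM.
    - by move=> w _; rewrite mule_ge0.
    rewrite UV np -/I [X in _ = _ + 2%:E * (X + _)](_ : _ = 0) ?add0e//.
    rewrite -[RHS](integral0 Lam setT); apply: eq_integral => x _.
    rewrite /pospart /negpart -EFinM.
    by have [x0|x0] := leP 0%R (q x); rewrite ?mul0r// [X in (_ * X)%R]max_r ?mulr0// oppr_le0.
  have -> : \int[Lam]_x (q x ^+ 2)%:E + 2%:E * (I * I) =
      \int[P]_w (psum xi (pospart q) w * psum xi (pospart q) w +
                 psum xi (negpart q) w * psum xi (negpart q) w).
    rewrite ge0_integralD//; last 4 first.
    - by move=> w _; rewrite mule_ge0.
    - exact: emeasurable_funM.
    - by move=> w _; rewrite mule_ge0.
    - exact: emeasurable_funM.
    rewrite UU VV np -/I addeACA -ge0_integralD//; last 4 first.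
    - by move=> w _; rewrite mule_ge0.
    - exact: emeasurable_funM.
    - by move=> w _; rewrite mule_ge0.
    - exact: emeasurable_funM.
    congr (_ + _); last by case: (I) If => [r| |]// _; rewrite -!EFinM -EFinD; congr EFin; ring.
    apply: eq_integral => x _; rewrite /pospart /negpart -!EFinM -EFinD; congr EFin.
    have [x0|x0] := leP 0%R (q x).
      by rewrite max_r ?oppr_le0// mulr0 addr0 expr2.
    by rewrite max_l ?oppr_ge0 ?ltW// mulr0 add0r expr2 mulrNN.
  apply: ge0_le_integral => //.
  - by move=> w _; rewrite adde_ge0// ?lee_fin ?sqr_ge0// !mule_ge0.
  - by apply: emeasurable_funD => //; apply: emeasurable_funM => //; exact: emeasurable_funM.
  - by apply: emeasurable_funD; exact: emeasurable_funM.
  (* When a one-sided sum is infinite, [fine] replaces it by 0 in [Z], but then the right-hand side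
     is +oo. *)
  move=> w _; rewrite /Z; move: (U0 w) (V0 w).
  case: (psum xi (pospart q) w) => [u| |]//; case: (psum xi (negpart q) w) => [v| |]// u0 v0.
  - by rewrite /= -!EFinM -!EFinD lee_fin; lra.
  - by rewrite [leRHS](_ : _ = +oo) ?leey// mulyy addey// -EFinM.
  - by rewrite [leRHS](_ : _ = +oo) ?leey// mulyy addye// -EFinM.
  - by rewrite [leRHS](_ : _ = +oo) ?leey// mulyy.
apply: (@le_trans _ _ (P [set w | (eta < `|Z w|)%R])).
  apply: le_measure_ae.
  - by apply: measurable_absr_gt; exact: measurable_rsum.
  - exact: measurable_absr_gt.
  by have := ae_finite mA0 A0fin; apply: filterS => w wfin /=; rewrite (rsumE wfin).
apply: le_trans (markov_sqr P mZ eta0) _.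
by rewrite lee_pmul2l// lte_fin invr_gt0 exprn_gt0.
Qed.

End variance.

End signed_sums.

(** * One big jump *)

Lemma nneseries_geometric (R : realType) (a r : R) : 0 <= r < 1 ->
  (\sum_(k <oo) (a * r ^+ k)%:E = (a / (1 - r))%:E)%E.
Proof.
move=> /andP[r0 r1]; apply/cvg_lim => //.
have : series (geometric a r) @ \oo --> a * (1 - r)^-1.
  by apply: cvg_geometric_series; rewrite ger0_norm.
move=> h; under eq_fun do rewrite sumEFin.
by apply: cvg_EFin => //; exact: nearW.
Qed.

Section dyadic.
Context (R : realType) d (T : measurableType d) (m : {measure set T -> \bar R}).
Variables (alpha : R) (alpha_gt0 : 0 < alpha) (alpha_lt2 : alpha < 2).

(** Sum of the geometric series with first term 2^alpha and ratio 2^alpha / 4, coming from the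
    dyadic layers of [integral_trunc_sqr]. The ratio is below 1 because alpha < 2. *)
Definition trunc_cst : R := 2 `^ alpha / (1 - 2 `^ alpha / 4).

Let r_itv : 0 <= (2 `^ alpha / 4 : R) < 1.
Proof.
rewrite divr_ge0 ?powR_ge0//= ltr_pdivrMr// mul1r.
have -> : 4 = 2 `^ 2%:R :> R by rewrite powR_mulrn// -natrX.
by rewrite /powR pnatr_eq0/= ltr_expR ltr_pM2r ?ln_gt0 ?ltr1n//.
Qed.

Lemma trunc_cst_ge0 : 0 <= trunc_cst.
Proof. by rewrite divr_ge0 ?powR_ge0// subr_ge0 ltW//; case/andP: r_itv. Qed.

(** On the layer e / 2^(k+1) < |phi| <= e / 2^k the square is at most (e / 2^k)^2, and the tail
    bound at the lower edge controls the measure of the layer. The product is M e^(2 - alpha)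
    2^alpha (2^alpha / 4)^k. *)
Lemma integral_trunc_sqr (phi : T -> R) (M e : R) : measurable_fun setT phi ->
  0 <= M -> 0 < e ->
  (forall x : R, 0 < x -> (m [set z | (x < `|phi z|)%R] <= (M * x `^ (- alpha))%:E)%E) ->
  (\int[m]_z ((if (`|phi z| <= e)%R then phi z else 0) ^+ 2)%:E <=
    (M * trunc_cst * (e ^+ 2 * e `^ (- alpha)))%:E)%E.
Proof.
move=> mphi M0 e0 tail.
pose S k := [set z | e / 2 ^+ k.+1 < `|phi z|].
have mS k : measurable (S k) by exact: measurable_absr_gt.
have e2 k : 0 < e / 2 ^+ k by rewrite divr_gt0 ?exprn_gt0.
pose g k (z : T) : \bar R := ((e / 2 ^+ k) ^+ 2 * \1_(S k) z)%:E.
have mg k : measurable_fun setT (g k).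
  by apply/measurable_EFinP; apply: measurable_funM => //; exact: measurable_indic.
have g0 k z : (0 <= g k z)%E by rewrite lee_fin mulr_ge0// sqr_ge0.
apply: (@le_trans _ _ (\int[m]_z (\sum_(k <oo) g k z))%E).
  apply: ge0_le_integral => //.
  - by move=> z _; rewrite lee_fin sqr_ge0.
  - apply/measurable_EFinP; apply: measurable_funX; apply: measurable_fun_ifT => //.
    by apply: measurable_fun_ler => //; exact: measurableT_comp.
  - by apply: (@ge0_emeasurable_sum _ _ _ _ _ xpredT).
  move=> z _; case: ifPn => [phie|_]; last first.
    by rewrite expr0n/=; apply: nneseries_ge0.
  have [->|phi0] := eqVneq (phi z) 0.
    by rewrite expr0n/=; apply: nneseries_ge0.
  (* Some layer starts below |phi z|, by n < 2^n applied to one plus the integer part of e / |phi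
     z|. The least such layer also bounds |phi z| from above. *)
  have ex : exists k, e / 2 ^+ k.+1 < `|phi z|.
    have p0 : 0 < `|phi z| by rewrite normr_gt0.
    exists (Num.truncn (e / `|phi z|)).
    rewrite ltr_pdivrMr ?exprn_gt0// mulrC -ltr_pdivrMr//.
    apply: lt_le_trans (truncnS_gt _) _.
    by rewrite -natrX ler_nat ltnW// ltn_expl.
  have := ex_minnP ex; case => k ek kmin.
  have phik : `|phi z| <= e / 2 ^+ k.
    case: k ek kmin => [|k] _ kmin; first by rewrite expr0 divr1.
    by rewrite leNgt; apply/negP => /kmin; rewrite ltnn.
  apply: (@le_trans _ _ (g k z)).
    rewrite /g lee_fin indicE mem_set//= mulr1 -[leLHS]real_normK ?num_real//.
    by rewrite ler_sqr ?nnegrE// ltW.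
  rewrite (@nneseriesD1 _ _ k)//; apply: leeDl; exact: nneseries_ge0.
rewrite integral_nneseries//.
apply: (@le_trans _ _ (\sum_(k <oo) ((M * (e ^+ 2 * e `^ (- alpha)) * 2 `^ alpha) * (2 `^ alpha / 4) ^+ k)%:E)%E); last first.
  rewrite nneseries_geometric// lee_fin /trunc_cst.
  by rewrite [leLHS](_ : _ = M * (2 `^ alpha / (1 - 2 `^ alpha / 4)) * (e ^+ 2 * e `^ (- alpha)))//; ring.
apply: lee_nneseries => [k _ _|k _]; first exact: integral_ge0.
rewrite /g.
under eq_integral do rewrite EFinM.
rewrite ge0_integralZl_EFin ?sqr_ge0//; last exact/measurable_EFinP/measurable_indic.
rewrite integral_indic// setIT.
apply: (@le_trans _ _ (((e / 2 ^+ k) ^+ 2)%:E * (M * (e / 2 ^+ k.+1) `^ (- alpha))%:E)%E).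
  by rewrite lee_wpmul2l ?lee_fin ?sqr_ge0// tail.
rewrite -EFinM lee_fin.
have -> : (e / 2 ^+ k.+1) `^ (- alpha) = e `^ (- alpha) * (2 `^ alpha * (2 `^ alpha) ^+ k).
  rewrite powRM ?invr_ge0 ?exprn_ge0 ?ltW//; congr (_ * _).
  rewrite -exprS -powR_mulrn ?powR_ge0// -powRrM -powR_inv1 ?exprn_ge0// -powR_mulrn// -!powRrM.
  by congr (_ `^ _); ring.
rewrite le_eqVlt; apply/orP; left; apply/eqP.
rewrite !expr_div_n -exprM mulnC exprM.
move: (e `^ _) (2 `^ alpha) => u v.
have -> : (2 ^+ 2 : R) = 4 by ring.
have : (4 ^+ k : R) != 0 by rewrite expf_neq0.
by move: (4 ^+ k : R) (v ^+ k) => w y w0; field.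
Qed.

End dyadic.

Definition hi_part (R : realType) (E : Type) (e : R) (f : E -> R) (x : E) : R :=
  if e < `|f x| then f x else 0.

Definition lo_part (R : realType) (E : Type) (e : R) (f : E -> R) (x : E) : R :=
  if `|f x| <= e then f x else 0.

Lemma hi_lo_part (R : realType) (E : Type) (e : R) (f : E -> R) x :
  f x = hi_part e f x + lo_part e f x.
Proof. by rewrite /hi_part /lo_part; case: leP => _; rewrite ?addr0 ?add0r. Qed.

Lemma lo_part_le (R : realType) (E : Type) (e : R) (f : E -> R) x : 0 <= e ->
  `|lo_part e f x| <= e.
Proof. by move=> e0; rewrite /lo_part; case: ifPn => //; rewrite normr0. Qed.

Lemma measurable_hi_part (R : realType) d (E : measurableType d) (e : R) (f : E -> R) :
  measurable_fun setT f -> measurable_fun setT (hi_part e f).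
Proof.
move=> mf; apply: measurable_fun_ifT => //.
by apply: measurable_fun_ltr => //; exact: measurableT_comp.
Qed.

Lemma measurable_lo_part (R : realType) d (E : measurableType d) (e : R) (f : E -> R) :
  measurable_fun setT f -> measurable_fun setT (lo_part e f).
Proof.
move=> mf; apply: measurable_fun_ifT => //.
by apply: measurable_fun_ler => //; exact: measurableT_comp.
Qed.

(** The crude constant suffices: it multiplies a term that vanishes as the individual truncation
    level tends to 0. *)
Lemma sqr_sum_le (R : realDomainType) I (s : seq I) (f : I -> R) :
  (\sum_(t <- s) f t) ^+ 2 <= 2 ^+ size s * \sum_(t <- s) f t ^+ 2.
Proof.
elim: s => [|t s ih]; first by rewrite !big_nil expr0n/= mulr0.
rewrite !big_cons/= [2 ^+ _]exprS.
set S := \sum_(j <- s) f j in ih *; set Q := \sum_(j <- s) _ in ih *.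
have p1 : 1 <= 2 ^+ size s :> R by rewrite exprn_ege1// ler1n.
have := ler_wpM2r (sqr_ge0 (f t)) p1; have := sqr_ge0 (f t - S).
rewrite mul1r sqrrB sqrrD mulrDr.
by move: (f t ^+ 2) (S ^+ 2) (f t * S) (2 ^+ _) ih => x y z p; lra.
Qed.

Lemma measure_bigsetU_le (R : realType) d (T : measurableType d)
    (m : {measure set T -> \bar R}) I (s : seq I) (F : I -> set T) :
  (forall t, measurable (F t)) ->
  (m (\big[setU/set0]_(t <- s) F t) <= \sum_(t <- s) m (F t))%E.
Proof.
move=> mF; elim: s => [|t s ih]; first by rewrite !big_nil measure0.
rewrite !big_cons; apply: le_trans (measureU2 _ _ _) _ => //.
  exact: bigsetU_measurable.
by rewrite leeD2l.
Qed.

Lemma in_bigsetU (T : Type) (I : eqType) (s : seq I) (F : I -> set T) x :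
  (\big[setU/set0]_(t <- s) F t) x <-> exists2 t, t \in s & F t x.
Proof.
elim: s => [|t s ih]; first by rewrite big_nil; split => // -[].
rewrite big_cons; split.
  by move=> [Fx|/ih[u us Fu]]; [exists t|exists u] => //; rewrite inE ?eqxx ?us ?orbT.
by move=> [u]; rewrite inE => /orP[/eqP ->|us Fu]; [left|right; apply/ih; exists u].
Qed.

Lemma cvge0_lt (R : realType) T (F : set_system T) {FF : Filter F} (f : T -> \bar R) (e : R) :
  f @ F --> 0%E -> 0 < e -> \forall x \near F, (f x < e%:E)%E.
Proof.
move=> /fine_cvgP[ff] /cvgrPdist_lt h e0; apply: filterS2 ff (h e e0) => x fx.
rewrite sub0r normrN => hx; rewrite -(fineK fx) lte_fin.
exact: le_lt_trans (ler_norm _) hx.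
Qed.

Lemma near_sqr_powRN (R : realType) (alpha C e : R) : alpha < 2 -> 0 <= C -> 0 < e ->
  \forall x \near 0^'+, C * (x ^+ 2 * x `^ (- alpha)) < e.
Proof.
move=> a2 C0 e0.
have a20 : 0 < 2 - alpha by rewrite subr_gt0.
have /cvgrPdist_lt h : C * x `^ (2 - alpha) @[x --> 0^'+] --> 0.
  by have := cvgM (cvg_cst C) (powR_cvg0 a20); rewrite mulr0; apply.
near=> x.
have x0 : 0 < x by near: x; exact: nbhs_right_gt.
have -> : x ^+ 2 * x `^ (- alpha) = x `^ (2 - alpha).
  by rewrite powRD ?gt_eqF ?implybT// powR_mulrn ?ltW.
have : `|0 - C * x `^ (2 - alpha)| < e by near: x; exact: h.
by rewrite sub0r normrN; apply: le_lt_trans; exact: ler_norm.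
Unshelve. all: by end_near. Qed.

(** * Removal of the small jumps *)

Section small_jumps.
Context (R : realType) dO (Omega : measurableType dO) (P : probability Omega R).
Context d (E : measurableType d) (xi : nat -> Omega -> E).
Variable Lam : {measure set E -> \bar R}.
Hypothesis PRM : poisson_random_measure P xi Lam.
Variables (sym : E -> E) (msym : measurable_fun setT sym).
Hypothesis Lam_sym : forall A, measurable A -> Lam (sym @^-1` A) = Lam A.
Variables (alpha : R) (alpha_gt0 : 0 < alpha) (alpha_lt2 : alpha < 2).
Variables (I : eqType) (s : seq I) (a : I -> E -> R) (c : R) (X : I -> Omega -> R).
Hypotheses (ma : forall t, measurable_fun setT (a t))
  (mX : forall t, measurable_fun setT (X t))
  (a_odd : forall t x, a t (sym x) = - a t x).
Variables (M m : R) (M0 : 0 <= M) (m0 : 0 <= m).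
Hypothesis a_tail : forall t (x : R), 0 < x ->
  (Lam [set z | (x < `|a t z|)%R] <= (M * x `^ (- alpha))%:E)%E.
Hypothesis XE : forall t, series_in_prob P (fun i w => a t (xi i w)) (X t).

Let b x := c * \sum_(t <- s) a t x.

Hypothesis b_tail : forall x : R, 0 < x ->
  (Lam [set z | (x < `|b z|)%R] <= (m * x `^ (- alpha))%:E)%E.

Lemma truncated_sumE (e : R) (f : E -> R) w :
  \sum_(i \in [set i | e < `|f (xi i w)|]) f (xi i w) = rsum xi (hi_part e f) w.
Proof.
rewrite fsbig_mkcond; apply: eq_fsbigr => i _; rewrite patchE /hi_part.
by case: (boolP (_ < _)) => h; [rewrite mem_set|rewrite memNset//; apply/negP].
Qed.

Lemma measurable_b : measurable_fun setT b.
Proof. by apply: measurable_funM => //; exact: measurable_sum. Qed.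

(** The difference of the two truncation schemes. In this form it visibly vanishes off [jump_set].
    Rewritten as [lo_part e b] minus c times the sum of the [lo_part delta (a t)], it is visibly
    bounded with a small second moment. *)
Definition jump_error (e delta : R) (x : E) : R :=
  c * (\sum_(t <- s) hi_part delta (a t) x) - hi_part e b x.

Definition jump_set (e delta : R) : set E := [set x | e < `|b x|] `|`
  \big[setU/set0]_(t <- s) [set x | delta < `|a t x|].

Lemma measurable_jump_set e delta : measurable (jump_set e delta).
Proof.
apply: measurableU; first exact: measurable_absr_gt measurable_b.
by apply: bigsetU_measurable => t _; exact: measurable_absr_gt.
Qed.

Lemma jump_set_fin e delta : 0 < e -> 0 < delta -> (Lam (jump_set e delta) < +oo)%E.
Proof.
move=> e0 delta0; have mb := measurable_b.
apply: le_lt_trans (measureU2 _ _ _) _.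
- exact: measurable_absr_gt.
- by apply: bigsetU_measurable => t _; exact: measurable_absr_gt.
rewrite lte_add_pinfty//; first by rewrite (le_lt_trans (b_tail e0))// ltry.
apply: (@le_lt_trans _ _ (\sum_(t <- s) Lam [set x | (delta < `|a t x|)%R])%E).
  by apply: measure_bigsetU_le => t; exact: measurable_absr_gt.
by apply: lte_sum_pinfty => t _; rewrite (le_lt_trans (a_tail t delta0))// ltry.
Qed.

(** [rsum_var] for the jump error, with (u - v)^2 <= 2 u^2 + 2 v^2 for its two small parts. Only the
    second part carries [M] and the number of summands, and it goes to 0 with delta. *)
Lemma small_jumps_trunc (e eta delta : R) : 0 < e -> 0 < eta -> 0 < delta ->
  (P [set w | (eta < `|rsum xi (jump_error e delta) w|)%R] <=
    (eta ^- 2 * (2 * (m * trunc_cst alpha * (e ^+ 2 * e `^ (- alpha))) +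
      2 * (c ^+ 2 * (2 ^+ size s *
      ((size s)%:R * (M * trunc_cst alpha * (delta ^+ 2 * delta `^ (- alpha))))))))%:E)%E.
Proof.
move=> e0 eta0 delta0; set q := jump_error e delta.
have mb := measurable_b.
have qE x : q x = lo_part e b x - c * \sum_(t <- s) lo_part delta (a t) x.
  rewrite /q /jump_error (_ : lo_part e b x = b x - hi_part e b x); last first.
    by rewrite [in RHS](hi_lo_part e b) addrC addKr.
  rewrite /b.
  under [in RHS]eq_bigr do rewrite (hi_lo_part delta).
  by rewrite big_split/=; ring.
pose A0 := jump_set e delta.
have mA0 : measurable A0 by exact: measurable_jump_set.
have A0fin : (Lam A0 < +oo)%E by exact: jump_set_fin.
have qA0 x : ~ A0 x -> q x = 0.
  rewrite /A0 /jump_set => /=; move=> /not_orP[/= /negP eb /in_bigsetU da]; rewrite /q /jump_error /hi_part (negbTE eb) subr0.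
  rewrite big_seq big1 ?mulr0// => t ts.
  by case: ifPn => // dat; exfalso; apply: da; exists t.
have mq : measurable_fun setT q.
  apply: measurable_funB; last exact: measurable_hi_part.
  by apply: measurable_funM => //; apply: measurable_sum => t; exact: measurable_hi_part.
have q_odd x : q (sym x) = - q x.
  have bs : b (sym x) = - b x.
    rewrite /b -mulrN -sumrN; congr (_ * _).
    by apply: eq_bigr => t _; rewrite a_odd.
  have hN (u : R) (f : E -> R) : f (sym x) = - f x -> hi_part u f (sym x) = - hi_part u f x.
    by move=> fN; rewrite /hi_part fN normrN; case: ifP; rewrite ?oppr0.
  rewrite /q /jump_error hN// opprB opprK addrC; congr (_ + _).
  rewrite -mulrN -sumrN; congr (_ * _).
  by apply: eq_bigr => t _; rewrite hN.
have q_bnd x : `|q x| <= e + `|c| * ((size s)%:R * delta).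
  rewrite qE; apply: le_trans (ler_normB _ _) _; apply: lerD.
    by apply: lo_part_le; exact: ltW.
  rewrite normrM ler_wpM2l//; apply: le_trans (ler_norm_sum _ _ _) _.
  apply: (@le_trans _ _ (\sum_(t <- s) delta)).
    by apply: ler_sum => t _; apply: lo_part_le; exact: ltW.
  by rewrite big_const_seq count_predT iter_addr_0 mulr_natl.
apply: (le_trans (rsum_var PRM msym Lam_sym mA0 A0fin mq q_bnd qA0 q_odd eta0)).
rewrite EFinM lee_wpmul2l ?lee_fin ?invr_ge0 ?exprn_ge0 ?(ltW eta0)//.
have msq (f : E -> R) : measurable_fun setT f -> measurable_fun setT (fun x => (f x ^+ 2)%:E).
  by move=> mf; apply/measurable_EFinP; exact: measurable_funX.
pose Q x : R := 2 ^+ size s * \sum_(t <- s) lo_part delta (a t) x ^+ 2.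
have mQ : measurable_fun setT Q.
  apply: measurable_funM => //; apply: measurable_sum => t.
  by apply: measurable_funX; exact: measurable_lo_part.
have Q0 x : 0 <= Q x.
  by rewrite mulr_ge0 ?exprn_ge0// sumr_ge0// => t _; exact: sqr_ge0.
apply: (@le_trans _ _ (\int[Lam]_x ((2 * lo_part e b x ^+ 2)%:E +
    (2 * (c ^+ 2 * Q x))%:E))%E).
  apply: ge0_le_integral => //.
  - by move=> x _; rewrite lee_fin sqr_ge0.
  - exact: msq.
  - apply: emeasurable_funD; apply/measurable_EFinP; apply: measurable_funM => //.
      by apply: measurable_funX; exact: measurable_lo_part.
    exact: measurable_funM.
  move=> x _; rewrite -EFinD lee_fin qE.
  have := sqr_sum_le s (fun t => lo_part delta (a t) x); rewrite -/(Q x).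
  move: (lo_part e b x) (\sum_(t <- s) _) (Q x) (Q0 x) => u v w w0 vw.
  have := sqr_ge0 (u + c * v); have := ler_wpM2l (sqr_ge0 c) vw.
  nra.
rewrite ge0_integralD//; last 4 first.
- by move=> x _; rewrite lee_fin mulr_ge0// sqr_ge0.
- apply/measurable_EFinP; apply: measurable_funM => //.
  by apply: measurable_funX; exact: measurable_lo_part.
- by move=> x _; rewrite lee_fin mulr_ge0// mulr_ge0// sqr_ge0.
- by apply/measurable_EFinP; apply: measurable_funM => //; exact: measurable_funM.
rewrite EFinD; apply: leeD.
  under eq_integral do rewrite EFinM.
  rewrite ge0_integralZl_EFin//; last 2 first.
  - by move=> x _; rewrite lee_fin sqr_ge0.
  - by apply: msq; exact: measurable_lo_part.
  rewrite EFinM lee_wpmul2l ?lee_fin//.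
  exact: integral_trunc_sqr.
under eq_integral do rewrite EFinM EFinM.
rewrite ge0_integralZl_EFin//; last 2 first.
- by move=> x _; rewrite -EFinM lee_fin mulr_ge0// sqr_ge0.
- by apply: emeasurable_funM => //; exact/measurable_EFinP.
rewrite [leRHS]EFinM lee_wpmul2l ?lee_fin//.
rewrite ge0_integralZl_EFin ?sqr_ge0//; last 2 first.
- by move=> x _; rewrite lee_fin.
- exact/measurable_EFinP.
rewrite [leRHS]EFinM lee_wpmul2l ?lee_fin ?sqr_ge0//.
rewrite /Q; under eq_integral do rewrite EFinM.
rewrite ge0_integralZl_EFin ?exprn_ge0//; last 2 first.
- by move=> x _; rewrite lee_fin sumr_ge0// => t _; exact: sqr_ge0.
- apply/measurable_EFinP; apply: measurable_sum => t.
  by apply: measurable_funX; exact: measurable_lo_part.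
rewrite [leRHS]EFinM lee_wpmul2l ?lee_fin ?exprn_ge0//.
under eq_integral do rewrite -sumEFin.
rewrite ge0_integral_sum//; last 2 first.
- by move=> t; apply: msq; exact: measurable_lo_part.
- by move=> t x _; rewrite lee_fin sqr_ge0.
apply: (@le_trans _ _ (\sum_(t <- s) (M * trunc_cst alpha * (delta ^+ 2 * delta `^ (- alpha)))%:E)%E).
  apply: lee_sum => t _.
  by apply: integral_trunc_sqr => //; exact: a_tail.
by rewrite sumEFin big_const_seq count_predT iter_addr_0 mulr_natl.
Qed.

Lemma rsum_jump_error (e delta : R) w :
  finite_set [set i | jump_set e delta (xi i w)] ->
  rsum xi (jump_error e delta) w =
  c * (\sum_(t <- s) rsum xi (hi_part delta (a t)) w) - rsum xi (hi_part e b) w.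
Proof.
move=> fA.
have hA x : ~ jump_set e delta x -> hi_part e b x = 0 /\
    forall t, t \in s -> hi_part delta (a t) x = 0.
  move=> /not_orP[/= /negP eb /in_bigsetU da]; split.
    by rewrite /hi_part (negbTE eb).
  move=> t ts; rewrite /hi_part; case: ifPn => // dat; exfalso; apply: da.
  by exists t.
have qA x : ~ jump_set e delta x -> jump_error e delta x = 0.
  move=> /hA[h1 h2]; rewrite /jump_error h1 subr0 big_seq big1 ?mulr0//.
rewrite (rsum_fset fA qA) (rsum_fset fA (fun x h => (hA x h).1)).
rewrite !fsbig_finite//= /jump_error sumrB; congr (_ - _).
rewrite -mulr_sumr; congr (_ * _); rewrite exchange_big/= big_seq [RHS]big_seq.
apply: eq_bigr => t ts.
by rewrite (rsum_fset fA (fun x h => (hA x h).2 t ts)) fsbig_finite.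
Qed.

Lemma near_seq (F : set_system R) (FF : Filter F) (Q : I -> R -> Prop) :
  (forall t, \forall x \near F, Q t x) -> \forall x \near F, forall t, t \in s -> Q t x.
Proof.
move=> FQ; elim: s => [|t r ih]; first by apply: nearW.
apply: filterS2 (FQ t) ih => x Qt Qr u; rewrite inE => /orP[/eqP ->//|].
exact: Qr.
Qed.

(** As delta tends to 0, the term with [M] disappears and the truncated sums of the [a t] converge
    in probability to the [X t]. The resulting bound sees the summands only through the tail
    constant [m] of b. *)
Lemma small_jumps (e eta : R) : 0 < e -> 0 < eta ->
  (P [set w | (eta < `|c * (\sum_(t <- s) X t w) - rsum xi (hi_part e b) w|)%R] <=
    (16 * eta ^- 2 * (m * trunc_cst alpha * (e ^+ 2 * e `^ (- alpha))))%:E)%E.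
Proof.
move=> e0 eta0; apply/lee_addgt0Pr => tau tau0.
have mb := measurable_b.
pose n : R := (size s)%:R.
(* With this tolerance the errors of the n series, multiplied by |c|, add up to at most eta / 2. The
   1 keeps the divisor positive. *)
pose eta' := eta / 2 / (`|c| * n + 1).
have cn0 : 0 < `|c| * n + 1 by rewrite ltr_wpDl// mulr_ge0.
have eta'0 : 0 < eta' by rewrite !divr_gt0.
pose C := (eta / 2) ^- 2 * (2 * (c ^+ 2 * (2 ^+ size s * (n * (M * trunc_cst alpha))))).
have near1 : \forall x \near (0 : R)^'+, forall t, t \in s ->
    (P [set w | (eta' < `|rsum xi (hi_part x (a t)) w - X t w|)%R] < (tau / 2 / (n + 1))%:E)%E.
  apply: near_seq => t; have [_ /(_ _ eta'0)] := XE t.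
  under eq_fun do under eq_set do rewrite truncated_sumE.
  by move=> /cvge0_lt; apply; rewrite !divr_gt0// ltr_wpDl.
have C0 : 0 <= C.
  have eta20 : 0 < eta / 2 by rewrite divr_gt0.
  rewrite /C mulr_ge0 ?invr_ge0 ?exprn_ge0 ?(ltW eta20)// mulr_ge0//.
  rewrite mulr_ge0 ?sqr_ge0// mulr_ge0 ?exprn_ge0// mulr_ge0//.
  by rewrite mulr_ge0// trunc_cst_ge0.
have near2 : \forall x \near 0^'+, C * (x ^+ 2 * x `^ (- alpha)) < tau / 2.
  by apply: near_sqr_powRN => //; rewrite divr_gt0.
have [delta [delta0 [d1 d2]]] : exists delta, 0 < delta /\
    (forall t, t \in s ->
    (P [set w | (eta' < `|rsum xi (hi_part delta (a t)) w - X t w|)%R] < (tau / 2 / (n + 1))%:E)%E) /\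
    C * (delta ^+ 2 * delta `^ (- alpha)) < tau / 2.
  near (0 : R)^'+ => delta; exists delta; split.
    by near: delta; exact: nbhs_right_gt.
  by split; near: delta.
pose A1 := [set w | eta / 2 < `|rsum xi (jump_error e delta) w|].
pose A2 t := [set w | eta' < `|rsum xi (hi_part delta (a t)) w - X t w|].
have mX' t : measurable_fun setT (fun w => rsum xi (hi_part delta (a t)) w - X t w).
  by apply: measurable_funB => //; apply: (measurable_rsum PRM); exact: measurable_hi_part.
have mA1 : measurable A1.
  apply: measurable_absr_gt; apply: (measurable_rsum PRM).
  apply: measurable_funB; last exact: measurable_hi_part.
  by apply: measurable_funM => //; apply: measurable_sum => t; exact: measurable_hi_part.
have mA2 t : measurable (A2 t) by exact: measurable_absr_gt.
have mA2s : measurable (\big[setU/set0]_(t <- s) A2 t) by exact: bigsetU_measurable.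
apply: (@le_trans _ _ (P (A1 `|` \big[setU/set0]_(t <- s) A2 t))).
  apply: le_measure_ae.
  - apply: measurable_absr_gt; apply: measurable_funB.
      by apply: measurable_funM => //; exact: measurable_sum.
    by apply: (measurable_rsum PRM); exact: measurable_hi_part.
  - exact: measurableU.
  have := ae_finite PRM (measurable_jump_set e delta) (jump_set_fin e0 delta0).
  apply: filterS => w wfin /=; apply: contraPP => /not_orP[/negP nA1 nA2].
  apply/negP; rewrite -leNgt.
  have nA2t t : t \in s -> `|rsum xi (hi_part delta (a t)) w - X t w| <= eta'.
    move=> ts; rewrite leNgt; apply/negP => h; apply: nA2.
    by apply/in_bigsetU; exists t.
  move: nA1; rewrite -leNgt rsum_jump_error// => nA1.
  rewrite (_ : _ - _ = (c * \sum_(t <- s) rsum xi (hi_part delta (a t)) w - rsum xi (hi_part e b) w)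
    - c * \sum_(t <- s) (rsum xi (hi_part delta (a t)) w - X t w)); last first.
    by rewrite sumrB; ring.
  apply: le_trans (ler_normB _ _) _; rewrite [leRHS](splitr eta) lerD//.
  rewrite normrM.
  apply: (@le_trans _ _ (`|c| * (n * eta'))).
    rewrite ler_wpM2l//; apply: le_trans (ler_norm_sum _ _ _) _.
    apply: (@le_trans _ _ (\sum_(t <- s) eta')).
      by rewrite big_seq [leRHS]big_seq; exact: ler_sum.
    by rewrite big_const_seq count_predT iter_addr_0 mulr_natl.
  rewrite mulrA /eta' mulrCA ger_pMr ?divr_gt0//.
  by rewrite ler_pdivrMr// mul1r lerDl.
apply: le_trans (measureU2 _ _ _) _ => //.
have n1 : 0 < n + 1 by rewrite ltr_wpDl.
have PA2 : (P (\big[setU/set0]_(t <- s) A2 t) <= (tau / 2)%:E)%E.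
  apply: le_trans (measure_bigsetU_le P s mA2) _.
  apply: (@le_trans _ _ (\sum_(t <- s) (tau / 2 / (n + 1))%:E)%E).
    by rewrite big_seq [leRHS]big_seq; apply: lee_sum => t ts; exact/ltW/d1.
  rewrite sumEFin big_const_seq count_predT iter_addr_0 lee_fin -[leLHS]mulr_natl -/n.
  by rewrite mulrCA ger_pMr ?divr_gt0// ler_pdivrMr// mul1r lerDl.
have PA1 := small_jumps_trunc e0 (divr_gt0 eta0 (ltr0Sn R 1)) delta0.
apply: le_trans (leeD PA1 PA2) _; rewrite -!EFinD lee_fin.
have eta_neq0 : eta != 0 by rewrite gt_eqF.
(* Half of the claimed bound appears: the factor 8 is 2, from the square of a difference, times 4,
   from the level eta / 2. *)
rewrite (_ : _ * (_ + _) = 16 / eta ^+ 2 * (m * trunc_cst alpha * (e ^+ 2 * e `^ (- alpha))) / 2 + C * (delta ^+ 2 * delta `^ (- alpha))); last first.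
  rewrite /C -/n; move: (e `^ _) (delta `^ _) (trunc_cst _) (2 ^+ size s) => u v w z.
  by field.
set Z := 16 / _ * _; have Z0 : 0 <= Z.
  rewrite /Z mulr_ge0//; first by rewrite divr_ge0// sqr_ge0.
  apply: mulr_ge0; last by rewrite mulr_ge0 ?sqr_ge0 ?powR_ge0.
  by rewrite mulr_ge0// trunc_cst_ge0.
lra.
Unshelve. all: by end_near. Qed.

End small_jumps.

(** * Comparison with the largest term *)

Section big_jump.
Context (R : realType) dO (Omega : measurableType dO) (P : probability Omega R).
Context d (E : measurableType d) (xi : nat -> Omega -> E).
Variable Lam : {measure set E -> \bar R}.
Hypothesis PRM : poisson_random_measure P xi Lam.

Local Open Scope ereal_scope.

Lemma psum_ge_term (f : E -> \bar R) i w : (forall x, 0 <= f x) -> f (xi i w) <= psum xi f w.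
Proof.
move=> f0; rewrite /psum (@nneseriesD1 _ _ i)//.
by apply: leeDl; exact: nneseries_ge0.
Qed.

Lemma psum_ge_two (f : E -> \bar R) i j w : (forall x, 0 <= f x) -> i != j ->
  f (xi i w) + f (xi j w) <= psum xi f w.
Proof.
move=> f0 ij; rewrite /psum (@nneseriesD1 _ _ i)//; apply: leeD2l.
rewrite (@nneseriesD1 _ _ j)//; last by rewrite eq_sym.
by apply: leeDl; exact: nneseries_ge0.
Qed.

(** On a count N this is N if N >= 2 and 0 otherwise, since removing the value 1 leaves 0 at 0. *)
Definition multiple (x : \bar R) : \bar R := if x == 1 then 0 else x.

Lemma measurable_multiple : measurable_fun setT multiple.
Proof.
apply: measurable_fun_ifT => //.
apply: (measurable_fun_bool true); rewrite setTI.
have -> : (fun x : \bar R => x == 1) @^-1` [set true] = [set 1%:E].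
  by apply/seteqP; split => x /= /eqP.
exact: emeasurable_set1.
Qed.

(** With a = Lam A, E N - P(N = 1) = a - a exp(-a) <= a^2, because exp(-a) >= 1 - a. *)
Lemma mean_multiple (A : set E) (l : R) : measurable A -> Lam A <= l%:E ->
  \int[P]_w multiple (num_points R xi A w) <= (l ^+ 2)%:E.
Proof.
move=> mA Al; have [_ Pfin _ _] := PRM.
have mN := measurable_num_points PRM mA.
have Afin : Lam A < +oo by apply: le_lt_trans Al _; rewrite ltry.
have Af : Lam A \is a fin_num by rewrite ge0_fin_numE.
have N0 w : 0 <= num_points R xi A w.
  by rewrite num_pointsE; apply: psum_ge0 => x; rewrite lee_fin.
have NE w : num_points R xi A w = multiple (num_points R xi A w) +
    (\1_[set w | num_points R xi A w = 1%:R%:E] w)%:E.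
  rewrite /multiple indicE; case: eqP => N1.
    by rewrite mem_set// add0e.
  by rewrite memNset ?adde0.
have m1 : measurable [set w | num_points R xi A w = 1%:R%:E].
  by have := mN measurableT _ (emeasurable_set1 1%:R%:E); rewrite setTI.
have mm : measurable_fun setT (fun w => multiple (num_points R xi A w)).
  by apply: measurableT_comp => //; exact: measurable_multiple.
have m0 w : 0 <= multiple (num_points R xi A w) by rewrite /multiple; case: ifP.
have := mean_num_points PRM mA.
rewrite (eq_integral _ _ (fun w _ => NE w)) ge0_integralD//; last first.
  exact/measurable_EFinP/measurable_indic.
rewrite integral_indic// setIT [X in _ + X = _ -> _](Pfin A mA Afin 1%N).
rewrite expr1 factS fact0 muln1 divr1 => H.
have : \int[P]_w multiple (num_points R xi A w) = Lam A - (fine (Lam A) * expR (- fine (Lam A)))%:E.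
  by rewrite -[X in _ = X - _]H addeK.
move=> ->.
have al : (fine (Lam A) <= l)%R by rewrite -lee_fin fineK.
have a0 : (0 <= fine (Lam A))%R by rewrite fine_ge0.
rewrite -[X in X - _](fineK Af) -EFinB lee_fin.
move: (fine (Lam A)) al a0 => a al a0.
have := expR_ge1Dx (- a); have := expR_gt0 (- a).
have : (a ^+ 2 <= l ^+ 2)%R by rewrite ler_sqr ?nnegrE// (le_trans a0).
by move=> h1 h2 h3; nra.
Qed.

Variables (b : E -> R) (mb : measurable_fun setT b).
Variables (Y : Omega -> R) (mY : measurable_fun setT Y).
Variables (G : R -> R) (mG : measurable_fun setT G) (M r e eta A omega : R).
Hypotheses (G0 : forall x, (0 <= G x)%R) (GM : forall x, (G x <= M)%R).
Hypotheses (r0 : (0 < r)%R) (Gr : forall x, (`|x| <= r)%R -> G x = 0%R).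
Hypotheses (e0 : (0 < e)%R) (er : (e <= r)%R) (eta0 : (0 < eta)%R) (etar : (eta <= r / 2)%R).
Hypotheses (A0 : (0 < A)%R) (omega0 : (0 <= omega)%R).
Hypothesis G_uc : forall x y, (`|x| <= A -> `|x - y| <= eta -> `|G x - G y| <= omega)%R.

Let S (u : R) : set E := [set x | (u < `|b x|)%R].

Let mS (u : R) : measurable (S u). Proof. exact: measurable_absr_gt. Qed.

(** The exceptional contributions, in order: [Y] is far from the sum of its large terms; the modulus
    of continuity of G, paid only where G can be nonzero; a term beyond the range [A] of uniform
    continuity; several large terms at once. *)
Definition big_jump_err w : \bar R :=
  M%:E * (\1_[set w | (eta < `|Y w - rsum xi (hi_part e b) w|)%R] w)%:E +
  omega%:E * num_points R xi (S (r / 2)%R) w + M%:E * num_points R xi (S A) w +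
  M%:E * multiple (num_points R xi (S e) w).

Let M0 : (0 <= M)%R. Proof. exact: le_trans (GM point). Qed.

Let N0 (u : R) w : 0 <= num_points R xi (S u) w.
Proof. by rewrite num_pointsE; apply: psum_ge0 => x; rewrite lee_fin. Qed.

Let m0 (u : R) w : 0 <= multiple (num_points R xi (S u) w).
Proof. by rewrite /multiple; case: ifP. Qed.

Let N1 (u : R) i w : S u (xi i w) -> 1 <= num_points R xi (S u) w.
Proof.
move=> Si; rewrite num_pointsE; apply: le_trans (psum_ge_term i _ _) => //=.
  by rewrite indicE mem_set.
Qed.

Let Gb x : (G (b x))%:E <= M%:E * (\1_(S e) x)%:E.
Proof.
rewrite indicE; case: (boolP (x \in S e)) => [_|]; first by rewrite mule1 lee_fin.
by rewrite notin_setE /S /= => /negP; rewrite -leNgt => be; rewrite mule0 Gr// (le_trans be).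
Qed.

(** G vanishes on [-r, r] and e <= r, so only points with |b| > e contribute to the sum of G(b). Two
    or more such points are paid by [multiple]. Unless [Y] is far from the sum of its large terms,
    without such points [Y] is small and G(Y) = 0, and with exactly one, [Y] is close to the value
    of b there. *)
Lemma big_jump_ptw w : finite_set [set i | S e (xi i w)] ->
  (G (Y w))%:E <= psum xi (fun x => (G (b x))%:E) w + big_jump_err w /\
  psum xi (fun x => (G (b x))%:E) w <= (G (Y w))%:E + big_jump_err w.
Proof.
move=> fS.
pose D := [set w | (eta < `|Y w - rsum xi (hi_part e b) w|)%R].
have t1 : 0 <= M%:E * (\1_D w)%:E by rewrite mule_ge0// lee_fin.
have t2 : 0 <= omega%:E * num_points R xi (S (r / 2)%R) w by rewrite mule_ge0.
have t3 : 0 <= M%:E * num_points R xi (S A) w by rewrite mule_ge0.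
have t4 : 0 <= M%:E * multiple (num_points R xi (S e) w) by rewrite mule_ge0.
have J0 : 0 <= psum xi (fun x => (G (b x))%:E) w.
  by apply: psum_ge0 => x; rewrite lee_fin.
have err1 : M%:E * (\1_D w)%:E <= big_jump_err w.
  by rewrite /big_jump_err -!addeA leeDl// !adde_ge0.
have err2 : omega%:E * num_points R xi (S (r / 2)%R) w <= big_jump_err w.
  by rewrite /big_jump_err -!addeA addeCA leeDl// !adde_ge0.
have err3 : M%:E * num_points R xi (S A) w <= big_jump_err w.
  by rewrite /big_jump_err addeAC leeDr// !adde_ge0.
have err4 : M%:E * multiple (num_points R xi (S e) w) <= big_jump_err w.
  by rewrite /big_jump_err leeDr// !adde_ge0.
have err0 : 0 <= big_jump_err w by exact: le_trans err1.
have [[i [j [Si Sj ij]]]|one] := pselect (exists i j, [/\ S e (xi i w), S e (xi j w) & i != j]).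
  have N2 : 1 + 1 <= num_points R xi (S e) w.
    rewrite num_pointsE.
    have := @psum_ge_two (fun x => (\1_(S e) x)%:E) i j w _ ij.
    by rewrite !indicE !mem_set//; apply => x; rewrite lee_fin.
  have NS : multiple (num_points R xi (S e) w) = num_points R xi (S e) w.
    rewrite /multiple; case: eqP => // h; move: N2; rewrite h -EFinD lee_fin.
    by rewrite gerDl ler10.
  rewrite NS in err4; split.
    apply: le_trans (leeDr _ J0); apply: le_trans err4.
    apply: (@le_trans _ _ (M%:E * 1)); first by rewrite mule1 lee_fin.
    by rewrite lee_wpmul2l ?lee_fin//; exact: N1 Si.
  apply: le_trans (leeDr _ _); last by rewrite lee_fin.
  apply: le_trans err4; rewrite num_pointsE /psum -nneseriesZl; last by move=> k _; rewrite lee_fin.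
  by apply: lee_nneseries => [k _ _|k _]; [rewrite lee_fin|exact: Gb].
have JE : psum xi (fun x => (G (b x))%:E) w =
    (\sum_(i \in [set i | S e (xi i w)]) G (b (xi i w)))%R%:E.
  apply: psum_fset => // x; rewrite /S /= => /negP; rewrite -leNgt => be.
  by rewrite Gr// (le_trans be).
have LE : rsum xi (hi_part e b) w =
    (\sum_(i \in [set i | S e (xi i w)]) hi_part e b (xi i w))%R.
  by apply: rsum_fset => // x; rewrite /S /hi_part /= => /negP/negbTE ->.
have [[i Si]|none] := pselect (exists i, S e (xi i w)); last first.
  have SE : [set i | S e (xi i w)] = set0.
    by apply/seteqP; split => // i Si; apply: none; exists i.
  rewrite JE SE fsbig_set0; split; last by rewrite adde_ge0// lee_fin.
  rewrite add0e; have [Dw|] := boolP (w \in D).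
    by apply: le_trans err1; rewrite indicE Dw mule1 lee_fin.
  rewrite notin_setE /D /= LE SE fsbig_set0 subr0 => /negP; rewrite -leNgt => Ye.
  by rewrite Gr// (le_trans Ye)// (le_trans etar)// ler_pdivrMr// ler_peMr ?ler1n// ltW.
have SE : [set i | S e (xi i w)] = [set i].
  apply/seteqP; split => [j Sj|_ -> //].
  by apply/eqP; rewrite eq_sym; apply/negP => /negP ij; apply: one; exists i, j.
have hiE : hi_part e b (xi i w) = b (xi i w).
  by rewrite /hi_part; move: Si; rewrite /S /= => ->.
rewrite JE SE fsbig_set1.
have addR (x y : R) z : 0 <= z -> (x <= y)%R -> x%:E <= y%:E + z.
  by move=> z0 xy; apply: le_trans (leeDl _ z0); rewrite lee_fin.
have addR2 (x y u : R) z : u%:E <= z -> (x <= y + u)%R -> x%:E <= y%:E + z.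
  by move=> uz xyu; apply: le_trans (leeD2l _ uz); rewrite -EFinD lee_fin.
have [Dw|] := boolP (w \in D).
  have err5 : M%:E <= big_jump_err w by move: err1; rewrite indicE Dw mule1.
  by split; apply: (addR2 _ _ _ _ err5); rewrite ler_wpDl.
rewrite notin_setE /D /= LE SE fsbig_set1 hiE => /negP; rewrite -leNgt => Yb.
set x := b (xi i w) in Yb *.
have [xA|Ax] := leP `|x|%R A; last first.
  have err5 : M%:E <= big_jump_err w.
    apply: le_trans err3; rewrite -[leLHS]mule1 lee_wpmul2l ?lee_fin//.
    by apply: (@N1 _ i).
  by split; apply: (addR2 _ _ _ _ err5); rewrite ler_wpDl.
(* If |b| <= r / 2 then |Y| <= r, as eta <= r / 2, and both values of G vanish. So omega is paid
   only for points of [S (r / 2)], a set of finite intensity. *)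
have [xr|rx] := leP `|x|%R (r / 2)%R.
  rewrite (Gr (x := x)); last by rewrite (le_trans xr)// ler_pdivrMr// ler_peMr ?ler1n// ltW.
  rewrite (Gr (x := Y w)); last first.
    rewrite -(subrK x (Y w)) (le_trans (ler_normD _ _))// [leRHS](splitr r) lerD//.
    exact: le_trans Yb etar.
  by split; rewrite add0e.
have err5 : omega%:E <= big_jump_err w.
  apply: le_trans err2; rewrite -[leLHS]mule1 lee_wpmul2l ?lee_fin//.
  by apply: (@N1 _ i).
have := G_uc xA (y := Y w); rewrite distrC => /(_ Yb); rewrite ler_norml => /andP[h1 h2].
by split; apply: (addR2 _ _ _ _ err5); lra.
Qed.

Variables (alpha m : R).
Hypothesis b_tail : forall x : R, (0 < x)%R -> Lam (S x) <= (m * x `^ (- alpha))%:E.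
Hypothesis alpha_gt0 : (0 < alpha)%R.


(** The pointwise comparison is integrated; Campbell's formula turns the sum of G(b) over the points
    into an integral against [Lam]. *)
Lemma big_jump_expectation (p : R) :
  P [set w | (eta < `|Y w - rsum xi (hi_part e b) w|)%R] <= p%:E ->
  let err := (M * p + omega * (m * (r / 2) `^ (- alpha)) + M * (m * A `^ (- alpha)) +
    M * (m * e `^ (- alpha)) ^+ 2)%R in
  \int[P]_w (G (Y w))%:E <= \int[Lam]_x (G (b x))%:E + err%:E /\
  \int[Lam]_x (G (b x))%:E <= \int[P]_w (G (Y w))%:E + err%:E.
Proof.
move=> Dp err.
have mD : measurable [set w | (eta < `|Y w - rsum xi (hi_part e b) w|)%R].
  apply: measurable_absr_gt; apply: measurable_funB => //.
  by apply: (measurable_rsum PRM); exact: measurable_hi_part.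
have mN u : measurable_fun setT (num_points R xi (S u)).
  exact: (measurable_num_points PRM).
have mm u : measurable_fun setT (fun w => multiple (num_points R xi (S u) w)).
  by apply: measurableT_comp => //; exact: measurable_multiple.
have mGY : measurable_fun setT (fun w => (G (Y w))%:E).
  by apply/measurable_EFinP; exact: measurableT_comp.
have mGb : measurable_fun setT (fun x => (G (b x))%:E).
  by apply/measurable_EFinP; exact: measurableT_comp.
have Gb0 x : 0 <= (G (b x))%:E by rewrite lee_fin.
have m1 : measurable_fun setT
    (fun w => M%:E * (\1_[set w | (eta < `|Y w - rsum xi (hi_part e b) w|)%R] w)%:E).
  by apply: emeasurable_funM => //; apply/measurable_EFinP; exact: measurable_indic.
have m2 u : measurable_fun setT (fun w => omega%:E * num_points R xi (S u) w).
  exact: emeasurable_funM.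
have m3 u : measurable_fun setT (fun w => M%:E * num_points R xi (S u) w).
  exact: emeasurable_funM.
have m4 u : measurable_fun setT (fun w => M%:E * multiple (num_points R xi (S u) w)).
  exact: emeasurable_funM.
have err_ge0 w : 0 <= big_jump_err w.
  by rewrite /big_jump_err !adde_ge0// mule_ge0// lee_fin.
have merr : measurable_fun setT big_jump_err.
  by do 3?apply: emeasurable_funD.
have mS_fin (u : R) : (0 < u)%R -> \int[P]_w num_points R xi (S u) w <= (m * u `^ (- alpha))%:E.
  by move=> u0; rewrite (mean_num_points PRM)// b_tail.
have Eerr : \int[P]_w big_jump_err w <= err%:E.
  have z1 w : 0 <= M%:E * (\1_[set w | (eta < `|Y w - rsum xi (hi_part e b) w|)%R] w)%:E.
    by rewrite mule_ge0// lee_fin.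
  have z2 u w : 0 <= omega%:E * num_points R xi (S u) w by rewrite mule_ge0.
  have z3 u w : 0 <= M%:E * num_points R xi (S u) w by rewrite mule_ge0.
  have z4 u w : 0 <= M%:E * multiple (num_points R xi (S u) w) by rewrite mule_ge0.
  rewrite /big_jump_err; do 3![rewrite ge0_integralD;
    [|by []|by move=> w _; rewrite ?adde_ge0|by do ?apply: emeasurable_funD
     |by move=> w _|by []]].
  rewrite /err !EFinD; apply: leeD; [apply: leeD; [apply: leeD|]|].
  - rewrite ge0_integralZl_EFin//; last exact/measurable_EFinP/measurable_indic.
    by rewrite integral_indic// setIT EFinM lee_wpmul2l.
  - rewrite ge0_integralZl_EFin// EFinM lee_wpmul2l//.
    by apply: mS_fin; rewrite divr_gt0.
  - by rewrite ge0_integralZl_EFin// EFinM lee_wpmul2l//; exact: mS_fin.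
  - rewrite ge0_integralZl_EFin// EFinM lee_wpmul2l//.
    by apply: mean_multiple => //; exact: b_tail.
have Sfin : Lam (S e) < +oo by rewrite (le_lt_trans (b_tail e0))// ltry.
have mJ : measurable_fun setT (psum xi (fun x => (G (b x))%:E)).
  exact: (measurable_psum PRM).
have J0 w : 0 <= psum xi (fun x => (G (b x))%:E) w by exact: psum_ge0.
rewrite -(campbell PRM)//; split.
- apply: (@le_trans _ _ (\int[P]_w (psum xi (fun x => (G (b x))%:E) w + big_jump_err w))).
    apply: ae_ge0_le_integral => //.
    + by move=> w _; rewrite lee_fin.
    + by move=> w _; rewrite adde_ge0.
    + exact: emeasurable_funD.
    by have := ae_finite PRM (mS e) Sfin; apply: filterS => w /big_jump_ptw[].
  by rewrite ge0_integralD// leeD2l.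
- apply: (@le_trans _ _ (\int[P]_w ((G (Y w))%:E + big_jump_err w))).
    apply: ae_ge0_le_integral => //.
    + by move=> w _; rewrite adde_ge0// lee_fin.
    + exact: emeasurable_funD.
    by have := ae_finite PRM (mS e) Sfin; apply: filterS => w /big_jump_ptw[].
  rewrite ge0_integralD//; last by move=> w _; rewrite lee_fin.
  by rewrite leeD2l.
Qed.

End big_jump.

(** Only x is confined to the segment; y may lie outside. Compactness is used in its near-covering
    form, which makes the tolerance d uniform in x. *)
Lemma continuous_uniform_segment (R : realType) (G : R -> R) (A e : R) :
  continuous G -> 0 < e ->
  \forall d \near 0^'+, forall x y, `|x| <= A -> `|x - y| <= d -> `|G x - G y| <= e.
Proof.
move=> cG e0.
have := @segment_compact R (- A) A; rewrite compact_near_coveringP.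
move=> /(_ R 0^'+ (fun d x => forall y, `|x - y| <= d -> `|G x - G y| <= e)) h.
have : \forall d \near (0 : R)^'+, `[- A, A] `<=`
    (fun x => forall y, `|x - y| <= d -> `|G x - G y| <= e).
  apply: h => x _.
  have /cvgrPdist_lt /(_ (e / 2) (divr_gt0 e0 (ltr0Sn R 1))) := cG x.
  move=> /nbhs_ballP[d /= d0 dG].
  exists (ball x (d / 2), [set d' | d' < d / 2]).
    split; first by apply: nbhsx_ballx; rewrite divr_gt0.
    by apply: nbhs_right_lt; rewrite divr_gt0.
  move=> [x' d'] /= [xx' d'd] y x'y.
  have dist z : `|x - z| < d -> `|G x - G z| <= e / 2 by move=> ?; exact/ltW/dG.
  rewrite (_ : G x' - G y = (G x - G y) - (G x - G x')); last by ring.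
  apply: le_trans (ler_normB _ _) _; rewrite [leRHS](splitr e) lerD// dist//; last first.
    by rewrite (lt_trans xx')// ltr_pdivrMr// ltr_pMr// ltr1n.
  rewrite (_ : x - y = (x - x') + (x' - y)); last by ring.
  rewrite (le_lt_trans (ler_normD _ _))// [ltRHS](splitr d) ltrD//.
  exact: le_lt_trans x'y d'd.
apply: filterS => d Ad x y; rewrite ler_norml => xA; apply: Ad.
by rewrite /= in_itv.
Qed.

Section one_big_jump.
Context (R : realType) dO (Omega : measurableType dO) (P : probability Omega R).
Context d (E : measurableType d) (xi : nat -> Omega -> E).
Variable Lam : {measure set E -> \bar R}.
Hypothesis PRM : poisson_random_measure P xi Lam.
Variables (sym : E -> E) (msym : measurable_fun setT sym).
Hypothesis Lam_sym : forall A, measurable A -> Lam (sym @^-1` A) = Lam A.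
Variables (alpha : R) (alpha_gt0 : 0 < alpha) (alpha_lt2 : alpha < 2).
Variables (I : eqType) (a : I -> E -> R) (X : I -> Omega -> R).
Hypotheses (ma : forall t, measurable_fun setT (a t))
  (mX : forall t, measurable_fun setT (X t))
  (a_odd : forall t x, a t (sym x) = - a t x).
Variables (M : R) (M0 : 0 <= M).
Hypothesis a_tail : forall t (x : R), 0 < x ->
  (Lam [set z | (x < `|a t z|)%R] <= (M * x `^ (- alpha))%:E)%E.
Hypothesis XE : forall t, series_in_prob P (fun i w => a t (xi i w)) (X t).

(** B comes before the list of indices, the factor c and the tail constant m. The choices of [A],
    [omega] and e, which depend on G, tau and alpha alone, give each error that is linear in m a
    coefficient of at most tau / 4; the occurrence of two large terms gives the quadratic one. *)
Lemma one_big_jump (G : R -> R) (tau : R) : continuous G -> (forall x, 0 <= G x) ->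
  (exists K, forall x, G x <= K) -> (\forall x \near 0, G x = 0) -> 0 < tau ->
  exists2 B : R, 0 <= B & forall (s : seq I) (c m : R), 0 <= m ->
    (forall x : R, 0 < x ->
      (Lam [set z | (x < `|c * (\sum_(t <- s) a t z)|)%R] <= (m * x `^ (- alpha))%:E)%E) ->
    let EY := (\int[P]_w (G (c * (\sum_(t <- s) X t w)))%:E)%E in
    let EL := (\int[Lam]_z (G (c * (\sum_(t <- s) a t z)))%:E)%E in
    (EY <= EL + (tau * m + B * m ^+ 2)%:E)%E /\
    (EL <= EY + (tau * m + B * m ^+ 2)%:E)%E.
Proof.
move=> cG G0 [K GK] Gnear tau0.
have K0 : 0 <= K by apply: le_trans (GK 0).
have tau4 : 0 < tau / 4 by rewrite divr_gt0.
have [r r0 Gr] : exists2 r, 0 < r & forall x, `|x| <= r -> G x = 0.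
  move: Gnear => /nbhs_ballP[r /= r0 rG]; exists (r / 2); first by rewrite divr_gt0.
  move=> x xr; apply: rG; rewrite /ball/= sub0r normrN (le_lt_trans xr)//.
  by rewrite ltr_pdivrMr// ltr_pMr// ltr1n.
(* Chosen so that K A^(-alpha) <= tau / 4; the 1 keeps [A] positive when K = 0. *)
pose A := (4 * K / tau + 1) `^ alpha^-1.
have A1 : 0 < 4 * K / tau + 1 by rewrite ltr_wpDl// divr_ge0 ?mulr_ge0// ltW.
have A0 : 0 < A by rewrite powR_gt0.
have AE : A `^ (- alpha) = (4 * K / tau + 1)^-1.
  by rewrite /A -powRrM mulrN mulVf ?gt_eqF// powR_inv1// ltW.
pose omega := tau / 4 / (r / 2) `^ (- alpha).
have r20 : 0 < r / 2 by rewrite divr_gt0.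
have omega0 : 0 < omega by rewrite divr_gt0// powR_gt0.
have [eta [eta0 etar G_uc]] : exists eta, [/\ 0 < eta, eta <= r / 2 &
    forall x y, `|x| <= A -> `|x - y| <= eta -> `|G x - G y| <= omega].
  near (0 : R)^'+ => eta; exists eta; split.
  - by near: eta; exact: nbhs_right_gt.
  - by near: eta; exact: nbhs_right_le.
  - by near: eta; exact: continuous_uniform_segment.
pose Ce := K * (16 * eta ^- 2 * trunc_cst alpha).
have Ce0 : 0 <= Ce.
  by rewrite mulr_ge0// mulr_ge0 ?trunc_cst_ge0// divr_ge0// exprn_ge0// ltW.
have [e [e0 er eC]] : exists e, [/\ 0 < e, e <= r & Ce * (e ^+ 2 * e `^ (- alpha)) < tau / 4].
  near (0 : R)^'+ => e; exists e; split.
  - by near: e; exact: nbhs_right_gt.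
  - by near: e; exact: nbhs_right_le.
  - by near: e; exact: near_sqr_powRN.
exists (K * (e `^ (- alpha)) ^+ 2); first by rewrite mulr_ge0// sqr_ge0.
move=> s c m m0 b_tail EY EL.
pose b z := c * \sum_(t <- s) a t z.
pose Y w := c * \sum_(t <- s) X t w.
have mb : measurable_fun setT b.
  by apply: measurable_funM => //; exact: measurable_sum.
have mY : measurable_fun setT Y.
  by apply: measurable_funM => //; exact: measurable_sum.
have mG := continuous_measurable_fun cG.
have SJ := small_jumps PRM msym Lam_sym alpha_lt2 ma mX a_odd M0 m0 a_tail XE b_tail e0 eta0.
have := big_jump_expectation PRM mb mY mG G0 GK r0 Gr e0 er etar A0 (ltW omega0) G_uc b_tail SJ.
move=> /=; set err := (X in (_ <= \int[Lam]_x _ + X%:E)%E); move=> h.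
have err_le : err <= tau * m + K * e `^ (- alpha) ^+ 2 * m ^+ 2.
  rewrite /err.
  have -> : K * (16 / eta ^+ 2 * (m * trunc_cst alpha * (e ^+ 2 * e `^ (- alpha)))) =
      m * (Ce * (e ^+ 2 * e `^ (- alpha))) by rewrite /Ce; ring.
  have -> : omega * (m * (r / 2) `^ (- alpha)) = m * (tau / 4).
    by rewrite /omega; field; rewrite gt_eqF// powR_gt0.
  have h3 : K * (m * A `^ (- alpha)) <= m * (tau / 4).
    rewrite AE mulrCA ler_wpM2l// ler_pdivrMr// mulrDr mulr1.
    rewrite (_ : _ / 4 * _ = K); last by field; rewrite gt_eqF.
    by rewrite lerDl ltW.
  have h1 : m * (Ce * (e ^+ 2 * e `^ (- alpha))) <= m * (tau / 4).
    by rewrite ler_wpM2l// ltW.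
  have -> : (m * e `^ (- alpha)) ^+ 2 = e `^ (- alpha) ^+ 2 * m ^+ 2 by ring.
  rewrite mulrA; nra.
by split; [apply: le_trans h.1 _|apply: le_trans h.2 _]; rewrite leeD2l// lee_fin.
Unshelve. all: by end_near. Qed.

End one_big_jump.

(** * The jump measure *)

Section measure_rays.
Context (R : realType).
Local Open Scope ereal_scope.
Implicit Types m : {measure set R -> \bar R}.

(** Rays form a pi-system, but the measures may be infinite near 0. Uniqueness is applied to the
    restrictions to ]r, +oo[, which are finite, and r is sent to 0 along 1 / (k + 1). *)
Lemma measure_rays_unique_pos m1 m2 :
  (forall x : R, (0 < x)%R -> m1 `]x, +oo[%classic = m2 `]x, +oo[%classic) ->
  (forall x : R, (0 < x)%R -> m1 `]x, +oo[%classic < +oo) ->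
  forall A : set R, measurable A -> A `<=` `]0%R, +oo[%classic -> m1 A = m2 A.
Proof.
move=> m12 m1fin A mA A0.
have Ar (r : R) : (0 < r)%R -> m1 (A `&` `]r, +oo[%classic) = m2 (A `&` `]r, +oo[%classic).
  move=> r0; have mr : measurable (`]r, +oo[%classic : set R) by [].
  have rays x : (`]x, +oo[ `&` `]r, +oo[ = `]Num.max x r, +oo[)%classic.
    by apply/seteqP; split => y /=; rewrite !in_itv/= !andbT gt_max;
      [move=> [-> ->]|move=> /andP].
  have max0 x : (0 < Num.max x r)%R by rewrite lt_max r0 orbT.
  have := @measure_unique _ R _ (@RGenOInfty.G R) (fun k => `](- k%:R)%R, +oo[%classic)
    (RGenOInfty.measurableE R) _ _ _ (mrestr m1 mr) (mrestr m2 mr) _ _ A mA.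
  rewrite /= /mrestr; apply.
  - move=> _ _ [x ->] [y ->]; exists (Num.max x y).
    by apply/seteqP; split => z /=; rewrite !in_itv/= !andbT gt_max;
      [move=> [-> ->]|move=> /andP].
  - by move=> k; exists (- k%:R)%R.
  - apply/seteqP; split => // x _; exists (Num.truncn `|x|).+1 => //=.
    rewrite in_itv/= andbT ltrNl (le_lt_trans _ (truncnS_gt _))//.
    by rewrite -normrN ler_norm.
  - by move=> _ [x ->]; rewrite /mrestr rays m12.
  - by move=> k; rewrite /mrestr rays m1fin.
pose F (k : nat) : set R := A `&` `](k.+1%:R^-1)%R, +oo[%classic.
have FA : \bigcup_k F k = A.
  rewrite -setI_bigcupr; apply/setIidPl => x /A0/=; rewrite in_itv/= andbT => x0.
  exists (Num.truncn x^-1%R) => //=; rewrite in_itv/= andbT invf_plt ?posrE//.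
  exact: truncnS_gt.
have mF k : measurable (F k) by exact: measurableI.
have ndF : nondecreasing_seq F.
  move=> i j ij; apply/subsetPset => x [Ax /=]; rewrite !in_itv/= !andbT => ix; split => //=.
  rewrite in_itv/= andbT (le_lt_trans _ ix)// lef_pV2 ?posrE// ler_nat.
  by [].
have h m : m A = limn (m \o F).
  apply/esym/cvg_lim => //; rewrite -FA; apply: nondecreasing_cvg_mu => //.
  exact: bigcup_measurable.
by rewrite !h; congr (limn _); apply/funext => k /=; apply: Ar; rewrite invr_gt0.
Qed.

Let mopp : measurable_fun [set: R] (-%R : R -> R).
Proof. exact: oppr_measurable. Qed.

Definition reflected m : {measure set R -> \bar R} :=
  measure_function_pushforward__canonical__measure_function_Measure m mopp.

Lemma opp_preimage_ray (x : R) : (-%R : R -> R) @^-1` `]x, +oo[ = `]-oo, (- x)%R[%classic.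
Proof. by apply/seteqP; split => y /=; rewrite !in_itv/= andbT ltrNr. Qed.

Lemma measure_rays_unique m1 m2 :
  (forall x : R, (0 < x)%R -> m1 `]x, +oo[%classic = m2 `]x, +oo[%classic) ->
  (forall x : R, (0 < x)%R -> m1 `]x, +oo[%classic < +oo) ->
  (forall x : R, (0 < x)%R -> m1 `]-oo, (- x)%R[%classic = m2 `]-oo, (- x)%R[%classic) ->
  (forall x : R, (0 < x)%R -> m1 `]-oo, (- x)%R[%classic < +oo) ->
  forall A : set R, measurable A -> ~ A 0%R -> m1 A = m2 A.
Proof.
move=> p12 p1 n12 n1 A mA A0.
have AE : A = (A `&` `]0%R, +oo[%classic) `|` (A `&` `]-oo, 0%R[%classic).
  rewrite -setIUr; apply/esym/setIidPl => x Ax /=; rewrite !in_itv/= andbT.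
  have [x0|x0|x0] := ltgtP x 0%R; [by right|by left|by exfalso; apply: A0; rewrite -x0].
have mp : measurable (A `&` `]0%R, +oo[%classic) by exact: measurableI.
have mn : measurable (A `&` `]-oo, 0%R[%classic) by exact: measurableI.
have dis : (A `&` `]0%R, +oo[%classic) `&` (A `&` `]-oo, 0%R[%classic) = set0.
  apply/seteqP; split => // x [[_ /=]]; rewrite in_itv/= andbT => x0 [_ /=].
  by rewrite in_itv/= ltNge ltW.
rewrite AE !measureU//; congr (_ + _).
  by apply: measure_rays_unique_pos => // x [].
have h m : m (A `&` `]-oo, 0%R[%classic) =
    reflected m ((-%R : R -> R) @^-1` (A `&` `]-oo, 0%R[%classic)).
  rewrite /= /pushforward; congr (m _).
  by apply/seteqP; split => x /=; rewrite opprK.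
rewrite [LHS](h m1) [RHS](h m2); apply: measure_rays_unique_pos.
- by move=> x x0; rewrite /= /pushforward opp_preimage_ray n12.
- by move=> x x0; rewrite /= /pushforward opp_preimage_ray n1.
- by rewrite -[X in measurable X]setTI; exact: mopp.
- by move=> x [_ /=]; rewrite !in_itv/= andbT oppr_lt0.
Qed.

Variables (alpha : R) (nua : {measure set R -> \bar R}).
Hypothesis hnua : is_nu_alpha alpha nua.

(** The reflection exchanges the two families of rays, which determine the measure off 0; the point
    0 has no mass. *)
Lemma nu_alpha_opp (A : set R) : measurable A -> nua ((-%R : R -> R) @^-1` A) = nua A.
Proof.
move=> mA; have [n0 nr] := hnua.
have m0 : measurable ([set 0%R] : set R) by [].
have mAD : measurable (A `\ 0%R) by exact: measurableD.
have mopA B : measurable B -> measurable ((-%R : R -> R) @^-1` B).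
  by move=> mB; rewrite -[X in measurable X]setTI; exact: mopp.
have rays (x : R) : (0 < x)%R ->
   nua (-%R @^-1` `]x, +oo[%classic) = nua `]x, +oo[%classic /\
   nua (-%R @^-1` `]-oo, (- x)%R[%classic) = nua `]-oo, (- x)%R[%classic.
  move=> x0; rewrite opp_preimage_ray; have [-> ->] := nr x x0; split => //.
  rewrite -(nr x x0).1; congr (nua _).
  by apply/seteqP; split => y /=; rewrite !in_itv/= andbT ltrN2.
have E : nua (-%R @^-1` (A `\ 0%R)) = nua (A `\ 0%R).
  rewrite -[LHS]/(reflected nua (A `\ 0%R)).
  apply: measure_rays_unique => // [x x0|x x0|x x0|x x0|[_ /(_ erefl)]//]; rewrite /= /pushforward.
  - by rewrite (rays x x0).1.
  - by rewrite (rays x x0).1 (nr x x0).1 ltry.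
  - by rewrite (rays x x0).2.
  - by rewrite (rays x x0).2 (nr x x0).2 ltry.
have U0 B : measurable B -> nua B = nua (B `\ 0%R).
  move=> mB; rewrite (measureDI nua mB m0).
  rewrite [X in _ + X](_ : _ = 0) ?adde0//; apply/eqP; rewrite -measure_le0 -n0.
  by apply: le_measure; rewrite ?inE//; exact: measurableI.
rewrite (U0 A mA) -E (U0 _ (mopA _ mA)); congr (nua _).
apply/seteqP; split => x /= [Ax x0]; split => // h; apply: x0.
  by apply/eqP; rewrite -oppr_eq0 h.
by rewrite h oppr0.
Qed.

(** A measure on the line is determined off 0 by its tails when these are finite, so the image of
    [Lam] under b is exactly c times [nua] there. At 0 the image may have any mass, hence the
    condition on G. *)
Lemma integral_regular_tails d (E : measurableType d) (Lam : {measure set E -> \bar R})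
    (b : E -> R) (c : R) (G : R -> R) : (0 <= c)%R -> measurable_fun setT b ->
  (forall x : R, (0 < x)%R ->
    Lam [set z | (x < b z)%R] = (c * x `^ (- alpha))%:E /\
    Lam [set z | (b z < - x)%R] = (c * x `^ (- alpha))%:E) ->
  measurable_fun setT G -> (forall x, (0 <= G x)%R) -> G 0%R = 0%R ->
  \int[Lam]_z (G (b z))%:E = c%:E * \int[nua]_x (G x)%:E.
Proof.
move=> c0 mb tails mG G0 G00; have [n0 nr] := hnua.
have mGE : measurable_fun setT (EFin \o G) by exact/measurable_EFinP.
rewrite -[LHS](@ge0_integral_pushforward _ _ _ _ _ _ mb Lam setT (EFin \o G))//; last first.
  by move=> y _; rewrite lee_fin.
pose mb' : {measure set R -> \bar R} :=
  measure_function_pushforward__canonical__measure_function_Measure Lam mb.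
pose cn : {measure set R -> \bar R} := mscale (NngNum c0) nua.
have G_restr m : \int[m]_x (EFin \o G) x = \int[m]_(x in ~` [set 0%R]) (EFin \o G) x.
  rewrite [RHS]integral_mkcond; apply: eq_integral => x _; rewrite patchE.
  by case: ifPn => //; rewrite notin_setE /= => /contrapT ->; rewrite G00.
transitivity (\int[cn]_x (EFin \o G) x); last first.
  by rewrite ge0_integral_mscale// => x _; rewrite lee_fin.
rewrite -[LHS]/(\int[mb']_x (EFin \o G) x) (G_restr mb') (G_restr cn).
apply: (@eq_measure_integral _ _ _ _ cn mb') => A mA A0.
apply: measure_rays_unique => // [x x0|x x0|x x0|x x0|/A0/=//].
- rewrite /= /mscale/= (nr x x0).1 -EFinM -(tails x x0).1 /pushforward; congr (Lam _).
  by apply/seteqP; split => y /=; rewrite in_itv/= andbT.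
- suff -> : mb' `]x, +oo[%classic = (c * x `^ (- alpha))%:E by rewrite ltry.
  rewrite -(tails x x0).1 /= /pushforward; congr (Lam _).
  by apply/seteqP; split => y /=; rewrite in_itv/= andbT.
- rewrite /= /mscale/= (nr x x0).2 -EFinM -(tails x x0).2.
  by rewrite /pushforward; congr (Lam _).
- suff -> : mb' `]-oo, (- x)%R[%classic = (c * x `^ (- alpha))%:E by rewrite ltry.
  by rewrite -(tails x x0).2.
Qed.

End measure_rays.

Lemma cvgr_near_le (R : realType) (f : nat -> R) l z :
  f n @[n --> \oo] --> l -> l < z -> \forall n \near \oo, f n <= z.
Proof.
move=> /cvgrPdist_lt h lz; have zl : 0 < z - l by rewrite subr_gt0.
by apply: filterS (h _ zl) => n; rewrite ltr_norml => /andP[]; lra.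
Qed.

(** * Limits of scaled expectations *)

Section scaled_limit.
Context (R : realType) dO (Omega : measurableType dO) (P : probability Omega R).
Context d (E : measurableType d) (xi : nat -> Omega -> E).
Variable Lam : {measure set E -> \bar R}.
Hypothesis PRM : poisson_random_measure P xi Lam.
Variables (sym : E -> E) (msym : measurable_fun setT sym).
Hypothesis Lam_sym : forall A, measurable A -> Lam (sym @^-1` A) = Lam A.
Variables (alpha : R) (alpha_gt0 : 0 < alpha) (alpha_lt2 : alpha < 2).
Variables (nua : {measure set R -> \bar R}) (hnua : is_nu_alpha alpha nua).
Variables (I : eqType) (a : I -> E -> R) (X : I -> Omega -> R).
Hypotheses (ma : forall t, measurable_fun setT (a t))
  (mX : forall t, measurable_fun setT (X t))
  (a_odd : forall t x, a t (sym x) = - a t x).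
Variables (M : R) (M0 : 0 <= M).
Hypothesis a_tail : forall t (x : R), 0 < x ->
  (Lam [set z | (x < `|a t z|)%R] <= (M * x `^ (- alpha))%:E)%E.
Hypothesis XE : forall t, series_in_prob P (fun i w => a t (xi i w)) (X t).
Variables (s : nat -> seq I) (c m r : nat -> R) (C : R).
Hypotheses (m0 : forall n, 0 <= m n) (r0 : forall n, 0 <= r n).

Let b n z := c n * \sum_(t <- s n) a t z.
Let Y n w := c n * \sum_(t <- s n) X t w.

Hypothesis b_tail : forall n (x : R), 0 < x ->
  Lam [set z | x < b n z] = (m n * x `^ (- alpha))%:E /\
  Lam [set z | b n z < - x] = (m n * x `^ (- alpha))%:E.
Hypothesis rm : r n * m n @[n --> \oo] --> C.
Hypothesis m_cvg0 : m n @[n --> \oo] --> 0.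

Let mb n : measurable_fun setT (b n).
Proof. by apply: measurable_funM => //; exact: measurable_sum. Qed.

Let mY n : measurable_fun setT (Y n).
Proof. by apply: measurable_funM => //; exact: measurable_sum. Qed.

Let b_tail2 n (x : R) : 0 < x ->
  (Lam [set z | (x < `|b n z|)%R] <= (2 * m n * x `^ (- alpha))%:E)%E.
Proof.
move=> x0; have [h1 h2] := b_tail n x0.
have mp : measurable [set z | x < b n z].
  have := mb n measurableT (measurable_itv `]x, +oo[); rewrite setTI.
  by congr measurable; apply/seteqP; split => z /=; rewrite in_itv/= andbT.
have mn : measurable [set z | b n z < - x].
  have := mb n measurableT (measurable_itv `]-oo, (- x)[); rewrite setTI.
  by congr measurable; apply/seteqP; split => z /=; rewrite in_itv/=.
apply: (@le_trans _ _ (Lam ([set z | x < b n z] `|` [set z | b n z < - x]))).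
  apply: le_measure; rewrite ?inE//; [exact: measurable_absr_gt|exact: measurableU|].
  by move=> z /=; rewrite lter_normr ltrNr => /orP[]; [left|right].
apply: le_trans (measureU2 _ mp mn) _.
rewrite [X in (X + _)%E]h1 [X in (_ + X)%E]h2 -EFinD lee_fin -mulrDl.
by rewrite [2 * m n]mulr_natl mulr2n.
Qed.

Let GY_fin (G : R -> R) K n : measurable_fun setT G -> (forall x, 0 <= G x <= K) ->
  (\int[P]_w (G (Y n w))%:E)%E \is a fin_num.
Proof.
move=> mG GK; rewrite ge0_fin_numE; last first.
  by apply: integral_ge0 => w _; rewrite lee_fin; case/andP: (GK (Y n w)).
apply: (@le_lt_trans _ _ (\int[P]_w K%:E)%E).
  apply: ge0_le_integral => //.
  - by move=> w _; rewrite lee_fin; case/andP: (GK (Y n w)).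
  - by apply/measurable_EFinP; exact: measurableT_comp.
  - by move=> w _; rewrite lee_fin; case/andP: (GK (Y n w)).
by rewrite integral_cst// [X in (_ * X)%E]probability_setT mule1 ltry.
Qed.

Let nua_fin (G : R -> R) K e : measurable_fun setT G -> (forall x, 0 <= G x <= K) ->
  0 < e -> (forall x, `|x| <= e -> G x = 0) ->
  (\int[nua]_x (G x)%:E)%E \is a fin_num.
Proof.
move=> mG GK e0 Ge; have [n0 nr] := hnua.
have K0 : 0 <= K by case/andP: (GK 0) => h1 h2; exact: le_trans h2.
rewrite ge0_fin_numE; last first.
  by apply: integral_ge0 => x _; rewrite lee_fin; case/andP: (GK x).
pose A : set R := `]-oo, - e[%classic `|` `]e, +oo[%classic.
apply: (@le_lt_trans _ _ (\int[nua]_x (K%:E * (\1_A x)%:E))%E).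
  apply: ge0_le_integral => //.
  - by move=> x _; rewrite lee_fin; case/andP: (GK x).
  - exact/measurable_EFinP.
  - apply: emeasurable_funM => //; apply/measurable_EFinP/measurable_indic.
    exact: measurableU.
  move=> x _; rewrite indicE; case: (boolP (x \in A)) => [_|].
    by rewrite mule1 lee_fin; case/andP: (GK x).
  rewrite notin_setE /A /= !in_itv/= andbT => /not_orP[/negP h1 /negP h2].
  rewrite mule0 Ge// ler_norml; rewrite -!leNgt in h1 h2; apply/andP; split => //.
rewrite ge0_integralZl_EFin//; last first.
  by apply/measurable_EFinP/measurable_indic; exact: measurableU.
rewrite integral_indic//; last exact: measurableU.
rewrite setIT lte_mul_pinfty//.
apply: le_lt_trans (measureU2 _ _ _) _ => //.
by rewrite [X in (X + _)%E](nr e e0).2 [X in (_ + X)%E](nr e e0).1 -EFinD ltry.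
Qed.

(** The integral of G(b_n) against [Lam] is exactly m_n times that of G. The comparison error times
    r_n, namely r_n (tau' 2 m_n + B (2 m_n)^2), is eventually at most tau, since r_n m_n is bounded
    and m_n tends to 0. The factor 2 accounts for the two tails. *)
Let scaled_limit_ge0 (G : R -> R) : continuous G -> (forall x, 0 <= G x) ->
  (exists K, forall x, G x <= K) -> (\forall x \near 0, G x = 0) ->
  ((r n)%:E * \int[P]_w (G (Y n w))%:E @[n --> \oo] --> C%:E * \int[nua]_x (G x)%:E)%E
  /\ (\int[nua]_x (G x)%:E)%E \is a fin_num.
Proof.
move=> cG G0 [K GK] Gnear.
have mG := continuous_measurable_fun cG.
have G0K x : 0 <= G x <= K by rewrite G0 GK.
have [e e0 Ge] : exists2 e, 0 < e & forall x, `|x| <= e -> G x = 0.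
  move: (Gnear) => /nbhs_ballP[e /= e0 eG]; exists (e / 2); first by rewrite divr_gt0.
  move=> x xe; apply: eG; rewrite /ball/= sub0r normrN (le_lt_trans xe)//.
  by rewrite ltr_pdivrMr// ltr_pMr// ltr1n.
have If := nua_fin mG G0K e0 Ge; split => //.
have Yf n := GY_fin n mG G0K.
pose i := fine (\int[nua]_x (G x)%:E)%E.
pose y n := fine (\int[P]_w (G (Y n w))%:E)%E.
have ELE n : (\int[Lam]_z (G (b n z))%:E)%E = (m n * i)%:E.
  rewrite (@integral_regular_tails _ _ _ hnua _ _ Lam (b n) (m n))//.
  - by rewrite EFinM /i fineK.
  - by move=> x x0; exact: b_tail.
  - by apply: Ge; rewrite normr0 ltW.
have C0 : 0 <= C.
  have <- := cvg_lim (@Rhausdorff R) rm; apply: limr_ge; first by apply/cvg_ex; exists C.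
  by apply: nearW => n; rewrite mulr_ge0.
rewrite -(fineK If) -/i -EFinM.
have -> : (fun n => (r n)%:E * \int[P]_w (G (Y n w))%:E)%E = EFin \o (fun n => r n * y n).
  by apply/funext => n /=; rewrite EFinM /y fineK.
apply/cvg_EFin; first exact: nearW.
rewrite -[X in X @ _ --> _]/(fun n => r n * y n).
suff h : (r n * y n - r n * m n * i) @[n --> \oo] --> 0.
  have -> : (fun n => r n * y n) =
      (fun n => r n * y n - r n * m n * i) \+ (fun n => r n * m n * i).
    by apply/funext => n /=; rewrite subrK.
  rewrite -[C * i]add0r; apply: cvgD => //; apply: cvgM => //; exact: cvg_cst.
apply/cvgrPdist_le => tau tau0.
have C1 : 0 < C + 1 by rewrite ltr_wpDl.
(* Eventually r_n m_n <= C + 1, so the linear part of the error is at most 2 tau' (C + 1) = tau / 2;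
   the other half is left to the quadratic part. *)
pose tau' := tau / 4 / (C + 1).
have tau'0 : 0 < tau' by rewrite !divr_gt0.
have [B B0 bj] := one_big_jump PRM msym Lam_sym alpha_gt0 alpha_lt2 ma mX a_odd M0 a_tail XE
  cG G0 (ex_intro _ K GK) Gnear tau'0.
have n1 : \forall n \near \oo, r n * m n <= C + 1.
  have : C < C + 1 by rewrite ltrDl.
  exact: cvgr_near_le rm.
have n2 : \forall n \near \oo, 4 * B * (C + 1) * m n <= tau / 2.
  have h : 4 * B * (C + 1) * m n @[n --> \oo] --> 0.
    by have := cvgM (cvg_cst (4 * B * (C + 1))) m_cvg0; rewrite mulr0; apply.
  have t20 : 0 < tau / 2 by rewrite divr_gt0.
  exact: cvgr_near_le h t20.
near=> n.
have m20 : 0 <= 2 * m n by rewrite mulr_ge0.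
have [] := bj (s n) (c n) (2 * m n) m20 (@b_tail2 n).
have YE : (\int[P]_w (G (c n * \sum_(t <- s n) X t w))%:E = (y n)%:E)%E.
  by rewrite /y fineK// Yf.
rewrite /= YE ELE -!EFinD !lee_fin => h1 h2.
have rn := r0 n; have mn := m0 n.
have x1 : r n * m n <= C + 1 by near: n; exact: n1.
have x2 : 4 * B * (C + 1) * m n <= tau / 2 by near: n; exact: n2.
have err : r n * (tau' * (2 * m n) + B * (2 * m n) ^+ 2) <= tau.
  have -> : r n * (tau' * (2 * m n) + B * (2 * m n) ^+ 2) =
      2 * tau' * (r n * m n) + 4 * B * m n * (r n * m n) by ring.
  have e1 : 2 * tau' * (r n * m n) <= tau / 2.
    apply: (@le_trans _ _ (2 * tau' * (C + 1))).
      by rewrite ler_wpM2l// mulr_ge0// ltW.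
    by rewrite /tau' le_eqVlt; apply/orP; left; apply/eqP; field; rewrite gt_eqF.
  have e2 : 4 * B * m n * (r n * m n) <= 4 * B * m n * (C + 1).
    by rewrite ler_wpM2l// !mulr_ge0.
  lra.
rewrite sub0r normrN -mulrA -mulrBr normrM ger0_norm//.
apply: le_trans err; rewrite ler_wpM2l// ler_norml; lra.
Unshelve. all: by end_near. Qed.

(** The comparison with the largest term is one-sided and needs G >= 0. The positive and negative
    parts of a signed G are still continuous, bounded and zero near 0, and their integrals are
    finite. *)
Lemma scaled_limit (G : R -> R) : continuous G ->
  (exists K : R, forall x, `|G x| <= K) -> (\forall x \near 0, G x = 0) ->
  ((r n)%:E * \int[P]_w (G (Y n w))%:E @[n --> \oo] --> C%:E * \int[nua]_x (G x)%:E)%E.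
Proof.
move=> cG [K GK] Gnear.
pose Gp (x : R) : R := Num.max (G x) 0; pose Gn (x : R) : R := Num.max (- G x) 0.
have cp : continuous Gp.
  by move=> x; apply: continuous_max; [exact: cG|exact: cvg_cst].
have cn : continuous Gn.
  have cN : continuous (fun x : R => - G x) by move=> x; apply: continuousN; exact: cG.
  by move=> x; apply: (@continuous_max _ _ (fun x : R => - G x)); [exact: cN|exact: cvg_cst].
have Gp0 : \forall x \near 0, Gp x = 0 by apply: filterS Gnear => x; rewrite /Gp => ->; rewrite maxxx.
have Gn0 : \forall x \near 0, Gn x = 0.
  by apply: filterS Gnear => x; rewrite /Gn => ->; rewrite oppr0 maxxx.
have pK : exists K, forall x, Gp x <= K.
  exists K => x; rewrite /Gp ge_max (le_trans (ler_norm _) (GK x))/=.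
  exact: le_trans (normr_ge0 _) (GK x).
have nK : exists K, forall x, Gn x <= K.
  exists K => x; rewrite /Gn ge_max; apply/andP; split; last exact: le_trans (normr_ge0 _) (GK x).
  by apply: le_trans (ler_norm _) _; rewrite normrN.
have p0 x : 0 <= Gp x by rewrite le_max lexx orbT.
have n0 x : 0 <= Gn x by rewrite le_max lexx orbT.
have [hp fp] := scaled_limit_ge0 cp p0 pK Gp0.
have [hn fn] := scaled_limit_ge0 cn n0 nK Gn0.
have split_integral dT (T : measurableType dT) (mu : {measure set T -> \bar R}) (f : T -> R) :
    (\int[mu]_x (G (f x))%:E = \int[mu]_x (Gp (f x))%:E - \int[mu]_x (Gn (f x))%:E)%E.
  by rewrite integralE; congr (_ - _)%E; apply: eq_integral => x _;
    rewrite ?funeposE ?funenegE /= -?EFin_max.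
have fpY n : (\int[P]_w (Gp (Y n w))%:E)%E \is a fin_num.
  have [L pL] := pK; apply: (@GY_fin Gp L); first exact: continuous_measurable_fun.
  by move=> x; rewrite p0 pL.
rewrite (split_integral _ _ nua id) muleBr//; last by rewrite fin_num_adde_defr.
under eq_fun do rewrite (split_integral _ _ P (Y _)) muleBr ?fin_num_adde_defr//.
apply: cvgeB => //; rewrite fin_num_adde_defr//.
by rewrite fin_numM.
Qed.

End scaled_limit.

(** * Counting measure on the lattice and tails of the jump measure *)

Section integrals_zeta.
Context (R : realType) (d : nat).
Local Open Scope ereal_scope.

Lemma measurable_fun_Zd dT (T : measurableType dT) (f : Zd d -> T) :
  measurable_fun setT f.
Proof. by move=> _ A _. Qed.

Let L (n : nat) : set (Zd d) := [set t | pickle t = n].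

(** The fibers of [pickle] are empty or singletons and partition the lattice, which turns both sides
    into the same series. *)
Lemma integral_zeta (D : set (Zd d)) (F : Zd d -> \bar R) : (forall u, 0 <= F u) ->
  \int[zeta R D]_u F u = \esum_(u in D) F u.
Proof.
move=> F0.
have LT : setT = \bigcup_n L n by apply/seteqP; split => // t _; exists (pickle t).
have tL : trivIset setT L.
  by move=> i k _ _ [t [/= <- <-]].
rewrite esum_mkcond LT.
rewrite (@ge0_integral_bigcup _ _ _ (zeta R D) L); last 4 first.
- by move=> k.
- by rewrite -LT; exact: measurable_fun_Zd.
- by move=> x _; exact: F0.
- exact: tL.
rewrite nneseries_sum_bigcup; last 2 first.
- exact: tL.
- by move=> u; case: ifP.
apply: eq_eseriesr => n _.
have [[t tn]|nt] := pselect (exists t : Zd d, pickle t = n); last first.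
  have -> : L n = set0 by apply/seteqP; split => // t tn; apply: nt; exists t.
  by rewrite integral_set0 esum_set0.
have -> : L n = [set t].
  apply/seteqP; split => [s sn|_ ->//].
  by apply: (pcan_inj (@pickleK (Zd d))); rewrite sn tn.
have h0 : 0 <= (if t \in D then F t else 0) by case: ifP.
rewrite (esum_set1 h0).
have -> : \int[zeta R D]_(x in [set t]) F x = \int[zeta R D]_(x in [set t]) (cst (F t) x).
  by apply: eq_integral => s; rewrite inE => ->.
rewrite integral_cst; last exact: measurable_Zd.
have zE : zeta R D [set t] = (t \in D)%:R%:E.
  rewrite /zeta /mrestr /counting; case: (boolP (t \in D)); [rewrite inE|rewrite notin_setE] => tD.
    have -> : [set t] `&` D = [set t] by apply/seteqP; split => [s []//|s ->].
    by rewrite asboolT; [rewrite fset_set1 finmap.cardfs1|exact: finite_set1].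
  have -> : [set t] `&` D = set0 by apply/seteqP; split => // s [->].
  by rewrite asboolT; [rewrite fset_set0 finmap.cardfs0|exact: finite_set0].
rewrite [X in _ * X]zE; case: ifP => _; first by rewrite mule1.
by rewrite mule0.
Qed.

End integrals_zeta.

Section nu_alpha_rays.
Context (R : realType) (alpha : R) (alpha_gt0 : 0 < alpha).
Variables (nua : {measure set R -> \bar R}) (hnua : is_nu_alpha alpha nua).
Local Open Scope ereal_scope.

Lemma sigma_finite_nu_alpha : sigma_finite setT nua.
Proof.
have [n0 nr] := hnua.
pose F n : set R := if n is k.+1 then `]k.+1%:R^-1%R, +oo[%classic `|` `]-oo, (- k.+1%:R^-1)%R[%classic
                    else [set 0%R].
exists F.
  apply/seteqP; split => // x _.
  have [->|x0] := eqVneq x 0%R; first by exists 0%N.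
  have /ltr_add_invr[k] : (0 < `|x|)%R by rewrite normr_gt0.
  rewrite add0r => kx; exists k.+1 => //=; move: kx; rewrite lter_normr ltrNr !in_itv/= andbT.
  by move=> /orP[]; [left|right].
case=> [|k]; first by split; [exact: measurable_set1|have -> : nua (F 0%N) = 0 := n0; exact: ltry].
split; first exact: measurableU.
have k0 : (0 < k.+1%:R^-1 :> R)%R by rewrite invr_gt0.
apply: le_lt_trans (measureU2 _ _ _) _ => //.
by rewrite [X in (X + _)%E](nr _ k0).1 [X in (_ + X)%E](nr _ k0).2 -EFinD ltry.
Qed.

(** According to the sign of g the set is a right ray, a left ray or empty; in the last case
    |g|^alpha = 0 because alpha > 0. *)
Lemma nu_alpha_ray (x g : R) : (0 < x)%R ->
  nua [set j | (x < j * g)%R] = (x `^ (- alpha) * `|g| `^ alpha)%:E.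
Proof.
move=> x0; have [n0 nr] := hnua.
have h y : (0 < y)%R -> ((x / y) `^ (- alpha) = x `^ (- alpha) * y `^ alpha)%R.
  move=> y0; rewrite powRM ?invr_ge0 ?ltW//; congr (_ * _)%R.
  by rewrite -powR_inv1 ?ltW// -powRrM mulN1r opprK.
have [g0|g0|->] := ltgtP g 0%R; last 1 first.
- rewrite normr0 powR0 ?gt_eqF// mulr0.
  have -> : [set j : R | (x < j * 0)%R] = set0.
    by apply/seteqP; split => // j /=; rewrite mulr0 ltNge ltW.
  by rewrite measure0.
- have y0 : (0 < - g)%R by rewrite oppr_gt0.
  have -> : [set j | (x < j * g)%R] = `]-oo, (- (x / (- g)))%R[%classic.
    apply/seteqP; split => j /=; rewrite in_itv/= ltrNr ltr_pdivrMr// mulrNN//.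
  by rewrite [LHS](nr _ (divr_gt0 x0 y0)).2 h// ltr0_norm.
- have -> : [set j | (x < j * g)%R] = `](x / g)%R, +oo[%classic.
    by apply/seteqP; split => j /=; rewrite in_itv/= andbT ltr_pdivrMr.
  by rewrite [LHS](nr _ (divr_gt0 x0 g0)).1 h// gtr0_norm.
Qed.

End nu_alpha_rays.

Section jump_measure.
Context (R : realType) (alpha : R) (alpha_gt0 : 0 < alpha).
Variables (nua : {sigma_finite_measure set R -> \bar R}).
Hypothesis hnua : is_nu_alpha alpha nua.
Context dW (W : measurableType dW) (d : nat) (H : set (Zd d)).
Variable nu : {sigma_finite_measure set W -> \bar R}.
Local Open Scope ereal_scope.

Let Lam := ((nua \x nu) \x zeta R H).

(** The same product with its sigma-finiteness attached, since it is itself a factor of [Lam]. *)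
Let nn : {sigma_finite_measure set (R * W)%type -> \bar R} := HB.pack_for
  {sigma_finite_measure set (R * W)%type -> \bar R} (nua \x nu)
  (@Measure_isSigmaFinite.Build _ _ _ (nua \x nu) (sigma_finite_product nua nu)).

Definition flip_jump (z : R * W * Zd d) : R * W * Zd d := (- z.1.1, z.1.2, z.2)%R.

Lemma measurable_flip_jump : measurable_fun setT flip_jump.
Proof.
apply: measurable_fun_pair => //; apply: measurable_fun_pair => //.
  by apply: measurableT_comp => //; apply: measurableT_comp.
by apply: measurableT_comp.
Qed.

Let flip2 (z : R * W) : R * W := (- z.1, z.2)%R.

Let measurable_flip2 : measurable_fun setT flip2.
Proof. by apply: measurable_fun_pair => //; apply: measurableT_comp. Qed.

Let flip2_sym (A : set (R * W)) : measurable A -> (nua \x nu) (flip2 @^-1` A) = (nua \x nu) A.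
Proof.
move=> mA.
pose m' := measure_function_pushforward__canonical__measure_function_Measure
  (nua \x nu : {measure set (R * W)%type -> \bar R}) measurable_flip2.
rewrite -[LHS]/(m' A); apply/esym/(@product_measure_unique _ _ _ _ _ nua nu m' _ A mA) => A1 B1 mA1 mB1.
rewrite -[LHS]/((nua \x nu) (flip2 @^-1` (A1 `*` B1))).
have -> : flip2 @^-1` (A1 `*` B1) = ((-%R : R -> R) @^-1` A1) `*` B1 by [].
rewrite product_measure1E//; first by rewrite (nu_alpha_opp hnua).
by rewrite -[X in measurable X]setTI; exact: oppr_measurable.
Qed.

Lemma jump_measure_sym (A : set (R * W * Zd d)) : measurable A ->
  Lam (flip_jump @^-1` A) = Lam A.
Proof.
move=> mA.
pose m' := measure_function_pushforward__canonical__measure_function_Measure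
  (Lam : {measure set (R * W * Zd d) -> \bar R}) measurable_flip_jump.
rewrite -[LHS]/(m' A); apply/esym.
have u := @product_measure_unique _ _ _ _ _ nn (zeta R H) m'.
apply: (u _ A mA) => A1 B1 mA1 mB1.
rewrite -[LHS]/(Lam (flip_jump @^-1` (A1 `*` B1))).
have -> : flip_jump @^-1` (A1 `*` B1) = (flip2 @^-1` A1) `*` B1 by [].
have mF : measurable (flip2 @^-1` A1).
  by rewrite -[X in measurable X]setTI; exact: measurable_flip2.
by rewrite [LHS](product_measure1E nn (zeta R H) mF mB1); congr (_ * _); exact: flip2_sym.
Qed.

(** Tonelli's theorem, used for both products, isolates the coordinate j, on which [nu_alpha_ray] is
    exact. Hence the tail is a pure power of x for every kernel g. *)
Lemma jump_measure_ray (g : W * Zd d -> R) (x : R) : measurable_fun setT g -> (0 < x)%R ->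
  Lam [set z | (x < z.1.1 * g (z.1.2, z.2))%R] =
  (x `^ (- alpha))%:E * \int[nu \x zeta R H]_y (`|g y| `^ alpha)%:E.
Proof.
move=> mg x0.
pose A : set (R * W * Zd d) := [set z | (x < z.1.1 * g (z.1.2, z.2))%R].
have mA : measurable A.
  have mf : measurable_fun setT (fun z : R * W * Zd d => z.1.1 * g (z.1.2, z.2))%R.
    apply: measurable_funM; first by apply: measurableT_comp.
    apply: measurableT_comp => //; apply: measurable_fun_pair => //.
    by apply: measurableT_comp.
  have := mf measurableT _ (measurable_itv `]x, +oo[); rewrite setTI.
  by congr measurable; apply/seteqP; split => z /=; rewrite in_itv/= andbT.
have m1A : measurable_fun setT (EFin \o \1_A : R * W * Zd d -> \bar R).
  by apply/measurable_EFinP/measurable_indic.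
rewrite (_ : Lam _ = \int[nn \x zeta R H]_z (\1_A z)%:E); last first.
  by rewrite integral_indic// setIT.
rewrite (@fubini_tonelli2 _ _ _ _ _ nn (zeta R H) (EFin \o \1_A) m1A); last first.
  by move=> z; rewrite lee_fin.
pose G (y : W * Zd d) : \bar R := (`|g y| `^ alpha)%:E.
have mG : measurable_fun setT G.
  by apply/measurable_EFinP; apply: (measurableT_comp (f := @powR R ^~ alpha)); [exact: measurable_powR|apply: measurableT_comp].
have G0 y : 0 <= G y by rewrite lee_fin powR_ge0.
rewrite -[X in _ = _ * X]/(\int[nu \x zeta R H]_y G y).
rewrite (@fubini_tonelli2 _ _ _ _ _ nu (zeta R H) G mG); last exact: G0.
rewrite -ge0_integralZl_EFin; last 4 first.
- exact: measurableT.
- by move=> u _; apply: integral_ge0 => v _; exact: G0.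
- exact: measurable_fun_Zd.
- exact: powR_ge0.
apply: eq_integral => u _; rewrite /fubini_G.
pose Au : set (R * W) := [set y | A (y, u)].
have mAu : measurable Au.
  rewrite -[X in measurable X]/((pair^~ u) @^-1` A) -[X in measurable X]setTI.
  exact: (pair2_measurable u).
rewrite (_ : \int[nn]_x0 _ = \int[nua \x nu]_y (\1_Au y)%:E); last by [].
have m1Au : measurable_fun setT (EFin \o \1_Au : R * W -> \bar R).
  by apply/measurable_EFinP/measurable_indic.
rewrite (@fubini_tonelli2 _ _ _ _ _ nua nu (EFin \o \1_Au) m1Au); last first.
  by move=> z; rewrite lee_fin.
rewrite -ge0_integralZl_EFin; last 4 first.
- exact: measurableT.
- by move=> v _; exact: G0.
- by have := measurableT_comp mG (pair2_measurable u).
- exact: powR_ge0.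
apply: eq_integral => v _; rewrite /fubini_G.
rewrite (_ : \int[nua]_x0 _ = nua [set j | (x < j * g (v, u))%R]).
  by rewrite (nu_alpha_ray alpha_gt0 hnua).
pose B : set R := [set j | (x < j * g (v, u))%R].
have mB : measurable B.
  rewrite -[X in measurable X]/((pair^~ v) @^-1` Au) -[X in measurable X]setTI.
  exact: (pair2_measurable v).
rewrite (_ : \int[nua]_x0 _ = \int[nua]_y (\1_B y)%:E); last by [].
by rewrite integral_indic// setIT.
Qed.

End jump_measure.

(** * Averages of lattice kernels *)

Section powR_increments.
Context (R : realType).
Implicit Types x y m alpha : R.

Lemma powR_le1_self x alpha : 0 <= x <= 1 -> 0 < alpha <= 1 -> x <= x `^ alpha.
Proof.
move=> /andP[x0 x1] /andP[a0 a1].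
have [->|xn0] := eqVneq x 0; first by rewrite powR_ge0.
have xp : 0 < x by rewrite lt_neqAle eq_sym xn0.
rewrite -[leLHS]powRr1//.
have h : 1 <= x^-1 by rewrite invf_ge1.
have := ler_powR h a1.
rewrite -!powR_inv1// -!powRrM !mulN1r !powRN lef_pV2 ?posrE ?powR_gt0//.
Qed.

(** Subadditivity of the power: s <= s^alpha on [0, 1], applied to y / x and (x - y) / x, whose sum
    is 1. *)
Let increment_le1 x y alpha : 0 <= y <= x -> 0 < alpha <= 1 ->
  x `^ alpha - y `^ alpha <= (x - y) `^ alpha.
Proof.
move=> /andP[y0 yx] a01; have x0 := le_trans y0 yx.
have [->|xn0] := eqVneq x 0.
  by rewrite powR0 ?gt_eqF ?(andP a01).1// sub0r (le_trans _ (powR_ge0 _ _))// oppr_le0 powR_ge0.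
have xp : 0 < x by rewrite lt_neqAle eq_sym xn0.
have h1 : y / x <= (y / x) `^ alpha.
  by apply: powR_le1_self => //; rewrite divr_ge0//= ler_pdivrMr// mul1r.
have h2 : (x - y) / x <= ((x - y) / x) `^ alpha.
  apply: powR_le1_self => //; rewrite divr_ge0 ?subr_ge0//= ler_pdivrMr// mul1r.
  by rewrite gerBl.
have e1 : y `^ alpha = x `^ alpha * (y / x) `^ alpha.
  by rewrite -powRM ?divr_ge0// mulrC divfK// gt_eqF.
have e2 : (x - y) `^ alpha = x `^ alpha * ((x - y) / x) `^ alpha.
  by rewrite -powRM ?divr_ge0 ?subr_ge0// mulrC divfK// gt_eqF.
rewrite e1 e2 lerBlDl -mulrDr ler_peMr ?powR_ge0//.
have <- : y / x + (x - y) / x = 1 by field; rewrite gt_eqF.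
exact: lerD.
Qed.

(** With b = alpha - 1 in [0, 1] the quotient t^b / t is nonincreasing, so y x^b <= x y^b and y (x^b
    - y^b) <= y^b (x - y). Adding (x - y) x^b gives the bound. *)
Let increment_ge1 x y alpha : 0 <= y <= x -> 1 <= alpha <= 2 ->
  x `^ alpha - y `^ alpha <= 2 * x `^ (alpha - 1) * (x - y).
Proof.
move=> /andP[y0 yx] /andP[a1 a2]; have x0 := le_trans y0 yx.
pose b := alpha - 1.
have b0 : 0 <= b by rewrite subr_ge0.
have E z : 0 <= z -> z `^ alpha = z * z `^ b.
  move=> z0; rewrite -[X in X * _]powRr1// -powRD ?subrKC//.
  by rewrite gt_eqF ?implybT//; lra.
rewrite !E// -/b.
have h : y * x `^ b <= y `^ b * x.
  have [->|yn0] := eqVneq y 0; first by rewrite mul0r mulr_ge0// powR_ge0.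
  have yp : 0 < y by rewrite lt_neqAle eq_sym yn0.
  have xE : x `^ b = y `^ b * (x / y) `^ b.
    by rewrite -powRM ?divr_ge0// mulrC divfK// gt_eqF.
  have xy1 : 1 <= x / y by rewrite ler_pdivlMr// mul1r.
  have : (x / y) `^ b <= x / y by apply: ler1_powR => //; rewrite /b; lra.
  rewrite ler_pdivlMr// => h.
  have := ler_wpM2l (powR_ge0 y b) h; rewrite xE; lra.
have h2 : y `^ b <= x `^ b by apply: ge0_ler_powR.
have h3 := ler_wpM2r (_ : 0 <= x - y) h2.
have := h3 (_ : 0 <= x - y); rewrite subr_ge0 => /(_ yx); lra.
Qed.

(** One formula for two regimes: Holder continuity of exponent alpha when alpha <= 1, and a
    Lipschitz bound of order m^(alpha - 1) when alpha > 1. *)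
Lemma powR_increment_le x y m alpha (kappa := Num.min alpha 1) :
  0 < alpha < 2 -> 0 <= x <= m -> 0 <= y <= m ->
  `|x `^ alpha - y `^ alpha| <= 2 * m `^ (alpha - kappa) * `|x - y| `^ kappa.
Proof.
move=> /andP[a0 a2].
wlog yx : x y / y <= x.
  move=> h xm ym; have [yx|/ltW xy] := leP y x; first exact: h.
  by rewrite distrC [in leRHS]distrC; exact: h.
move=> /andP[x0 xm] /andP[y0 ym].
have h : y `^ alpha <= x `^ alpha by apply: ge0_ler_powR => //; exact: ltW.
rewrite ger0_norm ?subr_ge0// ger0_norm ?subr_ge0// /kappa.
have [a1|a1] := leP alpha 1.
  rewrite subrr powRr0 mulr1; apply: le_trans (increment_le1 _ _) _; rewrite ?y0 ?a0//.
  by rewrite ler_peMl ?powR_ge0// ler1n.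
rewrite powRr1 ?subr_ge0//; apply: le_trans (increment_ge1 _ _) _; rewrite ?y0//.
  by rewrite !ltW.
apply: ler_wpM2r; rewrite ?subr_ge0//; apply: ler_wpM2l => //.
by apply: ge0_ler_powR; rewrite ?nnegrE; lra.
Qed.

End powR_increments.

Section lattice_sums.
Context (R : realType) (d : nat) (H : set (Zd d)).
Implicit Types (g M : Zd d -> R).
Local Notation Z := (zeta R H).
Local Open Scope ereal_scope.

Lemma integrable_Zd g : \int[Z]_w `|g w|%:E < +oo -> Z.-integrable setT (EFin \o g).
Proof. by move=> gfin; apply/integrableP; split => //; exact: measurable_fun_Zd. Qed.

Lemma sumZE g : \int[Z]_w `|g w|%:E < +oo -> (sumZ H g)%:E = \int[Z]_w (g w)%:E.
Proof.
move=> gfin; rewrite integralE /sumZ.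
have fin (h : Zd d -> R) : (forall w, (0 <= h w <= `|g w|)%R) ->
    \int[Z]_w (h w)%:E \is a fin_num.
  move=> hg; rewrite ge0_fin_numE; last first.
    by apply: integral_ge0 => w _; rewrite lee_fin; case/andP: (hg w).
  apply: le_lt_trans gfin; apply: ge0_le_integral => //.
  - by move=> w _; rewrite lee_fin; case/andP: (hg w).
  - by move=> w _; rewrite lee_fin; case/andP: (hg w).
have g0 w : (0 <= Num.max (g w) 0 <= `|g w|)%R.
  by rewrite le_max lexx orbT/= ge_max ler_norm/=.
have g0' w : (0 <= Num.max (- g w) 0 <= `|g w|)%R.
  by rewrite le_max lexx orbT/= ge_max -normrN ler_norm/=.
rewrite -!integral_zeta => [|w|w]; last 2 first.
- by rewrite lee_fin; case/andP: (g0' w).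
- by rewrite lee_fin; case/andP: (g0 w).
rewrite EFinD EFinN !fineK ?fin//; congr (_ - _).
  by apply: eq_integral => w _; rewrite funeposE /= -EFin_max.
by apply: eq_integral => w _; rewrite funenegE /= -EFin_max.
Qed.

Lemma sumZ_norm_le g : `|sumZ H g|%:E <= \int[Z]_w `|g w|%:E.
Proof.
have [gfin|] := ltP (\int[Z]_w `|g w|%:E) +oo; last exact: le_trans (leey _).
by rewrite -abse_EFin sumZE//; apply: le_abse_integral => //; exact: measurable_fun_Zd.
Qed.

(* If T = sum |g|^kappa, then |g| <= T^(1/kappa), whence sum |g| <= T^(1/kappa - 1) T. *)
Lemma powR_sum_le g kappa (a : R) : (0 < kappa <= 1)%R ->
  \int[Z]_w `|g w|%:E = a%:E -> (a `^ kappa)%:E <= \int[Z]_w (`|g w| `^ kappa)%:E.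
Proof.
move=> /andP[k0 k1] ga.
have a0 : (0 <= a)%R by rewrite -lee_fin -ga; apply: integral_ge0.
have gk0 w : 0 <= (`|g w| `^ kappa)%:E by rewrite lee_fin powR_ge0.
have [Tfin|] := ltP (\int[Z]_w (`|g w| `^ kappa)%:E) +oo; last exact: le_trans (leey _).
set T := \int[Z]_w _ in Tfin *.
have T0 : 0 <= T by apply: integral_ge0 => w _; exact: gk0.
have Tf : T \is a fin_num by rewrite ge0_fin_numE.
set t := fine T; have tE : T = t%:E by rewrite fineK.
have t0 : (0 <= t)%R by exact: fine_ge0.
have gt w : H w -> (`|g w| `^ kappa <= t)%R.
  move=> Hw; rewrite -lee_fin -tE /T integral_zeta; last exact: gk0.
  apply: esum_ge; exists [set w]; first by split; [exact: finite_set1|move=> _ ->].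
  by rewrite fsbig_set1.
have gt1 w : H w -> (`|g w| <= `|g w| `^ kappa * t `^ (kappa^-1 - 1))%R.
  move=> Hw; have [->|gn0] := eqVneq (g w) 0%R.
    by rewrite normr0 mulr_ge0 ?powR_ge0.
  have gp : (0 < `|g w|)%R by rewrite normr_gt0.
  have e : (`|g w| = `|g w| `^ kappa * (`|g w| `^ kappa) `^ (kappa^-1 - 1))%R.
    rewrite -powRrM -powRD; last by rewrite (gt_eqF gp) implybT.
    by rewrite mulrBr mulr1 mulfV ?gt_eqF// subrKC powRr1.
  rewrite [leLHS]e ler_wpM2l ?powR_ge0// ge0_ler_powR ?nnegrE ?powR_ge0 ?gt//.
  by rewrite subr_ge0 invf_ge1.
have gt2 : a%:E <= (t `^ (kappa^-1 - 1) * t)%:E.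
  rewrite EFinM -tE -ge0_integralZl_EFin//; last exact: powR_ge0.
  rewrite -ga integral_zeta; last by move=> w; rewrite lee_fin.
  rewrite integral_zeta; last by move=> w; rewrite mule_ge0// lee_fin powR_ge0.
  by apply: le_esum => w Hw; rewrite -EFinM lee_fin mulrC gt1.
rewrite lee_fin in gt2; rewrite tE lee_fin.
have h : (t `^ (kappa^-1 - 1) * t = t `^ (kappa^-1))%R.
  have [->|tn0] := eqVneq t 0%R; first by rewrite mulr0 powR0// invr_eq0 gt_eqF.
  rewrite -[X in (_ * X)%R](powRr1 t0) -powRD ?tn0 ?implybT//.
  by rewrite subrK.
rewrite h in gt2.
have := ge0_ler_powR (ltW k0) (_ : a \in Num.nneg) (_ : (t `^ kappa^-1)%R \in Num.nneg) gt2.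
by rewrite !nnegrE powR_ge0 a0 -powRrM mulVf ?gt_eqF// powRr1// => /(_ isT isT).
Qed.

(** The weights M(w) are replaced by a single weight N, so that the sum factors. Both sums are at
    most B a in modulus, so [powR_increment_le] applies, and [powR_sum_le] moves the exponent kappa
    inside the sum. The error becomes a sum over w of products, which can be summed over u term by
    term. *)
Lemma kernel_sum_bound alpha g M (N B a b : R) (kappa := Num.min alpha 1%R) :
  (0 < alpha < 2)%R -> (forall w, 0 <= M w <= B)%R -> (0 <= N <= B)%R ->
  \int[Z]_w `|g w|%:E = a%:E -> b%:E = \int[Z]_w (g w * M w)%:E ->
  (`| `|b| `^ alpha - `|sumZ H g * N| `^ alpha |)%R%:E <=
  (2 * (B * a) `^ (alpha - kappa))%R%:E * \int[Z]_w (`|g w| `^ kappa * `|M w - N| `^ kappa)%R%:E.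
Proof.
move=> a02 MB NB ga bE.
have /andP[k0 k1] : (0 < kappa <= 1)%R.
  by rewrite /kappa lt_min ltr01 (andP a02).1 ge_min lexx orbT.
have B0 : (0 <= B)%R by case/andP: NB => h1 h2; exact: le_trans h2.
have a0 : (0 <= a)%R by rewrite -lee_fin -ga; apply: integral_ge0.
have gfin : \int[Z]_w `|g w|%:E < +oo by rewrite ga ltry.
have bound (h : Zd d -> R) : (forall w, `|h w| <= B)%R ->
    \int[Z]_w `|g w * h w|%:E <= (B * a)%:E.
  move=> hB; rewrite EFinM -ga -ge0_integralZl_EFin//.
  apply: ge0_le_integral => //.
  by move=> w _; rewrite normrM -EFinM lee_fin mulrC ler_wpM2r.
have MB' w : (`|M w| <= B)%R by case/andP: (MB w) => h1 h2; rewrite ger0_norm.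
have NB' : (`|N| <= B)%R by case/andP: NB => h1 h2; rewrite ger0_norm.
have iM := integrable_Zd (le_lt_trans (bound M MB') (ltry _)).
have iN := integrable_Zd (le_lt_trans (bound (fun=> N) (fun=> NB')) (ltry _)).
have sN : (sumZ H g * N)%:E = \int[Z]_w (g w * N)%:E.
  rewrite EFinM sumZE//.
  by rewrite -integralZr//; exact: integrable_Zd.
have hb : (`|b| <= B * a)%R.
  rewrite -lee_fin -abse_EFin bE; apply: le_trans (bound M MB').
  by apply: le_abse_integral => //; exact: measurable_fun_Zd.
have hs : (`|sumZ H g * N| <= B * a)%R.
  rewrite -lee_fin -abse_EFin sN; apply: le_trans (bound (fun=> N) (fun=> NB')).
  by apply: le_abse_integral => //; exact: measurable_fun_Zd.
have diff : `|b - sumZ H g * N|%:E <= \int[Z]_w `|g w * (M w - N)|%:E.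
  rewrite -abse_EFin EFinB bE sN -integralB_EFin//.
  apply: le_trans (le_abse_integral _ measurableT (measurable_fun_Zd _)) _.
  rewrite le_eqVlt; apply/orP; left; apply/eqP; apply: eq_integral => w _.
  by rewrite -EFinB abse_EFin mulrBr.
have c0 : (0 <= 2 * (B * a) `^ (alpha - kappa))%R by rewrite mulr_ge0 ?powR_ge0.
apply: (@le_trans _ _ (2 * (B * a) `^ (alpha - kappa) * `|b - sumZ H g * N| `^ kappa)%:E).
  rewrite lee_fin; apply: le_trans (powR_increment_le a02 (_ : 0 <= `|b| <= B * a)%R
    (_ : 0 <= `|sumZ H g * N| <= B * a)%R) _; rewrite ?hb ?hs ?normr_ge0//.
  rewrite ler_wpM2l//; apply: ge0_ler_powR; rewrite ?nnegrE ?(ltW k0)//.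
  exact: ler_dist_dist.
rewrite EFinM; apply: lee_wpmul2l; first by rewrite lee_fin.
have Dfin : \int[Z]_w `|g w * (M w - N)|%:E \is a fin_num.
  rewrite ge0_fin_numE; last by apply: integral_ge0.
  apply: le_lt_trans (bound (fun w => M w - N)%R _) (ltry _) => w.
  case/andP: (MB w) => h1 h2; case/andP: NB => h3 h4; rewrite ler_norml; apply/andP; split; lra.
pose D := fine (\int[Z]_w `|g w * (M w - N)|%:E).
have DE : \int[Z]_w `|g w * (M w - N)|%:E = D%:E by rewrite fineK.
have k01 : (0 < kappa <= 1)%R by rewrite k0.
apply: (@le_trans _ _ (D `^ kappa)%:E).
  rewrite lee_fin; apply: ge0_ler_powR; rewrite ?nnegrE ?(ltW k0)//.
    by apply: fine_ge0; exact: integral_ge0.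
  by rewrite -lee_fin -DE.
apply: le_trans (powR_sum_le k01 DE) _.
rewrite le_eqVlt; apply/orP; left; apply/eqP; apply: eq_integral => w _.
by rewrite normrM powRM.
Qed.

End lattice_sums.

Lemma measurable_fun_Zd2 d d' dT (T : measurableType dT) (f : Zd d * Zd d' -> T) :
  measurable_fun setT f.
Proof.
move=> _ A _; rewrite setTI.
have -> : f @^-1` A = \bigcup_n [set z : Zd d * Zd d' | A (f z) /\ pickle z = n].
  by apply/seteqP; split => [z Az|z [n _ [/=]]//]; exists (pickle z).
apply: bigcup_measurable => n _.
have [[z [Az zn]]|h] := pselect (exists z : Zd d * Zd d', A (f z) /\ pickle z = n).
  have -> : [set z : Zd d * Zd d' | A (f z) /\ pickle z = n] = [set z.1] `*` [set z.2].
    apply/seteqP; split => [y [_ yn]|[y1 y2] /= [-> ->]]; last by rewrite -surjective_pairing.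
    by have -> : y = z by apply: (pcan_inj (@pickleK (Zd d * Zd d')%type)); rewrite yn zn.
  exact: measurableX.
have -> : [set z : Zd d * Zd d' | A (f z) /\ pickle z = n] = set0 by apply/seteqP; split => // z hz; apply: h; exists z.
exact: measurable0.
Qed.

(** * Convergence of averaged kernels by domination *)

Section averaging.
Context (R : realType) (alpha : R) (alpha02 : 0 < alpha < 2).
Context dW (W : measurableType dW) (nu : {sigma_finite_measure set W -> \bar R}).
Context (d : nat) (H : set (Zd d)).
Local Notation Z := (zeta R H).
Variable f : W * Zd d -> R.
Hypothesis f_Lalpha : f \in Lfun (nu \x Z)%E alpha%:E.
Hypothesis f_abs : abs_sum_finite alpha nu H f.
Local Open Scope ereal_scope.

Let kappa : R := Num.min alpha 1%R.
Let kappa01 : (0 < kappa <= 1)%R.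
Proof. by case/andP: alpha02 => a0 a2; rewrite /kappa lt_min ltr01 a0 ge_min lexx orbT. Qed.

Let alpha0 : (0 < alpha)%R. Proof. by case/andP: alpha02. Qed.

Let mf : measurable_fun setT f.
Proof. by move: f_Lalpha => /sub_Lfun_mfun; rewrite inE. Qed.

Let mfv v : measurable_fun setT (fun w => f (v, w)). Proof. exact: measurable_fun_Zd. Qed.

Lemma Lfun_powR_finite : \int[nu \x Z]_y (`|f y| `^ alpha)%:E < +oo.
Proof.
move: f_Lalpha => /andP[_]; rewrite inE/= /finite_norm => /(poweR_lty alpha).
by rewrite powR_Lnorm ?gt_eqF.
Qed.

Definition abs_sum v : \bar R := \int[Z]_w `|f (v, w)|%:E.

Lemma abs_sum_ge0 v : 0 <= abs_sum v.
Proof. by apply: integral_ge0 => w _; rewrite lee_fin. Qed.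

Lemma measurable_abs_sum : measurable_fun setT abs_sum.
Proof.
apply: (@measurable_fun_fubini_tonelli_F _ _ _ _ _ Z (fun y => `|f y|%:E)).
  by apply/measurable_EFinP; exact: measurableT_comp.
by move=> y; rewrite lee_fin.
Qed.

Lemma integral_abs_sum_finite : \int[nu]_v poweR (abs_sum v) alpha < +oo.
Proof.
move: f_abs; rewrite /abs_sum_finite; congr (_ < _); apply: eq_integral => v _.
by rewrite /abs_sum integral_zeta// => u; rewrite lee_fin.
Qed.

Lemma abs_sum_ae : {ae nu, forall v, abs_sum v < +oo}.
Proof.
have : nu.-integrable setT (fun v => poweR (abs_sum v) alpha).
  apply/integrableP; split.
    by apply: (measurableT_comp (measurable_poweR _)); exact: measurable_abs_sum.
  under eq_integral => v _ do rewrite gee0_abs ?poweR_ge0//.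
  exact: integral_abs_sum_finite.
move=> /(integrable_ae measurableT); apply: filterS => v /(_ I).
rewrite ltey; apply: contraTneq => ->.
by rewrite poweRyr// gt_eqF.
Qed.

Let s v := sumZ H (fun u => f (v, u)).

Lemma measurable_sumZ : measurable_fun setT s.
Proof.
apply: measurable_funB; apply: measurableT_comp; try exact: fine_measurable.
- have := @measurable_fun_fubini_tonelli_F _ _ _ _ _ Z (fun y : W * Zd d => (Num.max (f y) 0%R)%:E).
  rewrite (_ : (fun x => \esum_(u in H) _) = fubini_F Z (fun y : W * Zd d => (Num.max (f y) 0%R)%:E)).
    apply; first by apply/measurable_EFinP; exact: measurable_maxr.
    by move=> y; rewrite lee_fin le_max lexx orbT.
  by apply/funext => v; rewrite /fubini_F integral_zeta// => u; rewrite lee_fin le_max lexx orbT.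
- have := @measurable_fun_fubini_tonelli_F _ _ _ _ _ Z (fun y : W * Zd d => (Num.max (- f y) 0%R)%:E).
  rewrite (_ : (fun x => \esum_(u in H) _) = fubini_F Z (fun y : W * Zd d => (Num.max (- f y) 0%R)%:E)).
    apply; last by move=> y; rewrite lee_fin le_max lexx orbT.
    apply/measurable_EFinP; apply: measurable_maxr => //; exact: measurableT_comp.
  by apply/funext => v; rewrite /fubini_F integral_zeta// => u; rewrite lee_fin le_max lexx orbT.
Qed.

Lemma tail_integralE : tail_integral alpha nu H f = \int[nu]_v (`|s v| `^ alpha)%:E.
Proof.
apply: eq_integral => v _; rewrite -/(s v); congr EFin.
have p0 : (0 `^ alpha = 0)%R by rewrite powR0 ?gt_eqF.
case: (boolP (0 <= s v)%R) => [h|]; last rewrite -ltNge => /ltW h.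
  by rewrite max_l// max_r ?oppr_le0// p0 addr0 ger0_norm.
by rewrite max_r// max_l ?oppr_ge0// p0 add0r ler0_norm.
Qed.

Lemma tail_integral_lty : tail_integral alpha nu H f < +oo.
Proof.
rewrite tail_integralE; apply: le_lt_trans integral_abs_sum_finite.
apply: ge0_le_integral => //.
- apply/measurable_EFinP; apply: (measurableT_comp (f := @powR R ^~ alpha)) => //.
  by apply: measurableT_comp => //; exact: measurable_sumZ.
- by apply: (measurableT_comp (measurable_poweR _)); exact: measurable_abs_sum.
move=> v _; have h := sumZ_norm_le H (fun u => f (v, u)).
rewrite -poweR_EFin; apply: gt0_ler_poweR => //; first exact: ltW.
  by rewrite in_itv/= lee_fin leey normr_ge0.
by rewrite in_itv/= abs_sum_ge0 leey.
Qed.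

Lemma le_integral_zeta (F G : Zd d -> \bar R) : (forall u, 0 <= F u) -> (forall u, 0 <= G u) ->
  (forall u, H u -> F u <= G u) -> \int[Z]_u F u <= \int[Z]_u G u.
Proof. by move=> F0 G0 FG; rewrite !integral_zeta//; exact: le_esum. Qed.

Variables (M : nat -> Zd d -> Zd d -> R) (N : nat -> Zd d -> R) (B : R) (q : nat -> R).
Hypotheses (MB : forall n w u, (0 <= M n w u <= B)%R) (NB : forall n u, (0 <= N n u <= B)%R).
Hypothesis q0 : forall n, (0 <= q n)%R.
Variable b : nat -> W * Zd d -> R.
Hypothesis mb : forall n, measurable_fun setT (b n).
Hypothesis bE : forall n v u, H u -> abs_sum v < +oo ->
  (b n (v, u))%:E = \int[Z]_w (f (v, w) * M n w u)%:E.
Variables (theta : nat -> Zd d -> R) (Theta : R).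
Hypothesis theta0 : forall n w, (0 <= theta n w <= Theta)%R.
Hypothesis theta_cvg : forall w, theta n w @[n --> \oo] --> 0%R.
Hypothesis thetaE : forall n w, H w ->
  (q n)%:E * \int[Z]_u (`|M n w u - N n u| `^ Num.min alpha 1)%:E <= (theta n w)%:E.
Variables (c : nat -> R) (c_ : R).
Hypothesis cE : forall n, (q n)%:E * \int[Z]_u (N n u `^ alpha)%:E = (c n)%:E.
Hypothesis c_cvg : c n @[n --> \oo] --> c_.

Let a v : R := fine (abs_sum v).

(** The part of the error of [kernel_sum_bound] that does not depend on n; multiplied by the bound
    [Theta] it is the dominating function. *)
Let h (y : W * Zd d) : R := 2 * (B * a y.1) `^ (alpha - kappa) * `|f y| `^ kappa.

Let B0 : (0 <= B)%R.
Proof. by case/andP: (NB 0%N 0%R) => ? ?; exact: (@le_trans _ _ (N 0%N 0%R)). Qed.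

Let h0 y : (0 <= h y)%R.
Proof. by rewrite !mulr_ge0 ?powR_ge0. Qed.

Let ma : measurable_fun setT a.
Proof. by apply: measurableT_comp; [exact: fine_measurable|exact: measurable_abs_sum]. Qed.

Let mh : measurable_fun setT h.
Proof.
apply: measurable_funM.
  apply: measurable_funM => //; apply: (measurableT_comp (f := @powR R ^~ (alpha - kappa)%R)) => //.
  by apply: measurable_funM => //; apply: measurableT_comp.
by apply: (measurableT_comp (f := @powR R ^~ kappa)) => //; apply: measurableT_comp.
Qed.

(** For alpha <= 1, h = 2 |f|^alpha is integrable by [f_Lalpha]. For alpha > 1, kappa = 1 and the
    sum of h over w is 2 B^(alpha - 1) times the alpha-th power of the sum of |f|, at almost every
    v, which is integrable by [f_abs]. *)
Let h_finite : \int[nu \x Z]_y (h y)%:E < +oo.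
Proof.
have [a1|a1] := leP alpha 1%R.
  have E y : (h y)%:E = 2%:E * (`|f y| `^ alpha)%:E.
    by rewrite -EFinM /h /kappa min_l// subrr powRr0 mulr1.
  rewrite (eq_integral _ _ (fun y _ => E y)) ge0_integralZl_EFin//.
    by rewrite lte_mul_pinfty// Lfun_powR_finite.
  by apply/measurable_EFinP; apply: (measurableT_comp (f := @powR R ^~ alpha)) => //;
    apply: measurableT_comp.
have k1 : kappa = 1%R by rewrite /kappa min_r// ltW.
have mhE : measurable_fun setT (EFin \o h) by exact/measurable_EFinP.
rewrite (@fubini_tonelli1 _ _ _ _ _ nu Z (EFin \o h) mhE); last by move=> y; rewrite lee_fin.
pose C := (2 * B `^ (alpha - 1))%R.
have C0 : (0 <= C)%R by rewrite mulr_ge0 ?powR_ge0.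
apply: (@le_lt_trans _ _ (\int[nu]_v (C%:E * poweR (abs_sum v) alpha))).
  apply: ge0_le_integral => //.
  - by move=> v _; apply: integral_ge0 => w _; rewrite lee_fin.
  - by apply: (@measurable_fun_fubini_tonelli_F _ _ _ _ _ Z (EFin \o h) mhE) => y; rewrite lee_fin.
  - apply: emeasurable_funM => //; apply: (measurableT_comp (measurable_poweR _)).
    exact: measurable_abs_sum.
  move=> v _; rewrite /fubini_F.
  have E w : (EFin \o h) (v, w) = (2 * (B * a v) `^ (alpha - 1))%:E * `|f (v, w)|%:E.
    by rewrite /= /h k1 powRr1// EFinM.
  rewrite (eq_integral _ _ (fun y _ => E y)) ge0_integralZl_EFin//; last by rewrite mulr_ge0 ?powR_ge0.
  rewrite -/(abs_sum v) powRM//; last by rewrite fine_ge0 ?abs_sum_ge0.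
  have [fin|] := ltP (abs_sum v) +oo; last first.
    (* Where the sum of |f| is infinite, [fine] gives [a v = 0], and h vanishes since alpha - 1 >
       0. *)
    rewrite leye_eq => /eqP e; rewrite /a e /= powR0 ?gt_eqF ?subr_gt0// !mulr0 mul0e.
    by rewrite mule_ge0 ?poweR_ge0// lee_fin.
  have av : abs_sum v = (a v)%:E by rewrite fineK// ge0_fin_numE// abs_sum_ge0.
  have av0 : (0 <= a v)%R by rewrite fine_ge0 ?abs_sum_ge0.
  rewrite av poweR_EFin -!EFinM lee_fin le_eqVlt; apply/orP; left; apply/eqP.
  have -> : (a v `^ alpha = a v `^ (alpha - 1) * a v)%R.
    by rewrite -[X in (_ * X)%R]powRr1// -powRD ?subrK// gt_eqF.
  by rewrite /C; ring.
rewrite ge0_integralZl_EFin//; last 2 first.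
- by move=> v _; exact: poweR_ge0.
- by apply: (measurableT_comp (measurable_poweR _)); exact: measurable_abs_sum.
by rewrite lte_mul_pinfty// ?lee_fin// integral_abs_sum_finite.
Qed.

Let E n := \int[nu \x Z]_y (h y * theta n y.2)%:E.

Let mhtheta n : measurable_fun setT (fun y => (h y * theta n y.2)%:E).
Proof.
apply/measurable_EFinP; apply: measurable_funM => //.
by apply: measurableT_comp => //; exact: measurable_fun_Zd.
Qed.

Let E_cvg : E n @[n --> \oo] --> 0.
Proof.
have := @dominated_convergence _ _ R (nu \x Z) setT measurableT
  (fun n y => (h y * theta n y.2)%:E) (cst 0) (fun y => Theta%:E * (h y)%:E).
case => //.
- by apply: aeW => y _; apply/cvg_EFin; [exact: nearW|rewrite -[X in _ --> X](mulr0 (h y));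
    apply: cvgM; [exact: cvg_cst|exact: theta_cvg]].
- apply: integrableZl => //; apply/integrableP; split; first exact/measurable_EFinP.
  by under eq_integral => y _ do rewrite gee0_abs ?lee_fin//.
- apply: aeW => y n _; rewrite -EFinM gee0_abs ?lee_fin; last first.
    by rewrite mulr_ge0// (andP (theta0 _ _)).1.
  by rewrite mulrC ler_wpM2r// (andP (theta0 _ _)).2.
by move=> _ _; rewrite integral0; apply.
Qed.

Let I n := \int[nu \x Z]_y (`|b n y| `^ alpha)%:E.

Let g n v := \int[Z]_u (`|b n (v, u)| `^ alpha)%:E.

Let e n v := \int[Z]_u (h (v, u) * theta n u)%:E.

(** [kernel_sum_bound] is summed over u for fixed v; exchanging the sums over u and w makes the
    inner sum bounded by theta. The comparison is kept as two one-sided inequalities between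
    extended reals. *)
Let pointwise n v : abs_sum v < +oo ->
  (q n)%:E * g n v <= (c n * `|s v| `^ alpha)%:E + e n v /\
  (c n * `|s v| `^ alpha)%:E <= (q n)%:E * g n v + e n v.
Proof.
move=> fin.
have av : \int[Z]_w `|f (v, w)|%:E = (a v)%:E by rewrite fineK// ge0_fin_numE// abs_sum_ge0.
pose k0 : R := (2 * (B * a v) `^ (alpha - kappa))%R.
have k00 : (0 <= k0)%R by rewrite mulr_ge0 ?powR_ge0.
pose K u := \int[Z]_w (`|f (v, w)| `^ kappa * `|M n w u - N n u| `^ kappa)%:E.
have K0 u : 0 <= K u by apply: integral_ge0 => w _; rewrite lee_fin mulr_ge0 ?powR_ge0.
have bound u : H u -> (`| `|b n (v, u)| `^ alpha - `|s v * N n u| `^ alpha |)%R%:E <= k0%:E * K u.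
  move=> Hu; exact: (kernel_sum_bound alpha02 (fun w => MB n w u) (NB n u) av (bE n Hu fin)).
have sNE u : (`|s v * N n u| `^ alpha = `|s v| `^ alpha * N n u `^ alpha)%R.
  by rewrite normrM powRM// (ger0_norm (andP (NB n u)).1).
have qK : (q n)%:E * \int[Z]_u (k0%:E * K u) <= e n v.
  rewrite ge0_integralZl_EFin//.
  rewrite (@fubini_tonelli _ _ _ _ _ Z Z (fun z => (`|f (v, z.2)| `^ kappa * `|M n z.2 z.1 - N n z.1| `^ kappa)%:E)); last 2 first.
  - exact: measurable_fun_Zd2.
  - by move=> z; rewrite lee_fin mulr_ge0 ?powR_ge0.
  rewrite muleCA -ge0_integralZl_EFin//; last first.
    by move=> w _; apply: integral_ge0 => u _; rewrite lee_fin mulr_ge0 ?powR_ge0.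
  rewrite -ge0_integralZl_EFin//; last first.
    by move=> w _; rewrite mule_ge0 ?lee_fin//; apply: integral_ge0 => u _; rewrite lee_fin mulr_ge0 ?powR_ge0.
  apply: le_integral_zeta.
  - move=> w; rewrite !mule_ge0 ?lee_fin//; apply: integral_ge0 => u _; rewrite lee_fin mulr_ge0 ?powR_ge0//.
  - by move=> w; rewrite lee_fin mulr_ge0// (andP (theta0 _ _)).1.
  move=> w Hw /=.
  under eq_integral => u _ do rewrite EFinM.
  rewrite ge0_integralZl_EFin ?powR_ge0//.
  set J := \int[_]_u _.
  have kf0 : 0 <= (k0 * `|f (v, w)| `^ kappa)%:E by rewrite lee_fin mulr_ge0 ?powR_ge0.
  have := lee_wpmul2l kf0 (thetaE n Hw).
  rewrite -/J -[X in _ <= X]EFinM [X in X * _ <= _ -> _](EFinM k0) -muleA.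
  by rewrite [X in _ * X <= _ -> _]muleCA.
have sNint : (q n)%:E * \int[Z]_u (`|s v * N n u| `^ alpha)%:E = (c n * `|s v| `^ alpha)%:E.
  under eq_integral => u _ do rewrite sNE EFinM.
  rewrite ge0_integralZl_EFin ?powR_ge0//; last by move=> u _; rewrite lee_fin powR_ge0.
  by rewrite muleCA cE -EFinM mulrC.
have kK0 u : 0 <= k0%:E * K u by rewrite mule_ge0 ?lee_fin.
have combine (F G : Zd d -> R) : (forall u, 0 <= F u)%R -> (forall u, 0 <= G u)%R ->
    (forall u, H u -> (F u)%:E <= (G u)%:E + k0%:E * K u) ->
    (q n)%:E * \int[Z]_u (F u)%:E <= (q n)%:E * \int[Z]_u (G u)%:E + e n v.
  move=> F0 G0 FG.
  apply: (@le_trans _ _ ((q n)%:E * \int[Z]_u ((G u)%:E + k0%:E * K u))).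
    apply: lee_wpmul2l; first by rewrite lee_fin.
    by apply: le_integral_zeta => // u; rewrite adde_ge0 ?lee_fin.
  rewrite ge0_integralD//; last by move=> u _; rewrite lee_fin.
  rewrite ge0_muleDr; last 2 first.
  - by apply: integral_ge0 => u _; rewrite lee_fin.
  - exact: integral_ge0.
  exact: leeD2l.
rewrite -sNint; split.
  apply: combine => [u|u|u Hu]; rewrite ?powR_ge0//.
  rewrite addeC -leeBlDr// -EFinB; apply: le_trans (bound u Hu).
  by rewrite lee_fin ler_norm.
apply: combine => [u|u|u Hu]; rewrite ?powR_ge0//.
rewrite addeC -leeBlDr// -EFinB; apply: le_trans (bound u Hu).
by rewrite lee_fin distrC ler_norm.
Qed.

Let mbn n : measurable_fun setT (fun y => (`|b n y| `^ alpha)%:E).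
Proof.
by apply/measurable_EFinP; apply: (measurableT_comp (f := @powR R ^~ alpha)) => //;
  apply: measurableT_comp.
Qed.

Let IE n : I n = \int[nu]_v g n v.
Proof.
by rewrite /I (@fubini_tonelli1 _ _ _ _ _ nu Z _ (mbn n)).
Qed.

Let mg n : measurable_fun setT (g n).
Proof.
by apply: (@measurable_fun_fubini_tonelli_F _ _ _ _ _ Z _ (mbn n)) => y; rewrite lee_fin powR_ge0.
Qed.

Let g0 n v : 0 <= g n v.
Proof. by apply: integral_ge0 => u _; rewrite lee_fin powR_ge0. Qed.

Let htheta0 n y : 0 <= (h y * theta n y.2)%:E.
Proof. by rewrite lee_fin mulr_ge0// (andP (theta0 _ _)).1. Qed.

Let EE n : E n = \int[nu]_v e n v.
Proof. by rewrite /E (@fubini_tonelli1 _ _ _ _ _ nu Z _ (mhtheta n)). Qed.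

Let me n : measurable_fun setT (e n).
Proof. exact: (@measurable_fun_fubini_tonelli_F _ _ _ _ _ Z _ (mhtheta n)). Qed.

Let e0 n v : 0 <= e n v.
Proof. by apply: integral_ge0 => u _; exact: (htheta0 n (v, u)). Qed.

Let c0 n : (0 <= c n)%R.
Proof.
by rewrite -lee_fin -cE mule_ge0 ?lee_fin//; apply: integral_ge0 => u _; rewrite lee_fin powR_ge0.
Qed.

Let msn n : measurable_fun setT (fun v => (c n * `|s v| `^ alpha)%:E).
Proof.
apply/measurable_EFinP; apply: measurable_funM => //.
apply: (measurableT_comp (f := @powR R ^~ alpha)) => //.
by apply: measurableT_comp => //; exact: measurable_sumZ.
Qed.

Let S := tail_integral alpha nu H f.

Let cS n : \int[nu]_v (c n * `|s v| `^ alpha)%:E = (c n)%:E * S.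
Proof.
rewrite /S tail_integralE; under eq_integral => v _ do rewrite EFinM.
rewrite ge0_integralZl_EFin//; apply/measurable_EFinP.
apply: (measurableT_comp (f := @powR R ^~ alpha)) => //.
by apply: measurableT_comp => //; exact: measurable_sumZ.
Qed.

Let upper n : (q n)%:E * I n <= (c n)%:E * S + E n.
Proof.
rewrite IE EE -cS -ge0_integralZl_EFin// -ge0_integralD//; last first.
  by move=> v _; rewrite lee_fin mulr_ge0 ?powR_ge0.
apply: ae_ge0_le_integral => //.
- by move=> v _; rewrite mule_ge0 ?lee_fin.
- exact: emeasurable_funM.
- by move=> v _; rewrite adde_ge0 ?lee_fin ?mulr_ge0 ?powR_ge0.
- exact: emeasurable_funD.
by apply: filterS abs_sum_ae => v vfin _; case: (pointwise n vfin).
Qed.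

Let lower n : (c n)%:E * S <= (q n)%:E * I n + E n.
Proof.
rewrite IE EE -cS -ge0_integralZl_EFin// -ge0_integralD//; last 2 first.
- by move=> v _; rewrite mule_ge0 ?lee_fin.
- exact: emeasurable_funM.
apply: ae_ge0_le_integral => //.
- by move=> v _; rewrite lee_fin mulr_ge0 ?powR_ge0.
- by move=> v _; rewrite adde_ge0 ?mule_ge0 ?lee_fin.
- by apply: emeasurable_funD => //; exact: emeasurable_funM.
by apply: filterS abs_sum_ae => v vfin _; case: (pointwise n vfin).
Qed.

Let Sfin : S \is a fin_num.
Proof. by rewrite ge0_fin_numE ?tail_integral_lty// tail_integral_ge0. Qed.

Let Efin n : E n \is a fin_num.
Proof.
rewrite ge0_fin_numE; last by apply: integral_ge0.
have T0 : (0 <= Theta)%R by case/andP: (theta0 0%N 0%R) => h1 h2; exact: le_trans h2.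
apply: (@le_lt_trans _ _ (\int[nu \x Z]_y (Theta%:E * (h y)%:E))); last first.
  rewrite ge0_integralZl_EFin//; last 2 first.
  - by move=> y _; rewrite lee_fin.
  - exact/measurable_EFinP.
  by rewrite lte_mul_pinfty// ?lee_fin.
apply: ge0_le_integral => //.
- by apply: emeasurable_funM => //; exact/measurable_EFinP.
by move=> y _; rewrite -EFinM lee_fin mulrC ler_wpM2r// (andP (theta0 _ _)).2.
Qed.

Let qI_fin n : (q n)%:E * I n \is a fin_num.
Proof.
rewrite ge0_fin_numE; last first.
  by rewrite mule_ge0 ?lee_fin//; apply: integral_ge0 => y _; rewrite lee_fin powR_ge0.
apply: le_lt_trans (upper n) _.
by rewrite ltey_eq fin_numD Efin fin_numM.
Qed.

Lemma averaging_finite n : (0 < q n)%R -> \int[nu \x Z]_y (`|b n y| `^ alpha)%:E < +oo.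
Proof.
move=> qn; have I0 : 0 <= I n by apply: integral_ge0 => y _; rewrite lee_fin powR_ge0.
rewrite -/(I n) -ge0_fin_numE//.
have -> : I n = (q n)^-1%:E * ((q n)%:E * I n).
  by rewrite muleA -EFinM mulVf ?gt_eqF// mul1e.
by rewrite fin_numM.
Qed.

(** Squeeze: q_n I_n lies between c_n S - E_n and c_n S + E_n, and E_n tends to 0 by dominated
    convergence. *)
Lemma averaging_cvg :
  (q n)%:E * \int[nu \x Z]_y (`|b n y| `^ alpha)%:E @[n --> \oo] --> c_%:E * S.
Proof.
rewrite -(fineK Sfin) -EFinM.
have -> : (fun n => (q n)%:E * \int[nu \x Z]_y (`|b n y| `^ alpha)%:E) =
    EFin \o (fun n => fine ((q n)%:E * I n)).
  by apply/funext => n /=; rewrite fineK.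
apply/cvg_EFin; first exact: nearW.
rewrite -[X in X @ _ --> _]/(fun n => fine ((q n)%:E * I n)).
have cSc : (c n * fine S)%R @[n --> \oo] --> (c_ * fine S)%R by apply: cvgM => //; exact: cvg_cst.
have Ec : (fine (E n))%R @[n --> \oo] --> 0%R.
  by have /fine_cvgP[_] := E_cvg.
have lo : (c n * fine S - fine (E n))%R @[n --> \oo] --> (c_ * fine S)%R.
  by rewrite -[X in _ --> X]subr0; exact: cvgB.
have hi : (c n * fine S + fine (E n))%R @[n --> \oo] --> (c_ * fine S)%R.
  by rewrite -[X in _ --> X]addr0; exact: cvgD.
apply: squeeze_cvgr lo hi; apply: nearW => n; apply/andP; split.
  rewrite lerBlDr -lee_fin EFinD EFinM !fineK//; exact: lower.
rewrite -lee_fin EFinD EFinM !fineK//; exact: upper.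
Qed.

End averaging.

(** * Counting box points in cosets *)

Lemma mx_norm_leP (K : realDomainType) d (x : 'cV[K]_d) (c : K) : 0 <= c ->
  mx_norm x <= c <-> forall i, `|x i 0| <= c.
Proof.
move=> c0; rewrite mx_normrE; split=> [h i|h].
  by apply: le_trans h; exact: (le_bigmax _ (fun ij : 'I_d * 'I_1 => `|x ij.1 ij.2|) (i, 0)).
by apply: bigmax_le => // -[i j] _; rewrite (ord1 j).
Qed.

Section box_enumeration.
Variable d : nat.

(** An explicit enumeration of the box through matrices of ordinals, so that its length is read off
    the cardinality of a matrix type. *)
Definition boxseq (n : nat) : seq (Zd d) :=
  [seq (map_mx (fun i : 'I_(2 * n).+1 => (i : nat)%:Z - n%:Z) A : Zd d) |
     A <- enum 'cV['I_(2 * n).+1]_d].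

Lemma boxseq_uniq n : uniq (boxseq n).
Proof.
rewrite map_inj_uniq ?enum_uniq// => A B AB; apply/matrixP => i j.
have := congr1 (fun M : 'cV[int]_d => M i j) AB; rewrite !mxE => h.
by apply: val_inj => /=; lia.
Qed.

Lemma size_boxseq n : size (boxseq n) = ((2 * n).+1 ^ d)%N.
Proof. by rewrite size_map -cardE card_mx card_ord muln1. Qed.

Lemma mem_boxP (t : Zd d) (n : nat) : box n t <-> forall i, `|t i 0| <= n%:Z.
Proof. exact: mx_norm_leP. Qed.

Lemma mem_boxseq n t : reflect (box n t) (t \in boxseq n).
Proof.
apply: (iffP mapP) => [[A _ ->]|/mem_boxP h].
  by apply/mem_boxP => i; rewrite mxE; case: (A i 0) => k /= kn; rewrite ler_norml; lia.
exists (\col_i inord (absz (t i 0 + n%:Z))); first by rewrite mem_enum.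
apply/matrixP => i j; rewrite !mxE (ord1 j) inordK; have := h i; lia.
Qed.

Lemma boxN n (t : Zd d) : box n (- t) <-> box n t.
Proof. by rewrite /box /= mx_normN. Qed.

Lemma boxD n m (t s : Zd d) : box n t -> box m s -> box (n + m) (t + s).
Proof.
move=> /mem_boxP tn /mem_boxP sm; apply/mem_boxP => i; rewrite mxE.
move: (tn i) (sm i); move: (t i 0) (s i 0) => x y; rewrite !ler_norml.
lia.
Qed.

Lemma box_le n m (t : Zd d) : (n <= m)%N -> box n t -> box m t.
Proof. by move=> nm /mem_boxP h; apply/mem_boxP => i; have := h i; rewrite !ler_norml; lia. Qed.

Lemma box_exists (t : Zd d) : exists n : nat, box n t.
Proof.
exists (\max_i absz (t i (0 : 'I_1)%R))%N; apply/mem_boxP => i.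
by have := @leq_bigmax _ (fun i => absz (t i 0)) i; rewrite ler_norml; lia.
Qed.

Lemma perm_boxseqN n : perm_eq [seq - t | t <- boxseq n] (boxseq n).
Proof.
apply: uniq_perm; [by rewrite map_inj_uniq ?boxseq_uniq//; exact: oppr_inj|exact: boxseq_uniq|].
move=> t; apply/mapP/idP => [[s /mem_boxseq sn ->]|/mem_boxseq tn]; first exact/mem_boxseq/boxN.
by exists (- t); [apply/mem_boxseq/boxN|rewrite opprK].
Qed.

(** The box of radius n and its translate by w both contain the box of radius n - r. *)
Lemma boxseq_shift_diff n (w : Zd d) r : box r w -> (r <= n)%N ->
  (size [seq t <- boxseq n | t \notin [seq (w + t)%R | t <- boxseq n]] <=
   (2 * n).+1 ^ d - (2 * (n - r)).+1 ^ d)%N /\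
  (size [seq t <- [seq (w + t)%R | t <- boxseq n] | t \notin boxseq n] <=
   (2 * n).+1 ^ d - (2 * (n - r)).+1 ^ d)%N.
Proof.
move=> wr rn; pose s2 := [seq (w + t)%R | t <- boxseq n].
have u2 : uniq s2 by rewrite map_inj_uniq ?boxseq_uniq//; exact: addrI.
have sz2 : size s2 = ((2 * n).+1 ^ d)%N by rewrite size_map size_boxseq.
have sub1 t : t \in boxseq (n - r) -> t \in boxseq n.
  by move=> /mem_boxseq h; apply/mem_boxseq; apply: box_le h; rewrite leq_subr.
have sub2 t : t \in boxseq (n - r) -> t \in s2.
  move=> /mem_boxseq h; apply/mapP; exists (t - w); last by rewrite addrC subrK.
  by apply/mem_boxseq; rewrite -(subnK rn); apply: boxD => //; exact/boxN.
have key (s s' : seq (Zd d)) : uniq s -> (forall t, t \in boxseq (n - r) -> t \in s) ->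
    (forall t, t \in boxseq (n - r) -> t \in s') -> size s = ((2 * n).+1 ^ d)%N ->
    (size [seq t <- s | t \notin s'] <= (2 * n).+1 ^ d - (2 * (n - r)).+1 ^ d)%N.
  move=> us hs hs' <-; rewrite -(size_boxseq (n - r)).
  have : (size (boxseq (n - r)) <= size [seq t <- s | t \in s'])%N.
    apply: uniq_leq_size; first exact: boxseq_uniq.
    by move=> t tn; rewrite mem_filter hs' ?hs.
  rewrite !size_filter; have := count_predC (mem s') s.
  rewrite (eq_count (_ : predC (mem s') =1 (fun t => t \notin s'))) => [|t]; last by rewrite !inE.
  rewrite (eq_count (_ : mem s' =1 (fun t => t \in s'))) => [|t]; last by rewrite inE.
  by move=> <- h; rewrite -addnBAC// leq_addl.
by split; apply: key => //; [exact: boxseq_uniq|exact: size_boxseq].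
Qed.

End box_enumeration.

Lemma count_diff (T : eqType) (P : pred T) (s1 s2 : seq T) : uniq s1 ->
  (count P s1 <= count P s2 + count P [seq t <- s1 | t \notin s2])%N.
Proof.
move=> u1.
have e : count P s1 = (count P [seq t <- s1 | t \in s2] + count P [seq t <- s1 | t \notin s2])%N.
  by rewrite -count_cat; apply/esym/permP; rewrite (permEl (perm_filterC (mem s2) s1)).
rewrite e leq_add2r -!size_filter; apply: uniq_leq_size; first by rewrite !filter_uniq.
by move=> t; rewrite !mem_filter => /and3P[-> ->].
Qed.

(** Below e the power is at most e^kappa, and it vanishes off the support; above e, x^(kappa - 1) <=
    e^(kappa - 1). Summed, this bounds a sum of kappa-th powers by the size of the support and the
    l^1 norm, with e free to balance them. *)
Lemma powR_le_threshold (R : realType) (kappa x e : R) : 0 < kappa <= 1 -> 0 <= x -> 0 < e ->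
  x `^ kappa <= e `^ kappa * (x != 0)%:R + e `^ (kappa - 1) * x.
Proof.
move=> /andP[k0 k1] x0 e0; have [->|xn0] := eqVneq x 0.
  by rewrite powR0 ?gt_eqF// !mulr0 addr0.
have xp : 0 < x by rewrite lt_neqAle eq_sym xn0.
rewrite mulr1; have [xe|ex] := leP x e.
  apply: (@le_trans _ _ (e `^ kappa)); last by rewrite lerDl mulr_ge0 ?powR_ge0.
  by apply: ge0_ler_powR => //; rewrite ?nnegrE; exact: ltW.
apply: (@le_trans _ _ (e `^ (kappa - 1) * x)); last by rewrite lerDr powR_ge0.
have -> : x `^ kappa = x `^ (kappa - 1) * x.
  by rewrite -[X in _ * X](powRr1 x0) -powRD ?subrK// xn0 implybT.
rewrite ler_wpM2r// -(opprB 1) !powRN lef_pV2 ?posrE ?powR_gt0//.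
by apply: ge0_ler_powR; rewrite ?nnegrE ?subr_ge0//; exact: ltW.
Qed.

Section transversal_sums.
Context (R : realType) (d : nat) (H : set (Zd d)).
Local Notation Z := (zeta R H).
Local Open Scope ereal_scope.

Lemma eq_integral_zeta (F G : Zd d -> \bar R) : (forall u, H u -> F u = G u) ->
  \int[Z]_u F u = \int[Z]_u G u.
Proof.
move=> FG; rewrite integralE [RHS]integralE !integral_zeta//.
by congr (_ - _); apply: eq_esum => u Hu; rewrite ?funeposE ?funenegE FG.
Qed.

Lemma zeta_set1 u : H u -> Z [set u] = 1.
Proof.
move=> Hu; rewrite /zeta /mrestr /counting.
have -> : [set u] `&` H = [set u] by apply/seteqP; split => [s []//|s ->].
by rewrite asboolT; [rewrite fset_set1 finmap.cardfs1|exact: finite_set1].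
Qed.

Lemma integral_zeta_unique (P : pred (Zd d)) (F : Zd d -> R) u0 :
  H u0 -> (forall u, H u -> P u = (u == u0)) ->
  \int[Z]_u (F u * (P u)%:R)%:E = (F u0)%:E /\
  Z.-integrable setT (fun u => (F u * (P u)%:R)%:E).
Proof.
move=> Hu0 Pu.
have m1 : measurable [set u0] by exact: measurable_Zd.
have int1 : \int[Z]_u (\1_[set u0] u)%:E = 1.
  by rewrite integral_indic// setIT; exact: zeta_set1.
have i1 : Z.-integrable setT (fun u => (\1_[set u0] u)%:E).
  apply/integrableP; split; first exact: measurable_fun_Zd.
  under eq_integral => u _ do rewrite gee0_abs ?lee_fin//.
  by rewrite int1 ltry.
have E u : H u -> (F u * (P u)%:R)%:E = (F u0)%:E * (\1_[set u0] u)%:E.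
  move=> Hu; rewrite Pu// indicE -EFinM; congr EFin.
  have [->|/eqP une] := eqVneq u u0; first by rewrite mem_set.
  by rewrite memNset ?mulr0.
split.
  by rewrite (eq_integral_zeta E) integralZl// int1 mule1.
apply/integrableP; split; first exact: measurable_fun_Zd.
rewrite (@eq_integral_zeta _ (fun u => `|F u0|%:E * (\1_[set u0] u)%:E)).
  by rewrite integralZl// int1 mule1 ltry.
by move=> u Hu; rewrite E// abseM !abse_EFin; congr (_ * _%:E); rewrite ger0_norm.
Qed.

(** Double counting: each t is counted at the single point u = tau t of H. *)
Lemma integral_zeta_count (I : eqType) (s : seq I) (P : I -> pred (Zd d)) (tau : I -> Zd d) (F : Zd d -> R) :
  (forall t, H (tau t)) -> (forall t u, H u -> P t u = (u == tau t)) ->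
  \int[Z]_u (F u * (count (P ^~ u) s)%:R)%:E = (\sum_(t <- s) F (tau t))%:E.
Proof.
move=> Ht Ptau.
have E u : (F u * (count (P ^~ u) s)%:R)%:E = \sum_(t <- s) (F u * (P t u)%:R)%:E.
  rewrite sumEFin -mulr_sumr -natr_sum; congr (_ * _%:R)%:E.
  by rewrite -sum1_count big_mkcond; apply: eq_bigr => t _; case: (P t u).
rewrite (eq_integral _ _ (fun u _ => E u)) integral_sum//; last first.
  by move=> t; have [_] := integral_zeta_unique F (Ht t) (Ptau t).
rewrite -sumEFin; apply: eq_bigr => t _.
by have [-> _] := integral_zeta_unique F (Ht t) (Ptau t).
Qed.

End transversal_sums.

Lemma cvg_invn (R : realType) : (n%:R^-1 : R) @[n --> \oo] --> (0 : R).
Proof. by rewrite -(@cvg_shiftS _ (fun n => n%:R^-1 : R)); exact: cvg_harmonic. Qed.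

Lemma cvg_affine_ratio (R : realType) (d : nat) (a : R) :
  ((2 * n%:R + a) ^+ d / n%:R ^+ d) @[n --> \oo] --> (2 ^+ d : R).
Proof.
have h : (2 + a * n%:R^-1) @[n --> \oo] --> (2 : R).
  rewrite -[X in _ --> X]addr0 -[X in _ --> _ + X](mulr0 a).
  by apply: cvgD; [exact: cvg_cst|apply: cvgM; [exact: cvg_cst|exact: cvg_invn]].
have := continuous_cvg _ (@exprn_continuous R d 2) h.
move=> /(_ _); apply: cvg_trans; apply: near_eq_cvg; near=> n.
have n0 : n%:R != 0 :> R by rewrite pnatr_eq0 -lt0n; near: n; exact: nbhs_infty_gt.
by rewrite -expr_div_n mulrDl mulfK.
Unshelve. all: by end_near. Qed.

Lemma natr_dist_le (R : realType) (a b x y : nat) : (a <= b + x)%N -> (b <= a + y)%N ->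
  `|b%:R - a%:R| <= (x + y)%:R :> R.
Proof.
rewrite -!(ler_nat R) !natrD => h1 h2.
by have := ler0n R x; have := ler0n R y; rewrite ler_norml => ? ?; apply/andP; split; lra.
Qed.

(** * Kernels counting the box points of a coset *)

Section coset_kernel.
Context (R : realType) (d : nat) (H K : set (Zd d)) (proj : Zd d -> Zd d).
Hypotheses (K0 : K 0) (KN : forall t, K t -> K (- t)) (KD : forall s t, K s -> K t -> K (s + t)).
Hypotheses (Hproj : forall t, H (proj t)) (Kproj : forall t, K (t - proj t)).
Hypothesis proj_unique : forall t u, H u -> K (t - u) -> u = proj t.
Variables (D P : nat) (DP : (D + P)%N = d) (P0 : (0 < P)%N).
Local Notation Z := (zeta R H).

Definition coset_count (n : nat) (z : Zd d) : nat := count (fun t => `[<K (z - t)>]) (boxseq d n).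

Variables (B c : R) (c0 : 0 < c).
Hypothesis count_ub : forall n z, (0 < n)%N -> (coset_count n z)%:R <= B * n%:R ^+ D.
Hypothesis count_lb : forall n z, (0 < n)%N -> coset_count n z != 0%N ->
  c * n%:R ^+ D <= (coset_count (2 * n) z)%:R.

Let kernel n (w u : Zd d) : R := (coset_count n (u - w))%:R / n%:R ^+ D.

Lemma coset_kernel_bound n (w u : Zd d) : 0 <= kernel n w u <= B + 1.
Proof.
have B0 : 0 <= B.
  by have := count_ub 0 (ltn0Sn 0); rewrite expr1n mulr1; apply: le_trans; exact: ler0n.
rewrite /kernel divr_ge0 ?exprn_ge0//=; case: n => [|n].
  (* At n = 0 the box is a single point, and 0^D is 1 or 0 according to D, the inverse of 0 being 0.
     The kernel is then at most 1, whence B + 1. *)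
  rewrite expr0n; case: eqP => [_|_]; last by rewrite invr0 mulr0 addr_ge0.
  rewrite divr1 (le_trans (_ : _ <= 1))// ?lerDr//.
  by rewrite (ler_nat _ _ 1) (leq_trans (count_size _ _))// size_boxseq muln0 exp1n.
have n0 : 0 < n.+1%:R ^+ D :> R by rewrite exprn_gt0.
by rewrite ler_pdivrMr// (le_trans (count_ub _ _))// ler_wpM2r ?(ltW n0)// lerDl.
Qed.

Let K_projE t u : H u -> `[<K (u - t)>] = (u == proj t).
Proof.
move=> Hu; apply/asboolP/eqP => [Kut|->]; last by rewrite -opprB; apply: KN.
by apply: proj_unique => //; rewrite -opprB; apply: KN.
Qed.

Local Open Scope ereal_scope.

Lemma sum_coset_count (F : Zd d -> R) (s : seq (Zd d)) :
  \int[Z]_u (F u * (count (fun t => `[<K (u - t)%R>]) s)%:R)%:E = (\sum_(t <- s) F (proj t))%:E.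
Proof. exact: (integral_zeta_count (P := fun t u => `[<K (u - t)%R>]) s F Hproj K_projE). Qed.

Lemma sum_coset_count1 (s : seq (Zd d)) :
  \int[Z]_u ((count (fun t => `[<K (u - t)%R>]) s)%:R)%:E = ((size s)%:R)%:E.
Proof.
have := sum_coset_count (fun=> 1%R) s; under eq_integral do rewrite mul1r.
by move=> ->; rewrite big_const_seq count_predT iter_addr addr0.
Qed.

Lemma coset_count_shift n (w u : Zd d) : coset_count n (u - w)%R =
  count (fun t => `[<K (u - t)%R>]) [seq (w + t)%R | t <- boxseq d n].
Proof. by rewrite count_map; apply: eq_count => t /=; rewrite opprD addrA. Qed.

(** A coset meeting the box of radius n, translated by w, has at least c n^D points in the
    translated box of radius 2 n, which has (4 n + 1)^d <= (5 n)^d points in all. *)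
Let support_le n (w : Zd d) : (0 < n)%N ->
  \int[Z]_u ((coset_count n (u - w)%R != 0%N)%:R)%:E <= (5 ^+ d * n%:R ^+ P / c)%:E.
Proof.
move=> n0; have nR : (0 < n%:R ^+ D :> R)%R by rewrite exprn_gt0// ltr0n.
apply: (@le_trans _ _ (\int[Z]_u ((c * n%:R ^+ D)^-1%:E * (coset_count (2 * n) (u - w)%R)%:R%:E))).
  apply: ge0_le_integral => // u _.
  rewrite -EFinM lee_fin; case: eqP => [|/eqP] h; first by rewrite mulr_ge0// invr_ge0 mulr_ge0// ltW.
  by rewrite mulrC ler_pdivlMr ?mulr_gt0// mul1r; exact: count_lb.
rewrite ge0_integralZl_EFin//; last by rewrite invr_ge0 mulr_ge0// ltW.
under eq_integral do rewrite coset_count_shift.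
rewrite sum_coset_count1 size_map size_boxseq -EFinM lee_fin.
have dE : (n%:R ^+ d = n%:R ^+ D * n%:R ^+ P :> R)%R by rewrite -exprD DP.
rewrite mulrC ler_pdivrMr ?mulr_gt0//.
have -> : (5 ^+ d * n%:R ^+ P / c * (c * n%:R ^+ D) = (5 * n%:R) ^+ d)%R.
  by rewrite exprMn dE; field; rewrite gt_eqF.
by rewrite natrX lerXn2r ?nnegrE// -natrM ler_nat; lia.
Qed.

(** Size of the symmetric difference of the box and its translate by w, relative to n^d. *)
Let delta n (w : Zd d) : R := ((size [seq t <- boxseq d n | t \notin [seq (w + t)%R | t <- boxseq d n]] +
  size [seq t <- [seq (w + t)%R | t <- boxseq d n] | t \notin boxseq d n])%:R / n%:R ^+ d)%R.

Let delta_le n w : (0 < n)%N -> (delta n w <= 2 * 3 ^+ d)%R.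
Proof.
move=> n0; rewrite /delta ler_pdivrMr ?exprn_gt0 ?ltr0n//.
apply: (@le_trans _ _ ((2 * (2 * n).+1 ^ d)%:R)).
  rewrite ler_nat mul2n -addnn; apply: leq_add; rewrite size_filter (leq_trans (count_size _ _))//.
    by rewrite size_boxseq.
  by rewrite size_map size_boxseq.
rewrite natrM -mulrA ler_wpM2l// -exprMn natrX lerXn2r ?nnegrE ?mulr_ge0//.
by rewrite -natrM ler_nat; lia.
Qed.

Let delta_ge0 n w : (0 <= delta n w)%R. Proof. by rewrite divr_ge0// exprn_ge0. Qed.

Let delta_cvg w : delta n w @[n --> \oo] --> 0%R.
Proof.
have [r wr] := box_exists w.
have h : (2 * ((2 * n%:R + 1) ^+ d / n%:R ^+ d - (2 * n%:R + (1 - 2 * r%:R)) ^+ d / n%:R ^+ d))%R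
    @[n --> \oo] --> (0 : R)%R.
  have e0 : (2 * (2 ^+ d - 2 ^+ d) = 0 :> R)%R by rewrite subrr mulr0.
  rewrite -e0.
  by apply: cvgM; [exact: cvg_cst|apply: cvgB; exact: cvg_affine_ratio].
apply: (squeeze_cvgr _ (cvg_cst (0 : R)%R) h); near=> n.
rewrite delta_ge0/= /delta -mulrBl mulrA ler_wpM2r ?invr_ge0 ?exprn_ge0//.
have rn : (r <= n)%N by near: n; exact: nbhs_infty_ge.
have [h1 h2] := boxseq_shift_diff wr rn.
have := leq_add h1 h2; rewrite -(ler_nat R) => /le_trans; apply.
have d0 : (0 < d)%N by rewrite -DP addn_gt0 P0 orbT.
rewrite addnn -mul2n natrM ler_wpM2l// natrB; last by rewrite leq_exp2r//; lia.
have e1 : ((2 * n).+1%:R = 2 * n%:R + 1 :> R)%R by rewrite -natr1 natrM.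
have e2 : ((2 * (n - r)).+1%:R = 2 * n%:R + (1 - 2 * r%:R) :> R)%R.
  by rewrite -natr1 natrM natrB//; ring.
by rewrite !natrX e1 e2.
Unshelve. all: by end_near. Qed.

Variables (alpha : R) (alpha02 : (0 < alpha < 2)%R).
Let kappa : R := Num.min alpha 1%R.

Let theta n w : R := fine ((n%:R ^- P)%:E * \int[Z]_u (`|kernel n w u - kernel n 0 u| `^ kappa)%:E).

(** [powR_le_threshold] for the difference of the two kernels: its support consists of cosets met by
    the box or by its translate, counted by [support_le], and its l^1 norm is at most the normalized
    size of the symmetric difference. *)
Let theta_bound n w e : (0 < n)%N -> (0 < e)%R ->
  (n%:R ^- P)%:E * \int[Z]_u (`|kernel n w u - kernel n 0 u| `^ kappa)%:E <=
  (e `^ kappa * (2 * (5 ^+ d / c)) + e `^ (kappa - 1) * delta n w)%:E.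
Proof.
move=> n0 e0; have nD : (0 < n%:R ^+ D :> R)%R by rewrite exprn_gt0// ltr0n.
have k01 : (0 < kappa <= 1)%R.
  by case/andP: alpha02 => a0 a2; rewrite /kappa lt_min ltr01 a0 ge_min lexx orbT.
pose s1 := boxseq d n; pose s2 := [seq (w + t)%R | t <- boxseq d n].
have u1 : uniq s1 by exact: boxseq_uniq.
have u2 : uniq s2 by rewrite map_inj_uniq//; exact: addrI.
pose s12 := [seq t <- s1 | t \notin s2] ++ [seq t <- s2 | t \notin s1].
pose cnt u : nat := count (fun t => `[<K (u - t)%R>]) s12.
pose I w u : R := (coset_count n (u - w)%R != 0%N)%:R.
have I0 w' u : (0 <= I w' u)%R by exact: ler0n.
have ek : (0 <= e `^ (kappa - 1) / n%:R ^+ D)%R by rewrite divr_ge0 ?powR_ge0 ?ltW.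
have ptw u : (`|kernel n w u - kernel n 0 u| `^ kappa <=
    e `^ kappa * (I w u + I 0 u) + e `^ (kappa - 1) / n%:R ^+ D * (cnt u)%:R)%R.
  have dist : (`|kernel n w u - kernel n 0 u| <= (cnt u)%:R / n%:R ^+ D)%R.
    rewrite /kernel -mulrBl normrM [X in (_ * X)%R]ger0_norm ?invr_ge0 ?(ltW nD)//.
    rewrite ler_wpM2r ?invr_ge0 ?(ltW nD)// !coset_count_shift.
    have -> : [seq (0 + t)%R | t <- boxseq d n] = s1.
      by rewrite -[RHS]map_id; apply: eq_map => t; rewrite add0r.
    have h1 := count_diff (fun t => `[<K (u - t)%R>]) s2 u1.
    have h2 := count_diff (fun t => `[<K (u - t)%R>]) s1 u2.
    by rewrite -/s2 /cnt count_cat; exact: natr_dist_le.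
  apply: le_trans (powR_le_threshold k01 (normr_ge0 _) e0) _.
  apply: lerD.
    rewrite ler_wpM2l ?powR_ge0// -natrD ler_nat normr_eq0 /kernel.
    case: (coset_count n (u - w)%R =P 0%N) => [->|_]; last by case: eqP.
    case: (coset_count n (u - 0)%R =P 0%N) => [->|_]; last by case: eqP.
    by rewrite subrr eqxx.
  by rewrite -mulrA [X in (_ <= _ * X)%R]mulrC ler_wpM2l ?powR_ge0.
have IE w' : \int[Z]_u (I w' u)%:E <= (5 ^+ d * n%:R ^+ P / c)%:E by exact: support_le.
apply: (@le_trans _ _ ((n%:R ^- P)%:E * (\int[Z]_u ((e `^ kappa)%:E * ((I w u)%:E + (I 0%R u)%:E) +
    (e `^ (kappa - 1) / n%:R ^+ D)%:E * ((cnt u)%:R)%:E)))).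
  apply: lee_wpmul2l; first by rewrite lee_fin invr_ge0 exprn_ge0.
  apply: le_integral_zeta => [u|u|u _].
  - by rewrite lee_fin powR_ge0.
  - by apply: adde_ge0; apply: mule_ge0; rewrite -?EFinD ?lee_fin ?powR_ge0 ?addr_ge0.
  - by have := ptw u; rewrite -lee_fin [X in _ <= X]EFinD (EFinM (e `^ kappa)) (EFinM (e `^ (kappa - 1) / n%:R ^+ D)) (EFinD (I w u)).
rewrite ge0_integralD//; last 2 first.
- by move=> u _; apply: mule_ge0; rewrite -?EFinD lee_fin ?powR_ge0 ?addr_ge0.
- by move=> u _; apply: mule_ge0; rewrite lee_fin.
rewrite ge0_integralZl_EFin ?powR_ge0//; last by move=> u _; rewrite -EFinD lee_fin addr_ge0.
rewrite ge0_integralD//; last 2 first.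
- by move=> u _; rewrite lee_fin.
- by move=> u _; rewrite lee_fin.
rewrite ge0_integralZl_EFin// sum_coset_count1 -EFinM.
have nP : (0 < n%:R ^+ P :> R)%R by rewrite exprn_gt0// ltr0n.
apply: (@le_trans _ _ ((n%:R ^- P)%:E * ((e `^ kappa)%:E * ((5 ^+ d * n%:R ^+ P / c)%:E + (5 ^+ d * n%:R ^+ P / c)%:E) +
   (e `^ (kappa - 1) / n%:R ^+ D * (size s12)%:R)%:E))).
  apply: lee_wpmul2l; first by rewrite lee_fin invr_ge0 ltW.
  apply: leeD2r; apply: lee_wpmul2l; first by rewrite lee_fin powR_ge0.
  by apply: leeD; exact: IE.
set x := (5 ^+ d * _ / c)%R; set y := (_ / _ * _%:R)%R.
have -> : (n%:R ^- P)%:E * ((e `^ kappa)%:E * (x%:E + x%:E) + y%:E) =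
    (n%:R ^- P * (e `^ kappa * (x + x) + y))%:E by [].
rewrite lee_fin /x /y /delta -/s1 -/s2 -size_cat -/s12 le_eqVlt; apply/orP; left; apply/eqP.
have dE : (n%:R ^+ d = n%:R ^+ D * n%:R ^+ P :> R)%R by rewrite -exprD DP.
by rewrite dE; field; rewrite (gt_eqF nP) (gt_eqF nD) (gt_eqF c0).
Qed.

Let theta_fin n w : (n%:R ^- P)%:E * \int[Z]_u (`|kernel n w u - kernel n 0 u| `^ kappa)%:E \is a fin_num.
Proof.
case: n => [|n]; first by rewrite expr0n gtn_eqF// invr0 mul0e.
rewrite ge0_fin_numE; last first.
  rewrite mule_ge0 ?lee_fin ?invr_ge0 ?exprn_ge0//; apply: integral_ge0 => u _.
  by rewrite lee_fin powR_ge0.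
exact: le_lt_trans (theta_bound w (ltn0Sn n) ltr01) (ltry _).
Qed.

Let theta_ge0 n w : (0 <= theta n w)%R.
Proof.
apply: fine_ge0; rewrite mule_ge0 ?lee_fin ?invr_ge0 ?exprn_ge0//; apply: integral_ge0 => u _.
by rewrite lee_fin powR_ge0.
Qed.

Let theta_le n w (e : R) : (0 < n)%N -> (0 < e)%R ->
  (theta n w <= e `^ kappa * (2 * (5 ^+ d / c)) + e `^ (kappa - 1) * delta n w)%R.
Proof. by move=> n0 e0; rewrite -lee_fin /theta fineK//; exact: theta_bound. Qed.

Let Theta : R := (2 * (5 ^+ d / c) + 2 * 3 ^+ d)%R.

Let theta_bounded n w : (0 <= theta n w <= Theta)%R.
Proof.
rewrite theta_ge0 /=; case: n => [|n].
  by rewrite /theta expr0n gtn_eqF// invr0 mul0e addr_ge0// mulr_ge0 ?exprn_ge0// divr_ge0 ?exprn_ge0 ?ltW.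
apply: le_trans (theta_le w (ltn0Sn n) ltr01) _.
by rewrite !powR1 !mul1r lerD2l delta_le.
Qed.

Let theta_cvg w : theta n w @[n --> \oo] --> 0%R.
Proof.
have k0 : (0 < kappa)%R by case/andP: alpha02 => a0 _; rewrite /kappa lt_min ltr01 a0.
apply/cvgrPdist_le => tau tau0.
pose L : R := (2 * (5 ^+ d / c))%R.
have L0 : (0 < L)%R by rewrite mulr_gt0// divr_gt0// exprn_gt0.
(* This e makes the support term equal to tau / 2 whatever n is; the other term tends to 0 because e
   is fixed. *)
pose e : R := ((tau / 2 / L) `^ kappa^-1)%R.
have e0 : (0 < e)%R by rewrite powR_gt0// !divr_gt0.
have eL : (e `^ kappa * L = tau / 2)%R.
  by rewrite -powRrM mulVf ?gt_eqF// powRr1 ?divfK ?gt_eqF// ltW// !divr_gt0.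
have dw : (e `^ (kappa - 1) * delta n w)%R @[n --> \oo] --> (0 : R)%R.
  by rewrite -(mulr0 (e `^ (kappa - 1))%R); apply: cvgM; [exact: cvg_cst|exact: delta_cvg].
have t20 : (0 < tau / 2)%R by rewrite divr_gt0.
have dle := cvgr_near_le dw t20.
near=> n; rewrite sub0r normrN ger0_norm//.
have n0 : (0 < n)%N by near: n; exact: nbhs_infty_gt.
apply: le_trans (theta_le w n0 e0) _.
rewrite -/L eL [leRHS](splitr tau) lerD2l.
by near: n; exact: dle.
Unshelve. all: by end_near. Qed.

Section averaging_cosets.
Context dW (W : measurableType dW) (nu : {sigma_finite_measure set W -> \bar R}).
Variable f : W * Zd d -> R.
Hypothesis f_Lalpha : f \in Lfun (nu \x Z) alpha%:E.
Hypothesis f_abs : abs_sum_finite alpha nu H f.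
Variables (b : nat -> W * Zd d -> R) (mb : forall n, measurable_fun setT (b n)).
Hypothesis bE : forall n v u, H u ->
  b n (v, u) = (n%:R ^- D * \sum_(t <- boxseq d n) f (v, proj (u - t)%R))%R.
Variables (a : nat -> R) (a_ : R).
Hypothesis aE : forall n, (n%:R ^- P)%:E *
  \int[Z]_u (((coset_count n u)%:R / n%:R ^+ D) `^ alpha)%:E = (a n)%:E.
Hypothesis a_cvg : a n @[n --> \oo] --> a_.

Let kernel0 n u : kernel n 0%R u = ((coset_count n u)%:R / n%:R ^+ D)%R.
Proof. by rewrite /kernel subr0. Qed.

(** Double counting again: w = proj (u - t) exactly when u - w - t lies in K, and the kernel counts
    the box points t with this property. *)
Let bE' n v u : H u -> abs_sum H f v < +oo ->
  (b n (v, u))%:E = \int[Z]_w (f (v, w) * kernel n w u)%:E.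
Proof.
move=> Hu _; rewrite bE// mulr_sumr.
have := sum_coset_count (fun w => (n%:R ^- D * f (v, w))%R) [seq (u - t)%R | t <- boxseq d n].
rewrite big_map => <-; apply: eq_integral => w _; congr EFin.
suff -> : count (fun t => `[<K (w - t)%R>]) [seq (u - t)%R | t <- boxseq d n] = coset_count n (u - w)%R.
  by rewrite /kernel -mulrA mulrC -mulrA.
rewrite count_map; apply: eq_count => t /=.
have eK : (- (u - w - t) = w - (u - t))%R by rewrite !opprB addrCA.
apply/asboolP/asboolP => h.
  by rewrite -[X in K X]opprK eK; apply: KN.
by rewrite -eK; apply: KN.
Qed.

Let a0E n : (n%:R ^- P)%:E * \int[Z]_u (kernel n 0 u `^ alpha)%:E = (a n)%:E.
Proof. by under eq_integral do rewrite kernel0. Qed.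

Let q0 n : (0 <= n%:R ^- P :> R)%R. Proof. by rewrite invr_ge0 exprn_ge0. Qed.

Let thetaE n w : H w -> (n%:R ^- P)%:E *
  \int[Z]_u (`|kernel n w u - kernel n 0 u| `^ Num.min alpha 1)%:E <= (theta n w)%:E.
Proof. by move=> _; rewrite /theta fineK. Qed.

Lemma coset_averaging_finite n : (0 < n)%N ->
  \int[nu \x Z]_y (`|b n y| `^ alpha)%:E < +oo.
Proof.
move=> n0; apply: (averaging_finite alpha02 f_Lalpha f_abs coset_kernel_bound
  (fun n => coset_kernel_bound n 0%R) q0 mb bE' theta_bounded thetaE a0E).
by rewrite invr_gt0 exprn_gt0// ltr0n.
Qed.

Lemma coset_averaging_cvg :
  (n%:R ^- P)%:E * \int[nu \x Z]_y (`|b n y| `^ alpha)%:E @[n --> \oo] -->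
  a_%:E * tail_integral alpha nu H f.
Proof.
exact: (averaging_cvg alpha02 f_Lalpha f_abs coset_kernel_bound
  (fun n => coset_kernel_bound n 0%R) q0 mb bE' theta_bounded theta_cvg thetaE a0E a_cvg).
Qed.

End averaging_cosets.

End coset_kernel.

(** * Convergence of the laws of box sums *)

Section M0_convergence.
Context (R : realType).
Local Open Scope ereal_scope.

Lemma integral_emscale d (T : measurableType d) (m : {measure set T -> \bar R})
    (k : R) (k0 : 0 <= k%:E) (g : T -> R) : measurable_fun setT g ->
  \int[m]_x `|g x|%:E < +oo ->
  \int[emscale k%:E m k0]_x (g x)%:E = k%:E * \int[m]_x (g x)%:E.
Proof.
move=> mg gfin; have k0' : (0 <= k)%R by rewrite -lee_fin.
have ge0 (h : T -> \bar R) : measurable_fun setT h -> (forall x, 0 <= h x) ->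
    \int[emscale k%:E m k0]_x h x = k%:E * \int[m]_x h x.
  move=> mh h0.
  transitivity (\int[mscale (NngNum k0') m]_x h x).
    by apply: eq_measure_integral => A mA _; rewrite /= /mscale /emscale.
  by apply: ge0_integral_mscale => // x _; exact: h0.
have mE : measurable_fun setT (EFin \o g) by exact/measurable_EFinP.
have h : \int[m]_x (EFin \o g)^\- x < +oo.
  apply: le_lt_trans gfin; apply: ge0_le_integral => //.
  - exact: measurable_funeneg.
  - by apply/measurable_EFinP; exact: measurableT_comp.
  by move=> x _; rewrite funenegE /= -EFin_max lee_fin ge_max normr_ge0 andbT -normrN ler_norm.
have fp := ge0 _ (measurable_funepos mE) (funepos_ge0 (EFin \o g)).
have fn := ge0 _ (measurable_funeneg mE) (funeneg_ge0 (EFin \o g)).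
rewrite [LHS]integralE [X in _ = _ * X]integralE.
transitivity (k%:E * \int[m]_x (EFin \o g)^\+ x - k%:E * \int[m]_x (EFin \o g)^\- x).
  by rewrite -fp -fn.
rewrite -muleBr// fin_num_adde_defl// fin_numN ge0_fin_numE//.
by apply: integral_ge0 => x _; exact: funeneg_ge0.
Qed.

Lemma integral_distribution_bounded d (T : measurableType d) (P : probability T R)
    (Y : {RV P >-> R}) (g : R -> R) (K : R) : measurable_fun setT g ->
  (forall x, `|g x| <= K)%R ->
  \int[distribution P Y]_x (g x)%:E = \int[P]_w (g (Y w))%:E /\
  \int[distribution P Y]_x `|g x|%:E < +oo.
Proof.
move=> mg gK.
have mY : measurable_fun setT (fun w => g (Y w)) by apply: measurableT_comp.
have fin : \int[P]_w `|g (Y w)|%:E < +oo.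
  apply: (@le_lt_trans _ _ (\int[P]_w K%:E)).
    apply: ge0_le_integral => //.
    - by apply/measurable_EFinP; exact: measurableT_comp.
    - by move=> w _; rewrite lee_fin.
  by rewrite integral_cst// [X in _ * X]probability_setT mule1 ltry.
split.
  rewrite (@integral_distribution _ _ _ _ _ P Y (EFin \o g))//; first exact/measurable_EFinP.
  by apply/integrableP; split; [exact/measurable_EFinP|].
rewrite (@ge0_integral_distribution _ _ _ _ _ P Y (fun x => `|g x|%:E))//.
by apply/measurable_EFinP; exact: measurableT_comp.
Qed.

Lemma integral_nu_alpha_finite alpha (nua : {measure set R -> \bar R}) (g : R -> R) (K : R) :
  is_nu_alpha alpha nua -> measurable_fun setT g -> (forall x, `|g x| <= K)%R ->
  (\forall x \near (0 : R)%R, g x = 0%R) -> \int[nua]_x `|g x|%:E < +oo.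
Proof.
move=> hnua mg gK g0; have [n0 nr] := hnua.
have [e e0 ge] : exists2 e : R, (0 < e)%R & forall x, (`|x| <= e)%R -> g x = 0%R.
  move: g0 => /nbhs_ballP[e /= e0 eG]; exists (e / 2)%R; first by rewrite divr_gt0.
  move=> x xe; apply: eG; rewrite /ball/= sub0r normrN (le_lt_trans xe)//.
  by rewrite ltr_pdivrMr// ltr_pMr// ltr1n.
have K0 : (0 <= K)%R by exact: le_trans (gK 0%R).
pose A : set R := `]-oo, (- e)%R[%classic `|` `]e, +oo[%classic.
have mA : measurable A by exact: measurableU.
apply: (@le_lt_trans _ _ (\int[nua]_x (K%:E * (\1_A x)%:E))).
  apply: ge0_le_integral => //.
  - by apply/measurable_EFinP; exact: measurableT_comp.
  - by apply: emeasurable_funM => //; apply/measurable_EFinP/measurable_indic.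
  move=> x _; rewrite indicE; case: (boolP (x \in A)) => [_|].
    by rewrite mule1 lee_fin.
  rewrite notin_setE /A /= !in_itv/= andbT => /not_orP[/negP h1 /negP h2].
  rewrite mule0 ge ?normr0// ler_norml; rewrite -!leNgt in h1 h2; apply/andP; split => //.
rewrite ge0_integralZl_EFin//; last by apply/measurable_EFinP/measurable_indic.
rewrite integral_indic// setIT lte_mul_pinfty//.
apply: le_lt_trans (measureU2 _ _ _) _ => //.
by rewrite [X in (X + _)](nr e e0).2 [X in (_ + X)](nr e e0).1 -EFinD ltry.
Qed.

Lemma in_M0_emscale (c : \bar R) (c0 : 0 <= c) (m : {measure set R -> \bar R}) :
  c < +oo -> (forall e : R, (0 < e)%R -> m [set x | (e <= `|x|)%R] < +oo) ->
  in_M0 (emscale c m c0).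
Proof.
move=> cfin mfin e e0; rewrite /emscale/=.
by apply: lte_mul_pinfty; [|rewrite ge0_fin_numE|exact: mfin].
Qed.

Lemma nu_alpha_in_M0 alpha (nua : {measure set R -> \bar R}) : is_nu_alpha alpha nua ->
  forall e : R, (0 < e)%R -> nua [set x | (e <= `|x|)%R] < +oo.
Proof.
move=> [n0 nr] e e0; have e20 : (0 < e / 2)%R by rewrite divr_gt0.
apply: (@le_lt_trans _ _ (nua (`](e / 2)%R, +oo[%classic `|` `]-oo, (- (e / 2))%R[%classic))).
  apply: le_measure; rewrite ?inE.
  - have -> : [set x : R | (e <= `|x|)%R] = (fun x : R => `|x|%R) @^-1` `[e, +oo[%classic.
      by apply/seteqP; split => x /=; rewrite in_itv/= andbT.
    by rewrite -[X in measurable X]setTI; apply: (@normr_measurable R setT) => //; exact: measurable_itv.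
  - exact: measurableU.
  move=> x /= ex; rewrite !in_itv/= andbT ltrNr.
  have : (e / 2 < `|x|)%R by rewrite (lt_le_trans _ ex)// ltr_pdivrMr// ltr_pMr// ltr1n.
  by rewrite lter_normr => /orP[]; [left|right].
apply: le_lt_trans (measureU2 _ _ _) _ => //.
by rewrite [X in (X + _)](nr _ e20).1 [X in (_ + X)](nr _ e20).2 -EFinD ltry.
Qed.

Lemma partial_sumE d dO (Omega : measurableType dO) (P : probability Omega R)
    (X : Zd d -> {RV P >-> R}) n w :
  (partial_sum X n : Omega -> R) w = (\sum_(t <- boxseq d n) X t w)%R.
Proof.
rewrite /partial_sum.
have -> : @box d n = [set` boxseq d n] by apply/seteqP; split => t /mem_boxseq.
by rewrite -fsbig_seq ?boxseq_uniq//; exact: (mfun_sum (boxseq d n) predT (fun t => X t : {mfun Omega >-> R})).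
Qed.

(** A change of variables under the law of the scaled sum reduces the convergence of measures to a
    limit of scaled expectations. *)
Lemma M0_cvg_of_limit d dO (Omega : measurableType dO) (P : probability Omega R)
    (X : Zd d -> {RV P >-> R}) alpha (nua : {measure set R -> \bar R})
    (gamma b : nat -> R) (p : nat) (C : \bar R) (C0 : 0 <= C) :
  is_nu_alpha alpha nua -> C < +oo ->
  (forall G : R -> R, continuous G -> (exists K : R, forall x, `|G x| <= K)%R ->
    (\forall x \near (0 : R)%R, G x = 0%R) ->
    (gamma n `^ alpha / n%:R ^+ p)%:E * \int[P]_w (G (b n * \sum_(t <- boxseq d n) X t w)%R)%:E
      @[n --> \oo] --> C * \int[nua]_x (G x)%:E) ->
  M0_cvg (fun n => emscale (rate alpha (gamma n) p n)
      (distribution P (b n *: partial_sum X n)) (rate_ge0 alpha (gamma n) p n))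
    (emscale C nua C0).
Proof.
move=> hnua Cfin lim; split.
- move=> n; apply: in_M0_emscale; first exact: ltry.
  move=> e e0; apply: le_lt_trans (probability_le1 _ _) (ltry _).
  have -> : [set x : R | (e <= `|x|)%R] = (fun x : R => `|x|%R) @^-1` `[e, +oo[%classic.
    by apply/seteqP; split => x /=; rewrite in_itv/= andbT.
  by rewrite -[X in measurable X]setTI; apply: (@normr_measurable R setT) => //; exact: measurable_itv.
- by apply: in_M0_emscale => //; exact: nu_alpha_in_M0 hnua.
move=> g cg [K gK] g0; have mg := continuous_measurable_fun cg.
have Cf : C \is a fin_num by rewrite ge0_fin_numE.
have := lim g cg (ex_intro _ K gK) g0.
have -> : \int[emscale C nua C0]_x (g x)%:E = C * \int[nua]_x (g x)%:E.
  move: (C0); rewrite -(fineK Cf) => C0'.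
  by rewrite integral_emscale//; exact: integral_nu_alpha_finite hnua mg gK g0.
apply: cvg_trans; apply: near_eq_cvg; apply: nearW => n.
have [h1 h2] := @integral_distribution_bounded _ _ P (b n *: partial_sum X n) g K mg gK.
rewrite /rate integral_emscale// h1; congr (_ * _); apply: eq_integral => w _.
by congr (g _)%:E; rewrite -partial_sumE.
Qed.

End M0_convergence.

Lemma cvg_succ (R : realType) (u : nat -> R) (l : R) :
  u n @[n --> \oo] --> l -> u n.+1 @[n --> \oo] --> l.
Proof. by move=> h; rewrite -(cvg_shiftS u) in h. Qed.

(** * Box sums of a series indexed modulo a subgroup *)

Section coset_sums.
Context (R : realType) (d : nat) (H K : set (Zd d)) (proj : Zd d -> Zd d).
Hypotheses (K0 : K 0) (KN : forall t, K t -> K (- t)) (KD : forall s t, K s -> K t -> K (s + t)).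
Hypotheses (Hproj : forall t, H (proj t)) (Kproj : forall t, K (t - proj t)).
Hypothesis proj_unique : forall t u, H u -> K (t - u) -> u = proj t.
Variables (D P : nat) (DP : (D + P)%N = d) (P0 : (0 < P)%N).
Variables (B c : R) (c0 : 0 < c).
Hypothesis count_ub : forall n z, (0 < n)%N -> (coset_count K n z)%:R <= B * n%:R ^+ D.
Hypothesis count_lb : forall n z, (0 < n)%N -> coset_count K n z != 0%N ->
  c * n%:R ^+ D <= (coset_count K (2 * n) z)%:R.
Variables (alpha : R) (alpha02 : 0 < alpha < 2).
Variable (nua : {sigma_finite_measure set R -> \bar R}).
Hypothesis hnua : is_nu_alpha alpha nua.
Context dW (W : measurableType dW) (nu : {sigma_finite_measure set W -> \bar R}).
Local Notation Z := (zeta R H).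
Variable f : W * Zd d -> R.
Hypothesis f_Lalpha : f \in Lfun (nu \x Z)%E alpha%:E.
Hypothesis f_abs : abs_sum_finite alpha nu H f.
Variables (a : nat -> R) (a_ : R).
Hypothesis aE : forall n, ((n%:R ^- P)%:E *
  \int[Z]_u (((coset_count K n u)%:R / n%:R ^+ D) `^ alpha)%:E = (a n)%:E)%E.
Hypothesis a_cvg : a n @[n --> \oo] --> a_.
Context dO (Omega : measurableType dO) (Pr : probability Omega R).
Variables (xi : nat -> Omega -> R * W * Zd d).
Hypothesis PRM : poisson_random_measure Pr xi ((nua \x nu) \x Z)%E.
Variable X : Zd d -> {RV Pr >-> R}.
Hypothesis XE : forall t, series_in_prob Pr
  (fun i w => (xi i w).1.1 * f ((xi i w).1.2, proj ((xi i w).2 - t))) (X t).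
Variables (gamma : nat -> R) (gamma0 : forall n, 0 < gamma n).
Hypothesis gamma_large : n%:R `^ (P%:R / alpha) / gamma n @[n --> \oo] --> 0.

Let alpha0 : 0 < alpha. Proof. by case/andP: alpha02. Qed.

Let mf : measurable_fun setT f.
Proof. by move: f_Lalpha => /sub_Lfun_mfun; rewrite inE. Qed.

Let ft t (y : W * Zd d) : R := f (y.1, proj (y.2 - t)).

Let mft t : measurable_fun setT (ft t).
Proof.
apply: measurableT_comp => //; apply: measurable_fun_pair => //.
by apply: (measurableT_comp (f := fun u : Zd d => proj (u - t))) => //.
Qed.

Let proj_shiftK s u : H u -> proj (proj (u - s) + s) = u.
Proof.
move=> Hu; apply/esym/proj_unique => //.
have := KN (Kproj (u - s)); congr K.
by rewrite opprB opprB addrA.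
Qed.

Let proj_shiftK' s u : H u -> proj (proj (u + s) - s) = u.
Proof. by move=> Hu; have := proj_shiftK (- s) Hu; rewrite opprK. Qed.

Let shift_bij t : set_bij H H (fun u => proj (u - t)).
Proof.
split; first by move=> u Hu; exact: Hproj.
- by move=> u v; rewrite !inE => Hu Hv /(congr1 (fun z => proj (z + t))); rewrite !proj_shiftK.
by move=> u Hu; exists (proj (u + t)); [exact: Hproj|exact: proj_shiftK'].
Qed.

Local Open Scope ereal_scope.

Let powR_meas (g : W * Zd d -> R) : measurable_fun setT g ->
  measurable_fun setT (fun y => (`|g y| `^ alpha)%:E).
Proof.
move=> mg; apply/measurable_EFinP; apply: (measurableT_comp (f := @powR R ^~ alpha)) => //.
exact: measurableT_comp.
Qed.

(** The map u |-> proj (u - t) permutes H, so all the kernels [ft t] have the same alpha-th moment.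
    This makes the individual tail bounds uniform in t. *)
Let ft_mass t : \int[nu \x Z]_y (`|ft t y| `^ alpha)%:E = \int[nu \x Z]_y (`|f y| `^ alpha)%:E.
Proof.
rewrite (@fubini_tonelli1 _ _ _ _ _ nu Z _ (powR_meas (mft t))); last by move=> y; rewrite lee_fin powR_ge0.
rewrite (@fubini_tonelli1 _ _ _ _ _ nu Z _ (powR_meas mf)); last by move=> y; rewrite lee_fin powR_ge0.
apply: eq_integral => v _; rewrite /fubini_F.
rewrite !integral_zeta; last 2 first.
- by move=> u; rewrite lee_fin powR_ge0.
- by move=> u; rewrite lee_fin powR_ge0.
exact: (esym (@reindex_esum R _ _ H H _ (fun u => (`|f (v, u)| `^ alpha)%:E) (shift_bij t))).
Qed.

Let F := fine (\int[nu \x Z]_y (`|f y| `^ alpha)%:E).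

Let FE t : \int[nu \x Z]_y (`|ft t y| `^ alpha)%:E = F%:E.
Proof.
rewrite ft_mass /F fineK// ge0_fin_numE; first by apply: Lfun_powR_finite => //; exact: f_Lalpha.
by apply: integral_ge0 => y _; rewrite lee_fin powR_ge0.
Qed.

Let F0 : (0 <= F)%R.
Proof. by apply: fine_ge0; apply: integral_ge0 => y _; rewrite lee_fin powR_ge0. Qed.

Let Lam : {measure set (R * W * Zd d)%type -> \bar R} := ((nua \x nu) \x Z).

Let at_ t (z : R * W * Zd d) : R := (z.1.1 * f (z.1.2, proj (z.2 - t)))%R.

Let ray_neg (g : W * Zd d -> R) (x : R) : measurable_fun setT g -> (0 < x)%R ->
  Lam [set z | (z.1.1 * g (z.1.2, z.2) < - x)%R] =
  (x `^ (- alpha))%:E * \int[nu \x Z]_y (`|g y| `^ alpha)%:E.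
Proof.
move=> mg x0; have mg' : measurable_fun setT (fun y => - g y)%R by exact: measurableT_comp.
have := jump_measure_ray alpha0 hnua H nu mg' x0.
under [in X in _ = X -> _]eq_integral do rewrite normrN.
by move=> <-; congr (Lam _); apply/seteqP; split => z /=; rewrite mulrN ltrNr.
Qed.

Let ray_pos (g : W * Zd d -> R) (x : R) : measurable_fun setT g -> (0 < x)%R ->
  Lam [set z | (x < z.1.1 * g (z.1.2, z.2))%R] =
  (x `^ (- alpha))%:E * \int[nu \x Z]_y (`|g y| `^ alpha)%:E.
Proof. by move=> mg x0; exact: jump_measure_ray. Qed.

Let lift_meas (g : W * Zd d -> R) : measurable_fun setT g ->
  measurable_fun setT (fun z : R * W * Zd d => z.1.1 * g (z.1.2, z.2))%R.
Proof.
move=> mg; apply: measurable_funM; first by apply: measurableT_comp.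
apply: measurableT_comp => //; apply: measurable_fun_pair => //.
by apply: measurableT_comp.
Qed.

Let mat t : measurable_fun setT (at_ t). Proof. exact: lift_meas (mft t). Qed.

Let a_tail t (x : R) : (0 < x)%R ->
  Lam [set z | (x < `|at_ t z|)%R] <= (2 * F * x `^ (- alpha))%:E.
Proof.
move=> x0.
have h1 : Lam [set z | (x < at_ t z)%R] = (x `^ (- alpha) * F)%:E.
  by rewrite (ray_pos (mft t) x0) FE.
have h2 : Lam [set z | (at_ t z < - x)%R] = (x `^ (- alpha) * F)%:E.
  by rewrite (ray_neg (mft t) x0) FE.
have mp : measurable [set z | (x < at_ t z)%R].
  have := mat t measurableT (measurable_itv `]x, +oo[); rewrite setTI.
  by congr measurable; apply/seteqP; split => z /=; rewrite in_itv/= andbT.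
have mn : measurable [set z | (at_ t z < - x)%R].
  have := mat t measurableT (measurable_itv `]-oo, (- x)%R[); rewrite setTI.
  by congr measurable; apply/seteqP; split => z /=; rewrite in_itv/=.
apply: (@le_trans _ _ (Lam ([set z | (x < at_ t z)%R] `|` [set z | (at_ t z < - x)%R]))).
  apply: le_measure; rewrite ?inE//; [exact: measurable_absr_gt|exact: measurableU|].
  by move=> z /=; rewrite lter_normr ltrNr => /orP[]; [left|right].
apply: le_trans (measureU2 _ mp mn) _.
rewrite [X in (X + _)]h1 [X in (_ + X)]h2 -EFinD lee_fin.
by rewrite le_eqVlt; apply/orP; left; apply/eqP; ring.
Qed.

Let cn n : R := (n%:R ^- D * (gamma n)^-1)%R.

Let b n (y : W * Zd d) : R := (n%:R ^- D * \sum_(t <- boxseq d n) f (y.1, proj (y.2 - t)))%R.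

Let mb n : measurable_fun setT (b n).
Proof. by apply: measurable_funM => //; apply: measurable_sum => t; exact: mft. Qed.

Let Ib n := \int[nu \x Z]_y (`|b n y| `^ alpha)%:E.

Let Ib_fin n : (0 < n)%N -> Ib n \is a fin_num.
Proof.
move=> n0; rewrite ge0_fin_numE; last by apply: integral_ge0 => y _; rewrite lee_fin powR_ge0.
have h := (coset_averaging_finite KN Hproj Kproj proj_unique DP P0 c0 count_ub count_lb alpha02 f_Lalpha f_abs mb (fun n v u _ => erefl) aE n0).
exact: h.
Qed.

Let Ib_cvg : (n%:R ^- P)%:E * Ib n @[n --> \oo] --> a_%:E * tail_integral alpha nu H f.
Proof.
have h := (coset_averaging_cvg KN Hproj Kproj proj_unique DP P0 c0 count_ub count_lb alpha02 f_Lalpha f_abs mb (fun n v u _ => erefl) aE a_cvg).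
exact: h.
Qed.

Let S := fine (tail_integral alpha nu H f).

Let SE : tail_integral alpha nu H f = S%:E.
Proof. by rewrite /S fineK// ge0_fin_numE ?tail_integral_ge0//; exact: tail_integral_lty. Qed.

(** The index is shifted by one: at n = 0 the normalization degenerates, and the moment of the
    averaged kernel is known to be finite for n > 0. *)
Let m n : R := ((gamma n.+1)^-1 `^ alpha * fine (Ib n.+1))%R.
Let r n : R := (gamma n.+1 `^ alpha / n.+1%:R ^+ P)%R.

Let m0 n : (0 <= m n)%R.
Proof.
apply: mulr_ge0; first exact: powR_ge0.
by apply: fine_ge0; apply: integral_ge0 => y _; rewrite lee_fin; exact: powR_ge0.
Qed.

Let r0 n : (0 <= r n)%R. Proof. by rewrite divr_ge0 ?powR_ge0 ?exprn_ge0. Qed.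

Let b_tail n (x : R) : (0 < x)%R ->
  Lam [set z | (x < cn n.+1 * \sum_(t <- boxseq d n.+1) at_ t z)%R] = (m n * x `^ (- alpha))%:E /\
  Lam [set z | (cn n.+1 * \sum_(t <- boxseq d n.+1) at_ t z < - x)%R] = (m n * x `^ (- alpha))%:E.
Proof.
move=> x0; pose g y := ((gamma n.+1)^-1 * b n.+1 y)%R.
have mg : measurable_fun setT g by exact: measurable_funM.
have E z : (cn n.+1 * \sum_(t <- boxseq d n.+1) at_ t z = z.1.1 * g (z.1.2, z.2))%R.
  by rewrite /at_ -mulr_sumr /g /b /cn /=; ring.
have I : \int[nu \x Z]_y (`|g y| `^ alpha)%:E = (m n)%:E.
  have e y : (`|g y| `^ alpha)%:E = ((gamma n.+1)^-1 `^ alpha)%:E * (`|b n.+1 y| `^ alpha)%:E.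
    have gi : (0 <= (gamma n.+1)^-1)%R by rewrite invr_ge0 ltW.
    by rewrite /g normrM (ger0_norm gi) powRM// EFinM.
  rewrite (eq_integral _ _ (fun y _ => e y)) ge0_integralZl_EFin ?powR_ge0//; last exact: powR_meas.
  by rewrite /m [RHS]EFinM fineK//; exact: Ib_fin.
have e1 : [set z | (x < cn n.+1 * \sum_(t <- boxseq d n.+1) at_ t z)%R] =
   [set z : R * W * Zd d | (x < z.1.1 * g (z.1.2, z.2))%R].
  by apply/seteqP; split => z /=; rewrite E.
have e2 : [set z | (cn n.+1 * \sum_(t <- boxseq d n.+1) at_ t z < - x)%R] =
   [set z : R * W * Zd d | (z.1.1 * g (z.1.2, z.2) < - x)%R].
  by apply/seteqP; split => z /=; rewrite E.
by rewrite e1 e2 (ray_pos mg x0) (ray_neg mg x0) I -EFinM mulrC.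
Qed.

Let rmE n : (r n * m n = n.+1%:R ^- P * fine (Ib n.+1))%R.
Proof.
have g0 : (gamma n.+1 `^ alpha != 0)%R by rewrite gt_eqF// powR_gt0.
have gi : ((gamma n.+1)^-1 `^ alpha = (gamma n.+1 `^ alpha)^-1)%R.
  by rewrite -powR_inv1 ?(ltW (gamma0 _))// -powRrM mulN1r powRN.
by rewrite /r /m gi mulrACA mulfV// mul1r.
Qed.

Let IbR_cvg : (n%:R ^- P * fine (Ib n))%R @[n --> \oo] --> (a_ * S)%R.
Proof.
have := Ib_cvg; rewrite SE -EFinM => /fine_cvgP[_]; apply: cvg_trans; apply: near_eq_cvg.
by near=> n => /=; rewrite fineM//; apply: Ib_fin; near: n; exact: nbhs_infty_gt.
Unshelve. all: by end_near. Qed.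

Let rm : (r n * m n)%R @[n --> \oo] --> (a_ * S)%R.
Proof.
have -> : (fun n => r n * m n)%R = (fun n => n.+1%:R ^- P * fine (Ib n.+1))%R.
  by apply/funext => n; exact: rmE.
exact: (cvg_succ IbR_cvg).
Qed.

(** Up to the shift, m_n is (n^(P / alpha) / gamma_n)^alpha times n^(-P) [Ib n]: the first factor
    tends to 0 by the growth of gamma, the second converges. *)
Let m_cvg0 : m n @[n --> \oo] --> 0%R.
Proof.
have e n : m n = ((n.+1%:R `^ (P%:R / alpha) / gamma n.+1) `^ alpha * (n.+1%:R ^- P * fine (Ib n.+1)))%R.
  have nP : (n.+1%:R ^+ P != 0 :> R)%R by rewrite expf_neq0// pnatr_eq0.
  rewrite powRM ?powR_ge0 ?invr_ge0 ?(ltW (gamma0 _))// -powRrM divfK ?gt_eqF// powR_mulrn//.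
  by rewrite /m; field.
have h : ((n.+1%:R `^ (P%:R / alpha) / gamma n.+1) `^ alpha)%R @[n --> \oo] --> (0 : R)%R.
  have g1 : (n.+1%:R `^ (P%:R / alpha) / gamma n.+1)%R @[n --> \oo] --> (0 : R)%R.
    exact: (cvg_succ gamma_large).
  apply/cvgrPdist_le => tau tau0.
  have t0 : (0 < tau `^ alpha^-1)%R by rewrite powR_gt0.
  have := cvgr_near_le g1 t0; apply: filterS => n hn.
  rewrite sub0r normrN ger0_norm ?powR_ge0//.
  have an0 : alpha != 0%R by rewrite gt_eqF.
  have tE : tau = ((tau `^ alpha^-1) `^ alpha)%R by rewrite -powRrM mulVf// powRr1// ltW.
  rewrite [leRHS]tE.
  apply: ge0_ler_powR; rewrite ?nnegrE ?powR_ge0 ?(ltW alpha0)//.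
  by rewrite divr_ge0 ?powR_ge0// ltW.
have -> : m = (fun n => (n.+1%:R `^ (P%:R / alpha) / gamma n.+1) `^ alpha * (n.+1%:R ^- P * fine (Ib n.+1)))%R.
  by apply/funext => n; exact: e.
rewrite -(mul0r (a_ * S)%R); by apply: cvgM; [exact: h|exact: (cvg_succ IbR_cvg)].
Qed.

Let a_odd t z : at_ t (flip_jump z) = (- at_ t z)%R.
Proof. by rewrite /at_ /flip_jump /= mulNr. Qed.

Let mX t : measurable_fun setT (X t : Omega -> R). Proof. exact: measurable_funPT. Qed.

Let M0 : (0 <= 2 * F)%R. Proof. by rewrite mulr_ge0. Qed.

Let Lam_sym (A : set (R * W * Zd d)) : measurable A -> Lam (@flip_jump R dW W d @^-1` A) = Lam A.
Proof. by move=> mA; exact: (jump_measure_sym hnua H nu). Qed.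

Lemma coset_sum_limit (G : R -> R) : continuous G ->
  (exists K : R, forall x, `|G x| <= K)%R -> (\forall x \near (0 : R)%R, G x = 0%R) ->
  (gamma n `^ alpha / n%:R ^+ P)%:E *
    \int[Pr]_w (G (n%:R ^- D * (gamma n)^-1 * \sum_(t <- boxseq d n) X t w)%R)%:E @[n --> \oo] -->
  a_%:E * tail_integral alpha nu H f * \int[nua]_x (G x)%:E.
Proof.
move=> cG Gb G0; rewrite -cvg_shiftS SE -EFinM.
case/andP: (alpha02) => al0 al2.
exact: (@scaled_limit _ _ _ _ _ _ _ _ PRM _ (@measurable_flip_jump _ _ _ _) Lam_sym _ al0 al2 _ hnua _ at_
  (fun t => X t : Omega -> R) mat mX a_odd _ M0 a_tail XE (fun n => boxseq d n.+1) (fun n => cn n.+1) m r _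
  m0 r0 b_tail rm m_cvg0 G cG Gb G0).
Qed.

End coset_sums.

(** A copy of [nua] indexed by the proof of [is_nu_alpha], so that the sigma-finiteness deduced from
    that proof can be attached to it as an instance. *)
Definition nu_alpha_measure (R : realType) (alpha : R) (nua : {measure set R -> \bar R})
  of is_nu_alpha alpha nua : set R -> \bar R := nua.

HB.instance Definition _ (R : realType) (alpha : R) (nua : {measure set R -> \bar R})
  (hnua : is_nu_alpha alpha nua) := Measure.copy (nu_alpha_measure hnua) (nua : set R -> \bar R).

HB.instance Definition _ (R : realType) (alpha : R) (nua : {measure set R -> \bar R})
  (hnua : is_nu_alpha alpha nua) :=
  @Measure_isSigmaFinite.Build _ _ _ (nu_alpha_measure hnua) (sigma_finite_nu_alpha hnua).

(** * The dissipative case *)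

Section trivial_subgroup.
Context (R : realType) (d : nat).

Lemma coset_count_set0 n (z : Zd d) : coset_count [set 0] n z = (z \in boxseq d n) :> nat.
Proof.
rewrite -count_uniq_mem ?boxseq_uniq//; apply: eq_count => t /=.
by apply/asboolP/eqP => [/eqP|->]; [rewrite subr_eq0 => /eqP|exact: subrr].
Qed.

Lemma powR_bool (alpha : R) (b : bool) : 0 < alpha -> (b%:R : R) `^ alpha = b%:R.
Proof. by move=> a0; case: b; rewrite ?powR1// powR0// gt_eqF. Qed.

Lemma sum_coset_count_set0 (alpha : R) n : 0 < alpha ->
  (\int[zeta R [set: Zd d]]_u (((coset_count [set 0%R] n u)%:R / n%:R ^+ 0) `^ alpha)%:E =
   ((2 * n).+1 ^ d)%:R%:E)%E.
Proof.
move=> a0; rewrite -size_boxseq.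
rewrite -(@sum_coset_count1 R d setT [set 0%R] id _ _ _ _ (boxseq d n)) //.
- apply: eq_integral => u _; congr EFin; rewrite expr0 divr1 coset_count_set0 powR_bool//.
  by rewrite -coset_count_set0.
- by move=> t /= ->; rewrite oppr0.
- by move=> t /=; exact: subrr.
- by move=> t u _ /= /eqP; rewrite subr_eq0 => /eqP.
Qed.

End trivial_subgroup.

(** The coset limit for the trivial subgroup, with [proj = id], D = 0 and P = d. The coset counts
    are indicators of the box, and 2^d is the limit of (2 n + 1)^d / n^d. *)
Lemma dissipative_limit (R : realType) (d : nat) (hd : (0 < d)%N)
  (alpha : R) (alpha_gt0 : 0 < alpha) (alpha_lt2 : alpha < 2)
  (nua : {measure set R -> \bar R}) (hnua : is_nu_alpha alpha nua)
  (dO : measure_display) (Omega : measurableType dO) (P : probability Omega R)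
  (X : Zd d -> {RV P >-> R})
  (dW : measure_display) (W : measurableType dW)
  (nu : {sigma_finite_measure set W -> \bar R})
  (f : W * Zd d -> R)
  (f_Lalpha : f \in Lfun (nu \x zeta R setT)%E alpha%:E)
  (j : nat -> Omega -> R) (v : nat -> Omega -> W) (u : nat -> Omega -> Zd d)
  (PRM : poisson_random_measure P (fun i w => (j i w, v i w, u i w))
           ((nua \x nu) \x zeta R setT)%E)
  (X_series : forall t : Zd d,
     series_in_prob P (fun i w => j i w * f (v i w, u i w - t)) (X t))
  (f_abs : abs_sum_finite alpha nu setT f)
  (gamma : nat -> R) (gamma_gt0 : forall n, 0 < gamma n)
  (gamma_large : n%:R `^ (d%:R / alpha) / gamma n @[n --> \oo] --> 0) :
  M0_cvg
    (fun n => emscale (rate alpha (gamma n) d n)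
       (distribution P ((gamma n)^-1 *: partial_sum X n))
       (rate_ge0 alpha (gamma n) d n))
    (emscale (const_dissipative alpha nu f) nua
       (const_dissipative_ge0 alpha nu f)).
Proof.
have a02 : 0 < alpha < 2 by rewrite alpha_gt0.
have S_lty := tail_integral_lty a02 f_Lalpha f_abs.
apply: (@M0_cvg_of_limit R d dO Omega P X alpha nua gamma (fun n => (gamma n)^-1) d _ _ hnua).
  by apply: lte_mul_pinfty => //; rewrite lee_fin exprn_ge0.
move=> G cG Gb G0.
pose K : set (Zd d) := [set 0].
have KN t : K t -> K (- t) by move=> ->; exact: oppr0.
have KD s t : K s -> K t -> K (s + t) by move=> -> ->; exact: addr0.
have Kproj t : K (t - id t) by exact: subrr.
have pu (t s : Zd d) : [set: Zd d] s -> K (t - s) -> s = id t.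
  by move=> _ /eqP; rewrite subr_eq0 => /eqP.
have ub n (z : Zd d) : (0 < n)%N -> (coset_count K n z)%:R <= 1 * n%:R ^+ 0 :> R.
  by move=> _; rewrite expr0 mulr1 coset_count_set0 (ler_nat _ _ 1) leq_b1.
have lb n (z : Zd d) : (0 < n)%N -> coset_count K n z != 0%N ->
    1 * n%:R ^+ 0 <= (coset_count K (2 * n) z)%:R :> R.
  move=> n0; rewrite !coset_count_set0 expr0 mulr1 eqb0 negbK => /mem_boxseq zn.
  have -> : z \in boxseq d (2 * n) by apply/mem_boxseq; apply: box_le zn; lia.
  by [].
have aE n : ((n%:R ^- d)%:E * \int[zeta R [set: Zd d]]_s
    (((coset_count K n s)%:R / n%:R ^+ 0) `^ alpha)%:E = (((2 * n%:R + 1) ^+ d / n%:R ^+ d)%R : R)%:E)%E.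
  by rewrite sum_coset_count_set0// -EFinM mulrC natrX -natr1 natrM.
have XE t : series_in_prob P (fun i w => ((fun i w => (j i w, v i w, u i w)) i w).1.1 *
    f (((fun i w => (j i w, v i w, u i w)) i w).1.2, id (((fun i w => (j i w, v i w, u i w)) i w).2 - t))) (X t).
  exact: X_series.
have := @coset_sum_limit R d setT K id KN (fun=> I) Kproj pu 0%N d (add0n d) hd 1 1 ltr01 ub lb
  alpha a02 (nu_alpha_measure hnua : {sigma_finite_measure set R -> \bar R}) hnua _ W nu f f_Lalpha f_abs _ _ aE (@cvg_affine_ratio R d 1)
  _ Omega P _ PRM X XE gamma gamma_gt0 gamma_large G cG Gb G0.
by under eq_fun do rewrite expr0 invr1 mul1r.
Qed.

(** * Lattice points and volumes *)

Section tuple_cubes.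
Context (R : realType).
Local Open Scope ereal_scope.

Lemma measurable_tuple_box k (a b : 'I_k -> R) :
  measurable [set t : k.-tuple R | forall i, (a i <= tnth t i < b i)%R].
Proof.
rewrite (_ : [set t | _] = \bigcap_(i in [set: 'I_k]) ((@tnth k R)^~ i @^-1` `[a i, b i[%classic)).
  apply: fin_bigcap_measurable => // i _.
  by rewrite -[X in measurable X]setTI; apply: measurable_tnth => //; exact: measurable_itv.
apply/seteqP; split => [t Bt i _ /=|t Bt i]; first by rewrite in_itv/=; exact: Bt.
by have := Bt i I; rewrite /= in_itv.
Qed.

Lemma lebesgue_tuple_half_open k (a b : 'I_k -> R) : (forall i, a i <= b i)%R ->
  lebesgue_tuple R k [set t | forall i, (a i <= tnth t i < b i)%R] =
  (\prod_(i < k) (b i - a i))%R%:E.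
Proof.
elim: k a b => [|k ih] a b ab.
  by rewrite big_ord0 /= /dirac indicE mem_set//= => -[].
rewrite big_ord_recl EFinM /=.
set B := [set t | _].
pose B' := [set t : k.-tuple R | forall i : 'I_k,
  (a (lift ord0 i) <= tnth t i < b (lift ord0 i))%R].
have mB' : measurable B' by exact: measurable_tuple_box.
rewrite /lebesgue_cons /pushforward.
rewrite (_ : _ @^-1` B = `[a ord0, b ord0[ `*` B').
  rewrite product_measure1E//= lebesgue_measure_itv/= lte_fin.
  rewrite [X in _ * X](ih (fun i => a (lift ord0 i)) (fun i => b (lift ord0 i)))//.
  congr (_ * _).
  case: ltP => [//|ba]; congr EFin; apply/esym/eqP.
  by rewrite subr_eq0; apply/eqP/le_anti; rewrite ba ab.
apply/seteqP; split => -[x t] /=.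
  move=> Bt; split; first by rewrite in_itv/=; have := Bt ord0; rewrite tnth0.
  by move=> i; have := Bt (lift ord0 i); rewrite tnthS.
move=> [+ B't] i; rewrite in_itv/= => xab.
by case: (unliftP ord0 i) => [j ->|->]; rewrite ?tnthS ?tnth0.
Qed.

Variable k : nat.

(** Half-open sides make the cubes of mesh 1 / n a partition of the space. *)
Definition cube (n : nat) (m : Zd k) : set (k.-tuple R) :=
  [set t | forall i, ((m i 0)%:~R / n%:R <= tnth t i < ((m i 0)%:~R + 1) / n%:R)%R].

Lemma measurable_cube n m : measurable (cube n m).
Proof. exact: measurable_tuple_box. Qed.

Lemma cube_measure n m : (0 < n)%N -> lebesgue_tuple R k (cube n m) = (n%:R ^- k)%:E.
Proof.
move=> n0; have nR : (0 < n%:R :> R)%R by rewrite ltr0n.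
rewrite /cube (@lebesgue_tuple_half_open k (fun i => (m i 0)%:~R / n%:R)%R (fun i => ((m i 0)%:~R + 1) / n%:R)%R).
  congr EFin; rewrite (eq_bigr (fun=> n%:R^-1)%R); first by rewrite prodr_const card_ord exprVn.
  by move=> i _; rewrite -mulrBl addrAC subrr add0r mul1r.
by move=> i; rewrite ler_wpM2r ?invr_ge0 ?(ltW nR)// lerDl.
Qed.

Lemma integral_cube n m : (0 < n)%N ->
  \int[lebesgue_tuple R k]_(t in cube n m) (\1_(cube n m) t)%:E = (n%:R ^- k)%:E.
Proof.
move=> n0; rewrite integral_indic; [|exact: measurable_cube|exact: measurable_cube].
by rewrite setIid; exact: cube_measure.
Qed.

Definition cube_index (n : nat) (t : k.-tuple R) : Zd k := \col_i Num.floor (n%:R * tnth t i)%R.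

Lemma mem_cube n m t : (0 < n)%N -> cube n m t <-> m = cube_index n t.
Proof.
move=> n0; have nR : (0 < n%:R :> R)%R by rewrite ltr0n.
split=> [h|-> i].
  apply/matrixP => i j; rewrite (ord1 j) mxE; apply/esym/floor_def.
  have := h i; rewrite ler_pdivrMr// ltr_pdivlMr// intrD [(n%:R * _)%R]mulrC => /andP[-> ->//].
by rewrite mxE ler_pdivrMr// ltr_pdivlMr// mulrC floor_le_tmp/= -intrD1 floorD1_gt.
Qed.

Lemma measurable_fun_Zd_prod d' (T : measurableType d') dY (Y : measurableType dY) (F : Zd k * T -> Y) :
  (forall m, measurable_fun setT (fun t => F (m, t))) -> measurable_fun setT F.
Proof.
move=> mF _ A mA; rewrite setTI.
have -> : F @^-1` A = \bigcup_n \bigcup_(m in [set m : Zd k | pickle m = n]) ([set m] `*` ((fun t => F (m, t)) @^-1` A)).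
  apply/seteqP; split => [[m t] At|[m t] [n _ [m' /= _ [-> //]]]].
  by exists (pickle m) => //; exists m.
apply: bigcup_measurable => n _.
have [[m mn]|h] := pselect (exists m : Zd k, pickle m = n).
  have -> : [set m : Zd k | pickle m = n] = [set m].
    by apply/seteqP; split => [m' m'n|_ ->//]; apply: (pcan_inj (@pickleK (Zd k))); rewrite mn m'n.
  rewrite bigcup_set1; apply: measurableX => //.
  by have := mF m measurableT _ mA; rewrite setTI.
have -> : [set m : Zd k | pickle m = n] = set0 by apply/seteqP; split => // m mn; apply: h; exists m.
by rewrite bigcup_set0.
Qed.

(** Each y lies in exactly one cube, of index floor (n y), so phi is the sum over m of its
    restrictions; Tonelli's theorem exchanges sum and integral. *)
Lemma integral_cubes n (phi : k.-tuple R -> \bar R) : (0 < n)%N ->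
  measurable_fun setT phi -> (forall y, 0 <= phi y) ->
  \int[lebesgue_tuple R k]_y phi y =
  \int[zeta R [set: Zd k]]_m \int[lebesgue_tuple R k]_(y in cube n m) phi y.
Proof.
move=> n0 mphi phi0.
pose F (z : Zd k * k.-tuple R) := phi z.2 * (\1_(cube n z.1) z.2)%:E.
have mF : measurable_fun setT F.
  apply: measurable_fun_Zd_prod => m; apply: emeasurable_funM => //.
  by apply/measurable_EFinP; apply: measurable_indic; exact: measurable_cube.
have F0 z : 0 <= F z by rewrite mule_ge0// lee_fin.
have E1 y : phi y = \int[zeta R [set: Zd k]]_m F (m, y).
  rewrite /F /= ge0_integralZl//.
  have [e _] := @integral_zeta_unique R k setT (fun m => m == cube_index n y) (fun=> 1%R) (cube_index n y) I (fun _ _ => erefl).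
  rewrite (_ : \int[_]_m _ = 1) ?mule1// -[RHS]e; apply: eq_integral => m _.
  rewrite mul1r indicE; have -> : (y \in cube n m) = (m == cube_index n y).
    apply/idP/eqP => [/set_mem /(mem_cube m y n0)//|h].
    by apply/mem_set/(mem_cube m y n0).
  by [].
rewrite (eq_integral _ _ (fun y _ => E1 y)).
rewrite -(@fubini_tonelli _ _ _ _ _ (zeta R [set: Zd k]) (lebesgue_tuple R k) F mF F0).
apply: eq_integral => m _; rewrite [RHS]integral_mkcond.
apply: eq_integral => y _; rewrite /F /= patchE indicE.
by case: ifP; rewrite ?mule1 ?mule0.
Qed.

End tuple_cubes.

(** * Comparison of lattice counts with volumes *)

Section lattice_volumes.
Context (R : realType) (d p : nat) (U : 'M[int]_(d, p)) (V : 'M[int]_(d, d - p)).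
Local Notation D := (d - p)%N.
Local Open Scope ereal_scope.

(** [Qset] with a variable radius: passing between points and cubes costs a dilation of order 1 /
    n. *)
Definition Qset_le (r : R) (y : p.-tuple R) : set (D.-tuple R) :=
  [set lam | (mx_norm (lincomb U V y lam) <= r)%R].

Definition vol_le (r : R) (y : p.-tuple R) : \bar R := lebesgue_tuple R D (Qset_le r y).

(** It dominates the l^1 norm of every row of U and V together, hence the displacement of each
    coordinate when all the arguments move by at most 1. *)
Definition entry_bound : nat := (\sum_i (\sum_j absz (U i j) + \sum_j absz (V i j)))%N.

Lemma lincombE (y : p.-tuple R) (lam : D.-tuple R) i :
  lincomb U V y lam i 0%R = (\sum_j (U i j)%:~R * tnth y j + \sum_j (V i j)%:~R * tnth lam j)%R.
Proof. by rewrite /lincomb !mxE; congr (_ + _)%R; apply: eq_bigr => j _; rewrite !mxE. Qed.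

Let setQ r : set (p.-tuple R * D.-tuple R) := [set z | Qset_le r z.1 z.2].

Let measurable_setQ r : (0 <= r)%R -> measurable (setQ r).
Proof.
move=> r0.
rewrite (_ : setQ r = \bigcap_(i in [set: 'I_d])
    ((fun z : p.-tuple R * D.-tuple R => \sum_j (U i j)%:~R * tnth z.1 j + \sum_j (V i j)%:~R * tnth z.2 j)%R
      @^-1` `[(- r)%R, r]%classic)).
  apply: fin_bigcap_measurable => // i _; rewrite -[X in measurable X]setTI.
  suff : measurable_fun setT (fun z : p.-tuple R * D.-tuple R =>
      \sum_j (U i j)%:~R * tnth z.1 j + \sum_j (V i j)%:~R * tnth z.2 j)%R.
    by apply => //; exact: measurable_itv.
  apply: measurable_funD; apply: measurable_sum => j; apply: measurable_funM => //.
    by apply: (measurableT_comp (measurable_tnth j)).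
  by apply: (measurableT_comp (measurable_tnth j)).
apply/seteqP; split => [z h i _ /=|z h].
  by rewrite in_itv/= -ler_norml -lincombE; exact: (mx_norm_leP _ r0).1 h i.
apply/(mx_norm_leP _ r0) => i; have := h i I.
by rewrite /= in_itv/= -ler_norml -lincombE.
Qed.

Lemma measurable_Qset r y : (0 <= r)%R -> measurable (Qset_le r y).
Proof. by move=> r0; have := measurable_xsection y (measurable_setQ r0); rewrite xsectionE. Qed.

Lemma measurable_vol_le r : (0 <= r)%R -> measurable_fun setT (vol_le r).
Proof.
move=> r0; have := measurable_fun_xsection (lebesgue_tuple R D) (measurable_setQ r0).
by congr measurable_fun; apply/funext => y /=; rewrite xsectionE.
Qed.

Lemma vol_le_mono r s y : (0 <= r <= s)%R -> vol_le r y <= vol_le s y.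
Proof.
move=> /andP[r0 rs]; apply: le_measure; rewrite ?inE; try (apply: measurable_Qset; lra).
by move=> lam /= h; exact: le_trans h rs.
Qed.

(* Passing from (y, lam) to the corners (m, q) of the cubes of mesh 1/n containing them. *)
Lemma lincomb_cube n (m : Zd p) (q : Zd D) (y : p.-tuple R) (lam : D.-tuple R) i : (0 < n)%N -> cube n m y -> cube n q lam ->
  (`|n%:R * lincomb U V y lam i 0 - ((U *m m + V *m q) i 0)%:~R| <= entry_bound%:R)%R.
Proof.
move=> n0 ym lq; have nR : (0 < n%:R :> R)%R by rewrite ltr0n.
have frac (a : int) (t : R) : (a%:~R / n%:R <= t < (a%:~R + 1) / n%:R -> `|n%:R * t - a%:~R| <= 1)%R.
  rewrite ler_pdivrMr// ltr_pdivlMr// mulrC => /andP[h1 h2].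
  by rewrite ger0_norm ?subr_ge0// lerBlDr addrC ltW.
have bound k (A : 'I_k -> int) (t : k.-tuple R) (z : Zd k) : cube n z t ->
    (`|n%:R * (\sum_j (A j)%:~R * tnth t j) - (\sum_j A j * z j 0)%:~R| <= (\sum_j absz (A j))%:R)%R.
  move=> h; rewrite mulr_sumr rmorph_sum/= -sumrB natr_sum.
  apply: le_trans (ler_norm_sum _ _ _) _; apply: ler_sum => j _.
  rewrite intrM mulrCA -mulrBr normrM -[leRHS]mulr1; apply: ler_pM => //.
    by rewrite natr_absz intr_norm.
  exact: frac (h j).
rewrite lincombE !mxE mulrDr intrD opprD addrACA.
apply: le_trans (ler_normD _ _) _.
apply: (@le_trans _ _ ((\sum_j absz (U i j))%:R + (\sum_j absz (V i j))%:R)%R).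
  by apply: lerD; [exact: (bound p (U i) y m)|exact: (bound D (V i) lam q)].
by rewrite -natrD ler_nat /entry_bound (bigD1 i)//= leq_addr.
Qed.

Let box_lattice (x : Zd d) (N : nat) (m : Zd p) (q : Zd D) :=
  `[<box N (x + (U *m m + V *m q) : Zd d)%R>].

Definition fiber_count (x : Zd d) (N : nat) (m : Zd p) : \bar R :=
  \int[zeta R [set: Zd D]]_q ((box_lattice x N m q)%:R : R)%:E.

Variables (x : Zd d) (cx : nat) (xb : box cx x).
Let C := (entry_bound + cx)%N.

Let box_norm N (t : Zd d) i : box N t -> (`|(t i 0)%:~R| <= N%:R :> R)%R.
Proof. by move=> /mem_boxP /(_ i) h; rewrite -intr_norm [leRHS]pmulrn ler_int. Qed.

(** The cubes based at the counted q are disjoint, have volume n^(-D) and lie in the set of radius 1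
    + C / n, where C absorbs the rounding and the shift x. *)
Lemma fiber_count_le_vol n m y : (0 < n)%N -> cube n m y ->
  (n%:R ^- D)%:E * fiber_count x n m <= vol_le (1 + C%:R / n%:R)%R y.
Proof.
move=> n0 ym; have nR : (0 < n%:R :> R)%R by rewrite ltr0n.
have r0 : (0 <= 1 + C%:R / n%:R :> R)%R by rewrite addr_ge0// divr_ge0.
have mQ := measurable_Qset y r0.
rewrite /vol_le -(setIT (Qset_le _ y)) -integral_indic// (integral_cubes n0); last 2 first.
- by apply/measurable_EFinP; exact: measurable_indic.
- by move=> lam; rewrite lee_fin.
rewrite /fiber_count -ge0_integralZl_EFin//.
apply: le_integral_zeta.
- by move=> q; rewrite mule_ge0// lee_fin// invr_ge0 exprn_ge0.
- by move=> q; apply: integral_ge0 => lam _; rewrite lee_fin.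
move=> q _; rewrite /box_lattice; case: asboolP => [bq|_]; last first.
  by rewrite mule0; apply: integral_ge0 => lam _; rewrite lee_fin.
rewrite mule1 -(integral_cube R q n0).
apply: ge0_le_integral.
- exact: measurable_cube.
- by move=> lam _; rewrite lee_fin.
- by apply: measurable_funTS; apply/measurable_EFinP; apply: measurable_indic; exact: measurable_cube.
- by apply: measurable_funTS; apply/measurable_EFinP/measurable_indic.
move=> lam lq; rewrite lee_fin !indicE; case: (_ \in _) => //=.
rewrite mem_set// /Qset_le /=; apply/(mx_norm_leP _ r0) => i.
have h1 := lincomb_cube i n0 ym lq; have h2 := box_norm i bq; have h3 := box_norm i xb.
move: h2; rewrite mxE intrD => h2.
have -> : (1 + C%:R / n%:R = (n%:R + C%:R) / n%:R :> R)%R by rewrite mulrDl divff ?gt_eqF.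
rewrite ler_pdivlMr// mulrC.
have -> : (n%:R * `|lincomb U V y lam i 0| = `|n%:R * lincomb U V y lam i 0|)%R by rewrite normrM gtr0_norm.
rewrite /C natrD.
move: h1 h2 h3; rewrite !ler_norml => /andP[? ?] /andP[? ?] /andP[? ?]; apply/andP; split; lra.
Qed.

(** Every cube meeting the set of radius r has its corner among the counted q, once the box radius
    exceeds n r by C. The mesh and the box radius are kept apart: with N = n the admissible r would
    depend on n. *)
Lemma vol_le_fiber_count n m y N (r : R) : (0 < n)%N -> (0 <= r)%R -> (n%:R * r + C%:R <= N%:R)%R ->
  cube n m y -> vol_le r y <= (n%:R ^- D)%:E * fiber_count x N m.
Proof.
move=> n0 r0 rN ym; have nR : (0 < n%:R :> R)%R by rewrite ltr0n.
have mQ := measurable_Qset y r0.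
rewrite /vol_le -(setIT (Qset_le _ y)) -integral_indic// (integral_cubes n0); last 2 first.
- by apply/measurable_EFinP; exact: measurable_indic.
- by move=> lam; rewrite lee_fin.
rewrite /fiber_count -ge0_integralZl_EFin//.
apply: le_integral_zeta.
- by move=> q; apply: integral_ge0 => lam _; rewrite lee_fin.
- by move=> q; rewrite mule_ge0// lee_fin// invr_ge0 exprn_ge0.
move=> q _.
have b0 : (0 <= (box_lattice x N m q)%:R :> R)%R by [].
rewrite muleC -(integral_cube R q n0).
rewrite -ge0_integralZl_EFin//; last 2 first.
- exact: measurable_cube.
- by apply: measurable_funTS; apply/measurable_EFinP; apply: measurable_indic; exact: measurable_cube.
apply: ge0_le_integral.
- exact: measurable_cube.
- by move=> lam _; rewrite lee_fin.
- by apply: measurable_funTS; apply/measurable_EFinP/measurable_indic.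
- apply: measurable_funTS; apply: emeasurable_funM => //; apply/measurable_EFinP; apply: measurable_indic; exact: measurable_cube.
move=> lam lq; rewrite -EFinM lee_fin [X in (_ <= _ * X)%R]indicE mem_set// mulr1 indicE.
case: (boolP (lam \in Qset_le r y)) => // /set_mem lamQ.
rewrite /box_lattice asboolT//; apply/mem_boxP => i.
rewrite -(ler_int R) intr_norm -[leRHS]pmulrn mxE intrD.
have h1 := lincomb_cube i n0 ym lq; have h3 := box_norm i xb.
have h2 := (mx_norm_leP _ r0).1 lamQ i.
have h4 : (`|n%:R * lincomb U V y lam i 0| <= n%:R * r)%R by rewrite normrM gtr0_norm// ler_wpM2l// ltW.
move: h1 h3 h4 rN; rewrite /C natrD !ler_norml => /andP[? ?] /andP[? ?] /andP[? ?] ?; apply/andP; split; lra.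
Qed.

End lattice_volumes.

Lemma cvg_powR0 (R : realType) (kappa : R) (u : nat -> R) : 0 < kappa -> (forall n, 0 <= u n) ->
  u n @[n --> \oo] --> 0 -> (u n `^ kappa) @[n --> \oo] --> 0.
Proof.
move=> k0 u0 hu; apply/cvgrPdist_le => tau tau0.
have t0 : 0 < tau `^ kappa^-1 by rewrite powR_gt0.
have := cvgr_near_le hu t0; apply: filterS => n hn.
rewrite sub0r normrN ger0_norm ?powR_ge0//.
have tE : tau = (tau `^ kappa^-1) `^ kappa by rewrite -powRrM mulVf ?gt_eqF// powRr1// ltW.
by rewrite [leRHS]tE; apply: ge0_ler_powR; rewrite ?nnegrE ?powR_ge0 ?(ltW k0).
Qed.

Lemma integral_zeta_pairs (R : realType) d p l (H : set (Zd d)) (e : 'I_l * Zd p -> Zd d)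
    (g : Zd d -> \bar R) : set_bij setT H e -> (forall u, 0 <= g u)%E ->
  (\int[zeta R H]_u g u = \sum_(k < l) \int[zeta R [set: Zd p]]_m g (e (k, m)))%E.
Proof.
move=> eb g0; rewrite integral_zeta// (@reindex_esum R _ _ setT H e g eb).
have -> : [set: 'I_l * Zd p] = [set: 'I_l] `*`` (fun=> [set: Zd p]) by apply/seteqP; split => -[].
rewrite (_ : (fun i => g (e i)) = fun z : 'I_l * Zd p => g (e (z.1, z.2))); last first.
  by apply/funext => -[].
rewrite -(@esum_esum _ _ _ _ _ (fun k m => g (e (k, m))))//.
have fT : finite_set [set: 'I_l] by exact: finite_finset.
rewrite esum_fset//; last by move=> k _; exact: esum_ge0.
have -> : [set: 'I_l] = [set` enum 'I_l] by apply/seteqP; split => // k _ /=; rewrite mem_enum.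
rewrite -fsbig_seq ?enum_uniq// big_enum/=; apply: eq_bigr => k _.
by rewrite integral_zeta.
Qed.

(** * Asymptotics of the lattice averages *)

Section lattice_asymptotics.
Context (R : realType) (d p : nat) (U : 'M[int]_(d, p)) (V : 'M[int]_(d, d - p)).
Local Notation D := (d - p)%N.
Variables (H K : set (Zd d)) (proj : Zd d -> Zd d).
Hypotheses (KN : forall t, K t -> K (- t)) (KD : forall s t, K s -> K t -> K (s + t)).
Hypotheses (Hproj : forall t, H (proj t)) (Kproj : forall t, K (t - proj t)).
Hypothesis proj_unique : forall t u, H u -> K (t - u) -> u = proj t.
Hypothesis V_basis : Zbasis V K.
Variables (l : nat) (x : 'I_l -> Zd d).
Let e (z : 'I_l * Zd p) : Zd d := x z.1 + (U *m z.2 : Zd d).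
Hypothesis e_bij : set_bij setT H e.
Variables (alpha : R) (alpha02 : 0 < alpha < 2).
Local Open Scope ereal_scope.

Let alpha0 : (0 < alpha)%R. Proof. by case/andP: alpha02. Qed.

Let V_inj (q q' : Zd D) : (V *m q = V *m q' :> Zd d) -> q = q'.
Proof. by case: V_basis => _ inj _ qq; apply: inj => //; rewrite inE. Qed.

Let V_mem (q : Zd D) : K (V *m q : Zd d).
Proof. by case: V_basis => f _ _; exact: f. Qed.

Let V_surj t : K t -> exists q : Zd D, V *m q = t.
Proof. by case: V_basis => _ _ s /s[q _ <-]; exists q. Qed.

(** V q runs through K without repetition, so the fiber consists of the box points congruent to y +
    U m modulo K. *)
Lemma fiber_countE (y : Zd d) N (m : Zd p) :
  fiber_count R U V y N m = ((coset_count K N (y + (U *m m : Zd d)))%:R : R)%:E.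
Proof.
set z : Zd d := (y + (U *m m : Zd d))%R.
pose vinv (w : Zd d) : Zd D := get [set q : Zd D | V *m q = w :> Zd d].
have vinvE w : K w -> V *m vinv w = w.
  by move=> /V_surj[q qw]; exact: (@getI _ [set q : Zd D | V *m q = w :> Zd d] q qw).
pose s := [seq t <- boxseq d N | `[<K (z - t)%R>]].
have us : uniq s by rewrite filter_uniq// boxseq_uniq.
have := @integral_zeta_count R D setT _ s (fun t q => q == vinv (t - z)%R) (fun t => vinv (t - z)%R)
  (fun=> 1%R) (fun=> I) (fun _ _ _ => erefl).
rewrite big_const_seq count_predT iter_addr addr0 size_filter => <-.
apply: eq_integral => q _; rewrite mul1r addrA -/z; congr (_%:R%:E).
transitivity (count_mem (z + (V *m q : Zd d))%R s).
  rewrite count_uniq_mem//; congr nat_of_bool; apply/asboolP/idP.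
    move=> /mem_boxseq h; rewrite mem_filter h andbT; apply/asboolP.
    by rewrite opprD addrA subrr add0r; apply: KN.
  by rewrite mem_filter => /andP[_ /mem_boxseq].
apply: eq_in_count => t; rewrite mem_filter => /andP[/asboolP Kt _] /=.
have Kt' : K (t - z)%R by rewrite -opprB; exact: KN.
apply/eqP/eqP => [->|->]; last by rewrite vinvE// addrC subrK.
by apply: V_inj; rewrite vinvE// addrC addKr.
Qed.

Let xb_ex : exists c, forall k, box c (x k).
Proof.
have h k : exists c, box c (x k) by exact: box_exists.
pose c k := get [set c | box c (x k)].
have cP k : box (c k) (x k) by have [n hn] := h k; exact: (@getI _ [set c | box c (x k)] n hn).
by exists (\max_k c k)%N => k; apply: box_le (cP k); exact: (leq_bigmax k).
Qed.

Let cx : nat := get [set c | forall k, box c (x k)].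
Let xb k : box cx (x k).
Proof. by have [c h] := xb_ex; exact: (@getI _ [set c | forall k, box c (x k)] c h k). Qed.

Let C : nat := (entry_bound U V + cx)%N.

Let N n k (m : Zd p) : R := (coset_count K n (x k + (U *m m : Zd d))%R)%:R.

Let fc n k m : fiber_count R U V (x k) n m = (N n k m)%:E. Proof. exact: fiber_countE. Qed.

Let upper n k m y : (0 < n)%N -> cube n m y ->
  (N n k m / n%:R ^+ D)%:E <= vol_le U V (1 + C%:R / n%:R)%R y.
Proof. by move=> n0 ym; have := fiber_count_le_vol U V (xb k) n0 ym; rewrite fc -EFinM mulrC. Qed.

Let lower n k m y M (r : R) : (0 < n)%N -> (0 <= r)%R -> (n%:R * r + C%:R <= M%:R)%R -> cube n m y ->
  vol_le U V r y <= (N M k m / n%:R ^+ D)%:E.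
Proof. by move=> n0 r0 rM ym; have := vol_le_fiber_count (xb k) n0 r0 rM ym; rewrite fc -EFinM mulrC. Qed.

Let in_cube n (y : p.-tuple R) : (0 < n)%N -> cube n (cube_index n y) y.
Proof. by move=> n0; exact/mem_cube. Qed.

Let C1 n : (0 < n)%N -> (1 + C%:R / n%:R <= 1 + C%:R :> R)%R.
Proof. by move=> n0; rewrite lerD2l ler_piMr// invf_le1 ?ltr0n// ler1n. Qed.

Let C10 n : (0 <= 1 + C%:R / n%:R :> R)%R. Proof. by rewrite addr_ge0// divr_ge0. Qed.

Variable k0 : 'I_l.

(** The comparison at mesh 1 with radius 1 + C, which requires the box radius 1 + 2 C. In this way
    all the volumes in use are bounded by the size of a fixed box. *)
Let vol_bound y : vol_le U V (1 + C%:R)%R y <= (N (1 + 2 * C) k0 (cube_index 1 y))%:E.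
Proof.
have := @lower 1 k0 _ y (1 + 2 * C)%N (1 + C%:R)%R (ltn0Sn 0) _ _ (in_cube y (ltn0Sn 0)).
by rewrite expr1n divr1; apply; [rewrite addr_ge0|rewrite mul1r natrD natrM; lra].
Qed.

Definition size_bound : R := (size (boxseq d (1 + 2 * C)))%:R.

Let N_le n k m : (N n k m <= (size (boxseq d n))%:R)%R.
Proof. by rewrite ler_nat; exact: count_size. Qed.

Lemma lattice_count_ub n z : (0 < n)%N -> ((coset_count K n z)%:R <= size_bound * n%:R ^+ D :> R)%R.
Proof.
move=> n0; have nD : (0 < n%:R ^+ D :> R)%R by rewrite exprn_gt0// ltr0n.
have [[k m] _ em] : (e @` setT) (proj z).
  by case: e_bij => _ _; apply; exact: Hproj.
have -> : coset_count K n z = coset_count K n (x k + (U *m m : Zd d))%R.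
  have -> : (x k + (U *m m : Zd d))%R = proj z := em.
  apply/esym/eq_count => t; apply/asboolP/asboolP => h.
    by rewrite -(subrK (proj z) z) -addrA; apply: KD.
  by rewrite -(subrK z (proj z)) -addrA; apply: KD => //; rewrite -opprB; apply: KN.
pose y : p.-tuple R := [tuple ((m i 0)%:~R / n%:R)%R | i < p].
have ym : cube n m y.
  move=> i; rewrite tnth_mktuple lexx/= ltr_pM2r ?invr_gt0 ?ltr0n//.
  by rewrite ltrDl.
rewrite -ler_pdivrMr// -lee_fin; apply: le_trans (upper k n0 ym) _.
apply: (@le_trans _ _ (vol_le U V (1 + C%:R)%R y)).
  by apply: vol_le_mono; rewrite C10 C1.
by apply: le_trans (vol_bound y) _; rewrite lee_fin N_le.
Qed.

(** Let t be a point of the coset in the box of radius n and r the integer part of n / E. Since E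
    bounds the row sums of V, the points t + V q with q in the box of radius r stay in the box of
    radius 2 n; there are (2 r + 1)^D of them and 2 r + 1 >= n / E. *)
Lemma lattice_count_lb : exists2 c : R, (0 < c)%R & forall n z, (0 < n)%N -> coset_count K n z != 0%N ->
  (c * n%:R ^+ D <= (coset_count K (2 * n) z)%:R)%R.
Proof.
pose E := (entry_bound U V).+1; have E0 : (0 < E%:R :> R)%R by rewrite ltr0n.
exists (E%:R ^- D)%R; first by rewrite invr_gt0 exprn_gt0.
move=> n z n0 cn; have [t tb Kt] : exists2 t, t \in boxseq d n & K (z - t)%R.
  by move: cn; rewrite -lt0n -has_count => /hasP[t tb /asboolP Kt]; exists t.
pose r := (n %/ E)%N.
have inj : injective (fun q : Zd D => (t + (V *m q : Zd d))%R).
  by move=> q q' /addrI; exact: V_inj.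
apply: (@le_trans _ _ (size [seq (t + (V *m q : Zd d))%R | q <- boxseq D r])%:R); last first.
  rewrite ler_nat /coset_count -size_filter; apply: uniq_leq_size.
    by rewrite map_inj_uniq ?boxseq_uniq.
  move=> s /mapP[q qr ->]; rewrite mem_filter; apply/andP; split.
    apply/asboolP; rewrite opprD addrA; apply: KD => //; apply: KN; exact: V_mem.
  apply/mem_boxseq; rewrite mul2n -addnn; apply: boxD; first exact/mem_boxseq.
  apply/mem_boxP => i; rewrite mxE; move/mem_boxseq/mem_boxP in qr.
  apply: le_trans (ler_norm_sum _ _ _) _.
  apply: (@le_trans _ _ (\sum_j (absz (V i j) * r)%N%:Z)%R).
    apply: ler_sum => j _; rewrite normrM PoszM abszE; apply: ler_pM => //; exact: qr.
  rewrite -(big_morph Posz PoszD (erefl (Posz 0))) lez_nat -big_distrl/=.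
  apply: (@leq_trans (E * r)%N); last by rewrite mulnC leq_trunc_div.
  by rewrite leq_mul2r /E /entry_bound (bigD1 i)//= -addnS -addnA addnCA leq_addr orbT.
rewrite size_map size_boxseq natrX -exprVn -exprMn lerXn2r ?nnegrE ?mulr_ge0 ?invr_ge0 ?(ltW E0)//.
rewrite mulrC ler_pdivrMr// -natrM ler_nat.
by have := divn_eq n E; have := ltn_pmod n (ltn0Sn (entry_bound U V)); rewrite -/E -/r; nia.
Qed.

Let vol_ge0 r (y : p.-tuple R) : 0 <= vol_le U V r y. Proof. exact: measure_ge0. Qed.

Let J r := \int[lebesgue_tuple R p]_y poweR (vol_le U V r y) alpha.

Let mvolp r : (0 <= r)%R -> measurable_fun setT (fun y => poweR (vol_le U V r y) alpha).
Proof. by move=> r0; apply: (measurableT_comp (measurable_poweR _)); exact: measurable_vol_le. Qed.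

Let N0 n k m : (0 <= N n k m)%R. Proof. by []. Qed.

Let ND0 n M k m : (0 <= N M k m / n%:R ^+ D)%R. Proof. by rewrite divr_ge0// exprn_ge0. Qed.

Let A n M k := (n%:R ^- p)%:E * \int[zeta R [set: Zd p]]_m ((N M k m / n%:R ^+ D) `^ alpha)%:E.

Let A_cubes n M k : (0 < n)%N -> A n M k = \int[zeta R [set: Zd p]]_m
   \int[lebesgue_tuple R p]_(y in cube n m) (cst ((N M k m / n%:R ^+ D) `^ alpha)%:E y).
Proof.
move=> n0; rewrite /A -ge0_integralZl_EFin//; last by move=> m _; rewrite lee_fin powR_ge0.
apply: eq_integral => m _; rewrite integral_cst; last exact: measurable_cube.
by rewrite [X in _ = _ * X](cube_measure R m n0) muleC.
Qed.

Let le_poweR (a b : \bar R) : 0 <= a -> a <= b -> poweR a alpha <= poweR b alpha.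
Proof.
move=> a0 ab; apply: gt0_ler_poweR => //; first exact: ltW.
  by rewrite in_itv/= a0 leey.
by rewrite in_itv/= (le_trans a0 ab) leey.
Qed.

Let A_upper n k : (0 < n)%N -> A n n k <= J (1 + C%:R / n%:R)%R.
Proof.
move=> n0; rewrite A_cubes// /J (integral_cubes n0); last 2 first.
- exact: mvolp (C10 n).
- by move=> y; exact: poweR_ge0.
apply: le_integral_zeta => [m|m|m _].
- by apply: integral_ge0 => y _; rewrite lee_fin powR_ge0.
- by apply: integral_ge0 => y _; exact: poweR_ge0.
apply: ge0_le_integral.
- exact: measurable_cube.
- by move=> y _; rewrite lee_fin powR_ge0.
- exact: measurable_cst.
- by apply: measurable_funTS; exact: mvolp (C10 n).
move=> y ym; rewrite -poweR_EFin; apply: le_poweR; first by rewrite lee_fin.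
exact: upper.
Qed.

Let J_le n M (r : R) k : (0 < n)%N -> (0 <= r)%R -> (n%:R * r + C%:R <= M%:R)%R -> J r <= A n M k.
Proof.
move=> n0 r0 rM; rewrite A_cubes// /J (integral_cubes n0); last 2 first.
- exact: mvolp r0.
- by move=> y; exact: poweR_ge0.
apply: le_integral_zeta => [m|m|m _].
- by apply: integral_ge0 => y _; exact: poweR_ge0.
- by apply: integral_ge0 => y _; rewrite lee_fin powR_ge0.
apply: ge0_le_integral.
- exact: measurable_cube.
- by move=> y _; exact: poweR_ge0.
- by apply: measurable_funTS; exact: mvolp r0.
- exact: measurable_cst.
by move=> y ym; rewrite -poweR_EFin; apply: le_poweR => //; exact: lower rM ym.
Qed.

Let T n M := (n%:R ^- p)%:E * \int[zeta R H]_u (((coset_count K M u)%:R / n%:R ^+ D) `^ alpha)%:E.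

Let T_sum n M : T n M = \sum_(k < l) A n M k.
Proof.
rewrite /T (integral_zeta_pairs e_bij); last by move=> u; rewrite lee_fin powR_ge0.
rewrite ge0_sume_distrr//.
by move=> k _; apply: integral_ge0 => m _; rewrite lee_fin powR_ge0.
Qed.

Let A0 n M k : 0 <= A n M k.
Proof.
rewrite mule_ge0 ?lee_fin ?invr_ge0 ?exprn_ge0//.
by apply: integral_ge0 => m _; rewrite lee_fin powR_ge0.
Qed.

(** A nonzero count N satisfies N^alpha <= N^2 <= s N, where s is the size of the box, and the
    counts add up to s. *)
Lemma lattice_sum_fin n M : (0 < n)%N -> T n M < +oo.
Proof.
move=> n0; have nD : (0 < n%:R ^+ D :> R)%R by rewrite exprn_gt0// ltr0n.
rewrite /T; apply: lte_mul_pinfty; rewrite ?lee_fin ?invr_ge0 ?exprn_ge0//.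
pose s : R := (size (boxseq d M))%:R.
pose k : R := ((n%:R ^- D) `^ alpha * (1 + s))%R.
have k_ge0 : (0 <= k)%R by rewrite mulr_ge0 ?powR_ge0// addr_ge0.
apply: (@le_lt_trans _ _ (\int[zeta R H]_u (k%:E * (coset_count K M u)%:R%:E))).
  apply: le_integral_zeta => [u|u|u _]; [by rewrite lee_fin powR_ge0|by rewrite mule_ge0 ?lee_fin|].
  rewrite -EFinM lee_fin powRM ?invr_ge0 ?exprn_ge0// mulrC /k -mulrA ler_wpM2l ?powR_ge0//.
  have [->|cn0] := eqVneq (coset_count K M u) 0%N; first by rewrite powR0 ?gt_eqF// mulr0.
  have c1 : (1 <= (coset_count K M u)%:R :> R)%R by rewrite ler1n lt0n.
  have cs : ((coset_count K M u)%:R <= s :> R)%R by rewrite ler_nat count_size.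
  apply: (@le_trans _ _ ((coset_count K M u)%:R `^ 2)%R).
    by apply: ler_powR => //; case/andP: alpha02 => _ /ltW.
  by rewrite powR_mulrn// expr2 ler_wpM2r// (le_trans cs)// lerDr.
rewrite ge0_integralZl_EFin//.
have := @sum_coset_count1 R d H K proj KN Hproj Kproj proj_unique (boxseq d M).
by rewrite /coset_count => ->; rewrite -EFinM ltry.
Qed.

(** The comparison at mesh 1 bounds the integral by a lattice sum, finite by [lattice_sum_fin]. *)
Let J_fin r : (0 <= r <= 1 + C%:R)%R -> J r \is a fin_num.
Proof.
move=> /andP[r0 r1]; rewrite ge0_fin_numE; last by apply: integral_ge0 => y _; exact: poweR_ge0.
have rM : (1%:R * r + C%:R <= (1 + 2 * C)%:R :> R)%R by rewrite mul1r natrD natrM; lra.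
apply: le_lt_trans (J_le k0 (ltn0Sn 0) r0 rM) _.
apply: le_lt_trans (lattice_sum_fin (1 + 2 * C) (ltn0Sn 0)).
by rewrite T_sum (bigD1 k0)//= leeDl// sume_ge0.
Qed.

Let vol_cvg (y : p.-tuple R) : vol_le U V (1 + C%:R / n.+1%:R)%R y @[n --> \oo] --> vol_le U V 1%R y.
Proof.
pose F n := Qset_le U V (1 + C%:R / n.+1%:R)%R y.
have mF n : measurable (F n) by exact: measurable_Qset.
have FE : \bigcap_n F n = Qset_le U V 1%R y.
  apply/seteqP; split=> [lam h|lam h n _]; last first.
    by rewrite /F /Qset_le /=; apply: le_trans h _; rewrite lerDl divr_ge0.
  rewrite /Qset_le /=; apply/ler_addgt0Pr => eps e0.
  have c0 : (C%:R / n.+1%:R)%R @[n --> \oo] --> (0 : R)%R.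
    have h0 : (C%:R * 0 = 0 :> R)%R by rewrite mulr0.
    by rewrite -h0; apply: cvgM; [exact: cvg_cst|exact: cvg_harmonic].
  have [n hn] := filter_ex (cvgr_near_le c0 e0).
  by apply: le_trans (h n I) _; rewrite lerD2l.
have := @nonincreasing_cvg_mu _ _ _ (lebesgue_tuple R D) F.
rewrite FE; apply => //.
- apply: (@le_lt_trans _ _ (vol_le U V (1 + C%:R)%R y)).
    by apply: vol_le_mono; rewrite C10 C1.
  by apply: le_lt_trans (vol_bound y) _; exact: ltry.
- exact: measurable_Qset.
apply/nonincreasing_seqP => n; apply/subsetPset => lam h; apply: le_trans h _.
by rewrite lerD2l ler_wpM2l// lef_pV2 ?posrE ?ltr0n// ler_nat.
Qed.

Let vol_fin r (y : p.-tuple R) : (0 <= r <= 1 + C%:R)%R -> vol_le U V r y \is a fin_num.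
Proof.
move=> rC; rewrite ge0_fin_numE//; apply: le_lt_trans (vol_le_mono U V y rC) _.
by apply: le_lt_trans (vol_bound y) _; exact: ltry.
Qed.

Let one_le : (0 <= (1 : R) <= 1 + C%:R)%R. Proof. by rewrite ler01 lerDl ler0n. Qed.

Let J_cvg : J (1 + C%:R / n.+1%:R)%R @[n --> \oo] --> J 1%R.
Proof.
have := @dominated_convergence _ _ R (lebesgue_tuple R p) setT measurableT
  (fun n y => poweR (vol_le U V (1 + C%:R / n.+1%:R)%R y) alpha)
  (fun y => poweR (vol_le U V 1%R y) alpha) (fun y => poweR (vol_le U V (1 + C%:R)%R y) alpha).
case => //.
- by move=> n; exact: mvolp.
- exact: mvolp.
- apply: aeW => y _.
  have f1 n : vol_le U V (1 + C%:R / n.+1%:R)%R y \is a fin_num by apply: vol_fin; rewrite C10 C1.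
  have g1 : vol_le U V 1%R y \is a fin_num by exact: vol_fin.
  pose v n := fine (vol_le U V (1 + C%:R / n.+1%:R)%R y); pose w := fine (vol_le U V 1%R y).
  pose mx := fine (vol_le U V (1 + C%:R)%R y).
  have vw : v n @[n --> \oo] --> w by have /fine_cvgP[_] : vol_le U V (1 + C%:R / n.+1%:R)%R y @[n --> \oo] --> w%:E by rewrite fineK; [exact: vol_cvg|exact: g1].
  have m1 : vol_le U V (1 + C%:R)%R y \is a fin_num by apply: vol_fin; rewrite lexx andbT addr_ge0.
  have vm n : (0 <= v n <= mx)%R by rewrite fine_ge0//= fine_le// vol_le_mono// C10 C1.
  have wm : (0 <= w <= mx)%R by rewrite fine_ge0//= fine_le// vol_le_mono.
  have k00 : (0 < Num.min alpha 1)%R by rewrite lt_min ltr01 alpha0.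
  (* Continuity of the power on [0, mx], through the increment bound with exponent min(alpha, 1). *)
  have key : (v n `^ alpha)%R @[n --> \oo] --> (w `^ alpha)%R.
    have d0 : `|v n - w|%R @[n --> \oo] --> (0 : R)%R.
      by have := cvg_norm (cvgB vw (cvg_cst w)); rewrite subrr normr0; apply.
    have := cvg_powR0 k00 (fun n => normr_ge0 (v n - w)%R) d0.
    move=> /(cvgM (cvg_cst (2 * mx `^ (alpha - Num.min alpha 1))%R)); rewrite mulr0 => d1.
    apply/cvgrPdist_le => tau tau0; have := cvgr_near_le d1 tau0; apply: filterS => n hn.
    by rewrite distrC; apply: le_trans hn; exact: powR_increment_le.
  rewrite (_ : (fun n => _) = EFin \o (fun n => v n `^ alpha)%R); last first.
    by apply/funext => n; rewrite /= -poweR_EFin fineK.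
  rewrite -(fineK g1) poweR_EFin; apply/cvg_EFin; [exact: nearW|exact: key].
- apply/integrableP; split; first by apply: mvolp; rewrite addr_ge0.
  under eq_integral do rewrite gee0_abs ?poweR_ge0//.
  have : J (1 + C%:R)%R \is a fin_num by apply: J_fin; rewrite lexx andbT addr_ge0.
  by rewrite ge0_fin_numE//; apply: integral_ge0 => y _; exact: poweR_ge0.
apply: aeW => y n _; rewrite gee0_abs ?poweR_ge0//; apply: le_poweR => //.
by apply: vol_le_mono; rewrite C10 C1.
Qed.

Definition lattice_average n : R := fine (T n n).

Lemma lattice_averageE n : (0 < p)%N -> T n n = (lattice_average n)%:E.
Proof.
move=> p0; rewrite /lattice_average fineK//; case: n => [|n].
  by rewrite /T expr0n gtn_eqF// invr0 mul0e.
rewrite ge0_fin_numE; first exact: lattice_sum_fin.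
by rewrite T_sum sume_ge0.
Qed.

Lemma lattice_volume_fin : J 1%R \is a fin_num. Proof. exact: J_fin. Qed.

(** Changing the mesh from 1 / n to 1 / M multiplies the sum exactly by (n / M)^(p + alpha D). As n
    <= M and alpha <= 2, this is at least the power with natural exponent p + 2 D. *)
Let T_scale n M : (0 < n)%N -> (n <= M)%N ->
  ((n%:R / M%:R) ^+ (p + 2 * D))%:E * T n M <= T M M.
Proof.
move=> n0 nM; have M0 : (0 < M)%N by exact: leq_trans nM.
have nR : (0 < n%:R :> R)%R by rewrite ltr0n.
have MR : (0 < M%:R :> R)%R by rewrite ltr0n.
rewrite /T muleA -EFinM.
have -> : ((n%:R / M%:R) ^+ (p + 2 * D) / n%:R ^+ p = M%:R ^- p * (n%:R / M%:R) ^+ (2 * D) :> R)%R.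
  by rewrite exprD !expr_div_n; field; rewrite !expf_neq0// gt_eqF.
rewrite EFinM -muleA; apply: lee_wpmul2l; first by rewrite lee_fin invr_ge0 exprn_ge0.
rewrite -ge0_integralZl_EFin ?exprn_ge0 ?divr_ge0//.
apply: le_integral_zeta => [u|u|u _].
- by rewrite mule_ge0 ?lee_fin ?powR_ge0 ?exprn_ge0 ?divr_ge0.
- by rewrite lee_fin powR_ge0.
rewrite -EFinM lee_fin; pose rho : R := ((n%:R / M%:R) ^+ D)%R.
have rho0 : (0 < rho)%R by rewrite exprn_gt0// divr_gt0.
have rho1 : (rho <= 1)%R by rewrite exprn_ile1 ?divr_ge0// ler_pdivrMr// mul1r ler_nat.
have -> : ((coset_count K M u)%:R / M%:R ^+ D = rho * ((coset_count K M u)%:R / n%:R ^+ D) :> R)%R.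
  by rewrite /rho expr_div_n; field; rewrite !expf_neq0// gt_eqF.
rewrite powRM ?(ltW rho0) ?divr_ge0 ?exprn_ge0// ler_wpM2r ?powR_ge0//.
rewrite mulnC exprM -/rho -powR_mulrn ?(ltW rho0)//.
apply: ger_powR; first by rewrite rho0.
by case/andP: alpha02 => _ /ltW.
Qed.

(** Squeeze. From above, the dilated integrals decrease to the one of radius 1. From below, a
    slightly coarser mesh makes the radius 1 admissible, and [T_scale] restores the mesh at the cost
    of a factor tending to 1. *)
Lemma lattice_average_cvg : lattice_average n @[n --> \oo] --> (l%:R * fine (J 1))%R.
Proof.
have sumJ r : \sum_(k < l) J r = l%:R%:E * J r.
  by rewrite big_const_ord iter_adde adde0 mule_natl || rewrite sumr_const card_ord mule_natl.
have Jf n : J (1 + C%:R / n.+1%:R)%R \is a fin_num by apply: J_fin; rewrite C10 C1.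
have J1f := lattice_volume_fin.
have Tf n : T n.+1 n.+1 \is a fin_num.
  rewrite ge0_fin_numE; first exact: lattice_sum_fin.
  by rewrite T_sum sume_ge0.
have hi : (l%:R * fine (J (1 + C%:R / n.+1%:R)))%R @[n --> \oo] --> (l%:R * fine (J 1))%R.
  apply: cvgM; first exact: cvg_cst.
  have Jc : J (1 + C%:R / n.+1%:R)%R @[n --> \oo] --> (fine (J 1%R))%:E by rewrite fineK; [exact: J_cvg|exact: J1f].
  by have /fine_cvgP[_] := Jc.
have lo : ((1 - C%:R / n.+1%:R) ^+ (p + 2 * D) * (l%:R * fine (J 1)))%R @[n --> \oo] --> (l%:R * fine (J 1))%R.
  have h1 : (1 - C%:R / n.+1%:R)%R @[n --> \oo] --> (1 : R)%R.
    have e1 : (1 - C%:R * 0 = 1 :> R)%R by rewrite mulr0 subr0.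
    rewrite -[X in _ --> X]e1; apply: cvgB; first exact: cvg_cst.
    by apply: cvgM; [exact: cvg_cst|exact: cvg_harmonic].
  have h2 := continuous_cvg _ (@exprn_continuous R (p + 2 * D) 1%R) h1.
  rewrite expr1n in h2.
  rewrite -[X in _ --> X]mul1r; apply: cvgM; [exact: h2|exact: cvg_cst].
rewrite -cvg_shiftS; apply: squeeze_cvgr lo hi; near=> n.
have nC : (C <= n)%N by near: n; exact: nbhs_infty_ge.
(* The mesh for which n0 + C = n + 1, the condition of [J_le] at r = 1. *)
pose n0 := (n.+1 - C)%N; have n00 : (0 < n0)%N by rewrite /n0; lia.
apply/andP; split; last first.
  rewrite -lee_fin /lattice_average fineK// EFinM fineK// -sumJ T_sum.
  by apply: lee_sum => k _; exact: A_upper.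
have lJ : (l%:R * fine (J 1))%:E <= T n0 n.+1.
  rewrite EFinM fineK// -sumJ T_sum; apply: lee_sum => k _; apply: J_le => //.
  by rewrite mulr1 -natrD ler_nat /n0; lia.
have rE : (1 - C%:R / n.+1%:R = n0%:R / n.+1%:R :> R)%R.
  rewrite /n0 natrB; last by lia.
  by rewrite mulrBl divff// pnatr_eq0.
have gE : (lattice_average n.+1)%:E = T n.+1 n.+1 by exact: fineK (Tf n).
have h : (n0 <= n.+1)%N by rewrite /n0; lia.
have le1 : ((n0%:R / n.+1%:R) ^+ (p + 2 * D) * (l%:R * fine (J 1)))%:E <= (lattice_average n.+1)%:E.
  rewrite gE EFinM; apply: le_trans (T_scale n00 h); apply: lee_wpmul2l; last exact: lJ.
  by rewrite lee_fin exprn_ge0// divr_ge0.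
rewrite lee_fin in le1; rewrite rE; exact: le1.
Unshelve. all: by end_near. Qed.

End lattice_asymptotics.

(** * Uniqueness of stable integrals *)

Lemma measurable_powR_comp (R : realType) dT (T : measurableType dT) (h : T -> R) (p : R) :
  measurable_fun setT h -> measurable_fun setT (fun x => h x `^ p).
Proof.
by move=> mh; apply: (measurableT_comp (f := fun x : R => x `^ p)) => //; exact: measurable_powR.
Qed.

Section trigonometric_bounds.
Context (R : realType).
Implicit Types z : R.

(** On [0, 1] the function x - sin x + cos x has derivative 1 - (sin x + cos x) <= 0, since (sin +
    cos)^2 = 1 + 2 sin cos >= 1 there; so it stays below its value 1 at 0. The linearization error
    of the sine is thus bounded by a quantity whose mean is read off the characteristic function. *)
Lemma le_sub_sin z : `|z| <= 1 -> `|z - sin z| <= 1 - cos z.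
Proof.
wlog z0 : z / 0 <= z.
  move=> h z1; have [|/ltW zn] := leP 0 z; first by move=> /h; exact.
  have e : - z - sin (- z) = - (z - sin z) by rewrite sinN; ring.
  by have := h (- z); rewrite oppr_ge0 normrN e normrN cosN; apply.
rewrite ger0_norm// => z1.
have sc (c : R) : 0 <= c <= 1 -> [/\ 0 <= sin c, 0 <= cos c & 1 <= sin c + cos c].
  move=> /andP[c0 c1]; have pi2 := pi_ge2 R.
  have s0 : 0 <= sin c by apply: sin_ge0_pi; lra.
  have k0 : 0 <= cos c by apply: cos_ge0_pihalf; lra.
  split => //; have := cos2Dsin2 c; have := cos_le1 c; have := sin_le1 c; nra.
have key (f df : R -> R) : (forall x : R, is_derive x (1 : R) f (df x)) -> (forall x, 0 <= x <= 1 -> df x <= 0) ->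
    f z <= f 0.
  move=> fd df0.
  have cf : {within `[0, z], continuous f}.
    apply: continuous_subspaceT => x; apply: differentiable_continuous.
    by apply/derivable1_diffP; have := fd x; case.
  have [c cz e] := @MVT_segment R f df 0 z z0 (fun x _ => fd x) cf.
  rewrite -subr_le0 e mulr_le0_ge0//; last by rewrite subr0.
  apply: df0; move: cz; rewrite in_itv/= => /andP[-> cz]; exact: le_trans cz z1.
have ds (x : R) : is_derive (x : R) (1 : R) (sin - id : R -> R) (cos x - 1).
  by apply: is_deriveB.
have dc (x : R) : is_derive (x : R) (1 : R) (id - sin + cos : R -> R) (1 - cos x + - sin x).
  by apply: is_deriveD; apply: is_deriveB.
have h1 := key _ _ dc.
have h2 := key _ _ ds.
rewrite ger0_norm; last first.
  have : sin z - z <= sin 0 - 0.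
    by apply: h2 => x _; rewrite subr_le0 cos_le1.
  by rewrite sin0 subr0 => ?; lra.
have : z - sin z + cos z <= 0 - sin 0 + cos 0.
  by apply: h1 => x /sc[? ? ?]; lra.
by rewrite sin0 cos0; lra.
Qed.

Lemma cos_half_lt1 : cos (2^-1 : R) < 1.
Proof.
have pi2 := pi_ge2 R; rewrite -[ltRHS](cos0 R) ltr_cos ?invr_gt0// in_itv/=; apply/andP; split; lra.
Qed.

Lemma sub_cos_ge z : 2^-1 <= `|z| <= 1 -> 1 - cos (2^-1) <= 1 - cos z.
Proof.
have pi2 := pi_ge2 R.
have -> : cos z = cos `|z| by case: (ger0P z) => _; rewrite ?cosN.
move=> /andP[h1 h2]; rewrite lerB//; move: h1; rewrite le_eqVlt => /predU1P[<-//|h1].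
by apply: ltW; rewrite ltr_cos// in_itv/=; apply/andP; split; lra.
Qed.

(** A large |z| is detected by a single term of the series of the 1 - cos (z / 2^k): at this k the
    term is at least 1 - cos (1 / 2). *)
Lemma dyadic_scale z : 1 <= `|z| -> exists k : nat, 2^-1 <= `|z / 2 ^+ k| <= 1.
Proof.
move=> z1; have p2 k : 0 < 2 ^+ k :> R by rewrite exprn_gt0.
have ex : exists k, `|z| <= 2 ^+ k.
  exists (Num.bound `|z|); apply: ltW; apply: (lt_le_trans (archi_boundP (normr_ge0 z))).
  by rewrite -natrX ler_nat ltnW// ltn_expl.
case: (ex_minnP ex) => -[|k] hk hmin.
  by exists 0%N; rewrite expr0 divr1; move: hk; rewrite expr0 => hk; apply/andP; split => //; lra.
exists k.+1; rewrite normrM normfV (gtr0_norm (p2 _)) ler_pdivrMr// mul1r hk andbT.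
rewrite ler_pdivlMr// exprS mulrA mulVf// mul1r leNgt; apply/negP => /ltW /hmin.
by rewrite ltnn.
Qed.

End trigonometric_bounds.

Section SaS_variables.
Context (R : realType) dO (Omega : measurableType dO) (P : probability Omega R).
Variables (alpha : R) (alpha0 : 0 < alpha).
Implicit Types Z : {RV P >-> R}.
Local Open Scope ereal_scope.

Lemma bounded_integrable (f : Omega -> R) (K : R) : measurable_fun setT f ->
  (forall w, `|f w| <= K)%R -> P.-integrable setT (EFin \o f).
Proof.
move=> mf fK; apply/integrableP; split; first exact/measurable_EFinP.
apply: (@le_lt_trans _ _ (\int[P]_w (cst K%:E w))).
  apply: ge0_le_integral => //.
  - by apply/measurable_EFinP; exact: measurableT_comp.
  - by move=> w _; rewrite lee_fin (le_trans _ (fK w)).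
by rewrite integral_cst// [X in _ * X]probability_setT mule1 ltry.
Qed.

Lemma measurable_cos_comp Z (t : R) : measurable_fun setT (fun w => cos (t * Z w))%R.
Proof.
apply: (measurableT_comp (f := @cos R)); last exact: measurable_funM.
by apply: continuous_measurable_fun; exact: continuous_cos.
Qed.

Lemma measurable_sin_comp Z : measurable_fun setT (fun w => sin (Z w))%R.
Proof.
apply: (measurableT_comp (f := @sin R)) => //.
by apply: continuous_measurable_fun; exact: continuous_sin.
Qed.

Lemma SaS_sub_cos Z sigma (t : R) : (0 <= sigma)%R -> is_SaS P alpha sigma Z ->
  \int[P]_w (1 - cos (t * Z w))%:E <= ((sigma * `|t|) `^ alpha)%:E.
Proof.
move=> s0 /(_ t)[h _].
have i1 : P.-integrable setT (EFin \o (fun=> 1%R : R)).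
  by apply: (@bounded_integrable _ 1%R) => // w; rewrite normr1.
have ic : P.-integrable setT (EFin \o (fun w => cos (t * Z w))%R).
  by apply: (@bounded_integrable _ 1%R) => [|w]; [exact: measurable_cos_comp|exact: cos_max].
under eq_integral do rewrite EFinB.
rewrite integralB_EFin// h integral_cst// [X in _ * X - _]probability_setT mule1 -EFinB lee_fin.
have := @expR_ge1Dx R (- (sigma * `|t|) `^ alpha)%R; lra.
Qed.

Lemma SaS_sin_sqr Z sigma : (0 <= sigma)%R -> is_SaS P alpha sigma Z ->
  \int[P]_w ((sin (Z w)) ^+ 2)%:E <= ((sigma * 2) `^ alpha)%:E.
Proof.
move=> s0 hZ; have := SaS_sub_cos 2 s0 hZ; rewrite ger0_norm//; apply: le_trans.
apply: ge0_le_integral => //.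
- by move=> w _; rewrite lee_fin sqr_ge0.
- by apply/measurable_EFinP; apply: measurable_funX; exact: measurable_sin_comp.
- by apply/measurable_EFinP; apply: measurable_funB => //; exact: measurable_cos_comp.
move=> w _; rewrite lee_fin [(2 * _)%R]mulr_natl mulr2n cosD -!expr2 cos2sin2.
by have := sqr_ge0 (sin (Z w)); lra.
Qed.

(** The factor 1 - cos (1 / 2) is the lower bound of the detecting term, and 1 - 2^(-alpha) comes
    from the geometric series of the means. *)
Definition SaS_tail_cst : R := ((1 - cos (2^-1)) * (1 - (2^-1) `^ alpha))^-1.

Lemma SaS_tail_cst_ge0 : (0 <= SaS_tail_cst)%R.
Proof.
rewrite invr_ge0 mulr_ge0 ?subr_ge0 ?cos_le1//.
have e1 : (1 = 1 `^ alpha :> R)%R by rewrite powR1.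
rewrite [leRHS]e1; apply: ge0_ler_powR; rewrite ?nnegrE// ?(ltW alpha0)//.
by rewrite invf_le1// ler1n.
Qed.

(** On |Z| > 1 the series over k of 1 - cos (Z / 2^k) is at least 1 - cos (1 / 2). Its mean is at
    most the sum of (sigma / 2^k)^alpha, by 1 - exp(-x) <= x. *)
Lemma SaS_tail Z sigma : (0 <= sigma)%R -> is_SaS P alpha sigma Z ->
  P [set w | (1 < `|Z w|)%R] <= (SaS_tail_cst * sigma `^ alpha)%:E.
Proof.
move=> s0 hZ; pose r : R := ((2^-1) `^ alpha)%R.
have c0 : (0 < 1 - cos (2^-1) :> R)%R by rewrite subr_gt0 cos_half_lt1.
have r0 : (0 <= r)%R by exact: powR_ge0.
have r1 : (r < 1)%R.
  have e1 : (1 = 1 `^ alpha :> R)%R by rewrite powR1.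
  rewrite /r [ltRHS]e1; apply: gt0_ltr_powR; rewrite ?nnegrE//.
  by rewrite invf_lt1// ltr1n.
pose g k w := (1 - cos ((2 ^- k) * Z w) : R)%R.
have g0 k w : (0 <= g k w)%R by rewrite subr_ge0 cos_le1.
have mg k : measurable_fun setT (fun w => (g k w)%:E).
  by apply/measurable_EFinP; apply: measurable_funB => //; exact: measurable_cos_comp.
pose A := [set w | (1 < `|Z w|)%R].
have mA : measurable A by exact: measurable_absr_gt.
have ptw w : (1 - cos (2^-1))%:E * (\1_A w)%:E <= \sum_(k <oo) (g k w)%:E.
  rewrite indicE; case: (boolP (w \in A)) => [/set_mem /ltW /dyadic_scale[k hk]|_]; last first.
    by rewrite mule0; apply: nneseries_ge0 => k _ _; rewrite lee_fin.
  rewrite mule1; apply: (@le_trans _ _ (g k w)%:E).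
    by rewrite lee_fin /g mulrC; exact: sub_cos_ge.
  have h : \sum_(0 <= i < k.+1) (g i w)%:E <= \sum_(i <oo) (g i w)%:E.
    by apply: nneseries_lim_ge => n _ _; rewrite lee_fin.
  apply: le_trans h; rewrite big_nat_recr//= leeDr// sume_ge0// => i _.
  by rewrite lee_fin.
have key : (1 - cos (2^-1))%:E * P A <= \sum_(k <oo) ((sigma `^ alpha * r ^+ k)%:E).
  apply: (@le_trans _ _ (\int[P]_w \sum_(k <oo) (g k w)%:E)).
    have -> : (1 - cos (2^-1))%:E * P A = \int[P]_w ((1 - cos (2^-1))%:E * (\1_A w)%:E).
      rewrite ge0_integralZl_EFin ?ltW//; first by rewrite integral_indic// setIT.
      by apply/measurable_EFinP; exact: measurable_indic.
    apply: ge0_le_integral => //.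
    - by apply: emeasurable_funM => //; apply/measurable_EFinP; exact: measurable_indic.
    - by apply: ge0_emeasurable_sum => // k w _; rewrite lee_fin.
  rewrite integral_nneseries//; last by move=> k w _; rewrite lee_fin.
  apply: lee_nneseries => [k _ _|k _].
    by apply: integral_ge0 => w _; rewrite lee_fin.
  have := SaS_sub_cos (2 ^- k) s0 hZ => /le_trans; apply; rewrite lee_fin ger0_norm ?invr_ge0 ?exprn_ge0//.
  rewrite powRM ?invr_ge0 ?exprn_ge0// ler_wpM2l ?powR_ge0// /r.
  by rewrite -powR_mulrn ?powR_ge0// -powRrM mulrC powRrM powR_mulrn ?invr_ge0// exprVn.
rewrite nneseries_geometric ?r0// in key.
have fP : P A \is a fin_num by exact: fin_num_measure.
move: key; rewrite -/A -(fineK fP) -EFinM !lee_fin /SaS_tail_cst -/r ler_pdivlMr ?subr_gt0// => key.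
have z0 : (0 < (1 - cos (2^-1)) * (1 - r))%R by apply: mulr_gt0 => //; rewrite subr_gt0.
by rewrite ler_pdivlMl// mulrAC.
Qed.

Lemma is_SaS_scale (a sigma : R) (Y : Omega -> R) : is_SaS P alpha sigma Y ->
  is_SaS P alpha (`|a| * sigma)%R (fun w => a * Y w)%R.
Proof.
move=> h t; have [h1 h2] := h (t * a)%R; split.
  have -> : (`|a| * sigma * `|t| = sigma * `|t * a|)%R by rewrite normrM; ring.
  by rewrite -h1; apply: eq_integral => w _; rewrite mulrA.
by rewrite -h2; apply: eq_integral => w _; rewrite mulrA.
Qed.

Lemma sum_tail_cst_ge0 (e : R) : (0 < e)%R ->
  (0 <= SaS_tail_cst + 4 / e ^+ 2 * 2 `^ alpha + 2 / e)%R.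
Proof.
move=> e0; apply: addr_ge0; last by apply: divr_ge0 => //; exact: ltW.
apply: addr_ge0; first exact: SaS_tail_cst_ge0.
by apply: mulr_ge0; [apply: divr_ge0 => //; exact: sqr_ge0|exact: powR_ge0].
Qed.

(* Uncorrelated sines and the tail bound replace the characteristic function of
   the sum. *)
Section sums.
Context (I : eqType) (Z : I -> {RV P >-> R}) (sigma : I -> R) (s : seq I).
Hypothesis us : uniq s.
Hypothesis sigma0 : forall i, (0 <= sigma i)%R.
Hypothesis hZ : forall i, i \in s -> is_SaS P alpha (sigma i) (Z i).
Hypothesis orth : forall i j, i \in s -> j \in s -> i != j ->
  \int[P]_w (sin (Z i w) * sin (Z j w))%:E = 0.

Lemma integral_sum_sin_sqr :
  \int[P]_w ((\sum_(i <- s) sin (Z i w)) ^+ 2)%:E <=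
  (\sum_(i <- s) (sigma i * 2) `^ alpha)%:E.
Proof.
have int i j : P.-integrable setT (fun w => (sin (Z i w) * sin (Z j w))%:E).
  apply: (@bounded_integrable (fun w => sin (Z i w) * sin (Z j w))%R 1%R) => [|w].
    by apply: measurable_funM; exact: measurable_sin_comp.
  by rewrite normrM mulr_ile1 ?sin_max.
have -> : \int[P]_w ((\sum_(i <- s) sin (Z i w)) ^+ 2)%:E =
    \sum_(i <- s) \sum_(j <- s) \int[P]_w (sin (Z i w) * sin (Z j w))%:E.
  under [RHS]eq_bigr => i _ do rewrite -(integral_sum measurableT (int i)).
  rewrite -(@integral_sum _ _ _ P setT measurableT); last by move=> i; apply: integrable_sum.
  apply: eq_integral => w _; rewrite expr2 big_distrlr/= -sumEFin.
  by apply: eq_bigr => i _; rewrite -sumEFin.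
rewrite -sumEFin big_seq [leRHS]big_seq; apply: lee_sum => i si.
rewrite (bigD1_seq i)//= big1_seq ?adde0; last by move=> j /andP[ji js]; rewrite orth// eq_sym.
apply: le_trans (SaS_sin_sqr (sigma0 i) (hZ si)); rewrite le_eqVlt; apply/orP; left; apply/eqP.
by apply: eq_integral => w _; rewrite expr2.
Qed.

(** If no |Z_i| exceeds 1, the sum differs from the sum of the sines by at most the sum of the 1 -
    cos Z_i. The constants 4 / e^2 and 2 / e are those of Chebyshev's and Markov's inequalities at
    level e / 2; the remaining one pays for some |Z_i| > 1. *)
Lemma sum_tail (e : R) : (0 < e)%R -> P [set w | (e < `|\sum_(i <- s) Z i w|)%R] <=
  ((SaS_tail_cst + 4 / e ^+ 2 * 2 `^ alpha + 2 / e) * \sum_(i <- s) sigma i `^ alpha)%:E.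
Proof.
move=> e0; pose S w := (\sum_(i <- s) sin (Z i w))%R.
pose B1 w := (\sum_(i <- s) (\1_[set w | (1 < `|Z i w|)%R] w : R))%R.
pose B3 w := (\sum_(i <- s) (1 - cos (1 * Z i w)))%R.
pose A := [set w | (e < `|\sum_(i <- s) Z i w|)%R].
have mA : measurable A by apply: measurable_absr_gt; apply: measurable_sum => i.
have mAi i : measurable [set w | (1 < `|Z i w|)%R] by exact: measurable_absr_gt.
have mB1 : measurable_fun setT B1 by apply: measurable_sum => i; exact: measurable_indic.
have mS : measurable_fun setT S by apply: measurable_sum => i; exact: measurable_sin_comp.
have mc i : measurable_fun setT (fun w => 1 - cos (1 * Z i w))%R.
  by apply: measurable_funB => //; exact: measurable_cos_comp.
have mB3 : measurable_fun setT B3 by exact: measurable_sum.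
have B10 w : (0 <= B1 w)%R by apply: sumr_ge0 => i _; rewrite indicE.
have B30 w : (0 <= B3 w)%R by apply: sumr_ge0 => i _; rewrite subr_ge0 cos_le1.
pose k1 : R := (4 / e ^+ 2)%R; pose k2 : R := (2 / e)%R.
have k10 : (0 <= k1)%R by rewrite divr_ge0 ?sqr_ge0.
have k20 : (0 <= k2)%R by rewrite divr_ge0 ?ltW.
have ptw w : (\1_A w <= B1 w + (k1 * S w ^+ 2 + k2 * B3 w))%R.
  have q0 : (0 <= k1 * S w ^+ 2)%R by rewrite mulr_ge0 ?sqr_ge0.
  have t0 : (0 <= k2 * B3 w)%R by rewrite mulr_ge0.
  have b0 := B10 w.
  rewrite indicE; case: (boolP (w \in A)) => [/set_mem wA|_]; last by rewrite !addr_ge0.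
  have [/hasP[i si zi]|/hasPn no] := boolP (has (fun i => 1 < `|Z i w|)%R s).
    apply: (@le_trans _ _ (B1 w)); last by rewrite lerDl addr_ge0.
    by rewrite /B1 (bigD1_seq i)//= indicE mem_set// lerDl sumr_ge0.
  have h : (`|\sum_(i <- s) Z i w| <= `|S w| + B3 w)%R.
    have -> : (\sum_(i <- s) Z i w = S w + \sum_(i <- s) (Z i w - sin (Z i w)))%R.
      by rewrite sumrB /S addrC subrK.
    apply: le_trans (ler_normD _ _) _; rewrite lerD2l.
    apply: le_trans (ler_norm_sum _ _ _) _; rewrite /B3 big_seq [leRHS]big_seq.
    by apply: ler_sum => i si; rewrite mul1r; apply: le_sub_sin; rewrite leNgt no.
  have {h} : (e < `|S w| + B3 w)%R by exact: lt_le_trans wA h.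
  have [hS|hS] := leP `|S w|%R (e / 2)%R => h.
    have : (1 <= k2 * B3 w)%R by rewrite /k2 mulrAC ler_pdivlMr// mul1r; lra.
    by rewrite /=; lra.
  have : (1 <= k1 * S w ^+ 2)%R.
    rewrite /k1 mulrAC ler_pdivlMr ?exprn_gt0// mul1r -(real_normK (num_real (S w))).
    by move: hS; set x := `|S w|%R => hS; nra.
  by rewrite /=; lra.
have -> : P [set w | (e < `|\sum_(i <- s) Z i w|)%R] = \int[P]_w (\1_A w)%:E.
  by rewrite integral_indic// setIT.
have mSk : measurable_fun setT (fun w => (S w ^+ 2)%:E).
  by apply/measurable_EFinP; exact: measurable_funX.
apply: (@le_trans _ _ (\int[P]_w ((B1 w)%:E + (k1%:E * (S w ^+ 2)%:E + k2%:E * (B3 w)%:E)))).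
  apply: ge0_le_integral => //.
  - by apply/measurable_EFinP; exact: measurable_indic.
  - apply: emeasurable_funD; first exact/measurable_EFinP.
    by apply: emeasurable_funD; apply: emeasurable_funM => //; exact/measurable_EFinP.
  - by move=> w _; rewrite -!EFinM -!EFinD lee_fin.
have pS w : 0 <= (S w ^+ 2)%:E by rewrite lee_fin sqr_ge0.
have p3 w : 0 <= (B3 w)%:E by rewrite lee_fin.
have m3 : measurable_fun setT (fun w => (B3 w)%:E) by exact/measurable_EFinP.
have mk1 : measurable_fun setT (fun w => k1%:E * (S w ^+ 2)%:E) by exact: emeasurable_funM.
have mk2 : measurable_fun setT (fun w => k2%:E * (B3 w)%:E) by exact: emeasurable_funM.
have pk1 w : 0 <= k1%:E * (S w ^+ 2)%:E by rewrite mule_ge0// lee_fin.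
have pk2 w : 0 <= k2%:E * (B3 w)%:E by rewrite mule_ge0// lee_fin.
have -> : \int[P]_w ((B1 w)%:E + (k1%:E * (S w ^+ 2)%:E + k2%:E * (B3 w)%:E)) =
    \int[P]_w (B1 w)%:E + (k1%:E * \int[P]_w (S w ^+ 2)%:E + k2%:E * \int[P]_w (B3 w)%:E).
  rewrite ge0_integralD//.
  - rewrite ge0_integralD// ge0_integralZl_EFin// ge0_integralZl_EFin//.
  - by move=> w _; rewrite lee_fin.
  - exact/measurable_EFinP.
  - by move=> w _; rewrite adde_ge0.
  - exact: emeasurable_funD.
have I1 : \int[P]_w (B1 w)%:E <= (SaS_tail_cst * \sum_(i <- s) sigma i `^ alpha)%:E.
  under eq_integral do rewrite /B1 -sumEFin.
  have m1i i : measurable_fun setT (fun w => (\1_[set w | (1 < `|Z i w|)%R] w)%:E : \bar R).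
    by apply/measurable_EFinP; exact: measurable_indic.
  rewrite ge0_integral_sum//.
  rewrite big_distrr/= -sumEFin big_seq [leRHS]big_seq; apply: lee_sum => i si.
  by rewrite integral_indic// setIT; apply: SaS_tail => //; exact: hZ.
have I2 : \int[P]_w (S w ^+ 2)%:E <= (2 `^ alpha * \sum_(i <- s) sigma i `^ alpha)%:E.
  apply: le_trans integral_sum_sin_sqr _; rewrite lee_fin big_distrr/=.
  by apply: ler_sum => i _; rewrite powRM// mulrC.
have I3 : \int[P]_w (B3 w)%:E <= (\sum_(i <- s) sigma i `^ alpha)%:E.
  under eq_integral do rewrite /B3 -sumEFin.
  have m3i i : measurable_fun setT (fun w => (1 - cos (1 * Z i w))%:E).
    by apply/measurable_EFinP; exact: mc.
  have p3i i w : 0 <= (1 - cos (1 * Z i w))%:E by rewrite lee_fin subr_ge0 cos_le1.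
  rewrite ge0_integral_sum//.
  rewrite -sumEFin big_seq [leRHS]big_seq; apply: lee_sum => i si.
  by have := SaS_sub_cos 1 (sigma0 i) (hZ si); rewrite normr1 mulr1.
have k1E : 0 <= k1%:E by rewrite lee_fin.
have k2E : 0 <= k2%:E by rewrite lee_fin.
apply: le_trans (leeD I1 (leeD (lee_wpmul2l k1E I2) (lee_wpmul2l k2E I3))) _.
rewrite -!EFinM -!EFinD lee_fin -/k1 -/k2 le_eqVlt; apply/orP; left; apply/eqP; ring.
Qed.

End sums.

(** By independence the joint law is the product of the marginals, and the integral over the second
    variable alone is already 0. *)
Lemma independent_sin_orthogonal (Z1 Z2 : {RV P >-> R}) (a b : R) :
  (forall B1 B2, measurable B1 -> measurable B2 ->
    P (Z1 @^-1` B1 `&` Z2 @^-1` B2) = P (Z1 @^-1` B1) * P (Z2 @^-1` B2)) ->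
  \int[P]_w (sin (b * Z2 w))%:E = 0 ->
  \int[P]_w (sin (a * Z1 w) * sin (b * Z2 w))%:E = 0.
Proof.
move=> ind s0; pose Zp w := (Z1 w, Z2 w).
have mZp : measurable_fun setT Zp by exact: measurable_fun_pair.
pose ZP : {mfun Omega >-> (R * R)%type} := mfun_Sub (mem_set mZp).
have msin (c : R) : measurable_fun setT (fun y : R => sin (c * y))%R.
  apply: (measurableT_comp (f := @sin R)); last exact: measurable_funM.
  by apply: continuous_measurable_fun; exact: continuous_sin.
have joint A : measurable A ->
    (distribution P Z1 \x distribution P Z2) A = distribution P ZP A.
  move=> mA; apply: product_measure_unique => // B1 B2 mB1 mB2; exact: ind.
pose F (z : R * R) := (sin (a * z.1) * sin (b * z.2))%R.
have mF : measurable_fun setT F.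
  by apply: measurable_funM; [exact: (measurableT_comp (msin a))|exact: (measurableT_comp (msin b))].
have F1 z : (`|F z| <= 1)%R by rewrite normrM mulr_ile1 ?sin_max.
have mFE : measurable_fun setT (EFin \o F) by exact/measurable_EFinP.
have iP : P.-integrable setT ((EFin \o F) \o ZP).
  by apply: (@bounded_integrable (F \o Zp) 1%R) => [|w]; [exact: measurableT_comp|exact: F1].
have -> : \int[P]_w (sin (a * Z1 w) * sin (b * Z2 w))%:E = \int[distribution P ZP]_z (F z)%:E.
  by rewrite integral_distribution.
rewrite (eq_measure_integral (distribution P Z1 \x distribution P Z2)%E); last first.
  by move=> A mA _; exact: (esym (joint A mA)).
rewrite -integral12_prod_meas1; last first.
  apply/integrableP; split=> //.
  rewrite (eq_measure_integral (distribution P ZP)); last by move=> A mA _; exact: (joint A mA).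
  rewrite ge0_integral_distribution//; last exact: measurableT_comp.
  by move/integrableP: iP => [].
apply: integral0_eq => x _; rewrite /fubini_F/=.
have i2 : P.-integrable setT ((EFin \o (fun y : R => sin (b * y))%R) \o Z2).
  apply: (@bounded_integrable (fun w => sin (b * Z2 w))%R 1%R) => [|w]; last exact: sin_max.
  exact: (measurableT_comp (msin b)).
have ms : measurable_fun setT (EFin \o (fun y : R => sin (b * y))%R) by exact/measurable_EFinP.
have e0 : \int[distribution P Z2]_y (sin (b * y))%:E = 0.
  by rewrite (integral_distribution ms i2).
have i2' : (distribution P Z2).-integrable setT (fun y => (sin (b * y))%:E).
  apply/integrableP; split => //; rewrite ge0_integral_distribution//; last exact: measurableT_comp.
  by move/integrableP: i2 => [].
rewrite /F/=; under eq_integral do rewrite EFinM.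
by rewrite integralZl// e0 mule0.
Qed.

End SaS_variables.

(** * Integrals of simple functions and their limits *)

Section stable_random_measure.
Import HBSimple.
Context (R : realType) dO (Omega : measurableType dO) (P : probability Omega R).
Variables (alpha : R) (alpha0 : 0 < alpha).
Context dE (E : measurableType dE) (m : {measure set E -> \bar R}).
Variable M : set E -> {RV P >-> R}.
Hypothesis hM : SaS_random_measure alpha m M.
Local Open Scope ereal_scope.

(** Countable additivity along the constant sequence of empty sets: the terms of a convergent series
    tend to 0. *)
Lemma ae_random_measure0 : {ae P, forall w, M set0 w = 0%R}.
Proof.
have [_ _ /(_ (fun=> set0))] := hM; rewrite bigcup0// measure0 => h.
have {}h : {ae P, forall w, series (fun=> M set0 w) @ \oo --> M set0 w}.
  by apply: h => //; apply/trivIsetP => i j _ _ _; rewrite set0I.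
apply: filterS h => w hw; have := cvg_series_cvg_0 (cvgP _ hw).
by move=> /(cvg_lim (@Rhausdorff R)); rewrite (lim_cst (@Rhausdorff R)).
Qed.

Lemma ae_random_measure_additive N (A : nat -> set E) : (forall i, measurable (A i)) ->
  (forall i, (N <= i)%N -> A i = set0) -> m (\bigcup_i A i) < +oo -> trivIset setT A ->
  {ae P, forall w, M (\bigcup_i A i) w = (\sum_(i < N) M (A i) w)%R}.
Proof.
move=> mA A0 fA tA; have [_ _ h] := hM.
apply: filterS2 ae_random_measure0 (h A mA fA tA) => w w0 hw.
have c : series (fun i => M (A i) w) @ \oo --> (\sum_(i < N) M (A i) w)%R.
  apply: cvg_near_cst; exists N => // n /= Nn.
  rewrite /series/= (@big_cat_nat _ _ _ N)//= big_mkord (_ : (\sum_(N <= i < n) M (A i) w)%R = 0%R) ?addr0//.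
  by rewrite big_nat big1// => i /andP[Ni _]; rewrite A0.
by rewrite -(cvg_lim (@Rhausdorff R) c) -(cvg_lim (@Rhausdorff R) hw).
Qed.

Lemma ae_seq (T : eqType) (s : seq T) (Q : T -> Omega -> Prop) :
  (forall y, y \in s -> {ae P, forall w, Q y w}) ->
  {ae P, forall w, forall y, y \in s -> Q y w}.
Proof.
elim: s => [|y s ih] h; first exact: aeW.
have hs : {ae P, forall w, forall y, y \in s -> Q y w}.
  by apply: ih => z zs; apply: h; rewrite inE zs orbT.
apply: filterS2 (h y (mem_head _ _)) hs => w hy hw z.
by rewrite inE => /predU1P[->//|]; exact: hw.
Qed.

Definition sfun_values (g : {sfun E >-> R}) : seq R := finmap.enum_fset (fset_set (range g)).

Lemma sfun_values_uniq (g : {sfun E >-> R}) : uniq (sfun_values g).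
Proof. exact: finmap.fset_uniq. Qed.

Lemma mem_sfun_values (g : {sfun E >-> R}) z : g z \in sfun_values g.
Proof.
have := in_fset_set (fimfunP g) (g z).
by rewrite [RHS]mem_set => [h|]; [exact: h|exists z].
Qed.

Lemma ae_random_measure_partition (g : {sfun E >-> R}) (A : set E) : measurable A -> m A < +oo ->
  {ae P, forall w, M A w = (\sum_(y <- sfun_values g) M (A `&` g @^-1` [set y]) w)%R}.
Proof.
move=> mA fA; pose s := sfun_values g.
pose B i := if (i < size s)%N then A `&` g @^-1` [set nth 0%R s i] else set0.
have UB : \bigcup_i B i = A.
  apply/seteqP; split => [z [i _]|z Az]; first by rewrite /B; case: ifP => // _ [].
  have gs : g z \in s by exact: mem_sfun_values.
  exists (index (g z) s) => //; rewrite /B index_mem gs; split => //=.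
  by rewrite nth_index.
have mB i : measurable (B i).
  rewrite /B; case: ifP => // _; apply: measurableI => //; exact: measurable_funPTI.
have B0 i : (size s <= i)%N -> B i = set0 by rewrite /B ltnNge => ->.
have tB : trivIset setT B.
  apply/trivIsetP => i j _ _ ij; rewrite /B.
  case: ifP => si; case: ifP => sj; rewrite ?set0I ?setI0//.
  apply/seteqP; split => // z /= [[_ e1] [_ e2]].
  by move: ij; rewrite -(nth_uniq 0%R si sj (sfun_values_uniq _)) -e1 -e2 eqxx.
have := ae_random_measure_additive mB B0; rewrite UB => /(_ fA tB).
apply: filterS => w ->; rewrite (big_nth 0%R) big_mkord; apply: eq_bigr => i _.
by rewrite /B ltn_ord.
Qed.

Definition sfun_integral (g : {sfun E >-> R}) w :=
  (\sum_(y \in range g) y * M (g @^-1` [set y]) w)%R.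

Lemma measurable_sfun_integral g : measurable_fun setT (sfun_integral g).
Proof.
rewrite (_ : sfun_integral g =
    fun w => (\sum_(y <- sfun_values g) y * M (g @^-1` [set y]) w)%R).
  by apply: measurable_sum => y; exact: measurable_funM.
by apply/funext => w; rewrite /sfun_integral fsbig_finite//; exact: fimfunP.
Qed.

Lemma measurable_sfun_neq0 (g : {sfun E >-> R}) : measurable [set x | g x != 0%R].
Proof.
rewrite (_ : [set x | _] = g @^-1` [set~ 0%R]); first by apply: measurable_funPTI; exact: measurableC.
by apply/seteqP; split => x /= /eqP.
Qed.

Lemma ae_sfun_integral (g g' : {sfun E >-> R}) : m [set x | g x != 0%R] < +oo ->
  {ae P, forall w, sfun_integral g w =
    (\sum_(y <- sfun_values g) \sum_(y' <- sfun_values g')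
       y * M (g @^-1` [set y] `&` g' @^-1` [set y']) w)%R}.
Proof.
move=> fg.
pose Q y w := (y * M (g @^-1` [set y]) w = \sum_(y' <- sfun_values g')
       y * M (g @^-1` [set y] `&` g' @^-1` [set y']) w)%R.
have h y : {ae P, forall w, Q y w}.
  have [->|y0] := eqVneq y 0%R.
    by apply: aeW => w; rewrite /Q mul0r big1// => ? _; rewrite mul0r.
  have my : measurable (g @^-1` [set y]) by exact: measurable_funPTI.
  have fy : m (g @^-1` [set y]) < +oo.
    apply: le_lt_trans fg; apply: le_measure; rewrite ?inE//.
    - exact: measurable_sfun_neq0.
    - by move=> x /= ->.
  by apply: filterS (ae_random_measure_partition g' my fy) => w e; rewrite /Q e big_distrr.
apply: filterS (ae_seq (s := sfun_values g) (fun y _ => h y)) => w hw.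
rewrite /sfun_integral fsbig_finite/=; last exact: fimfunP.
by rewrite big_seq [RHS]big_seq; apply: eq_bigr => y ys; exact: hw.
Qed.

(** On the common refinement the difference is a sum of variables (y - y') M(A) with A = {g = y, g'
    = y'}, whose scales to the power alpha add up to the integral of |g - g'|^alpha. Pairs with y =
    y' are dropped: they contribute 0, and the piece y = y' = 0 may have infinite measure. *)
Lemma sfun_integral_sub_tail (g g' : {sfun E >-> R}) (e : R) : (0 < e)%R ->
  m [set x | g x != 0%R] < +oo -> m [set x | g' x != 0%R] < +oo ->
  P [set w | (e < `|sfun_integral g w - sfun_integral g' w|)%R] <=
  (SaS_tail_cst alpha + 4 / e ^+ 2 * 2 `^ alpha + 2 / e)%:E *
  \int[m]_x (`|g x - g' x| `^ alpha)%:E.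
Proof.
move=> e0 fg fg'.
pose s := sfun_values g; pose s' := sfun_values g'.
pose L := [seq z <- [seq (y, y') | y <- s, y' <- s'] | z.1 != z.2].
have uL : uniq L.
  by apply: filter_uniq; apply: allpairs_uniq; rewrite ?sfun_values_uniq// => -[? ?] [? ?].
pose A (z : R * R) := g @^-1` [set z.1] `&` g' @^-1` [set z.2].
pose Z z : {mfun Omega >-> R} := ((z.1 - z.2)%R *: (M (A z) : {mfun Omega >-> R}))%R.
pose sg z := (`|z.1 - z.2| * fine (m (A z)) `^ alpha^-1)%R.
have mA z : measurable (A z) by apply: measurableI; exact: measurable_funPTI.
have fA z : z.1 != z.2 -> m (A z) < +oo.
  move=> z12; have [z0|z0] := eqVneq z.1 0%R.
    apply: le_lt_trans fg'; apply: le_measure; rewrite ?inE//.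
    - exact: measurable_sfun_neq0.
    - by move=> x [_ /= ->]; rewrite eq_sym -z0.
  apply: le_lt_trans fg; apply: le_measure; rewrite ?inE//.
  - exact: measurable_sfun_neq0.
  - by move=> x [/= ->].
have LA z : z \in L -> m (A z) < +oo by rewrite mem_filter => /andP[/fA].
have tA z z' : z != z' -> A z `&` A z' = set0.
  move=> zz; apply/seteqP; split => // x [[/= e1 e2] [/= e3 e4]].
  by move: zz; rewrite (surjective_pairing z) (surjective_pairing z') -e1 -e2 -e3 -e4 eqxx.
have aeL : {ae P, forall w, (sfun_integral g w - sfun_integral g' w = \sum_(z <- L) Z z w)%R}.
  apply: filterS2 (ae_sfun_integral g' fg) (ae_sfun_integral g fg') => w -> ->.
  rewrite [X in (_ - X)%R]exchange_big/= -sumrB.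
  rewrite (_ : (\sum_(z <- L) Z z w = \sum_(y <- s) \sum_(y' <- s')
      (if y != y' then Z (y, y') w else 0))%R); last first.
    by rewrite /L big_filter big_mkcond big_allpairs_dep.
  apply: eq_bigr => y _; rewrite -sumrB; apply: eq_bigr => y' _.
  rewrite [X in (_ - y' * M X w)%R]setIC -mulrBl.
  by case: eqVneq => [->|//]; rewrite subrr mul0r.
apply: (@le_trans _ _ (P [set w | (e < `|\sum_(z <- L) Z z w|)%R])).
  apply: le_measure_ae.
  - by apply: measurable_absr_gt; apply: measurable_funB; exact: measurable_sfun_integral.
  - by apply: measurable_absr_gt; apply: measurable_sum => z; exact: measurable_funPT.
  - by apply: filterS aeL => w /= ->.
have sg0 z : (0 <= sg z)%R by rewrite mulr_ge0 ?powR_ge0.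
have hZ z : z \in L -> is_SaS P alpha (sg z) (Z z).
  by move=> zL; have [h1 _ _] := hM; exact: is_SaS_scale (h1 _ (mA z) (LA z zL)).
have orth z z' : z \in L -> z' \in L -> z != z' -> \int[P]_w (sin (Z z w) * sin (Z z' w))%:E = 0.
  move=> zL zL' zz; have [h1 h2 _] := hM.
  apply: (independent_sin_orthogonal (Z1 := M (A z)) (Z2 := M (A z')) (z.1 - z.2)); last first.
    by have [_] := h1 _ (mA z') (LA z' zL') (z'.1 - z'.2)%R.
  move=> B1 B2 mB1 mB2; pose AA (i : 'I_2) := if i == ord0 then A z else A z'.
  have ind : mutually_independent P (fun i => M (AA i) : Omega -> R).
    apply: h2.
    - by move=> i; rewrite /AA; case: ifP.
    - by move=> i; rewrite /AA; case: ifP => _; exact: LA.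
    apply/trivIsetP => i j _ _ ij; rewrite /AA.
    have : (i == ord0) != (j == ord0).
      by move: ij; rewrite -!val_eqE /=; case: i j => [[|[|[]]]//= ?] [[|[|[]]]//= ?].
    case: (i == ord0); case: (j == ord0) => // _; first exact: tA.
    by rewrite setIC; exact: tA.
  have := ind (fun i => if i == ord0 then B1 else B2) _.
  rewrite 2!big_ord_recl big_ord0 mule1/= => <-; last by move=> i; case: ifP.
  congr (P _); apply/seteqP; split => w /=.
    by move=> [w1 w2] i _; rewrite /= /AA; case: (i == ord0).
  by move=> h; split; [exact: (h ord0 I)|exact: (h (lift ord0 ord0) I)].
apply: le_trans (sum_tail alpha0 uL sg0 hZ orth e0) _; rewrite EFinM.
apply: lee_wpmul2l.
  by rewrite lee_fin; exact: sum_tail_cst_ge0.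
have mi z : measurable_fun setT (fun x => (`|z.1 - z.2| `^ alpha)%:E * (\1_(A z) x)%:E).
  by apply: emeasurable_funM => //; apply/measurable_EFinP; exact: measurable_indic.
have pz z x : 0 <= (`|z.1 - z.2| `^ alpha)%:E * (\1_(A z) x)%:E.
  by rewrite mule_ge0// lee_fin ?powR_ge0// indicE.
have ez z : z \in L -> (sg z `^ alpha)%:E =
    \int[m]_x ((`|z.1 - z.2| `^ alpha)%:E * (\1_(A z) x)%:E).
  move=> zL; rewrite ge0_integralZl_EFin ?powR_ge0//; last first.
    by apply/measurable_EFinP; exact: measurable_indic.
  rewrite integral_indic// setIT /sg powRM ?powR_ge0// -powRrM mulVf ?gt_eqF// powRr1 ?fine_ge0//.
  by rewrite EFinM fineK// ge0_fin_numE// LA.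
rewrite -sumEFin (eq_big_seq _ ez) -ge0_integral_sum//.
apply: ge0_le_integral => //.
- by move=> x _; apply: sume_ge0 => z _.
- exact: emeasurable_sum.
- apply/measurable_EFinP; apply: measurable_powR_comp; apply: measurableT_comp => //.
  by apply: measurable_funB; exact: measurable_funPT.
move=> x _; have off z : z != (g x, g' x) -> \1_(A z) x = 0%R :> R.
  move=> zx; rewrite indicE memNset// => -[/= e1 e2].
  by move: zx; rewrite (surjective_pairing z) -e1 -e2 eqxx.
have [xl|xl] := boolP ((g x, g' x) \in L).
  rewrite (bigD1_seq (g x, g' x))//= big1 ?adde0; last by move=> z /off ->; rewrite mule0.
  by rewrite indicE mem_set// mule1.
rewrite big1_seq ?lee_fin ?powR_ge0// => z /andP[_ zL]; rewrite off ?mule0//.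
by apply: contraNneq xl => <-.
Qed.

(** The two approximating sequences are compared with each other: as f and f' agree almost
    everywhere, the integral of |g n - g' n|^alpha tends to 0, and [sfun_integral_sub_tail] makes
    the integrals of the simple functions close in probability. *)
Lemma stable_integral_unique (f f' : E -> R) (Y Y' : {RV P >-> R}) :
  measurable_fun setT f -> measurable_fun setT f' -> {ae m, forall x, f x = f' x} ->
  stable_integral alpha m M f Y -> stable_integral alpha m M f' Y' ->
  {ae P, forall w, Y w = Y' w}.
Proof.
move=> mf mf' ff [g [fg cg gY]] [g' [fg' cg' gY']].
have mpow (h : E -> R) : measurable_fun setT h -> measurable_fun setT (fun x => (`|h x| `^ alpha)%:E).
  by move=> mh; apply/measurable_EFinP; apply: measurable_powR_comp; exact: measurableT_comp.
have mg n : measurable_fun setT (g n) by exact: measurable_funPT.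
have mg' n : measurable_fun setT (g' n) by exact: measurable_funPT.
pose K : R := (2 `^ alpha)%R.
(* A quasi-triangle inequality valid for all alpha > 0, from |a - b| <= 2 max(|a|, |b|). *)
have tri (a b : R) : (`|a - b| `^ alpha <= K * (`|a| `^ alpha + `|b| `^ alpha))%R.
  wlog ab : a b / (`|b| <= `|a|)%R.
    move=> h; have [/h//|/ltW /h] := leP `|b|%R `|a|%R.
    by rewrite distrC [X in (_ <= _ * X)%R]addrC.
  apply: (@le_trans _ _ ((2 * `|a|) `^ alpha)%R).
    rewrite ge0_ler_powR ?nnegrE ?mulr_ge0 ?(ltW alpha0)//.
    by apply: le_trans (ler_normB _ _) _; rewrite mulr_natl mulr2n lerD2l.
  by rewrite powRM// ler_wpM2l ?powR_ge0// lerDl powR_ge0.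
have dist n : \int[m]_x (`|g n x - g' n x| `^ alpha)%:E <=
    K%:E * (\int[m]_x (`|f x - g n x| `^ alpha)%:E + \int[m]_x (`|f' x - g' n x| `^ alpha)%:E).
  have m1 : measurable_fun setT (fun x => (`|f x - g n x| `^ alpha)%:E).
    by apply: (mpow (fun x => f x - g n x)%R); exact: measurable_funB.
  have m2 : measurable_fun setT (fun x => (`|f' x - g' n x| `^ alpha)%:E).
    by apply: (mpow (fun x => f' x - g' n x)%R); exact: measurable_funB.
  have m12 := emeasurable_funD m1 m2.
  have p12 x : 0 <= (`|f x - g n x| `^ alpha)%:E + (`|f' x - g' n x| `^ alpha)%:E.
    by rewrite adde_ge0 ?lee_fin ?powR_ge0.
  rewrite -ge0_integralD// -ge0_integralZl_EFin ?powR_ge0//.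
  apply: ae_ge0_le_integral => //.
  - by apply: (mpow (fun x => g n x - g' n x)%R); exact: measurable_funB.
  - by move=> x _; rewrite mule_ge0 ?adde_ge0 ?lee_fin ?powR_ge0.
  - by apply: emeasurable_funM => //; exact: emeasurable_funD.
  apply: filterS ff => x fx _; rewrite -EFinD -EFinM lee_fin -fx.
  have -> : (`|g n x - g' n x| = `|(f x - g' n x) - (f x - g n x)|)%R.
    by congr (`|_|)%R; ring.
  by apply: le_trans (tri _ _) _; rewrite [X in (_ * X)%R]addrC.
have D0 n : P [set w | (n.+1%:R^-1 *+ 3 < `|Y w - Y' w|)%R] = 0.
  set e : R := (n.+1%:R^-1)%R; have e0 : (0 < e)%R by rewrite invr_gt0.
  pose C : R := (SaS_tail_cst alpha + 4 / e ^+ 2 * 2 `^ alpha + 2 / e)%R.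
  have C0 : (0 <= C)%R.
    exact: sum_tail_cst_ge0.
  pose u k := P [set w | (e < `|sfun_integral (g k) w - Y w|)%R].
  pose u' k := P [set w | (e < `|sfun_integral (g' k) w - Y' w|)%R].
  pose v k := C%:E * (K%:E * (\int[m]_x (`|f x - g k x| `^ alpha)%:E +
    \int[m]_x (`|f' x - g' k x| `^ alpha)%:E)).
  have ub k : P [set w | (e *+ 3 < `|Y w - Y' w|)%R] <= u k + (v k + u' k).
    pose A1 := [set w | (e < `|sfun_integral (g k) w - Y w|)%R].
    pose A2 := [set w | (e < `|sfun_integral (g k) w - sfun_integral (g' k) w|)%R].
    pose A3 := [set w | (e < `|sfun_integral (g' k) w - Y' w|)%R].
    have mA1 : measurable A1.
      by apply: measurable_absr_gt; apply: measurable_funB => //; exact: measurable_sfun_integral.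
    have mA2 : measurable A2.
      by apply: measurable_absr_gt; apply: measurable_funB; exact: measurable_sfun_integral.
    have mA3 : measurable A3.
      by apply: measurable_absr_gt; apply: measurable_funB => //; exact: measurable_sfun_integral.
    apply: (@le_trans _ _ (P (A1 `|` (A2 `|` A3)))).
      apply: le_measure; rewrite ?inE//.
      - by apply: measurable_absr_gt; exact: measurable_funB.
      - by apply: measurableU => //; exact: measurableU.
      move=> w /= hw; apply: contrapT => /not_orP[h1 /not_orP[h2 h3]].
      move: hw h1 h2 h3; rewrite /A1 /A2 /A3/= => hw.
      move=> /negP; rewrite -leNgt => h1 /negP; rewrite -leNgt => h2 /negP; rewrite -leNgt => h3.
      move: hw; rewrite ltNge => /negP; apply.
      have -> : (Y w - Y' w = - (sfun_integral (g k) w - Y w) +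
        ((sfun_integral (g k) w - sfun_integral (g' k) w) + (sfun_integral (g' k) w - Y' w)))%R by ring.
      rewrite mulrS mulr2n; apply: le_trans (ler_normD _ _) _; rewrite normrN lerD//.
      by apply: le_trans (ler_normD _ _) _; rewrite lerD.
    apply: le_trans (measureU2 _ _ _) _ => //; first exact: measurableU.
    apply: leeD => //; apply: le_trans (measureU2 _ _ _) _ => //; apply: leeD => //.
    apply: le_trans (sfun_integral_sub_tail e0 (fg k) (fg' k)) _; rewrite -/C /v.
    by apply: lee_wpmul2l; rewrite ?lee_fin.
  have cv : u k + (v k + u' k) @[k --> \oo] --> 0.
    have u0 : u k @[k --> \oo] --> 0 by exact: gY.
    have u'0 : u' k @[k --> \oo] --> 0 by exact: gY'.
    have v0 : v k @[k --> \oo] --> 0.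
      rewrite -[X in _ --> X](mule0 C%:E); apply: cvgeZl => //.
      rewrite -[X in _ --> X](mule0 K%:E); apply: cvgeZl => //.
      by rewrite -[X in _ --> X]adde0; apply: (cvgeD _ cg cg').
    rewrite -[X in _ --> X]adde0; apply: (cvgeD _ u0) => //.
    by rewrite -[X in _ --> X]adde0; apply: (cvgeD _ v0 u'0).
  apply/eqP; rewrite -measure_le0; apply: (cvge_to_ge cv).
  by near=> k; exact: ub.
have small n : {ae P, forall w, (`|Y w - Y' w| <= n.+1%:R^-1 *+ 3)%R}.
  exists [set w | (n.+1%:R^-1 *+ 3 < `|Y w - Y' w|)%R]; split => //.
  - by apply: measurable_absr_gt; exact: measurable_funB.
  - by move=> w /= /negP; rewrite -ltNge.
apply: filterS (ae_foralln small) => w hw; apply/eqP; rewrite -subr_eq0 -normr_le0.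
rewrite leNgt; apply/negP => d0.
pose n := Num.bound (3 / `|Y w - Y' w|)%R.
have := archi_boundP (divr_ge0 (ler0n R 3) (ltW d0)); rewrite -/n => hn.
have := hw n; rewrite leNgt => /negP; apply.
rewrite -(@mulr_natr _ _ 3) mulrC ltr_pdivrMr ?ltr0Sn// -[n.+1%:R]natr1 mulrDr mulr1.
by move: (n%:R : R) hn => N; rewrite ltr_pdivrMr// mulrC; lra.
Unshelve. all: by end_near. Qed.

End stable_random_measure.

(** * Periodicity of the field along the stabilizer *)

Section periodicity.
Context (R : realType) (d : nat) dS (S : measurableType dS).
Variable mu : {sigma_finite_measure set S -> \bar R}.
Local Open Scope ereal_scope.

(** The densities are compared on sets of finite measure where both are at most n, hence integrable;
    these sets exhaust the space. *)
Lemma density_unique (rho : set S -> \bar R) (w1 w2 : S -> R) :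
  is_density mu rho w1 -> is_density mu rho w2 -> {ae mu, forall s, w1 s = w2 s}.
Proof.
move=> [m1 p1 e1] [m2 p2 e2].
have /sigma_finiteP[F [TF hF Ffin]] := sigma_finiteT mu.
pose G n := F n `&` [set s | (w1 s <= n%:R)%R] `&` [set s | (w2 s <= n%:R)%R].
have mle (w : S -> R) (n : nat) : measurable_fun setT w -> measurable [set s | (w s <= n%:R)%R].
  move=> mw; rewrite (_ : [set s | _] = w @^-1` `]-oo, n%:R]%classic).
    by rewrite -[X in measurable X]setTI; apply: mw => //; exact: measurable_itv.
  by apply/seteqP; split => s /=; rewrite in_itv.
have mG n : measurable (G n).
  by apply: measurableI; [apply: measurableI; [have [] := Ffin n|exact: mle]|exact: mle].
have h n : {ae mu, forall s, G n s -> (w1 s)%:E = (w2 s)%:E}.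
  apply: (@integral_ae_eq _ _ _ mu (G n) (mG n) (fun s => (w2 s)%:E) (fun s => (w1 s)%:E)).
  - apply/integrableP; split.
      by apply/measurable_EFinP; exact: measurable_funTS.
    apply: (@le_lt_trans _ _ (\int[mu]_(s in G n) (cst n%:R%:E s))).
      apply: ge0_le_integral => //.
      + by apply/measurable_EFinP; apply: measurableT_comp => //; exact: measurable_funTS.
      + by move=> s [[_ /= hs] _]; rewrite lee_fin ger0_norm.
    rewrite integral_cst// lte_mul_pinfty//.
    apply: le_lt_trans (Ffin n).2; apply: le_measure; rewrite ?inE//; last by move=> s [[]].
    by have [] := Ffin n.
  - by apply/measurable_EFinP; exact: measurable_funTS.
  - by move=> B BG mB; rewrite -e1// -e2.
apply: filterS (ae_foralln h) => s hs.
have [n0 _ Fs] : (\bigcup_i F i) s by rewrite -TF.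
pose n := maxn n0 (maxn (Num.bound (w1 s)) (Num.bound (w2 s))).
apply: EFin_inj; apply: (hs n); split; [split|] => /=.
- by have /subsetPset := hF _ _ (leq_maxl n0 (maxn (Num.bound (w1 s)) (Num.bound (w2 s)))); apply.
- by rewrite (le_trans (ltW (archi_boundP (p1 s))))// ler_nat /n !leq_max leqnn orbT.
- by rewrite (le_trans (ltW (archi_boundP (p2 s))))// ler_nat /n !leq_max leqnn !orbT.
Qed.

(* The kernels of X_t and X_(t + k) agree almost everywhere for k in the
   stabilizer. *)
Lemma generated_by_periodic (phi : Zd d -> S -> S) (alpha : R) (c : Zd d -> S -> R)
    dO (Omega : measurableType dO) (P : probability Omega R) (X : Zd d -> {RV P >-> R}) :
  (0 < alpha)%R -> nonsingular_action mu phi -> cocycle phi c ->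
  (forall k, stabilizer phi k -> forall s, c k s = 1%R) ->
  generated_by mu phi alpha c P X ->
  forall t k, stabilizer phi k -> {ae P, forall w, X (t + k)%R w = X t w}.
Proof.
move=> alpha0 [mphi phi0 phiD _] [mc c1 cD] cK.
case=> f; case=> rn; case=> dO1; case=> Omega1; case=> P1; case=> M; case=> Y hyp t k hk.
have [[fL _] drn hM hY XY] := hyp.
have phik : phi k = id by exact: hk.
have phitk : phi (t + k)%R = phi t by rewrite phiD phik.
have ctk s : c (t + k)%R s = c t s by rewrite cD cK// phik mul1r.
have mf : measurable_fun setT f by move: fL => /sub_Lfun_mfun; rewrite inE.
have mker r : measurable_fun setT (fun s => c r s * rn r s `^ alpha^-1 * f (phi r s))%R.
  apply: measurable_funM; last exact: measurableT_comp.
  apply: measurable_funM => //; apply: measurable_powR_comp; by have [] := drn r.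
have rnE : {ae mu, forall s, rn (t + k)%R s = rn t s}.
  by apply: (density_unique (drn _)); have := drn t; rewrite -phitk.
have YE : {ae P1, forall w, Y (t + k)%R w = Y t w}.
  apply: (stable_integral_unique alpha0 hM (mker _) (mker _) _ (hY _) (hY _)).
  by apply: filterS rnE => s e; rewrite ctk e phitk.
(* Almost sure equality of two variables says that the law of the pair is carried by the diagonal,
   so it passes from [Y] to [X] by equality of the two-dimensional laws. *)
pose B : set (2.-tuple R) := [set z | tnth z ord0 = tnth z ord_max].
have mB : measurable B.
  rewrite (_ : B = (fun z : 2.-tuple R => (tnth z ord0 - tnth z ord_max)%R) @^-1` [set 0%R]).
    rewrite -[X in measurable X]setTI; apply: measurable_funB => //; exact: measurable_tnth.
  by apply/seteqP; split => z /= => [->|/eqP]; rewrite ?subrr// subr_eq0 => /eqP.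
have := XY 2%N [tuple (t + k)%R; t] B mB.
rewrite (_ : [set w | B [tuple of map (Y ^~ w) [tuple (t + k)%R; t]]] =
  [set w | Y (t + k)%R w = Y t w]); last first.
  by apply/seteqP; split => w; rewrite /B/= !(tnth_nth 0%R).
rewrite (_ : [set w | B [tuple of map (X ^~ w) [tuple (t + k)%R; t]]] =
  [set w | X (t + k)%R w = X t w]); last first.
  by apply/seteqP; split => w; rewrite /B/= !(tnth_nth 0%R).
have meq dU (U : measurableType dU) (a b : U -> R) : measurable_fun setT a -> measurable_fun setT b ->
    measurable [set w | a w = b w].
  move=> ma mb; rewrite (_ : [set w | _] = (fun w => a w - b w)%R @^-1` [set 0%R]).
    by rewrite -[X in measurable X]setTI; apply: measurable_funB.
  by apply/seteqP; split => z /= => [->|/eqP]; rewrite ?subrr// subr_eq0 => /eqP.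
have mX : measurable [set w | X (t + k)%R w = X t w] by exact: meq.
have mY : measurable [set w | Y (t + k)%R w = Y t w] by exact: meq.
have Y1 : P1 [set w | Y (t + k)%R w = Y t w] = 1.
  apply/eqP; rewrite eq_le probability_le1//= -(probability_setT P1); apply: le_measure_ae => //.
  by apply: filterS YE => w.
rewrite Y1 => X1; exists (~` [set w | X (t + k)%R w = X t w]); split => //.
- exact: measurableC.
- by rewrite probability_setC// X1 subee.
Qed.

End periodicity.

(** * The conservative case *)

Section lattice_decomposition.
Context (d p l : nat) dS (S : measurableType dS) (phi : Zd d -> S -> S).
Hypothesis phi0 : phi 0 = id.
Hypothesis phiD : forall t1 t2, phi (t1 + t2) = phi t1 \o phi t2.
Context (Fbar : set (S -> S)) (Psi : (S -> S) -> Zd d).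
Hypothesis Fbar_id : Fbar id.
Hypothesis Psi_section : section_on phi Fbar Psi.
Context (F K : set (Zd d)) (FE : F = Psi @` Fbar) (KE : K = stabilizer phi).
Context (U : 'M[int]_(d, p)) (U_basis : Zbasis U F).
Context (x : 'I_l -> Zd d) (x_reps : coset_reps x (sum_set F K)).
Context (H : set (Zd d)) (HE : H = coset_union x F).

Lemma stabilizerD s t : K s -> K t -> K (s + t).
Proof. by rewrite KE /stabilizer/= phiD => -> ->. Qed.

Lemma stabilizerN t : K t -> K (- t).
Proof.
rewrite KE /stabilizer/= => Kt; have := phiD (- t) t.
by rewrite addNr phi0 Kt => ->.
Qed.

Lemma stabilizer0 : K 0. Proof. by rewrite KE. Qed.

Lemma free_partE t : F t -> exists z : 'cV[int]_p, t = U *m z.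
Proof. by have [_ _ surj] := U_basis; move=> /surj[z _ <-]; exists z. Qed.

Lemma free_part_mem (z : 'cV[int]_p) : F (U *m z : Zd d).
Proof. by have [fun_ _ _] := U_basis; exact: fun_. Qed.

Lemma free_partB s t : F s -> F t -> F (s - t).
Proof.
move=> /free_partE[z ->] /free_partE[z' ->].
by have := free_part_mem (z - z'); rewrite mulmxBr.
Qed.

(** If t = Psi a lies in K then a = phi (Psi a) = id, and Psi id = 0 by additivity. *)
Lemma free_part_stabilizer t : F t -> K t -> t = 0.
Proof.
have [PsiD _ phiPsi] := Psi_section.
rewrite FE KE /stabilizer/= => -[a Fa <-]; rewrite phiPsi// => a1; rewrite a1.
have := PsiD id id Fbar_id Fbar_id; rewrite (_ : id \o id = id)// => /eqP.
by rewrite -[X in X == _]addr0 => /eqP /addrI.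
Qed.

Lemma coset_index_unique k k' s t : F (s - x k) -> F (t - x k') -> K (s - t) -> k = k'.
Proof.
move=> Fs Ft Kst; have [k1 [_ uk]] := x_reps s.
transitivity k1; first (apply/esym/uk); last apply: uk.
  exists (s - x k) => //; exists 0; [exact: stabilizer0|by rewrite addr0].
by exists (t - x k') => //; exists (s - t) => //; rewrite addrC addrA subrK.
Qed.

Lemma coset_unionE s : H s <-> exists k, F (s - x k).
Proof.
rewrite HE; split => [[k _ [f Ff <-]]|[k Fs]].
  by exists k; rewrite addrAC subrr add0r.
by exists k => //; exists (s - x k) => //; rewrite addrC subrK.
Qed.

(** Congruence modulo K determines the representative x_k, and two points of x_k + F differ by an
    element of F; lying also in K, it is 0. *)
Lemma coset_union_unique s t : H s -> H t -> K (s - t) -> s = t.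
Proof.
move=> /coset_unionE[k Fs] /coset_unionE[k' Ft] Kst.
have kk := coset_index_unique Fs Ft Kst; rewrite -kk in Ft.
apply/eqP; rewrite -subr_eq0; apply/eqP; apply: free_part_stabilizer => //.
by have := free_partB Fs Ft; rewrite opprB addrA subrK.
Qed.

Lemma proj_modP t : H (proj_mod H K t) /\ K (t - proj_mod H K t).
Proof.
rewrite /proj_mod; apply: (@getPex _ [set s | H s /\ K (t - s)]).
have [k [[f Ff [g Kg e]] _]] := x_reps t; exists (x k + f); split.
  by apply/coset_unionE; exists k; rewrite addrAC subrr add0r.
by rewrite opprD addrA -e addrAC subrr add0r.
Qed.

Lemma proj_mod_unique t s : H s -> K (t - s) -> s = proj_mod H K t.
Proof.
have [Hp Kp] := proj_modP t; move=> Hs Ks; apply: coset_union_unique => //.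
by have := stabilizerD Kp (stabilizerN Ks); rewrite opprB addrC addrA subrK.
Qed.

Lemma coset_union_bij :
  set_bij setT H (fun z : 'I_l * Zd p => x z.1 + (U *m z.2 : Zd d)).
Proof.
have F0 k (m : Zd p) : F (x k + (U *m m : Zd d) - x k).
  by rewrite addrAC subrr add0r; exact: free_part_mem.
split=> [[k m] _|[k m] [k' m'] _ _ /= e|s].
- by apply/coset_unionE; exists k; exact: F0.
- have kk : k = k'.
    apply: (coset_index_unique (F0 k m) (F0 k' m')); rewrite e subrr; exact: stabilizer0.
  move: e; rewrite kk => /addrI e; congr pair.
  by have [_ inj _] := U_basis; apply: inj; rewrite ?inE.
- move=> /coset_unionE[k /free_partE[m e]]; exists (k, m) => //=.
  by rewrite -e addrC subrK.
Qed.

End lattice_decomposition.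

(** The coset limit with D = d - p and P = p. The bounds on the counts and the limit of their
    averages come from the comparison with volumes, and periodicity brings the sum over the box back
    to the variables indexed by H. *)
Lemma conservative_limit (R : realType) (d : nat)
  (alpha : R) (alpha_gt0 : 0 < alpha) (alpha_lt2 : alpha < 2)
  (nua : {measure set R -> \bar R}) (hnua : is_nu_alpha alpha nua)
  (dO : measure_display) (Omega : measurableType dO) (P : probability Omega R)
  (X : Zd d -> {RV P >-> R})
  (dS : measure_display) (S : measurableType dS)
  (mu : {sigma_finite_measure set S -> \bar R})
  (phi : Zd d -> S -> S) (phi_action : nonsingular_action mu phi)
  (c : Zd d -> S -> R) (c_cocycle : cocycle phi c)
  (X_generated : generated_by mu phi alpha c P X)
  (p l : nat) (p_ge1 : (1 <= p)%N) (p_ltd : (p < d)%N)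
  (Fbar : set (S -> S)) (Fbar_id : Fbar id)
  (Psi : (S -> S) -> Zd d) (Psi_section : section_on phi Fbar Psi)
  (F K : set (Zd d)) (FE : F = Psi @` Fbar) (KE : K = stabilizer phi)
  (U : 'M[int]_(d, p)) (U_basis : Zbasis U F)
  (V : 'M[int]_(d, d - p)) (V_basis : Zbasis V K)
  (x : 'I_l -> Zd d) (x_reps : coset_reps x (sum_set F K))
  (H : set (Zd d)) (HE : H = coset_union x F)
  (c_K : forall t, K t -> forall s, c t s = 1)
  (dW : measure_display) (W : measurableType dW)
  (nu : {sigma_finite_measure set W -> \bar R})
  (h : W * Zd d -> R)
  (h_Lalpha : h \in Lfun (nu \x zeta R H)%E alpha%:E)
  (j : nat -> Omega -> R) (v : nat -> Omega -> W) (u : nat -> Omega -> Zd d)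
  (PRM : poisson_random_measure P (fun i w => (j i w, v i w, u i w))
           ((nua \x nu) \x zeta R H)%E)
  (X_series : forall s, H s ->
     series_in_prob P
       (fun i w => j i w * h (v i w, oplus H K (u i w) s)) (X s))
  (h_abs : abs_sum_finite alpha nu H h)
  (gamma : nat -> R) (gamma_gt0 : forall n, 0 < gamma n)
  (gamma_large : n%:R `^ (p%:R / alpha) / gamma n @[n --> \oo] --> 0) :
  M0_cvg
    (fun n => emscale (rate alpha (gamma n) p n)
       (distribution P
          ((n%:R ^- (d - p) * (gamma n)^-1) *: partial_sum X n))
       (rate_ge0 alpha (gamma n) p n))
    (emscale (const_conservative alpha nu l U V H h) nua
       (const_conservative_ge0 alpha nu l U V H h)).
Proof.
have a02 : 0 < alpha < 2 by rewrite alpha_gt0.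
have [_ phi0 phiD _] := phi_action.
have KN := stabilizerN phi0 phiD KE; have KD := stabilizerD phiD KE.
have projP := proj_modP x_reps HE.
have Hproj t := (projP t).1; have Kproj t := (projP t).2.
have proj_unique := proj_mod_unique phi0 phiD Fbar_id Psi_section FE KE U_basis x_reps HE.
have e_bij := coset_union_bij phi0 KE U_basis x_reps HE.
have [k0 _] := x_reps 0.
have S_lty := tail_integral_lty a02 h_Lalpha h_abs.
have Jfin := lattice_volume_fin KN Hproj Kproj proj_unique V_basis e_bij a02 k0.
(* Outside Delta the set Q_y is empty and its volume 0 contributes nothing, so the integral may be
   taken over the whole space. *)
have JE : (\int[lebesgue_tuple R p]_(y in Delta U V) poweR (vol U V y) alpha =
    \int[lebesgue_tuple R p]_y poweR (vol_le U V 1 y) alpha)%E.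
  rewrite integral_mkcond; apply: eq_integral => y _; rewrite patchE.
  case: ifPn => // yD.
  have -> : vol_le U V 1 y = 0%E.
    have Q0 : Qset U V y = set0.
      by apply/seteqP; split => // lam hlam; move: yD; rewrite notin_setE; apply; exists lam.
    rewrite -[LHS]/(lebesgue_tuple R (d - p) (Qset U V y)) Q0; exact: measure0.
  by rewrite -[RHS]/(poweR 0%:E alpha) poweR_EFin powR0// gt_eqF.
have CE : (l%:R * fine (\int[lebesgue_tuple R p]_y poweR (vol_le U V 1 y) alpha))%:E =
    (l%:R%:E * (\int[lebesgue_tuple R p]_(y in Delta U V) poweR (vol U V y) alpha))%E.
  by rewrite EFinM JE fineK.
apply: (@M0_cvg_of_limit R d dO Omega P X alpha nua gamma
  (fun n => n%:R ^- (d - p) * (gamma n)^-1) p _ _ hnua).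
  by rewrite /const_conservative -CE; apply: lte_mul_pinfty => //;
    rewrite ?lee_fin ?mulr_ge0 ?fine_ge0// integral_ge0// => y _; exact: poweR_ge0.
move=> G cG Gb G0.
have [cc cc0 lb] := lattice_count_lb U KN KD V_basis x a02.
have ub n (z : Zd d) : (0 < n)%N ->
    (coset_count K n z)%:R <= size_bound R U V x * n%:R ^+ (d - p) :> R.
  by move=> n0; exact: (lattice_count_ub R KN KD Hproj Kproj V_basis e_bij k0).
have aE n := lattice_averageE KN Hproj Kproj proj_unique e_bij a02 n p_ge1.
have acvg := lattice_average_cvg KN Hproj Kproj proj_unique V_basis e_bij a02 k0.
(* The representation on H translates by + s, whereas [coset_sum_limit] expects proj (u - t); hence
   the reflection. The box is symmetric, so by periodicity the sums of [X'] and of [X] over it agree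
   almost surely. *)
pose X' t : {RV P >-> R} := X (proj_mod H K (- t)).
have oplusE z t : oplus H K z (proj_mod H K (- t)) = proj_mod H K (z - t).
  apply: proj_unique; first exact: Hproj.
  have := KD _ _ (Kproj (z + proj_mod H K (- t))) (Kproj (- t)).
  rewrite /oplus; set q := proj_mod H K (- t); set q' := proj_mod H K (z + q).
  by rewrite (_ : z + q - q' + (- t - q) = z - t - q')//; apply/matrixP => a b; rewrite !mxE; ring.
have XE t : series_in_prob P (fun i w => ((fun i w => (j i w, v i w, u i w)) i w).1.1 *
    h (((fun i w => (j i w, v i w, u i w)) i w).1.2,
       proj_mod H K (((fun i w => (j i w, v i w, u i w)) i w).2 - t))) (X' t).
  have := X_series (proj_mod H K (- t)) (Hproj (- t)).
  rewrite (_ : (fun i w => j i w * h (v i w, oplus H K (u i w) (proj_mod H K (- t)))) =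
    (fun i w => j i w * h (v i w, proj_mod H K (u i w - t))))//.
  by apply/funext => i; apply/funext => w; rewrite oplusE.
have lim := @coset_sum_limit R d H K (proj_mod H K) KN Hproj Kproj proj_unique (d - p)%N p
  (subnK (ltnW p_ltd)) p_ge1 _ cc cc0 ub lb
  alpha a02 (nu_alpha_measure hnua : {sigma_finite_measure set R -> \bar R}) hnua _ W nu h
  h_Lalpha h_abs _ _ aE acvg
  _ Omega P _ PRM X' XE gamma gamma_gt0 gamma_large G cG Gb G0.
rewrite /const_conservative -CE.
have mG : measurable_fun setT G by exact: continuous_measurable_fun.
have sumE n : {ae P, forall w, \sum_(t <- boxseq d n) X' t w = \sum_(t <- boxseq d n) X t w}.
  have per t : {ae P, forall w, X (- t) w = X' t w}.
    have cK' k : stabilizer phi k -> forall s, c k s = 1 by rewrite -KE; exact: c_K.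
    have := generated_by_periodic alpha_gt0 phi_action c_cocycle cK' X_generated
      (proj_mod H K (- t)) (k := - t - proj_mod H K (- t)).
    by rewrite [proj_mod H K (- t) + _]addrC subrK -KE => /(_ (Kproj _)).
  apply: filterS (ae_seq (s := boxseq d n) (fun t _ => per t)) => w hw.
  rewrite -[RHS](perm_big _ (perm_boxseqN d n))/= big_map big_seq [RHS]big_seq.
  by apply: eq_bigr => t tn; rewrite hw.
have intE n : (\int[P]_w (G (n%:R ^- (d - p) * (gamma n)^-1 * \sum_(t <- boxseq d n) X t w))%:E =
    \int[P]_w (G (n%:R ^- (d - p) * (gamma n)^-1 * \sum_(t <- boxseq d n) X' t w))%:E)%E.
  have mint (Y : Zd d -> {RV P >-> R}) : measurable_fun setT
      (fun w => (G (n%:R ^- (d - p) * (gamma n)^-1 * \sum_(t <- boxseq d n) Y t w))%:E).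
    apply/measurable_EFinP; apply: (measurableT_comp mG); apply: measurable_funM => //.
    by apply: measurable_sum => t.
  apply: ae_eq_integral => //.
  by apply: filterS (sumE n) => w ew _; rewrite ew.
by under eq_fun do rewrite intE.
Qed.

Theorem theorem5p1
  (R : realType) (d : nat) (hd : (0 < d)%N)
  (alpha : R) (alpha_gt0 : 0 < alpha) (alpha_lt2 : alpha < 2)
  (nua : {measure set R -> \bar R}) (hnua : is_nu_alpha alpha nua)
  (dO : measure_display) (Omega : measurableType dO) (P : probability Omega R)
  (X : Zd d -> {RV P >-> R})
  (X_stationary : stationary P X) (X_SaS : SaS_field P alpha X) :
  (forall (dW : measure_display) (W : measurableType dW)
      (W_borel : standard_borel R W)
      (nu : {sigma_finite_measure set W -> \bar R})
      (f : W * Zd d -> R)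
      (f_Lalpha : f \in Lfun (nu \x zeta R setT)%E alpha%:E)
      (j : nat -> Omega -> R) (v : nat -> Omega -> W) (u : nat -> Omega -> Zd d)
      (j_neq0 : forall i w, j i w != 0)
      (PRM : poisson_random_measure P (fun i w => (j i w, v i w, u i w))
               ((nua \x nu) \x zeta R setT)%E)
      (X_series : forall t : Zd d,
         series_in_prob P (fun i w => j i w * f (v i w, u i w - t)) (X t))
      (f_abs : abs_sum_finite alpha nu setT f)
      (gamma : nat -> R) (gamma_gt0 : forall n, 0 < gamma n)
      (gamma_large : n%:R `^ (d%:R / alpha) / gamma n @[n --> \oo] --> 0),
    M0_cvg
      (fun n => emscale (rate alpha (gamma n) d n)
         (distribution P ((gamma n)^-1 *: partial_sum X n))
         (rate_ge0 alpha (gamma n) d n))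
      (emscale (const_dissipative alpha nu f) nua
         (const_dissipative_ge0 alpha nu f)))
  /\
  (forall (dS : measure_display) (S : measurableType dS)
      (S_borel : standard_borel R S)
      (mu : {sigma_finite_measure set S -> \bar R})
      (phi : Zd d -> S -> S) (phi_action : nonsingular_action mu phi)
      (c : Zd d -> S -> R) (c_cocycle : cocycle phi c)
      (X_generated : generated_by mu phi alpha c P X)
      (phi_conservative : conservative mu phi setT)
      (p l : nat) (p_ge1 : (1 <= p)%N) (p_ltd : (p < d)%N)
      (Fbar Nbar : set (S -> S))
      (FNbar : direct_decomposition phi Fbar Nbar)
      (Fbar_free : free_abelian_of_rank p Fbar) (Nbar_card : (Nbar #= `I_l)%card)
      (Psi : (S -> S) -> Zd d) (Psi_section : section_on phi Fbar Psi)
      (F K : set (Zd d)) (FE : F = Psi @` Fbar) (KE : K = stabilizer phi)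
      (U : 'M[int]_(d, p)) (U_basis : Zbasis U F)
      (V : 'M[int]_(d, d - p)) (V_basis : Zbasis V K)
      (x : 'I_l -> Zd d) (x_reps : coset_reps x (sum_set F K))
      (H : set (Zd d)) (HE : H = coset_union x F)
      (F_dissipative : dissipative phi F)
      (c_K : forall t, K t -> forall s, c t s = 1)
      (dW : measure_display) (W : measurableType dW)
      (W_borel : standard_borel R W)
      (nu : {sigma_finite_measure set W -> \bar R})
      (h : W * Zd d -> R)
      (h_Lalpha : h \in Lfun (nu \x zeta R H)%E alpha%:E)
      (j : nat -> Omega -> R) (v : nat -> Omega -> W) (u : nat -> Omega -> Zd d)
      (j_neq0 : forall i w, j i w != 0) (u_in_H : forall i w, H (u i w))
      (PRM : poisson_random_measure P (fun i w => (j i w, v i w, u i w))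
               ((nua \x nu) \x zeta R H)%E)
      (X_series : forall s, H s ->
         series_in_prob P
           (fun i w => j i w * h (v i w, oplus H K (u i w) s)) (X s))
      (h_abs : abs_sum_finite alpha nu H h)
      (gamma : nat -> R) (gamma_gt0 : forall n, 0 < gamma n)
      (gamma_large : n%:R `^ (p%:R / alpha) / gamma n @[n --> \oo] --> 0),
    M0_cvg
      (fun n => emscale (rate alpha (gamma n) p n)
         (distribution P
            ((n%:R ^- (d - p) * (gamma n)^-1) *: partial_sum X n))
         (rate_ge0 alpha (gamma n) p n))
      (emscale (const_conservative alpha nu l U V H h) nua
         (const_conservative_ge0 alpha nu l U V H h))).
Proof.
split=> [dW W _ nu f f_Lalpha j v u _|
  dS S _ mu phi phi_action c c_cocycle X_generated _ p l p_ge1 p_ltd Fbar Nbar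
  [[Fbar_id _ _] _ _ _] _ _ Psi Psi_section F K FE KE U U_basis V V_basis x x_reps H HE _ c_K
  dW W _ nu h h_Lalpha j v u _ _].
  exact: dissipative_limit.
exact: (conservative_limit alpha_gt0 alpha_lt2 hnua phi_action c_cocycle X_generated p_ge1
  p_ltd Fbar_id Psi_section FE KE U_basis V_basis x_reps HE c_K h_Lalpha).
Qed.
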